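(* Suppose that $v$ satisfies Assumption A and Assumption B (stated in the context) on the compact rectangle $T$. Then for any fixed $x_0\in T$ there exists a positive finite constant $\kappa$, which may depend on $x_0$, such that $$\liminf_{r\to0+}\ \sup_{x\in T:\,\Delta(x,x_0)\le r}\frac{|v(x)-v(x_0)|}{r(\log\log(1/r))^{-1/Q}}=\kappa^{1/Q}\quad\text{a.s.}$$ and $C_2\le\kappa\le C_1$, where $C_1$ and $C_2$ are the constants in the small ball probability estimate stated in the context. In particular, $\kappa$ coincides with the following limit, which is called the small ball constant of $v$ on $\{x\in T:\Delta(x,x_0)\le r\}$, if it exists: $$\kappa=-\lim_{r\to0,\;u/r\to0}\Big(\frac ur\Big)^Q\log\mathbb P\Big\{\sup_{x\in T:\,\Delta(x,x_0)\le r}|v(x)-v(x_0)|\le u\Big\}.$$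
   Context: Let $v=\{v(x):x\in\mathbb R^k\}$ be a real-valued continuous centered Gaussian random field, and let $T$ be a compact rectangle in $\mathbb R^k$. Write $\|X\|_{L^2}=(\mathbb E[X^2])^{1/2}$ for a random variable $X$. Assumption A. There exists a centered Gaussian random field $\{v(A,x):A\in\mathscr B(\mathbb R_+),x\in T\}$, where $\mathscr B(\mathbb R_+)$ is the Borel $\sigma$-algebra on $\mathbb R_+=[0,\infty)$, such that: (a) for every $x\in T$, $A\mapsto v(A,x)$ is an independently scattered Gaussian noise such that $v(\mathbb R_+,x)=v(x)$, and the processes $v(A,\cdot)$ and $v(B,\cdot)$ are independent whenever $A$ and $B$ are disjoint; (b) there exist constants $c_0>0$, $a_0\ge0$ and $\gamma_j>0$, $j=1,\dots,k$, such that for all $a_0\le a<b\le\infty$ and $x,y\in T$ (with $b^{-1}=0$ if $b=\infty$), $$\|v([a,b),x)-v(x)-v([a,b),y)+v(y)\|_{L^2}\le c_0\Big(\sum_{j=1}^ka^{\gamma_j}|x_j-y_j|+b^{-1}\Big)$$ and $$\|v([0,a_0),x)-v([0,a_0),y)\|_{L^2}\le c_0\sum_{j=1}^k|x_j-y_j|.$$ Notation: $\alpha_j=(\gamma_j+1)^{-1}\in(0,1)$, $Q=\sum_{j=1}^k\alpha_j^{-1}$, $\Delta(x,y)=\sum_{j=1}^k|x_j-y_j|^{\alpha_j}$ for $x,y\in\mathbb R^k$, and $B_\Delta(x,r)=\{y\in\mathbb R^k:\Delta(x,y)\le r\}$. Assumption B (strong local nondeterminism). There exists a constant $c_2>0$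 such that for all integers $n\ge1$ and all $x,x^1,\dots,x^n\in T$, $\mathrm{Var}(v(x)\mid v(x^1),\dots,v(x^n))\ge c_2\min_{0\le i\le n}\Delta^2(x,x^i)$, where $x^0=0$. Small ball probability estimate (fixing $C_1,C_2$). Under Assumptions A and B, there exist positive finite constants $C_1,C_2$ and $r_0>0$ small such that for any $0<u<r\le r_0$ and any $z\in T$ with $B_\Delta(z,r)\subset T$, $$\exp\big(-C_1(r/u)^Q\big)\le\mathbb P\Big\{\sup_{x\in B_\Delta(z,r)}|v(x)-v(z)|\le u\Big\}\le\exp\big(-C_2(r/u)^Q\big).$$ The constants $C_1,C_2$ in the claim are the constants in this estimate; they do not depend on the point $z$, $r$ or $u$. *)

(* Defs.v *)
From HB Require Import structures.
From mathcomp Require Import all_boot all_order all_algebra.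
From mathcomp Require Import all_classical all_reals all_analysis.

Set Implicit Arguments.
Unset Strict Implicit.
Unset Printing Implicit Defensive.

Import Order.TTheory GRing.Theory Num.Theory.
Import numFieldNormedType.Exports.

Local Open Scope classical_set_scope.
Local Open Scope ring_scope.

Section anisotropic_metric.
Context {R : realType} {k : nat}.
Implicit Types (gamma : 'I_k -> R) (x y : 'rV[R]_k).

Definition rectangle (l h : 'rV[R]_k) : set 'rV[R]_k :=
  [set x | forall j, l 0 j <= x 0 j <= h 0 j].

Definition alpha gamma (j : 'I_k) : R := (gamma j + 1)^-1.

Definition hom_dim gamma : R := \sum_j (alpha gamma j)^-1.

Definition Delta gamma x y : R := \sum_j `|x 0 j - y 0 j| `^ alpha gamma j.

Definition Delta_ball gamma x (r : R) : set 'rV[R]_k :=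
  [set y | Delta gamma x y <= r].

Definition osc (S : set 'rV[R]_k) (f : 'rV[R]_k -> R) x : \bar R :=
  ereal_sup [set (`|f y - f x|)%:E | y in S].

End anisotropic_metric.

Section probability_notions.
Context {d : measure_display} {Omega : measurableType d} {R : realType}.
Variable P : probability Omega R.

(* The almost surely null case is separate: the degenerate law is a centered
   Gaussian law, whereas [normal_prob 0 0] is not the Dirac measure at 0. *)
Definition centered_gaussian (X : Omega -> R) : Prop :=
  (exists2 s : R, 0 < s &
     forall U : set R, measurable U -> P (X @^-1` U) = normal_prob 0 s U) \/
  {ae P, forall w, X w = 0}.

Definition centered_gaussian_field {I : Type} (D : set I)
    (X : I -> {RV P >-> R}) : Prop :=
  forall (n : nat) (c : 'I_n -> R) (t : 'I_n -> I), (forall i, D (t i)) ->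
    centered_gaussian (fun w => \sum_(i < n) c i * X (t i) w).

Definition process_sigma_algebra {I : Type} (D : set I)
    (X : I -> {RV P >-> R}) : set_system Omega :=
  <<s \bigcup_(i in D) preimage_set_system [set: Omega] (X i) measurable >>.

Definition independent_processes {I : Type} (D : set I)
    (X Y : I -> {RV P >-> R}) : Prop :=
  forall E F, process_sigma_algebra D X E -> process_sigma_algebra D Y F ->
    P (E `&` F) = (P E * P F)%E.

(* Taking some of the [U i] to be [setT] gives the product rule for every
   subfamily. *)
Definition mutually_independent (n : nat) (X : 'I_n -> {RV P >-> R}) : Prop :=
  forall U : 'I_n -> set R, (forall i, measurable (U i)) ->
    P (\bigcap_i (X i @^-1` U i)) = (\prod_(i < n) P (X i @^-1` U i))%E.

Definition half_line : set R := [set t | 0 <= t].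

Definition borel_half_line : set (set R) :=
  [set A | measurable A /\ A `<=` half_line].

Definition independently_scattered (M : set R -> {RV P >-> R}) : Prop :=
  (forall (n : nat) (A : 'I_n -> set R),
     (forall i, borel_half_line (A i)) -> trivIset setT A ->
     mutually_independent (fun i => M (A i))) /\
  (forall A : nat -> set R,
     (forall i, borel_half_line (A i)) -> trivIset setT A ->
     {ae P, forall w,
        (\sum_(i < n) M (A i) w) @[n --> \oo] --> M (\bigcup_i A i) w}).

Definition cond_expectation (G : set_system Omega) (X Z : Omega -> R) : Prop :=
  [/\ P.-integrable setT (EFin \o X),
      P.-integrable setT (EFin \o Z),
      forall U : set R, measurable U -> G (Z @^-1` U) &
      forall E, G E ->
        (\int[P]_(w in E) (Z w)%:E = \int[P]_(w in E) (X w)%:E)%E].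

Definition cond_variance (G : set_system Omega) (X V : Omega -> R) : Prop :=
  exists2 Z, cond_expectation G X Z &
    cond_expectation G (fun w => (X w - Z w) ^+ 2) V.

Definition L2norm (X : Omega -> R) : \bar R := ('N[P]_(2%:E)[EFin \o X])%E.

End probability_notions.

Section assumptions.
Context {d : measure_display} {Omega : measurableType d} {R : realType}.
Context (P : probability Omega R) {k : nat}.
Implicit Types (gamma : 'I_k -> R) (T : set 'rV[R]_k).
Implicit Types (v : 'rV[R]_k -> {RV P >-> R}).

Definition continuous_gaussian_field v : Prop :=
  centered_gaussian_field setT v /\
  forall w, continuous (fun x => v x w).

Definition right_open (a : R) (b : \bar R) : set R :=
  [set t | a <= t /\ (t%:E < b)%E].

Definition inv_ext (b : \bar R) : R := if b is b'%:E then b'^-1 else 0.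

(* Only the values [W A x] with [A] Borel in the half-line and [x] in [T] are
   constrained. *)
Definition assumption_A gamma T v : Prop :=
  exists W : set R -> 'rV[R]_k -> {RV P >-> R},
  [/\ centered_gaussian_field (borel_half_line `*` T) (fun p => W p.1 p.2),
      forall x, T x ->
        independently_scattered (fun A => W A x) /\
        {ae P, forall w, W half_line x w = v x w},
      forall A B, borel_half_line A -> borel_half_line B ->
        A `&` B = set0 -> independent_processes T (W A) (W B) &
      exists c0 a0 : R,
      [/\ 0 < c0, 0 <= a0, forall j, 0 < gamma j,
          forall (a : R) (b : \bar R) x y,
            a0 <= a -> (a%:E < b)%E -> T x -> T y ->
            (L2norm P (fun w => (W (right_open a b) x w - v x w
                               - W (right_open a b) y w + v y w)%R)
             <= (c0 * (\sum_j a `^ gamma j * `|x 0 j - y 0 j|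
                       + inv_ext b))%:E)%E &
          forall x y, T x -> T y ->
            (L2norm P (fun w => (W (right_open 0 a0%:E) x w
                               - W (right_open 0 a0%:E) y w)%R)
             <= (c0 * \sum_j `|x 0 j - y 0 j|)%:E)%E]].

(* Strong local nondeterminism.  The initial value of the iterated minimum is
   the term with [x^0 = 0]. *)
Definition assumption_B gamma T v : Prop :=
  exists2 c2 : R, 0 < c2 &
  forall (n : nat) (x : 'rV[R]_k) (xs : 'I_n -> 'rV[R]_k),
    (0 < n)%N -> T x -> (forall i, T (xs i)) ->
    exists2 V : Omega -> R,
      cond_variance P (process_sigma_algebra setT (fun i => v (xs i))) (v x) V &
      {ae P, forall w,
         c2 * \big[Num.min/Delta gamma x 0 ^+ 2]_(i < n)
                Delta gamma x (xs i) ^+ 2 <= V w}.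

Definition small_ball_prob v (S : set 'rV[R]_k) x (u : R) : \bar R :=
  P [set w | (osc S (fun y => v y w) x <= u%:E)%E].

Definition small_ball_estimate gamma T v (C1 C2 : R) : Prop :=
  [/\ 0 < C1, 0 < C2 &
  exists2 r0 : R, 0 < r0 &
  forall (u r : R) z, 0 < u -> u < r -> r <= r0 -> T z ->
    Delta_ball gamma z r `<=` T ->
    ((expR (- C1 * (r / u) `^ hom_dim gamma))%:E
       <= small_ball_prob v (Delta_ball gamma z r) z u
       <= (expR (- C2 * (r / u) `^ hom_dim gamma))%:E)%E].

Definition chung_ratio gamma T v x0 (w : Omega) (r : R) : \bar R :=
  (osc (T `&` Delta_ball gamma x0 r) (fun x => v x w) x0
   * (r * ln (ln r^-1) `^ (- (hom_dim gamma)^-1))^-1%:E)%E.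

Definition chung_LIL gamma T v x0 (kappa : R) : Prop :=
  {ae P, forall w,
     limf_einf (chung_ratio gamma T v x0 w) (0 : R)^'+
     = (kappa `^ (hom_dim gamma)^-1)%:E}.

Definition small_ball_exponent gamma T v x0 (p : R * R) : \bar R :=
  (- (((p.2 / p.1) `^ hom_dim gamma)%:E
      * lne (small_ball_prob v (T `&` Delta_ball gamma x0 p.1) x0 p.2)))%E.

End assumptions.

(* Neighborhoods for the limit of pairs [(r, u)] with [0 < r], [0 < u],
   [r --> 0] and [u / r --> 0]. *)
Definition small_ball_regime {R : realType} : set_system (R * R) :=
  [set A | exists2 e : R, 0 < e &
     forall r u : R, 0 < r < e -> 0 < u -> u / r < e -> A (r, u)].

Global Instance small_ball_regime_filter {R : realType} :
  ProperFilter (@small_ball_regime R).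
Proof.
split.
  move=> [e e0 h].
  have r0 : 0 < e / 2 by rewrite divr_gt0.
  have u0 : 0 < e / 2 * (e / 2) by rewrite mulr_gt0.
  apply: (h (e / 2) (e / 2 * (e / 2))) => //.
    by rewrite r0 /= gtr_pMr // invf_lt1 // ltr1n.
  by rewrite mulfK ?gt_eqF // gtr_pMr // invf_lt1 // ltr1n.
split; first by exists 1.
  move=> A B [e e0 hA] [e' e'0 hB]; exists (Num.min e e').
    by rewrite lt_min e0.
  move=> r u /andP[r0]; rewrite lt_min => /andP[re re'] u0.
  rewrite lt_min => /andP[ue ue'].
  by split; [apply: hA => //; rewrite r0 | apply: hB => //; rewrite r0].
by move=> A B AB [e e0 hA]; exists e => // r u r0 u0 ur; apply: AB; exact: hA.
Qed.

(* Main.v *)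
(** A Gaussian process is handled through the moments E[h cos(<t, X> + a)], which
    determine joint laws, so that orthogonality yields independence.

    Lower small ball bound: two independent copies that round to the same cell
    differ, after division by sqrt 2, by a vector of the box, so that the box
    has probability at least the sum of the squared cell probabilities, which
    an entropy estimate along a chaining bounds from below.  Upper bound: by
    strong local nondeterminism, each new point at distance at least u from the
    previous ones costs a constant factor, and about (r / u)^Q such points fit
    in the ball.

    Law of the iterated logarithm: along geometric radii the upper bound and
    Borel-Cantelli bound the liminf from below.  Along the radii exp(-n^p) the
    oscillation comes, up to negligible terms, from disjoint bands of the noise,
    so that the lower bound and the second Borel-Cantelli lemma bound the liminf
    from above.  Since the noise over [0, m) is negligible near x0 and converges
    to v as m grows, the events in question are independent of v itself and the
    liminf is constant.  The constant inherits every small ball bound valid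
    around x0, and therefore equals the small ball exponent when it exists. *)

Require Import Defs.
From mathcomp Require Import all_boot all_order all_algebra.
From mathcomp Require Import all_classical all_reals all_analysis.
From mathcomp Require Import measurable_realfun zify ring lra.

Set Implicit Arguments.
Unset Strict Implicit.
Unset Printing Implicit Defensive.

Import Order.TTheory GRing.Theory Num.Theory.
Import numFieldNormedType.Exports.

Local Open Scope classical_set_scope.
Local Open Scope ring_scope.

(** The rate is forced by scaling: at level $u=c\,r(\log\log(1/r))^{-1/Q}$ the exponent $(r/u)^Q$ is
    $c^{-Q}\log\log(1/r)$. An upper bound with constant $D$ then gives, along geometric radii,
    probabilities of order $n^{-D/c^Q}$, summable when $c^Q<D$; a lower bound gives at least
    $1/(n+1)$ along $\exp(-n^p)$ with $p=c^Q/D$, and $p>1$ is also what separates successive bands.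
    Two obstacles shape the rest. The fields $v(A,\cdot)$ come without path regularity, and their
    relations to $v$ hold only almost surely, point by point; so oscillations are read on countable
    nets and transferred through null sets. And the lower small ball bound needs the exact order
    $(r/u)^Q$, with no logarithm lost: the chain is balanced at the level $m$ with $2^m\approx r/u$.
    Coarser links are few and each costs a logarithm; finer links are many, but a high Gaussian
    moment makes each almost free. Both sums are geometric around $m$, where the mesh has about
    $2^{mQ}$ points. *)

Lemma integrable_scale d (T : measurableType d) (R : realType)
    (m : {measure set T -> \bar R}) (D : set T) (f : T -> R) c : measurable D ->
  m.-integrable D (EFin \o f) -> m.-integrable D (EFin \o (fun x => c * f x)).
Proof.
move=> mD fi.
have -> : EFin \o (fun x => c * f x) = (fun x => c%:E * (EFin \o f) x)%E by apply/funext.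
exact: integrableZl.
Qed.

Lemma measurable_preim d (T : measurableType d) (R : realType) (f : T -> R) (U : set R) :
  measurable_fun setT f -> measurable U -> measurable (f @^-1` U).
Proof. by move=> mf mU; rewrite -[X in measurable X]setTI; exact: mf. Qed.

(** * Expectations of real random variables *)

Section expectation.
Context {d : measure_display} {T : measurableType d} {R : realType}.
Context (P : probability T R).
Implicit Types (f g : T -> R) (A : set T).

Definition Ex f : R := \int[P]_w f w.
Definition pr A : R := fine (P A).
Definition L1 f := P.-integrable setT (EFin \o f).
Definition bm f := measurable_fun setT f /\ exists M, forall w, `|f w| <= M.

Lemma L1_meas f : L1 f -> measurable_fun setT f.
Proof. by move=> /measurable_int/measurable_EFinP. Qed.

Lemma L1_le f g : measurable_fun setT f -> L1 g -> (forall w, `|f w| <= g w) -> L1 f.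
Proof.
move=> mf ig fg; apply: (le_integrable _ _ _ ig) => //.
  exact/measurable_EFinP.
by move=> w _ /=; rewrite lee_fin (le_trans (fg w))// ler_norm.
Qed.

Lemma L1_cst c : L1 (cst c).
Proof. exact: finite_measure_integrable_cst. Qed.

Lemma bm_L1 f : bm f -> L1 f.
Proof. by move=> [mf [M fM]]; apply: (@L1_le _ (cst M)) => //; exact: L1_cst. Qed.

Lemma bm_cst c : bm (cst c).
Proof. by split=> //; exists `|c|. Qed.

Lemma bmD f g : bm f -> bm g -> bm (fun w => f w + g w).
Proof.
move=> [mf [M fM]] [mg [N gN]]; split; first exact: measurable_funD.
by exists (M + N) => w; rewrite (le_trans (ler_normD _ _))// lerD.
Qed.

Lemma bmM f g : bm f -> bm g -> bm (fun w => f w * g w).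
Proof.
move=> [mf [M fM]] [mg [N gN]]; split; first exact: measurable_funM.
by exists (M * N) => w; rewrite normrM ler_pM.
Qed.

Lemma bm_cos f : measurable_fun setT f -> bm (fun w => cos (f w)).
Proof.
move=> mf; split; last by exists 1 => w; exact: cos_max.
by apply: measurableT_comp => //; apply: continuous_measurable_fun; exact: continuous_cos.
Qed.

Lemma bm_indic A : measurable A -> bm (\1_A).
Proof.
move=> mA; split; first exact: measurable_indic.
by exists 1 => w; rewrite indicE; case: (w \in A); rewrite ?normr1 ?normr0.
Qed.

Lemma L1D f g : L1 f -> L1 g -> L1 (fun w => f w + g w).
Proof.
move=> f1 g1; rewrite /L1.
have -> : EFin \o (fun w => f w + g w) = ((EFin \o f) \+ (EFin \o g))%E by apply/funext.
exact: integrableD.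
Qed.

Lemma L1Z c f : L1 f -> L1 (fun w => c * f w).
Proof.
move=> f1; rewrite /L1.
have -> : EFin \o (fun w => c * f w) = (fun w => c%:E * (EFin \o f) w)%E by apply/funext.
exact: integrableZl.
Qed.

Lemma L1N f : L1 f -> L1 (fun w => - f w).
Proof. by move=> /(@L1Z (-1)); congr L1; apply/funext => w; rewrite mulN1r. Qed.

Lemma L1B f g : L1 f -> L1 g -> L1 (fun w => f w - g w).
Proof. by move=> f1 g1; apply: L1D => //; exact: L1N. Qed.

Lemma L1M f g : L1 f -> bm g -> L1 (fun w => f w * g w).
Proof.
move=> f1 [mg [M gM]].
apply: (@L1_le _ (fun w => M * `|f w|)).
- by apply: measurable_funM => //; exact: L1_meas.
- by apply: L1Z; exact: integrable_norm.
- by move=> w; rewrite normrM mulrC ler_wpM2r.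
Qed.

Lemma ExD f g : L1 f -> L1 g -> Ex (fun w => f w + g w) = Ex f + Ex g.
Proof. by move=> *; exact: RintegralD. Qed.

Lemma ExB f g : L1 f -> L1 g -> Ex (fun w => f w - g w) = Ex f - Ex g.
Proof. by move=> *; exact: RintegralB. Qed.

Lemma ExZ c f : L1 f -> Ex (fun w => c * f w) = c * Ex f.
Proof. by move=> *; exact: RintegralZl. Qed.

Lemma ExN f : L1 f -> Ex (fun w => - f w) = - Ex f.
Proof.
move=> f1; rewrite -mulN1r -ExZ//; congr Ex; apply/funext => w.
by rewrite mulN1r.
Qed.

Lemma Ex_cst c : Ex (cst c) = c.
Proof. by rewrite /Ex Rintegral_cst//= probability_setT/= mulr1. Qed.

Lemma Ex_le f g : L1 f -> L1 g -> (forall w, f w <= g w) -> Ex f <= Ex g.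
Proof. by move=> f1 g1 fg; apply: le_Rintegral. Qed.

Lemma Ex_ge0 f : (forall w, 0 <= f w) -> 0 <= Ex f.
Proof. by move=> f0; apply: Rintegral_ge0. Qed.

Lemma L1_sum (J : Type) (r : seq J) (F : J -> T -> R) : (forall j, L1 (F j)) ->
  L1 (fun w => \sum_(j <- r) F j w).
Proof.
move=> lF; elim: r => [|j r IH].
  by under [X in L1 X]funext do rewrite big_nil; exact: L1_cst.
by under [X in L1 X]funext do rewrite big_cons; exact: L1D.
Qed.

Lemma Ex_sum (J : Type) (r : seq J) (F : J -> T -> R) : (forall j, L1 (F j)) ->
  Ex (fun w => \sum_(j <- r) F j w) = \sum_(j <- r) Ex (F j).
Proof.
move=> lF; elim: r => [|j r IH].
  by under [X in Ex X]funext do rewrite big_nil; rewrite big_nil; exact: Ex_cst.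
under [X in Ex X]funext do rewrite big_cons.
by rewrite big_cons ExD ?IH//; exact: L1_sum.
Qed.

Lemma pr_ge0 A : 0 <= pr A. Proof. exact: fine_ge0. Qed.

Lemma prE A : measurable A -> (pr A)%:E = P A.
Proof. by move=> mA; rewrite /pr fineK// fin_num_measure. Qed.

Lemma pr_indic A : measurable A -> Ex (\1_A) = pr A.
Proof. by move=> mA; rewrite /Ex /Rintegral integral_indic// setIT. Qed.

Lemma pr_le A B : measurable A -> measurable B -> A `<=` B -> pr A <= pr B.
Proof. by move=> mA mB AB; rewrite -lee_fin !prE// le_measure// inE. Qed.

Lemma pr_le1 A : measurable A -> pr A <= 1.
Proof. by move=> mA; rewrite -lee_fin prE//; exact: probability_le1. Qed.

Lemma prC A : measurable A -> pr (~` A) = 1 - pr A.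
Proof. by move=> mA; rewrite /pr probability_setC// fineB// fin_num_measure. Qed.

Lemma prU A B : measurable A -> measurable B -> pr (A `|` B) <= pr A + pr B.
Proof.
move=> mA mB; rewrite -lee_fin EFinD !prE//; last exact: measurableU.
by rewrite measureU2.
Qed.

Lemma Ex_cvg (f_ : nat -> T -> R) f M : (forall n, measurable_fun setT (f_ n)) ->
  measurable_fun setT f -> (forall n w, `|f_ n w| <= M) ->
  {ae P, forall w, f_ ^~ w @ \oo --> f w} -> Ex (f_ n) @[n --> \oo] --> Ex f.
Proof.
move=> mf_ mf fM ff.
have [] := @dominated_convergence _ T R P setT measurableT (fun n w => (f_ n w)%:E)
  (fun w => (f w)%:E) (fun w => M%:E).
- by move=> n; exact/measurable_EFinP/mf_.
- exact/measurable_EFinP.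
- apply: filterS ff => w fw _; apply: cvg_EFin fw; exact: nearW.
- exact: (L1_cst M).
- by apply: aeW => w n _; rewrite lee_fin.
move=> i1 _ c; apply: fine_cvg; rewrite /= fineK//.
exact: integrable_fin_num.
Qed.

Lemma Ex_eq_ae f g : measurable_fun setT f -> measurable_fun setT g ->
  {ae P, forall w, f w = g w} -> Ex f = Ex g.
Proof.
move=> mf mg fg; congr fine; apply: ae_eq_integral => //; try exact/measurable_EFinP.
by apply: filterS fg => w /= -> _.
Qed.

Lemma L1_eq_ae f g : measurable_fun setT f -> measurable_fun setT g ->
  {ae P, forall w, f w = g w} -> L1 f -> L1 g.
Proof.
move=> mf mg fg /integrableP[_ fi]; apply/integrableP; split; first exact/measurable_EFinP.
rewrite (_ : integral _ _ _ = \int[P]_x `|(f x)%:E|)%E//.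
apply: ae_eq_integral => //; try by apply/measurableT_comp => //; exact/measurable_EFinP.
by apply: filterS fg => w /= -> _.
Qed.

End expectation.

(** * Gaussian integrals *)

Section normal_integrals.
Context {R : realType}.
Local Notation mu := (@lebesgue_measure R).
Implicit Types (f F : R -> R) (s x t : R).

(** The fundamental theorem of calculus on growing symmetric intervals, with [|f|] dominating the
    restrictions. It serves as integration by parts against the Gaussian density. *)
Lemma integral_deriv_eq0 F f : (forall x, is_derive x 1 F (f x)) -> continuous f ->
  mu.-integrable setT (EFin \o f) ->
  (F n%:R - F (- n%:R)) @[n --> \oo] --> 0 -> \int[mu]_x f x = 0.
Proof.
move=> dF cf intf F0.
have FE n : \int[mu]_(x in `[(- n.+1%:R), n.+1%:R]) f x = F n.+1%:R - F (- n.+1%:R).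
  rewrite /Rintegral (@continuous_FTC2 _ f F)//.
  - by apply: gtrN; rewrite ltr0n.
  - exact: continuous_subspaceT.
  - have cF x : {for x, continuous F}.
      by apply: differentiable_continuous; apply/derivable1_diffP; exact: (@ex_derive _ _ _ _ _ _ _ (dF x)).
    split.
    + by move=> x _; exact: ex_derive.
    + by apply: cvg_at_right_filter; exact: cF.
    + by apply: cvg_at_left_filter; exact: cF.
  - by move=> x _; rewrite derive1E; exact: derive_val.
pose D n := [set` `[(- n.+1%:R : R), n.+1%:R]].
have mf : measurable_fun (setT : set (measurableTypeR R)) f by exact: continuous_measurable_fun.
have [] := @dominated_convergence _ _ R mu setT measurableT
  (fun n x => ((f \_ (D n)) x)%:E) (fun x => (f x)%:E) (fun x => `|f x|%:E).
- move=> n; apply/measurable_EFinP.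
  have mD : measurable (D n : set (measurableTypeR R)) by exact: measurable_itv.
  by apply: (measurable_restrictT f mD).1; exact: measurable_funTS.
- exact/measurable_EFinP.
- apply: aeW => x _; apply: cvg_near_cst.
  near=> n; congr EFin; rewrite patchE mem_set// /D/= in_itv/= -ler_norml.
  near: n; exists (Num.truncn `|x|) => // n /= xn.
  have /andP[_ /ltW h] := truncn_itv (normr_ge0 x).
  by rewrite (le_trans h)// ler_nat.
- exact: integrable_norm.
- apply: aeW => x n _; rewrite lee_fin patchE; case: ifPn => // _.
  by rewrite normr0.
move=> _ _ c.
have : (F n.+1%:R - F (- n.+1%:R)) @[n --> \oo] --> \int[mu]_x f x.
  under eq_fun do rewrite -FE Rintegral_mkcond.
  apply: fine_cvg; rewrite /= fineK//.
  exact: integrable_fin_num.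
move/cvg_unique => h; apply: h => //.
by move: F0; rewrite -(cvg_shiftS (fun n => F n%:R - F (- n%:R))).
Unshelve. all: by end_near. Qed.

Lemma normal_pdf0E s x : s != 0 ->
  normal_pdf 0 s x = normal_peak s * expR (- (x ^+ 2) / (s ^+ 2 *+ 2)).
Proof. by move=> s0; rewrite normal_pdfE// /normal_fun subr0. Qed.

Lemma derive_normal_pdf s x : s != 0 ->
  is_derive x 1 (normal_pdf 0 s) (- (x / s ^+ 2) * normal_pdf 0 s x).
Proof.
move=> s0.
have -> : normal_pdf 0 s = (fun x => normal_peak s * expR (- (x ^+ 2) / (s ^+ 2 *+ 2))).
  by apply/funext => y; rewrite normal_pdf0E.
apply: trigger_derive.
rewrite /GRing.scale/= !mulr1 !mulr0 add0r.
by field; rewrite ?s0.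
Qed.

(** Adding $x^2/(4s^2)$ to the exponent halves it, which is the density of variance $2s^2$ up to a
    factor $\sqrt2$. This yields the dominating function of [normal_integrable_exp] and the
    exponential moment of [gauss_exp]. *)
Lemma normal_pdf_sqrt2 s x : s != 0 ->
  expR (x ^+ 2 / (s ^+ 2 *+ 4)) * normal_pdf 0 s x
  = Num.sqrt 2 * normal_pdf 0 (Num.sqrt 2 * s) x.
Proof.
move=> s0; have s20 : Num.sqrt 2 * s != 0 by rewrite mulf_neq0// sqrtr_eq0 -ltNge.
rewrite !normal_pdf0E// mulrCA -expRD mulrA; congr (_ * expR _).
  rewrite /normal_peak exprMn sqr_sqrtr//.
  have -> : 2 * s ^+ 2 * pi *+ 2 = 2 * (s ^+ 2 * pi *+ 2) by ring.
  by rewrite sqrtrM// invfM mulrA divff ?mul1r// sqrtr_eq0 -ltNge.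
by rewrite exprMn sqr_sqrtr//; field; rewrite ?s0.
Qed.

Lemma normal_integrable_exp s f C : s != 0 -> measurable_fun setT f ->
  (forall x, `|f x| <= C * expR (x ^+ 2 / (s ^+ 2 *+ 4))) ->
  mu.-integrable setT (EFin \o (fun x => f x * normal_pdf 0 s x)).
Proof.
move=> s0 mf fC.
apply: (@le_integrable _ _ _ mu setT _ _
  (EFin \o (fun x => (C * Num.sqrt 2) * normal_pdf 0 (Num.sqrt 2 * s) x))) => //.
- by apply/measurable_EFinP/measurable_funM => //; exact: measurable_normal_pdf.
- move=> x _ /=; rewrite lee_fin normrM.
  have C0 : 0 <= C by rewrite -(pmulr_lge0 _ (expR_gt0 (x ^+ 2 / (s ^+ 2 *+ 4)))) (le_trans _ (fC x)).
  rewrite (ger0_norm (normal_pdf_ge0 _ _ _)) [leRHS]ger0_norm; last first.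
    by rewrite !mulr_ge0// normal_pdf_ge0.
  rewrite -mulrA -normal_pdf_sqrt2// mulrA ler_wpM2r//.
  exact: normal_pdf_ge0.
have -> : EFin \o (fun x => (C * Num.sqrt 2) * normal_pdf 0 (Num.sqrt 2 * s) x) =
  (fun x => (C * Num.sqrt 2)%:E * (normal_pdf 0 (Num.sqrt 2 * s) x)%:E)%E by apply/funext.
by apply: integrableZl => //; exact: integrable_normal_pdf.
Qed.

Lemma expR_sqr_ge s x : s != 0 -> x ^+ 2 <= s ^+ 2 *+ 4 * expR (x ^+ 2 / (s ^+ 2 *+ 4)).
Proof.
move=> s0; have s4 : 0 < s ^+ 2 *+ 4 by rewrite mulrn_wgt0// exprn_even_gt0.
rewrite mulrC -ler_pdivrMr// (le_trans _ (expR_ge1Dx _))//.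
by rewrite lerDr.
Qed.

Lemma normal_pdf_sqr_le s x : s != 0 -> x ^+ 2 * normal_pdf 0 s x <= (s ^+ 2 *+ 2) * normal_peak s.
Proof.
move=> s0; have s2 : 0 < s ^+ 2 *+ 2 by rewrite mulrn_wgt0// exprn_even_gt0.
rewrite normal_pdf0E// mulrCA mulrC ler_wpM2r ?normal_peak_ge0//.
rewrite mulNr expRN ler_pdivrMr ?expR_gt0// mulrC -ler_pdivrMr//.
by rewrite (le_trans _ (expR_ge1Dx _))// lerDr.
Qed.

Lemma normal_pdf_cvg0 s F : s != 0 -> (forall x, `|F x| <= 1 + `|x|) ->
  (F n%:R * normal_pdf 0 s n%:R - F (- n%:R) * normal_pdf 0 s (- n%:R)) @[n --> \oo] --> 0.
Proof.
move=> s0 FC.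
pose C := (s ^+ 2 *+ 2) * normal_peak s.
have b (y : R) n : `|y| = n.+1%:R -> `|F y * normal_pdf 0 s y| <= C *+ 2 * n.+1%:R^-1.
  move=> yn; rewrite normrM (ger0_norm (normal_pdf_ge0 _ _ _)).
  have := normal_pdf_sqr_le y s0; rewrite -/C => h.
  have p0 := normal_pdf_ge0 0 s y.
  have n0 : (0:R) < n.+1%:R by rewrite ltr0n.
  rewrite ler_pdivlMr// mulr2n.
  have y2 : y ^+ 2 = n.+1%:R ^+ 2 by rewrite -yn real_normK// num_real.
  have n1 : (1:R) <= n.+1%:R by rewrite ler1n.
  have := FC y; rewrite yn => F1.
  apply: (@le_trans _ _ ((n.+1%:R *+ 2) * normal_pdf 0 s y * n.+1%:R)).
    apply: ler_wpM2r; first exact: ltW.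
    by apply: ler_wpM2r => //; rewrite (le_trans F1)// mulr2n lerD2r.
  rewrite -mulr2n (_ : _ * _ * _ = (y ^+ 2 * normal_pdf 0 s y) *+ 2) ?lerMn2r ?h ?orbT//.
  by rewrite y2; ring.
have bn (y : nat -> R) : (forall n, `|y n| = n%:R) -> (F (y n) * normal_pdf 0 s (y n)) @[n --> \oo] --> 0.
  move=> yn; rewrite -cvg_shiftS; apply: norm_cvg0.
  apply: (@squeeze_cvgr _ _ _ _ (cst 0) (fun n => C *+ 2 * n.+1%:R^-1)).
  - by apply: nearW => n; rewrite normr_ge0/= b.
  - exact: cvg_cst.
  - rewrite -[X in _ --> X](mulr0 (C *+ 2)); apply: cvgMr.
    exact: (@cvg_harmonic R).
rewrite -[X in _ --> X](subr0 0); apply: cvgB; apply: bn => n.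
  by rewrite normr_nat.
by rewrite normrN normr_nat.
Qed.


Lemma expR_sqr_ge1 s x : 1 <= expR (x ^+ 2 / (s ^+ 2 *+ 4)).
Proof. by rewrite -[leLHS]expR0 ler_expR divr_ge0 ?sqr_ge0// mulrn_wge0 ?sqr_ge0. Qed.

Lemma expR_norm_ge s x : s != 0 -> `|x| <= (1 + s ^+ 2 *+ 4) * expR (x ^+ 2 / (s ^+ 2 *+ 4)).
Proof.
move=> s0; rewrite mulrDl mul1r; apply: le_trans (lerD (expR_sqr_ge1 s x) (expR_sqr_ge x s0)).
have := sqr_ge0 (`|x| - 1); rewrite -(real_normK (num_real x)) => h; have := normr_ge0 x; nra.
Qed.

Lemma continuous_cosM t th : continuous (fun x : R => cos (t * x + th)).
Proof.
move=> x; apply: continuous_comp; last exact: continuous_cos.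
by apply: cvgD; [exact: mulrl_continuous|exact: cvg_cst].
Qed.

Lemma continuous_sinM t th : continuous (fun x : R => sin (t * x + th)).
Proof.
move=> x; apply: continuous_comp; last exact: continuous_sin.
by apply: cvgD; [exact: mulrl_continuous|exact: cvg_cst].
Qed.

(** The phase [th] replaces complex exponentials: the phases $0$ and $-\pi/2$ give the real and
    imaginary parts of the characteristic function. *)
Definition normal_cos s th t := \int[mu]_x (cos (t * x + th) * normal_pdf 0 s x).

Lemma integrable_normal_cos s t th : s != 0 ->
  mu.-integrable setT (EFin \o (fun x => cos (t * x + th) * normal_pdf 0 s x)).
Proof.
move=> s0; apply: (@normal_integrable_exp _ _ 1) => //.
  by apply: continuous_measurable_fun; exact: continuous_cosM.
by move=> x; rewrite mul1r (le_trans (cos_max _))// expR_sqr_ge1.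
Qed.

Lemma integrable_normal_xsin s t th : s != 0 ->
  mu.-integrable setT (EFin \o (fun x => (x * sin (t * x + th)) * normal_pdf 0 s x)).
Proof.
move=> s0; apply: (@normal_integrable_exp _ _ (1 + s ^+ 2 *+ 4)) => //.
  by apply: measurable_funM => //; apply: continuous_measurable_fun; exact: continuous_sinM.
move=> x; rewrite normrM (le_trans _ (expR_norm_ge x s0))//.
by rewrite ler_piMr// sin_max.
Qed.

Lemma integrable_normal_sqr s : s != 0 ->
  mu.-integrable setT (EFin \o (fun x => x ^+ 2 * normal_pdf 0 s x)).
Proof.
move=> s0; apply: (@normal_integrable_exp _ _ (s ^+ 2 *+ 4)) => //.
by move=> x; rewrite ger0_norm ?sqr_ge0// expR_sqr_ge.
Qed.

(** Gaussian integration by parts: the derivative of $\sin(tx+\theta)\varphi_s(x)$ integrates to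
    0. *)
Lemma normal_xsin s t th : s != 0 ->
  \int[mu]_x ((x * sin (t * x + th)) * normal_pdf 0 s x) = s ^+ 2 * t * normal_cos s th t.
Proof.
move=> s0; have s20 : s ^+ 2 != 0 by rewrite sqrf_eq0.
have i1 : mu.-integrable setT (EFin \o (fun x => t * (cos (t * x + th) * normal_pdf 0 s x))).
  by apply: integrable_scale => //; exact: integrable_normal_cos.
have i2 : mu.-integrable setT (EFin \o (fun x => (s ^+ 2)^-1 * ((x * sin (t * x + th)) * normal_pdf 0 s x))).
  by apply: integrable_scale => //; exact: integrable_normal_xsin.
have cp := @continuous_normal_pdf R 0 s s0.
have : \int[mu]_x (t * (cos (t * x + th) * normal_pdf 0 s x) - (s ^+ 2)^-1 * ((x * sin (t * x + th)) * normal_pdf 0 s x)) = 0.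
  apply: (@integral_deriv_eq0 (fun x => sin (t * x + th) * normal_pdf 0 s x)).
  - move=> x; have := derive_normal_pdf x s0 => dp.
    apply: trigger_derive; rewrite /GRing.scale/= !mulr1 ?mulr0 ?add0r ?addr0.
    by field.
  - move=> x; apply: cvgB.
      by apply: cvgMr; apply: cvgM; [exact: continuous_cosM|exact: cp].
    apply: cvgMr; apply: cvgM; last exact: cp.
    by apply: cvgM; [exact: cvg_id|exact: continuous_sinM].
  - have := integrableB measurableT i1 i2; apply: eq_integrable => //.
  - apply: (normal_pdf_cvg0 (F := fun x => sin (t * x + th)) s0) => x; rewrite (le_trans (sin_max _))//.
    by rewrite lerDl.
rewrite RintegralB// !RintegralZl//; last 2 first.
- exact: integrable_normal_xsin.
- exact: integrable_normal_cos.
rewrite -/(normal_cos s th t) => /eqP; rewrite subr_eq0 => /eqP h.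
by rewrite -mulrA h mulVKf.
Qed.

Lemma normal_variance s : s != 0 -> \int[mu]_x (x ^+ 2 * normal_pdf 0 s x) = s ^+ 2.
Proof.
move=> s0; have s20 : s ^+ 2 != 0 by rewrite sqrf_eq0.
have i1 : mu.-integrable setT (EFin \o (normal_pdf 0 s)) by exact: integrable_normal_pdf.
have i2 : mu.-integrable setT (EFin \o (fun x => (s ^+ 2)^-1 * (x ^+ 2 * normal_pdf 0 s x))).
  by apply: integrable_scale => //; exact: integrable_normal_sqr.
have cp := @continuous_normal_pdf R 0 s s0.
have : \int[mu]_x (normal_pdf 0 s x - (s ^+ 2)^-1 * (x ^+ 2 * normal_pdf 0 s x)) = 0.
  apply: (@integral_deriv_eq0 (fun x => x * normal_pdf 0 s x)).
  - move=> x; have := derive_normal_pdf x s0 => dp.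
    apply: trigger_derive; rewrite /GRing.scale/= !mulr1.
    by field.
  - move=> x; apply: cvgB; first exact: cp.
    apply: cvgMr; apply: cvgM; last exact: cp.
    exact: sqr_continuous.
  - have := integrableB measurableT i1 i2; apply: eq_integrable => //.
  - by apply: (normal_pdf_cvg0 (F := id) s0) => x; rewrite lerDr.
rewrite RintegralB// RintegralZl//; last exact: integrable_normal_sqr.
rewrite [X in X - _]/Rintegral integral_normal_pdf/= => /eqP; rewrite subr_eq0 => /eqP h.
by rewrite -[RHS]mulr1 [X in _ = _ * X]h mulVKf.
Qed.

(** Differentiation under the integral is licensed by the integrable bound $|x|\varphi_s(x)$ on the
    derivative; integration by parts then gives a linear differential equation, solved in
    [normal_cosE]. *)
Lemma derive_normal_cos s th t : s != 0 ->
  is_derive t 1 (normal_cos s th) (- (s ^+ 2 * t * normal_cos s th t)).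
Proof.
move=> s0.
have dE (u x : R) : is_derive u (1:R) (fun u : R => cos (u * x + th) * normal_pdf 0 s x) (- ((x * sin (u * x + th)) * normal_pdf 0 s x)).
  apply: trigger_derive; rewrite /GRing.scale/= !mulr1 ?mulr0 ?add0r ?addr0.
  by ring.
have tI : [set` `](t - 1), (t + 1)[] t by rewrite /= in_itv/= ltrBlDr ltrDl ltr01.
have i x : [set` `](t - 1), (t + 1)[] x -> mu.-integrable setT (EFin \o (fun y => cos (x * y + th) * normal_pdf 0 s y)).
  by move=> _; exact: integrable_normal_cos.
have dd x y : [set` `](t - 1), (t + 1)[] x -> setT y -> derivable ((fun x y => cos (x * y + th) * normal_pdf 0 s y)^~ y) x 1.
  by move=> _ _; exact: (@ex_derive _ _ _ _ _ _ _ (dE x y)).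
have G0 y : 0 <= `|y| * normal_pdf 0 s y by rewrite mulr_ge0// normal_pdf_ge0.
have iG : mu.-integrable setT (EFin \o (fun y => `|y| * normal_pdf 0 s y)).
  apply: (@normal_integrable_exp _ _ (1 + s ^+ 2 *+ 4)) => //.
  by move=> x; rewrite normr_id; exact: expR_norm_ge.
have uG x y : [set` `](t - 1), (t + 1)[] x -> setT y ->
    `|partial1of2 (fun x y => cos (x * y + th) * normal_pdf 0 s y) x y| <= `|y| * normal_pdf 0 s y.
  move=> _ _; rewrite partial1of2E (@derive_val _ _ _ _ _ _ _ (dE x y)).
  rewrite normrN normrM (ger0_norm (normal_pdf_ge0 _ _ _)) ler_wpM2r ?normal_pdf_ge0//.
  by rewrite normrM ler_piMr// sin_max.
have h1 := @derivable_under_integral R _ _ mu _ setT measurableT t _ _ tI i dd _ G0 iG uG.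
have h2 := @differentiation_under_integral R _ _ mu _ setT measurableT t _ _ tI i dd _ G0 iG uG.
apply: DeriveDef; first exact: h1.
rewrite -derive1E h2 -normal_xsin//.
under eq_Rintegral do rewrite partial1of2E (@derive_val _ _ _ _ _ _ _ (dE t _)).
rewrite -mulN1r -RintegralZl//; last exact: integrable_normal_xsin.
by apply: eq_Rintegral => x _; rewrite mulN1r.
Qed.

Lemma normal_cosE s t th : s != 0 -> normal_cos s th t = cos th * expR (- (s ^+ 2 * t ^+ 2 / 2)).
Proof.
move=> s0.
have : normal_cos s th t * expR (s ^+ 2 * t ^+ 2 / 2) = normal_cos s th 0 * expR (s ^+ 2 * 0 ^+ 2 / 2).
  apply: (@is_derive_0_is_cst _ (fun t => normal_cos s th t * expR (s ^+ 2 * t ^+ 2 / 2))) => x.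
  have := derive_normal_cos th x s0 => dn.
  apply: trigger_derive; rewrite /GRing.scale/= !mulr1 ?mulr0 ?add0r ?addr0.
  by field.
have -> : normal_cos s th 0 = cos th.
  rewrite /normal_cos.
  under eq_Rintegral do rewrite mul0r add0r.
  rewrite RintegralZl//; last exact: integrable_normal_pdf.
  by rewrite /Rintegral integral_normal_pdf mulr1.
rewrite expr0n/= mulr0 mul0r expR0 mulr1 => h.
by rewrite expRN; apply: (canRL (mulfK _) h); rewrite gt_eqF// expR_gt0.
Qed.

Lemma normal_mean s : s != 0 -> \int[mu]_x (x * normal_pdf 0 s x) = 0.
Proof.
move=> s0.
have h := normal_xsin 0 (pi / 2) s0.
rewrite normal_cosE// cos_pihalf !mul0r mulr0 in h; rewrite -[RHS]h.
by apply: eq_Rintegral => x _; rewrite mul0r add0r sin_pihalf mulr1.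
Qed.

(** Only the interval from $bs$ to $(b+1)s$ is kept; on it the density is at least its value at the
    right end. *)
Lemma normal_tail_ge s b : 0 < s -> 0 <= b ->
  ((expR (- ((b + 1) ^+ 2 / 2)) / Num.sqrt (pi *+ 2))%:E <= normal_prob 0 s [set` `](b * s)%R, +oo[])%E.
Proof.
move=> s0 b0; have sn0 : s != 0 by rewrite gt_eqF.
apply: (@le_trans _ _ (normal_prob 0 s [set` `]b * s, (b + 1) * s]])); last first.
  by apply: le_measure; rewrite ?inE// => x /=; rewrite !in_itv/= => /andP[->].
rewrite /normal_prob.
pose c := normal_peak s * expR (- ((b + 1) ^+ 2 / 2)).
apply: (@le_trans _ _ (\int[mu]_(x in `](b * s)%R, ((b + 1) * s)%R]) c%:E)%E); last first.
  apply: ge0_le_integral => //=.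
  - by move=> x _; rewrite lee_fin mulr_ge0 ?normal_peak_ge0 ?expR_ge0.
  - by apply/measurable_EFinP/measurable_funTS; exact: measurable_normal_pdf.
  - move=> x; rewrite in_itv/= => /andP[bx xb]; rewrite lee_fin normal_pdf0E//.
    rewrite ler_wpM2l ?normal_peak_ge0// ler_expR mulNr lerN2.
    rewrite ler_pdivrMr ?mulrn_wgt0 ?exprn_gt0//.
    have -> : (b + 1) ^+ 2 / 2 * (s ^+ 2 *+ 2) = ((b + 1) * s) ^+ 2 by field.
    rewrite lerXn2r// ?nnegrE//; last by rewrite mulr_ge0 ?addr_ge0// ltW.
    by rewrite (le_trans _ (ltW bx))// mulr_ge0// ltW.
rewrite integral_cst//= lebesgue_measure_itv/= lte_fin ltr_pM2r// ltrDl ltr01.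
rewrite -EFinB -EFinM lee_fin /c /normal_peak.
have -> : Num.sqrt (s ^+ 2 * pi *+ 2) = s * Num.sqrt (pi *+ 2).
  by rewrite -mulrnAr sqrtrM ?sqr_ge0// sqrtr_sqr gtr0_norm.
have : 0 < Num.sqrt (pi *+ 2 : R) by rewrite sqrtr_gt0 mulrn_wgt0// pi_gt0.
move: (Num.sqrt _) => q q0.
by rewrite le_eqVlt; apply/orP; left; apply/eqP; field; rewrite ?gt_eqF.
Qed.

Lemma integral_normal_prob s (f : R -> \bar R) : measurable_fun setT f ->
  (forall x, 0 <= f x)%E ->
  (\int[normal_prob 0 s]_x f x = \int[mu]_x (f x * (normal_pdf 0 s x)%:E))%E.
Proof.
move=> mf f0; have dom := @normal_prob_dominates R 0 s.
pose h := Radon_Nikodym_SigmaFinite.f (normal_prob 0 s) mu.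
have ih : mu.-integrable setT h := Radon_Nikodym_SigmaFinite.f_integrable dom.
rewrite -(Radon_Nikodym_SigmaFinite.change_of_variables dom)//.
have mp : measurable_fun setT (fun x : measurableTypeR R => (normal_pdf 0 s x)%:E).
  by apply/measurable_EFinP; exact: measurable_normal_pdf.
apply: ae_eq_integral => //.
- by apply: emeasurable_funM => //; exact: (measurable_int _ ih).
- exact: emeasurable_funM.
- apply: ae_eqe_mul2l; apply: integral_ae_eq => //.
  by move=> E _ mE; rewrite -Radon_Nikodym_SigmaFinite.f_integral.
Qed.

Lemma integrable_normal_prob s (f : R -> R) : measurable_fun setT f ->
  mu.-integrable setT (EFin \o (fun x => f x * normal_pdf 0 s x)) ->
  (normal_prob 0 s).-integrable setT (EFin \o f) /\
  \int[normal_prob 0 s]_x f x = \int[mu]_x (f x * normal_pdf 0 s x).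
Proof.
move=> mf fi.
have pE (x : R) : `|f x * normal_pdf 0 s x| = `|f x| * normal_pdf 0 s x.
  by rewrite normrM (ger0_norm (normal_pdf_ge0 _ _ _)).
have fn : (normal_prob 0 s).-integrable setT (EFin \o f).
  apply/integrableP; split; first exact/measurable_EFinP.
  rewrite integral_normal_prob//; last first.
    by apply: measurableT_comp => //; exact/measurable_EFinP.
  move/integrableP : fi => [_]; apply: le_lt_trans.
  by rewrite le_eqVlt; apply/orP; left; apply/eqP; apply: eq_integral => x _ /=; rewrite pE.
split=> //.
have fnp (g : R -> R) : measurable_fun setT g -> (forall x, 0 <= g x <= `|f x|) ->
   [/\ mu.-integrable setT (EFin \o (fun x => g x * normal_pdf 0 s x)),
    (normal_prob 0 s).-integrable setT (EFin \o g) &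
    \int[normal_prob 0 s]_x g x = \int[mu]_x (g x * normal_pdf 0 s x)].
  move=> mg gf; split.
  - apply: (le_integrable _ _ _ fi) => //.
      by apply/measurable_EFinP; apply: measurable_funM => //; exact: measurable_normal_pdf.
    move=> x _ /=; rewrite lee_fin pE normrM (ger0_norm (normal_pdf_ge0 _ _ _)).
    by have /andP[g0 gx] := gf x; rewrite ler_wpM2r ?normal_pdf_ge0// ger0_norm.
  - apply: (le_integrable _ _ _ fn) => //; first exact/measurable_EFinP.
    by move=> x _ /=; have /andP[g0 gx] := gf x; rewrite lee_fin ger0_norm.
  - rewrite /Rintegral integral_normal_prob//; first exact/measurable_EFinP.
    by move=> x; rewrite lee_fin; have /andP[] := gf x.
pose g1 x := Num.max (f x) 0; pose g2 x := Num.max (- f x) 0.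
have m1 : measurable_fun setT g1 by exact: measurable_maxr.
have m2 : measurable_fun setT g2 by apply: measurable_maxr => //; exact: measurableT_comp.
have [|a1 a2 a3] := fnp _ m1.
  by move=> x; rewrite /g1 le_max lexx orbT ge_max ler_norm normr_ge0.
have [|b1 b2 b3] := fnp _ m2.
  by move=> x; rewrite /g2 le_max lexx orbT ge_max -normrN ler_norm normr_ge0.
have fE x : f x = g1 x - g2 x by rewrite /g1 /g2; case: (leP (f x) 0) => h; case: (leP (- f x) 0); lra.
transitivity (\int[normal_prob 0 s]_x (g1 x - g2 x)).
  by apply: eq_Rintegral => x _.
transitivity (\int[mu]_x (g1 x * normal_pdf 0 s x - g2 x * normal_pdf 0 s x)); last first.
  by apply: eq_Rintegral => x _; rewrite fE mulrBl.
by rewrite !RintegralB// a3 b3.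
Qed.

End normal_integrals.

Section gaussian_variable.
Context {d : measure_display} {Omega : measurableType d} {R : realType}.
Context (P : probability Omega R).
Implicit Types X Y : Omega -> R.
Local Notation E := (Ex P).

Definition gauss X := measurable_fun setT X /\ centered_gaussian P X.

Lemma normal_transfer X s (f : R -> R) : measurable_fun setT X -> s != 0 ->
  (forall U : set R, measurable U -> P (X @^-1` U) = normal_prob 0 s U) ->
  measurable_fun setT f ->
  lebesgue_measure.-integrable setT (EFin \o (fun x : R => f x * normal_pdf 0 s x)) ->
  L1 P (f \o X) /\ E (f \o X) = \int[lebesgue_measure]_x (f x * normal_pdf 0 s x).
Proof.
move=> mX s0 XE mf fi.
have [fn fE] := integrable_normal_prob mf fi.
have mX' : measurable_fun setT (X : Omega -> measurableTypeR R) := mX.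
pose mXm := isMeasurableFun.Build _ _ _ _ _ mX'.
pose X' : {mfun Omega >-> measurableTypeR R} := MeasurableFun.Pack (MeasurableFun.Class mXm).
have pE (g : R -> \bar R) : (\int[pushforward P X']_x g x = \int[normal_prob 0 s]_x g x)%E.
  by apply: eq_measure_integral => A mA _; exact: XE.
have fX : L1 P (f \o X).
  apply/integrableP; split; first by apply/measurable_EFinP; exact: measurableT_comp.
  move/integrableP : fn => [_]; rewrite -pE ge0_integral_pushforward//.
  by apply: measurableT_comp => //; exact/measurable_EFinP.
split=> //; rewrite -fE /Ex /Rintegral -pE.
rewrite (@integral_pushforward _ _ _ _ _ X' mX')//.
exact/measurable_EFinP.
Qed.

Lemma gauss_cases X : gauss X -> (exists s, [/\ 0 < s, measurable_fun setT X &
   (forall U : set R, measurable U -> P (X @^-1` U) = normal_prob 0 s U)]) \/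
  (measurable_fun setT X /\ {ae P, forall w, X w = 0}).
Proof. by move=> [mX [[s s0 h]|h]]; [left; exists s|right]. Qed.

Lemma measurable_sqr X : measurable_fun setT X -> measurable_fun setT (fun w => X w ^+ 2).
Proof. by move=> mX; exact: measurable_funX. Qed.

Lemma ex0 X : measurable_fun setT X -> {ae P, forall w, X w = 0} -> E (fun w => X w ^+ 2) = 0.
Proof.
move=> mX X0; rewrite -[RHS](Ex_cst P); apply: Ex_eq_ae => //; first exact: measurable_sqr.
by apply: filterS X0 => w ->; rewrite expr0n.
Qed.

Lemma normal_sqr X s : 0 < s -> measurable_fun setT X ->
  (forall U : set R, measurable U -> P (X @^-1` U) = normal_prob 0 s U) ->
  L1 P (fun w => X w ^+ 2) /\ E (fun w => X w ^+ 2) = s ^+ 2.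
Proof.
move=> s0 mX XE; have sn0 : s != 0 by rewrite gt_eqF.
have [] := @normal_transfer X s (fun x => x ^+ 2) mX sn0 XE.
- exact: measurable_funX.
- exact: integrable_normal_sqr.
by move=> h1 h2; split=> //; rewrite -normal_variance.
Qed.

Lemma gauss_sqr X : gauss X -> L1 P (fun w => X w ^+ 2).
Proof.
move=> /gauss_cases[[s [s0 mX XE]]|[mX X0]]; first by have [] := normal_sqr s0 mX XE.
apply: (L1_eq_ae _ _ _ (L1_cst P 0)) => //; first exact: measurable_sqr.
by apply: filterS X0 => w ->; rewrite expr0n.
Qed.

Lemma gauss_cos X th : gauss X ->
  E (fun w => cos (X w + th)) = cos th * expR (- (E (fun w => X w ^+ 2) / 2)).
Proof.
move=> /gauss_cases[[s [s0 mX XE]]|[mX X0]].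
  have sn0 : s != 0 by rewrite gt_eqF.
  have [_ ->] := normal_sqr s0 mX XE.
  have [] := @normal_transfer X s (fun x => cos (1 * x + th)) mX sn0 XE.
  - by apply: continuous_measurable_fun; exact: continuous_cosM.
  - exact: integrable_normal_cos.
  move=> _ h; have := normal_cosE 1 th sn0; rewrite /normal_cos -h expr1n mulr1 => <-.
  by congr Ex; apply/funext => w /=; rewrite mul1r.
rewrite ex0// mul0r oppr0 expR0 mulr1 -[RHS](Ex_cst P); apply: Ex_eq_ae => //.
  by apply: (bm_cos _).1; exact: measurable_funD.
by apply: filterS X0 => w ->; rewrite add0r.
Qed.

Lemma gauss_mean X : gauss X -> L1 P X /\ E X = 0.
Proof.
move=> /gauss_cases[[s [s0 mX XE]]|[mX X0]].
  have sn0 : s != 0 by rewrite gt_eqF.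
  have [] := @normal_transfer X s id mX sn0 XE => //.
  - apply: (@normal_integrable_exp _ _ _ (1 + s ^+ 2 *+ 4)) => // x.
    exact: expR_norm_ge.
  by move=> h1 h2; split=> //; rewrite -(normal_mean sn0) -h2.
have X0' : {ae P, forall w, 0 = X w} by apply: filterS X0 => w ->.
split; first exact: (L1_eq_ae _ _ X0' (L1_cst P 0)).
by rewrite -[RHS](Ex_cst P); exact: Ex_eq_ae.
Qed.

(** At variance exactly $s^2$ the mean of $\exp(X^2/(4s^2))$ is $\sqrt2$; replacing $s$ by the
    larger [sg] only decreases the integrand. The moments and tails used in the chaining come from
    here. *)
Lemma gauss_exp X sg : gauss X -> 0 < sg -> E (fun w => X w ^+ 2) <= sg ^+ 2 ->
  L1 P (fun w => expR (X w ^+ 2 / (sg ^+ 2 *+ 4))) /\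
  E (fun w => expR (X w ^+ 2 / (sg ^+ 2 *+ 4))) <= Num.sqrt 2.
Proof.
have s2 : 1 <= Num.sqrt 2 :> R by rewrite -[leLHS]sqrtr1 ler_wsqrtr// ler1n.
have me (a : R) : measurable_fun setT (fun x : R => expR (x ^+ 2 / (a ^+ 2 *+ 4))).
  by apply: measurableT_comp => //; apply: measurable_funM => //; exact: measurable_funX.
move=> /gauss_cases[[s [s0 mX XE]]|[mX X0]] sg0; last first.
  have h : {ae P, forall w, 1 = expR (X w ^+ 2 / (sg ^+ 2 *+ 4))}.
    by apply: filterS X0 => w ->; rewrite expr0n mul0r expR0.
  have mXX : measurable_fun setT (fun w => expR (X w ^+ 2 / (sg ^+ 2 *+ 4))).
    exact: (measurableT_comp (me _)).
  move=> _; split; first exact: (L1_eq_ae _ _ h (L1_cst P 1)).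
  by rewrite -(Ex_eq_ae (f := cst 1) _ _ h)// Ex_cst.
have [_ ->] := normal_sqr s0 mX XE; move=> h.
have {h} ssg : s <= sg by move: h; rewrite ler_pXn2r// ?nnegrE ltW.
have sn0 : s != 0 by rewrite gt_eqF.
have [] := @normal_transfer X s (fun x => expR (x ^+ 2 / (s ^+ 2 *+ 4))) mX sn0 XE => //.
  apply: (@normal_integrable_exp _ _ _ 1) => // x.
  by rewrite mul1r ger0_norm// expR_ge0.
move=> h1 h2.
have le w : expR (X w ^+ 2 / (sg ^+ 2 *+ 4)) <= expR (X w ^+ 2 / (s ^+ 2 *+ 4)).
  rewrite ler_expR ler_wpM2l ?sqr_ge0// lef_pV2 ?posrE ?mulrn_wgt0 ?exprn_gt0//.
  by rewrite lerMn2r/= ler_pXn2r ?nnegrE// ltW.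
have L1X : L1 P (fun w => expR (X w ^+ 2 / (sg ^+ 2 *+ 4))).
  apply: (L1_le _ h1); first exact: (measurableT_comp (me _)).
  by move=> w; rewrite ger0_norm ?expR_ge0.
split=> //; rewrite (le_trans (Ex_le L1X h1 le))//.
rewrite [E _]h2.
under eq_Rintegral do rewrite normal_pdf_sqrt2//.
rewrite RintegralZl//; last exact: integrable_normal_pdf.
by rewrite /Rintegral integral_normal_pdf mulr1.
Qed.

Lemma gauss_lower_tail X b : gauss X -> 0 <= b -> 0 < E (fun w => X w ^+ 2) ->
  (expR (- ((b + 1) ^+ 2 / 2)) / Num.sqrt (pi *+ 2)) <=
  pr P [set w | b * Num.sqrt (E (fun w => X w ^+ 2)) < X w].
Proof.
move=> /gauss_cases[[s [s0 mX XE]]|[mX X0]] b0; last by rewrite ex0// ltxx.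
have [_ ->] := normal_sqr s0 mX XE => _.
rewrite sqrtr_sqr gtr0_norm// -lee_fin prE.
  rewrite (le_trans (normal_tail_ge s0 b0))// -XE//= le_eqVlt; apply/orP; left; apply/eqP.
  by congr (P _); apply/funext => w /=; rewrite in_itv/= andbT.
rewrite (_ : [set _ | _] = X @^-1` `]b * s, +oo[).
  by rewrite -[X in measurable X]setTI; exact: mX.
by apply/funext => w /=; rewrite in_itv/= andbT.
Qed.

End gaussian_variable.

(** * Trigonometric moments and independence *)

Section cramer_wold.
Context {d1 d2 : measure_display} {O1 : measurableType d1} {O2 : measurableType d2}.
Context {R : realType} (P1 : probability O1 R) (P2 : probability O2 R).
Context {I : Type} (X : I -> O1 -> R) (Y : I -> O2 -> R).
Context (mX : forall i, measurable_fun setT (X i)).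
Context (mY : forall i, measurable_fun setT (Y i)).

Definition lin {O : Type} (Z : I -> O -> R) (s : seq (R * I)) (w : O) : R :=
  \sum_(p <- s) p.1 * Z p.2 w.

Lemma measurable_lin {d} {O : measurableType d} (Z : I -> O -> R) s :
  (forall i, measurable_fun setT (Z i)) -> measurable_fun setT (lin Z s).
Proof.
move=> mZ; elim: s => [|p s IH].
  by rewrite (_ : lin Z [::] = cst 0)//; apply/funext => w; rewrite /lin big_nil.
rewrite (_ : lin Z (p :: s) = fun w => p.1 * Z p.2 w + lin Z s w); last first.
  by apply/funext => w; rewrite /lin big_cons.
by apply: measurable_funD => //; exact: measurable_funM.
Qed.

(* Weighted trigonometric moments stand in for the joint characteristic
   function: they identify the law of [X] under [h] with that of [Y] under [h']. *)
Definition same_trig (h : O1 -> R) (h' : O2 -> R) := [/\ bm h, bm h' &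
  forall s th, Ex P1 (fun w => h w * cos (lin X s w + th)) =
               Ex P2 (fun w => h' w * cos (lin Y s w + th))].

Lemma bm_trig h s th : bm h -> bm (fun w => h w * cos (lin X s w + th)).
Proof. by move=> bh; apply: bmM => //; apply: bm_cos; apply: measurable_funD => //; exact: measurable_lin. Qed.

Lemma bm_trig' h s th : bm h -> bm (fun w => h w * cos (lin Y s w + th)).
Proof. by move=> bh; apply: bmM => //; apply: bm_cos; apply: measurable_funD => //; exact: measurable_lin. Qed.

Lemma cosMcos (a b : R) : cos a * cos b = 2^-1 * cos (b + a) + 2^-1 * cos (- b + a).
Proof. by rewrite !cosD cosN sinN; field. Qed.

(** By the product-to-sum formula, multiplying the weight by $\cos(tX_i+\theta)$ amounts to
    prepending $(\pm t,i)$ to the linear combination, and the hypothesis covers all combinations and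
    phases. *)
Lemma same_trig_cos h h' i t th : same_trig h h' ->
  same_trig (fun w => h w * cos (t * X i w + th)) (fun w => h' w * cos (t * Y i w + th)).
Proof.
move=> [bh bh' hh]; split.
- by apply: bmM => //; apply: bm_cos; apply: measurable_funD => //; exact: measurable_funM.
- by apply: bmM => //; apply: bm_cos; apply: measurable_funD => //; exact: measurable_funM.
move=> s ph.
transitivity (2^-1 * Ex P1 (fun w => h w * cos (lin X ((t, i) :: s) w + (th + ph))) +
  2^-1 * Ex P1 (fun w => h w * cos (lin X ((- t, i) :: s) w + (- th + ph)))).
  rewrite -!ExZ -?ExD; try by [apply: bm_L1; exact: bm_trig|apply: L1Z; apply: bm_L1; exact: bm_trig].
  congr Ex; apply/funext => w.
  rewrite mulrAC -mulrA cosMcos /lin !big_cons/= mulrDr !(mulrCA _ (h w)).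
  by congr (_ * (_ * cos _) + _ * (_ * cos _)); ring.
rewrite !hh.
rewrite -!ExZ -?ExD; try by [apply: bm_L1; exact: bm_trig'|apply: L1Z; apply: bm_L1; exact: bm_trig'].
congr Ex; apply/funext => w.
rewrite mulrAC -mulrA cosMcos /lin !big_cons/= mulrDr !(mulrCA _ (h' w)).
by congr (_ * (_ * cos _) + _ * (_ * cos _)); ring.
Qed.

Lemma same_trig_comb a b h h' g g' : same_trig h h' -> same_trig g g' ->
  same_trig (fun w => a * h w + b * g w) (fun w => a * h' w + b * g' w).
Proof.
move=> [bh bh' hh] [bg bg' gg]; split.
- by apply: bmD; apply: bmM => //; exact: bm_cst.
- by apply: bmD; apply: bmM => //; exact: bm_cst.
move=> s th.
have -> : (fun w => (a * h w + b * g w) * cos (lin X s w + th)) =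
  (fun w => a * (h w * cos (lin X s w + th)) + b * (g w * cos (lin X s w + th))).
  by apply/funext => w; ring.
have -> : (fun w => (a * h' w + b * g' w) * cos (lin Y s w + th)) =
  (fun w => a * (h' w * cos (lin Y s w + th)) + b * (g' w * cos (lin Y s w + th))).
  by apply/funext => w; ring.
rewrite !ExD; try by [apply: L1Z; apply: bm_L1; exact: bm_trig|apply: L1Z; apply: bm_L1; exact: bm_trig'].
rewrite !ExZ ?hh ?gg//; by [apply: bm_L1; exact: bm_trig|apply: bm_L1; exact: bm_trig'].
Qed.

(** Bounded convergence; this is how discontinuous weights, such as indicators, are reached. *)
Lemma same_trig_lim M (h : nat -> O1 -> R) (h' : nat -> O2 -> R) g g' :
  (forall n, same_trig (h n) (h' n)) ->
  (forall n w, `|h n w| <= M) -> (forall n w, `|h' n w| <= M) ->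
  (forall w, h ^~ w @ \oo --> g w) -> (forall w, h' ^~ w @ \oo --> g' w) ->
  same_trig g g'.
Proof.
move=> hh hM hM' hg hg'.
have aux d (O : measurableType d) (f : nat -> O -> R) (k : O -> R) :
    (forall n, bm (f n)) -> (forall n w, `|f n w| <= M) -> (forall w, f ^~ w @ \oo --> k w) -> bm k.
  move=> bf fM fk; split.
    by apply: (@measurable_fun_cvg _ _ _ setT f) => // n; have [] := bf n.
  exists M => w; apply: (@closed_cvg _ _ \oo _ (fun x => `|f x w|) [set y | y <= M]) => //.
  - by apply: nearW => n; exact: fM.
  - exact: cvg_norm.
have bg : bm g by apply: (aux _ _ h) => // n; have [] := hh n.
have bg' : bm g' by apply: (aux _ _ h') => // n; have [] := hh n.
have cM (a b : R) : `|a| <= M -> `|a * cos b| <= M.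
  by move=> aM; rewrite normrM (le_trans _ aM)// ler_piMr// cos_max.
split=> // s th.
have c1 : Ex P1 (fun w => h n w * cos (lin X s w + th)) @[n --> \oo] -->
   Ex P1 (fun w => g w * cos (lin X s w + th)).
  apply: (@Ex_cvg _ _ _ _ _ _ M).
  - by move=> n; have [b _ _] := hh n; have [] := bm_trig s th b.
  - by have [] := bm_trig s th bg.
  - by move=> n w; apply: cM.
  - by apply: aeW => w; apply: cvgMl; exact: hg.
have c2 : Ex P2 (fun w => h' n w * cos (lin Y s w + th)) @[n --> \oo] -->
   Ex P2 (fun w => g' w * cos (lin Y s w + th)).
  apply: (@Ex_cvg _ _ _ _ _ _ M).
  - by move=> n; have [_ b _] := hh n; have [] := bm_trig' s th b.
  - by have [] := bm_trig' s th bg'.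
  - by move=> n w; apply: cM.
  - by apply: aeW => w; apply: cvgMl; exact: hg'.
apply: (@cvg_unique _ _ _ _ _ _ c1) => //.
by have -> : (fun n => Ex P1 (fun w => h n w * cos (lin X s w + th))) =
  (fun n => Ex P2 (fun w => h' n w * cos (lin Y s w + th))) by apply/funext => n; have [_ _] := hh n.
Qed.

Lemma same_trig_one_sub h h' (f : O1 -> R) (f' : O2 -> R) : same_trig h h' ->
  same_trig (fun w => h w * f w) (fun w => h' w * f' w) ->
  same_trig (fun w => h w * (1 - f w)) (fun w => h' w * (1 - f' w)).
Proof.
move=> hh hf.
rewrite (_ : (fun w => h w * (1 - f w)) = fun w => 1 * h w + (-1) * (h w * f w)); last first.
  by apply/funext => w; ring.
rewrite (_ : (fun w => h' w * (1 - f' w)) = fun w => 1 * h' w + (-1) * (h' w * f' w)); last first.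
  by apply/funext => w; ring.
exact: same_trig_comb.
Qed.

(* Tends to the indicator of [y < 1/2]; at [y = (1 - cos) / 2] this turns
   trigonometric moments into probabilities of half-spaces. *)
Definition step_poly (y : R) n : R := (1 - y ^+ n) ^+ (n * 2 ^ n)%N.

Lemma step_poly01 (y : R) n : 0 <= y <= 1 -> 0 <= step_poly y n <= 1.
Proof.
move=> /andP[y0 y1]; have /andP[a b] : 0 <= 1 - y ^+ n <= 1.
  by rewrite subr_ge0 exprn_ile1//= gerBl exprn_ge0.
by rewrite /step_poly exprn_ge0//= exprn_ile1.
Qed.

Lemma bernoulli_ge (a : R) n : 0 <= a <= 1 -> 1 - a *+ n <= (1 - a) ^+ n.
Proof.
move=> /andP[a0 a1]; elim: n => [|n IH]; first by rewrite expr0 mulr0n subr0.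
rewrite exprS; apply: (@le_trans _ _ ((1 - a) * (1 - a *+ n))); last first.
  by rewrite ler_wpM2l// subr_ge0.
rewrite mulrBl mul1r mulrS -subr_ge0.
rewrite (_ : _ - _ = a * (a *+ n)); first by rewrite mulr_ge0// mulrn_wge0.
by rewrite -[a *+ n]mulr_natr; ring.
Qed.

Lemma expr_mul2 (y : R) n : y ^+ n *+ (n * 2 ^ n)%N = (2 * y) ^+ n *+ n.
Proof. by rewrite mulnC mulrnA -[y ^+ n *+ (2 ^ n)%N]mulr_natl natrX -exprMn. Qed.

Lemma expr_le_expR (z : R) n : 0 <= z -> z ^+ n <= expR (- ((1 - z) *+ n)).
Proof.
move=> z0; rewrite -mulNrn -mulr_natl expRM_natl lerXn2r ?nnegrE ?expR_ge0//.
by rewrite (le_trans _ (expR_ge1Dx _))// opprB addrC subrK.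
Qed.

Lemma expRN_le_sqr (x : R) : 0 < x -> expR (- x) <= 4 / x ^+ 2.
Proof.
move=> x0; rewrite expRN -[leRHS]invrK invf_div lef_pV2 ?posrE ?expR_gt0 ?divr_gt0 ?exprn_gt0//.
have -> : x = x / 2 *+ 2 by rewrite -mulr_natr divfK.
rewrite -mulr_natl expRM_natl.
apply: (@le_trans _ _ ((1 + x / 2) ^+ 2)).
  by rewrite mulr_natl -mulr_natr divfK//; nra.
by rewrite lerXn2r ?nnegrE ?expR_ge0 ?expR_ge1Dx// addr_ge0// divr_ge0// ltW.
Qed.

(** Below $1/2$ Bernoulli's inequality bounds the defect by $n(2y)^n$. From $1/2$ on the value is at
    most $\exp(-n(2y)^n)\le e^{-n}$; the factor [n] in the exponent of [step_poly] is what forces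
    the limit 0 at $y=1/2$ itself. *)
Lemma step_poly_cvg (y : R) : 0 <= y <= 1 ->
  step_poly y n @[n --> \oo] --> (((y < 2^-1)%R : bool)%:R : R).
Proof.
move=> y01; have /andP[y0 y1] := y01; rewrite -cvg_shiftS.
case: ltP => y2.
  pose c := 4 / (1 - 2 * y) ^+ 2.
  have c0 : 0 < 1 - 2 * y by lra.
  apply: (@squeeze_cvgr _ _ _ _ (fun n => 1 - c * n.+1%:R^-1) (cst 1)).
  - apply: nearW => n; have /andP[_ ->] := step_poly01 n.+1 y01; rewrite andbT.
    have yn : 0 <= y ^+ n.+1 <= 1 by rewrite exprn_ge0//= exprn_ile1.
    rewrite (le_trans _ (bernoulli_ge _ yn))// lerB//.
    have z0 : 0 <= 2 * y by rewrite mulr_ge0.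
    rewrite expr_mul2.
    apply: (@le_trans _ _ ((4 / ((1 - 2 * y) *+ n.+1) ^+ 2) * n.+1%:R)).
      by rewrite -mulr_natr ler_wpM2r// (le_trans (expr_le_expR _ z0))// expRN_le_sqr// mulrn_wgt0.
    rewrite /c -(mulr_natr (1 - 2 * y)) exprMn invfM -!mulrA ler_wpM2l// ler_wpM2l ?invr_ge0 ?sqr_ge0//.
    by rewrite expr2 invfM -mulrA mulVf ?mulr1// pnatr_eq0.
  - rewrite -[X in _ --> X]subr0 -[X in _ - X](mulr0 c); apply: cvgB; first exact: cvg_cst.
    by apply: cvgMr; exact: (@cvg_harmonic R).
  - exact: cvg_cst.
apply: (@squeeze_cvgr _ _ _ _ (cst 0) (fun n => n.+1%:R^-1)).
- apply: nearW => n; have /andP[-> _] := step_poly01 n.+1 y01 => /=.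
  have yn : 0 <= 1 - y ^+ n.+1 by rewrite subr_ge0 exprn_ile1.
  rewrite (le_trans (expr_le_expR _ yn))// opprB addrCA subrr addr0.
  rewrite expRN lef_pV2 ?posrE ?expR_gt0// (le_trans _ (expR_ge1Dx _))//.
  rewrite expr_mul2.
  have h : 1 <= (2 * y) ^+ n.+1 by rewrite exprn_ege1//; lra.
  rewrite (@le_trans _ _ ((2 * y) ^+ n.+1 *+ n.+1))// ?lerDr// lerMn2r/=.
  exact: h.
- exact: cvg_cst.
- exact: (@cvg_harmonic R).
Qed.

Lemma same_trig_half h h' t th i : same_trig h h' ->
  same_trig (fun w => h w * ((0 < cos (t * X i w + th))%R : bool)%:R)
            (fun w => h' w * ((0 < cos (t * Y i w + th))%R : bool)%:R).
Proof.
move=> hh.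
pose y (x : R) := 2^-1 * (1 - cos (t * x + th)).
have y01 x : 0 <= y x <= 1.
  by rewrite /y; have := cos_le1 (t * x + th); have := cos_geN1 (t * x + th); lra.
have yE x : (0 < cos (t * x + th)) = (y x < 2^-1) by rewrite /y; apply/idP/idP; lra.
have st1 g g' : same_trig g g' -> same_trig (fun w => g w * y (X i w)) (fun w => g' w * y (Y i w)).
  move=> gg; have := same_trig_comb (2^-1) (- 2^-1) gg (same_trig_cos i t th gg).
  congr same_trig; apply/funext => w; rewrite /y; ring.
have st2 n g g' : same_trig g g' ->
    same_trig (fun w => g w * y (X i w) ^+ n) (fun w => g' w * y (Y i w) ^+ n).
  elim: n g g' => [|n IH] g g' gg.
    by move: gg; congr same_trig; apply/funext => w; rewrite expr0 mulr1.
  have := IH _ _ (st1 _ _ gg); congr same_trig; apply/funext => w; rewrite exprS; exact/esym/mulrA.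
have st3 n m g g' : same_trig g g' ->
    same_trig (fun w => g w * (1 - y (X i w) ^+ n) ^+ m) (fun w => g' w * (1 - y (Y i w) ^+ n) ^+ m).
  elim: m g g' => [|m IH] g g' gg.
    by move: gg; congr same_trig; apply/funext => w; rewrite expr0 mulr1.
  have := IH _ _ (same_trig_one_sub gg (st2 n _ _ gg)).
  by congr same_trig; apply/funext => w; rewrite exprS; exact/esym/mulrA.
have [[_ [M hM]] [_ [M' hM']] _] := hh.
have bnd (a b c : R) : `|a| <= c -> 0 <= b <= 1 -> `|a * b| <= c.
  move=> ac /andP[b0 b1]; rewrite normrM (ger0_norm b0) (le_trans _ ac)//.
  by rewrite ler_piMr.
apply: (@same_trig_lim (Num.max M M') (fun n w => h w * step_poly (y (X i w)) n)
   (fun n w => h' w * step_poly (y (Y i w)) n)).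
- by move=> n; exact: st3.
- by move=> n w; apply: bnd; [rewrite le_max hM|exact: step_poly01].
- by move=> n w; apply: bnd; [rewrite le_max hM' orbT|exact: step_poly01].
- by move=> w; apply: cvgMr; rewrite yE; exact: step_poly_cvg.
- by move=> w; apply: cvgMr; rewrite yE; exact: step_poly_cvg.
Qed.

(** A half-line is a limit of half-periods: $\sin((cx-a)/n)$ has the sign of $cx-a$ once
    $|cx-a|/n<\pi$, and the phase $-\pi/2$ writes this sine as a cosine, to which [same_trig_half]
    applies. *)
Lemma same_trig_gt h h' c i a : same_trig h h' ->
  same_trig (fun w => h w * ((a < c * X i w)%R : bool)%:R)
            (fun w => h' w * ((a < c * Y i w)%R : bool)%:R).
Proof.
move=> hh; have [[_ [M hM]] [_ [M' hM']] _] := hh.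
pose f n (x : R) := ((0 < cos (c / n.+1%:R * x + (- a / n.+1%:R - pi / 2)))%R : bool)%:R : R.
have fE x : f n x @[n --> \oo] --> (((a < c * x)%R : bool)%:R : R).
  have fE' n : f n x = ((0 < sin ((c * x - a) / n.+1%:R))%R : bool)%:R.
    rewrite /f; congr ((_ : bool)%:R); congr (_ < _).
    rewrite -[in RHS](subrK (pi / 2) (_ / _)) sinDpihalf.
    by congr cos; ring.
  apply: cvg_near_cst; near=> n; rewrite fE'; congr ((_ : bool)%:R).
  have n0 : (0:R) < n.+1%:R by rewrite ltr0n.
  have npi : `|c * x - a| / n.+1%:R < pi.
    rewrite ltr_pdivrMr//; apply: (@lt_le_trans _ _ n.+1%:R).
      apply: (@lt_le_trans _ _ (Num.truncn `|c * x - a|).+1%:R).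
        by have /andP[_] := truncn_itv (normr_ge0 (c * x - a)).
      by rewrite ler_nat ltnS; near: n; exists (Num.truncn `|c * x - a|).
    by rewrite ler_peMl// ?ltW//; have := @pi_ge2 R; lra.
  case: (ltrgtP a (c * x)) => ax.
  - rewrite sin_gt0_pi// divr_gt0 ?subr_gt0//=.
    by rewrite gtr0_norm ?subr_gt0// in npi.
  - apply/negbTE; rewrite -leNgt -[X in sin X]opprK sinN oppr_le0 -mulNr opprB.
    apply: sin_ge0_pi; rewrite divr_ge0 ?subr_ge0 ?ltW//=.
    by rewrite ltr0_norm ?subr_lt0// opprB in npi.
  - by rewrite ax subrr mul0r sin0 ltxx.
apply: (@same_trig_lim (Num.max M M') (fun n w => h w * f n (X i w))
   (fun n w => h' w * f n (Y i w))).
- by move=> n; exact: same_trig_half.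
- move=> n w; rewrite normrM (@le_trans _ _ `|h w|) ?le_max ?hM// ler_piMr//.
  by rewrite /f; case: (_ < _); rewrite ?normr1 ?normr0.
- move=> n w; rewrite normrM (@le_trans _ _ `|h' w|) ?le_max ?hM' ?orbT// ler_piMr//.
  by rewrite /f; case: (_ < _); rewrite ?normr1 ?normr0.
- by move=> w; apply: cvgMr.
- by move=> w; apply: cvgMr.
Unshelve. all: by end_near. Qed.

Lemma same_trig_abs h h' i t : same_trig h h' ->
  same_trig (fun w => h w * ((`|X i w| <= t)%R : bool)%:R)
            (fun w => h' w * ((`|Y i w| <= t)%R : bool)%:R).
Proof.
move=> hh.
have h1 := same_trig_one_sub hh (same_trig_gt 1 i t hh).
have := same_trig_one_sub h1 (same_trig_gt (-1) i t h1).
have nE (x : R) : ((`|x| <= t)%R : bool)%:R = (1 - (t < 1 * x)%R%:R) * (1 - (t < -1 * x)%R%:R) :> R.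
  rewrite mul1r mulN1r ler_norml [- t <= _]leNgt ltrNr [x <= t]leNgt.
  by case: (t < x); case: (t < - x); rewrite /= ?subr0 ?subrr ?mulr0 ?mul0r ?mulr1.
by congr same_trig; apply/funext => w; rewrite nE mulrA.
Qed.

Lemma same_trig_box n h h' (i : 'I_n -> I) (t : 'I_n -> R) : same_trig h h' ->
  Ex P1 (fun w => h w * \prod_j ((`|X (i j) w| <= t j)%R : bool)%:R) =
  Ex P2 (fun w => h' w * \prod_j ((`|Y (i j) w| <= t j)%R : bool)%:R).
Proof.
move=> hh.
suff : same_trig (fun w => h w * \prod_j ((`|X (i j) w| <= t j)%R : bool)%:R)
   (fun w => h' w * \prod_j ((`|Y (i j) w| <= t j)%R : bool)%:R).
  move=> [_ _ /(_ [::] 0)].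
  rewrite (_ : (fun w => _ * cos _) = fun w => h w * \prod_j ((`|X (i j) w| <= t j)%R : bool)%:R); last first.
    by apply/funext => w; rewrite /lin big_nil addr0 cos0 mulr1.
  rewrite (_ : (fun w => _ * cos _) = fun w => h' w * \prod_j ((`|Y (i j) w| <= t j)%R : bool)%:R)//.
  by apply/funext => w; rewrite /lin big_nil addr0 cos0 mulr1.
elim: n i t h h' hh => [|n IH] i t h h' hh.
  by move: hh; congr same_trig; apply/funext => w; rewrite big_ord0 mulr1.
have := IH (fun j => i (lift ord0 j)) (fun j => t (lift ord0 j)) _ _ (same_trig_abs (i ord0) (t ord0) hh).
by congr same_trig; apply/funext => w; rewrite big_ord_recl mulrA.
Qed.

End cramer_wold.

Section dynkin.
Context {d : measure_display} {O : measurableType d} {R : realType}.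
Context (P : probability O R) {J : Type} (X : J -> O -> R).
Context (mX : forall i, measurable_fun setT (X i)).

Definition sigma_of := <<s \bigcup_i preimage_set_system [set: O] (X i) measurable >>.

Lemma sigma_of_measurable : sigma_of `<=` measurable.
Proof.
apply: smallest_sub; first exact: sigma_algebra_measurable.
by move=> A [i _ [U mU <-]]; exact: mX.
Qed.

Definition ray_sets : set (set O) := [set A | exists l : seq (J * R),
  A = [set w | all (fun q => q.2 < X q.1 w) l]].

Lemma setI_closed_ray_sets : setI_closed ray_sets.
Proof.
move=> A B [l ->] [l' ->]; exists (l ++ l'); apply/seteqP; split=> w /=.
  by rewrite all_cat => -[-> ->].
by rewrite all_cat => /andP[].
Qed.

Lemma sigma_of_ray_sets : sigma_of `<=` <<s ray_sets >>.
Proof.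
apply: smallest_sub; first exact: smallest_sigma_algebra.
move=> A [i _ [U mU <-]]; rewrite setTI.
pose F := [set V : set R | <<s ray_sets >> (X i @^-1` V)].
have sF : sigma_algebra setT F.
  split=> /=.
  - by rewrite /F/= preimage_set0; exact: sigma_algebra0.
  - move=> B FB; rewrite /F/= setTD preimage_setC -setTD; exact: sigma_algebraCD.
  - by move=> B FB; rewrite /F/= preimage_bigcup; exact: sigma_algebra_bigcup.
have mE := RGenOInfty.measurableE R.
suff GF : <<s @RGenOInfty.G R >> `<=` F.
  have h := congr1 (fun C : set (set R) => C U) mE.
  by apply: GF; exact: (eq_ind _ (fun C : Prop => C) mU _ h).
apply: smallest_sub => // _ [a ->].
apply: sub_sigma_algebra; exists [:: (i, a)].
by apply/seteqP; split=> w /=; rewrite in_itv/= !andbT.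
Qed.

(** Dynkin's argument: finite intersections of half-spaces form a generating $\pi$-system on which
    [same_trig_gt] gives the equality, and the events with equal weighted measure are closed under
    complements and countable disjoint unions. With one weight constant, the conclusion is a product
    rule. *)
Lemma same_trig_sigma (h g : O -> R) : same_trig P P X X h g ->
  forall A, sigma_of A -> Ex P (fun w => h w * \1_A w) = Ex P (fun w => g w * \1_A w).
Proof.
move=> hg A /sigma_of_ray_sets; move: A.
have [bh bg _] := hg.
have bi (f : O -> R) A : bm f -> measurable A -> bm (fun w => f w * \1_A w).
  by move=> bf mA; apply: bmM => //; exact: bm_indic.
have li f A : bm f -> measurable A -> L1 P (fun w => f w * \1_A w).
  by move=> bf mA; apply: bm_L1; exact: bi.
have st l : forall f f', same_trig P P X X f f' ->
    same_trig P P X X (fun w => f w * \1_[set w | all (fun q => q.2 < X q.1 w) l] w)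
      (fun w => f' w * \1_[set w | all (fun q => q.2 < X q.1 w) l] w).
  elim: l => [|q l IH] f f' ff.
    by move: ff; congr same_trig; apply/funext => w; rewrite indicE mem_set ?mulr1.
  have := IH _ _ (same_trig_gt mX mX 1 q.1 q.2 ff).
  have iE w : \1_[set w | all (fun q => q.2 < X q.1 w) (q :: l)] w =
     ((q.2 < 1 * X q.1 w)%R : bool)%:R * \1_[set w | all (fun q => q.2 < X q.1 w) l] w :> R.
    rewrite !indicE mul1r -natrM mulnb; congr ((_ : bool)%:R).
    apply/idP/andP => [/set_mem/= /andP[a b]|[a /set_mem/= b]].
      by split=> //; exact: mem_set.
    by apply/mem_set => /=; rewrite a.
  by congr same_trig; apply/funext => w; rewrite iE mulrA.
rewrite -(setI_closed_g_dynkin_g_sigma_algebra setI_closed_ray_sets).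
suff : <<d ray_sets >> `<=` [set A | measurable A /\
    Ex P (fun w => h w * \1_A w) = Ex P (fun w => g w * \1_A w)].
  by move=> H A /H[].
apply: smallest_sub.
  split.
  - split=> //; have [_ _ /(_ [::] 0)] := st [::] _ _ hg.
    rewrite /lin; under eq_fun do rewrite big_nil addr0 cos0 mulr1.
    under [in RHS]eq_fun do rewrite big_nil addr0 cos0 mulr1.
    by rewrite (_ : [set w | _] = setT)//; apply/seteqP; split.
  - move=> A [mA hA]; split; first exact: measurableC.
    have c f : bm f -> Ex P (fun w => f w * \1_(~` A) w) = Ex P f - Ex P (fun w => f w * \1_A w).
      move=> bf; rewrite -ExB; [|exact: bm_L1|exact: li].
      congr Ex; apply/funext => w; rewrite !indicE in_setC.
      by case: (w \in A); rewrite /= ?mulr1 ?mulr0 ?subr0 ?subrr.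
    rewrite !c// hA; congr (_ - _); have [_ _ /(_ [::] 0)] := hg.
    rewrite /lin; under eq_fun do rewrite big_nil addr0 cos0 mulr1.
    by under [in RHS]eq_fun do rewrite big_nil addr0 cos0 mulr1.
  - move=> F tF FF; have mF k : measurable (F k) by have [] := FF k.
    have mU : measurable (\bigcup_k F k) by exact: bigcupT_measurable.
    split=> //.
    pose S n := \big[setU/set0]_(k < n) F k.
    have mS n : measurable (S n) by apply: bigsetU_measurable => k _.
    have SS n f : bm f -> Ex P (fun w => f w * \1_(S n.+1) w) =
        Ex P (fun w => f w * \1_(S n) w) + Ex P (fun w => f w * \1_(F n) w).
      move=> bf; rewrite -ExD; [|exact: li..].
      congr Ex; apply/funext => w; rewrite -mulrDr /S big_ord_recr/=.
      congr (_ * _); rewrite !indicE in_setU.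
      have [wF|wF] := boolP (w \in F n); last by rewrite orbF addr0.
      rewrite orbT; have [|] := boolP (w \in _); last by rewrite add0r.
      rewrite inE -bigcup_mkord => -[k /= kn Fk].
      have := tF k n I I (ex_intro _ w (conj Fk (set_mem wF))).
      by move=> kE; rewrite kE ltnn in kn.
    have Sc f : bm f -> Ex P (fun w => f w * \1_(S n) w) @[n --> \oo] -->
        Ex P (fun w => f w * \1_(\bigcup_k F k) w).
      move=> bf; have [mf [M fM]] := bf.
      apply: (@Ex_cvg _ _ _ _ _ _ M).
      - by move=> n; have [] := bi _ _ bf (mS n).
      - by have [] := bi _ _ bf mU.
      - move=> n w; rewrite normrM (le_trans _ (fM w))// ler_piMr// indicE.
        by case: (_ \in _); rewrite ?normr1 ?normr0.
      apply: aeW => w; apply: cvg_near_cst.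
      have [[k _ Fk]|nF] := pselect ((\bigcup_k F k) w).
        exists k.+1 => // n /= kn; congr (_ * _); rewrite !indicE !mem_set//; first by exists k.
        by rewrite /S -bigcup_mkord; exists k.
      apply: nearW => n; congr (_ * _); rewrite !indicE !memNset//.
      by rewrite /S -bigcup_mkord => -[k _ Fk]; apply: nF; exists k.
    have e n : Ex P (fun w => h w * \1_(S n) w) = Ex P (fun w => g w * \1_(S n) w).
      elim: n => [|n IH]; last by rewrite !SS// IH; have [_ ->] := FF n.
      by rewrite /S big_ord0; congr Ex; apply/funext => w; rewrite indic0 !mulr0.
    have := Sc _ bh; under eq_fun do rewrite e.
    by move/cvg_unique; apply => //; exact: Sc.
move=> A [l ->]; split.
  elim: l => [|q l IH]; first by rewrite (_ : mkset _ = setT)//; apply/seteqP; split.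
  rewrite (_ : mkset _ = (X q.1 @^-1` `]q.2, +oo[) `&` [set w | all (fun q => q.2 < X q.1 w) l]).
    by apply: measurableI => //; rewrite -[X in measurable X]setTI; exact: mX.
  by apply/seteqP; split=> w /=; rewrite in_itv/= andbT => /andP.
have [_ _ /(_ [::] 0)] := st l _ _ hg.
rewrite /lin; under eq_fun do rewrite big_nil addr0 cos0 mulr1.
by under [in RHS]eq_fun do rewrite big_nil addr0 cos0 mulr1.
Qed.

End dynkin.

(** * Inner products and linear spaces of Gaussian variables *)

Section square_integrable.
Context {d : measure_display} {O : measurableType d} {R : realType}.
Context (P : probability O R).
Implicit Types X Y Z : O -> R.

Definition L2 X := measurable_fun setT X /\ L1 P (fun w => X w ^+ 2).
Definition ip X Y := Ex P (fun w => X w * Y w).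

Lemma L2M X Y : L2 X -> L2 Y -> L1 P (fun w => X w * Y w).
Proof.
move=> [mX X2] [mY Y2]; apply: (L1_le _ (L1D X2 Y2)); first exact: measurable_funM.
move=> w; rewrite normrM -(real_normK (num_real (X w))) -(real_normK (num_real (Y w))).
by have := normr_ge0 (X w); have := normr_ge0 (Y w); nra.
Qed.

Lemma L2_comb a b X Y : L2 X -> L2 Y -> L2 (fun w => a * X w + b * Y w).
Proof.
move=> hX hY; have [mX X2] := hX; have [mY Y2] := hY; split.
  by apply: measurable_funD; exact: measurable_funM.
have -> : (fun w => (a * X w + b * Y w) ^+ 2) =
  (fun w => a ^+ 2 * X w ^+ 2 + (2 * a * b * (X w * Y w) + b ^+ 2 * Y w ^+ 2)).
  by apply/funext => w; ring.
by apply: L1D; [exact: L1Z|apply: L1D; apply: L1Z => //; exact: L2M].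
Qed.

Lemma ip_combl a b X Y Z : L2 X -> L2 Y -> L2 Z ->
  ip (fun w => a * X w + b * Y w) Z = a * ip X Z + b * ip Y Z.
Proof.
move=> hX hY hZ; rewrite /ip -!ExZ -?ExD; try by [apply: L1Z; exact: L2M|exact: L2M].
by congr Ex; apply/funext => w; ring.
Qed.

Lemma ipC X Y : ip X Y = ip Y X.
Proof. by congr Ex; apply/funext => w; rewrite mulrC. Qed.

Lemma ip_combr a b X Y Z : L2 X -> L2 Y -> L2 Z ->
  ip Z (fun w => a * X w + b * Y w) = a * ip Z X + b * ip Z Y.
Proof. by move=> *; rewrite ipC ip_combl// !(ipC Z). Qed.

Lemma ip_sqr X : ip X X = Ex P (fun w => X w ^+ 2).
Proof. by congr Ex; apply/funext => w; rewrite expr2. Qed.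

Lemma ip_ge0 X : 0 <= ip X X.
Proof. by rewrite ip_sqr; apply: Ex_ge0 => w; exact: sqr_ge0. Qed.

Lemma ip_expand a b X Y : L2 X -> L2 Y ->
  ip (fun w => a * X w + b * Y w) (fun w => a * X w + b * Y w) =
  a ^+ 2 * ip X X + 2 * a * b * ip X Y + b ^+ 2 * ip Y Y.
Proof.
move=> hX hY; rewrite ip_combl ?ip_combr//; last exact: L2_comb.
by rewrite (ipC Y X); ring.
Qed.

(** When $Y$ has norm zero, the squared norm of $X+tY$ is affine in $t$, and an affine function
    bounded below is constant. *)
Lemma ip_eq0 X Y : L2 X -> L2 Y -> ip Y Y = 0 -> ip X Y = 0.
Proof.
move=> hX hY Y0; have x0 := ip_ge0 X.
have h t : 0 <= ip X X + 2 * t * ip X Y.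
  by have := ip_ge0 (fun w => 1 * X w + t * Y w); rewrite ip_expand// Y0; lra.
apply/eqP/negPn/negP => c0.
have := h (- (ip X X + 1) / (2 * ip X Y)).
rewrite (_ : _ + _ = -1); first lra.
by field.
Qed.

Lemma L2_cst0 : L2 (fun=> 0).
Proof. by split=> //; rewrite (_ : (fun w => _) = cst 0); [exact: L1_cst|apply/funext => w; rewrite expr0n]. Qed.

Lemma L2_lin (I : Type) (X : I -> O -> R) s : (forall i, L2 (X i)) -> L2 (lin X s).
Proof.
move=> hX; elim: s => [|p s IH].
  by rewrite (_ : lin X [::] = fun=> 0); [exact: L2_cst0|apply/funext => w; rewrite /lin big_nil].
rewrite (_ : lin X (p :: s) = fun w => p.1 * X p.2 w + 1 * lin X s w); first exact: L2_comb.
by apply/funext => w; rewrite /lin big_cons mul1r.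
Qed.

Lemma ip_lin0 (I : Type) (X : I -> O -> R) s Y : (forall i, L2 (X i)) -> L2 Y ->
  (forall i, ip (X i) Y = 0) -> ip (lin X s) Y = 0.
Proof.
move=> hX hY XY; elim: s => [|p s IH].
  rewrite (_ : lin X [::] = fun=> 0); last by apply/funext => w; rewrite /lin big_nil.
  by rewrite /ip -[RHS](Ex_cst P); congr Ex; apply/funext => w; rewrite mul0r.
rewrite (_ : lin X (p :: s) = fun w => p.1 * X p.2 w + 1 * lin X s w); last first.
  by apply/funext => w; rewrite /lin big_cons mul1r.
by rewrite ip_combl//; [rewrite XY IH; lra|exact: L2_lin].
Qed.

Lemma ip_ae X Y Z : measurable_fun setT X -> measurable_fun setT Y -> measurable_fun setT Z ->
  {ae P, forall w, X w = Y w} -> ip X Z = ip Y Z.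
Proof.
move=> mX mY mZ XY; apply: Ex_eq_ae; [exact: measurable_funM..|].
by apply: filterS XY => w ->.
Qed.

End square_integrable.

Section gaussian_space.
Context {d : measure_display} {O : measurableType d} {R : realType}.
Context (P : probability O R).
Implicit Types (X Y Z : O -> R) (H : set (O -> R)).

(** Stability under linear combinations makes every finite subfamily jointly Gaussian, so that
    orthogonality and independence coincide within [H]. *)
Definition gspace H := [/\ H (fun=> 0), (forall X, H X -> gauss P X) &
  (forall a b X Y, H X -> H Y -> H (fun w => a * X w + b * Y w))].

Lemma gspace_L2 H X : gspace H -> H X -> L2 P X.
Proof. by move=> [_ gH _] /gH gX; split; [case: gX|exact: gauss_sqr]. Qed.

Lemma gspaceB H X Y : gspace H -> H X -> H Y -> H (fun w => X w - Y w).
Proof.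
move=> [_ _ cH] HX HY; have := cH 1 (-1) X Y HX HY.
by congr H; apply/funext => w; rewrite mul1r mulN1r.
Qed.

Lemma gspaceD H X Y : gspace H -> H X -> H Y -> H (fun w => X w + Y w).
Proof.
move=> [_ _ cH] HX HY; have := cH 1 1 X Y HX HY.
by congr H; apply/funext => w; rewrite !mul1r.
Qed.

Lemma gspace_lin H (I : Type) (X : I -> O -> R) s : gspace H ->
  (forall i, H (X i)) -> H (lin X s).
Proof.
move=> [H0 gH cH] HX; elim: s => [|p s IH].
  by rewrite (_ : lin X [::] = fun=> 0)//; apply/funext => w; rewrite /lin big_nil.
rewrite (_ : lin X (p :: s) = fun w => p.1 * X p.2 w + 1 * lin X s w); first exact: cH.
by apply/funext => w; rewrite /lin big_cons mul1r.
Qed.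

(** Orthogonality gives $Y+X$ and $Y-X$ the same variance, the sum of the two; the product-to-sum
    formula then reassembles the product of the two characteristic functions. *)
Lemma gspace_cos2 H X Y th ph : gspace H -> H X -> H Y -> ip P X Y = 0 ->
  Ex P (fun w => cos (X w + th) * cos (Y w + ph)) =
  Ex P (fun w => cos (X w + th)) * Ex P (fun w => cos (Y w + ph)).
Proof.
move=> gH HX HY XY; have [_ gg cH] := gH.
have lX := gspace_L2 gH HX; have lY := gspace_L2 gH HY.
have [mX _] := lX; have [mY _] := lY.
pose V := Ex P (fun w => X w ^+ 2); pose W := Ex P (fun w => Y w ^+ 2).
have vE a : a ^+ 2 = 1 -> Ex P (fun w => (1 * Y w + a * X w) ^+ 2) = V + W.
  by move=> a1; rewrite -ip_sqr ip_expand// ipC XY a1 !ip_sqr /V /W; lra.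
transitivity (2^-1 * Ex P (fun w => cos ((1 * Y w + 1 * X w) + (th + ph))) +
  2^-1 * Ex P (fun w => cos ((1 * Y w + (-1) * X w) + (ph - th)))).
  rewrite -!ExZ -?ExD; try by
    [apply: bm_L1; apply: bm_cos; apply: measurable_funD => //; apply: measurable_funD; exact: measurable_funM
    |apply: L1Z; apply: bm_L1; apply: bm_cos; apply: measurable_funD => //; apply: measurable_funD; exact: measurable_funM].
  congr Ex; apply/funext => w; rewrite mulrC cosMcos; congr (_ * cos _ + _ * cos _); ring.
rewrite !gauss_cos; try by [apply: gg|apply: gg; exact: cH].
rewrite !vE ?expr1n ?sqrrN ?expr1n// -/V -/W.
rewrite (_ : - ((V + W) / 2) = - (V / 2) + - (W / 2)); last by field.
by rewrite expRD !cosD sinN cosN; field.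
Qed.

(** [same_trig_sigma] is applied twice: with a cosine of the [Y]-family as weight it factors out an
    event of the first $\sigma$-algebra; with the indicator of that event as weight it passes from
    cosines to events of the second. *)
Lemma gspace_indep H (I J : Type) (X : I -> O -> R) (Y : J -> O -> R) :
  gspace H -> (forall i, H (X i)) -> (forall j, H (Y j)) ->
  (forall i j, ip P (X i) (Y j) = 0) ->
  forall A B, sigma_of X A -> sigma_of Y B -> pr P (A `&` B) = pr P A * pr P B.
Proof.
move=> gH HX HY XY A B sA sB.
have mX i : measurable_fun setT (X i) by have [] := gspace_L2 gH (HX i).
have mY i : measurable_fun setT (Y i) by have [] := gspace_L2 gH (HY i).
have mA := sigma_of_measurable mX sA; have mB := sigma_of_measurable mY sB.
have cc s s' th ph : Ex P (fun w => cos (lin X s w + th) * cos (lin Y s' w + ph)) =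
    Ex P (fun w => cos (lin X s w + th)) * Ex P (fun w => cos (lin Y s' w + ph)).
  apply: (gspace_cos2 _ _ gH); [exact: gspace_lin..|].
  apply: ip_lin0 => [i||i]; [exact: (gspace_L2 gH)|exact: (gspace_L2 gH (gspace_lin _ gH HY))|].
  by rewrite ipC; apply: ip_lin0 => [j||j]; [exact: (gspace_L2 gH)|exact: (gspace_L2 gH)|rewrite ipC].
have bY s' ph : bm (fun w => cos (lin Y s' w + ph)).
  by apply: bm_cos; apply: measurable_funD => //; exact: measurable_lin.
have bX s' ph : bm (fun w => cos (lin X s' w + ph)).
  by apply: bm_cos; apply: measurable_funD => //; exact: measurable_lin.
have step1 s' ph : Ex P (fun w => cos (lin Y s' w + ph) * \1_A w) =
    Ex P (fun w => cos (lin Y s' w + ph)) * pr P A.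
  have st : same_trig P P X X (fun w => cos (lin Y s' w + ph))
      (fun w => Ex P (fun w => cos (lin Y s' w + ph))).
    split=> //; first exact: bm_cst.
    move=> s th; rewrite ExZ; last exact: bm_L1.
    by rewrite mulrC -cc; congr Ex; apply/funext => w; rewrite mulrC.
  rewrite (same_trig_sigma mX st sA) ExZ ?pr_indic//.
  by apply: bm_L1; exact: bm_indic.
have st : same_trig P P Y Y (\1_A) (fun w => pr P A).
  split; [exact: bm_indic|exact: bm_cst|] => s th.
  rewrite ExZ; last exact: bm_L1.
  by rewrite mulrC -step1; congr Ex; apply/funext => w; rewrite mulrC.
have := same_trig_sigma mY st sB.
rewrite ExZ ?pr_indic//; last by apply: bm_L1; exact: bm_indic.
move=> <-; rewrite -pr_indic; last exact: measurableI.
by congr Ex; apply/funext => w; rewrite indicI.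
Qed.

Lemma gauss_ae X Y : measurable_fun setT Y -> {ae P, forall w, X w = Y w} -> gauss P X -> gauss P Y.
Proof.
move=> mY XY [mX gX]; split=> //; case: gX => [[s s0 h]|X0]; last first.
  by right; apply: filterS2 XY X0 => w ->.
left; exists s => // U mU; rewrite -h//.
have mXU (Z : O -> R) : measurable_fun setT Z -> measurable (Z @^-1` U).
  by move=> mZ; rewrite -[X in measurable X]setTI; exact: mZ.
rewrite -!prE; [|exact: mXU..]; congr EFin.
rewrite -!pr_indic; [|exact: mXU..].
apply: Ex_eq_ae; [by apply: measurable_indic; exact: mXU..|].
by apply: filterS XY => w XYw; rewrite !indicE /in_mem/= /mem_set/= /in_set/= XYw.
Qed.

(** Induction on [n], subtracting a multiple of the residual of the last vector, avoids inverting a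
    covariance matrix that may be singular. *)
Lemma projection n H X (Y : 'I_n -> O -> R) : gspace H -> H X -> (forall i, H (Y i)) ->
  exists c : 'I_n -> R, forall j, ip P (fun w => X w - \sum_i c i * Y i w) (Y j) = 0.
Proof.
move=> gH; elim: n X Y => [|n IH] X Y HX HY; first by exists (fun=> 0) => -[].
have [_ _ cH] := gH.
pose Y1 i := Y (widen_ord (leqnSn n) i).
have sumH m (c : 'I_m -> R) (Z : 'I_m -> O -> R) : (forall i, H (Z i)) -> H (fun w => \sum_i c i * Z i w).
  elim: m c Z => [|m IHm] c Z HZ.
    by have [H0 _ _] := gH; move: H0; congr H; apply/funext => w; rewrite big_ord0.
  have := cH (c ord0) 1 (Z ord0) _ (HZ _) (IHm (fun i => c (lift ord0 i)) (fun i => Z (lift ord0 i)) (fun i => HZ _)).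
  by congr H; apply/funext => w; rewrite big_ord_recl mul1r.
have [c hc] := IH X Y1 HX (fun i => HY _).
have [b hb] := IH (Y ord_max) Y1 (HY _) (fun i => HY _).
pose X' w := X w - \sum_i c i * Y1 i w.
pose Y' w := Y ord_max w - \sum_i b i * Y1 i w.
have HX' : H X' by apply: (gspaceB gH) => //; apply: sumH => i; exact: HY.
have HY' : H Y' by apply: (gspaceB gH) => //; apply: sumH => i; exact: HY.
have l := gspace_L2 gH.
have HY1 i : H (Y1 i) by exact: HY.
(* If the last vector is almost surely a combination of the others, its residual has norm zero and
   any coefficient works; 0 is taken, and [ip_eq0] keeps the identity below valid. *)
pose be := if ip P Y' Y' == 0 then 0 else ip P X' Y' / ip P Y' Y'.
have beE : ip P X' Y' = be * ip P Y' Y'.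
  rewrite /be; case: ifPn => [/eqP Y0|Y0]; last by rewrite divfK.
  by rewrite mul0r; apply: ip_eq0 => //; exact: l.
pose Z w := 1 * X' w + (- be) * Y' w.
have HZ : H Z by exact: cH.
have Z1 i : ip P Z (Y1 i) = 0.
  rewrite ip_combl; [|exact: l..]; rewrite hc hb; lra.
have ZY' : ip P Z Y' = 0 by rewrite ip_combl; [rewrite beE; lra|exact: l..].
have Zm : ip P Z (Y ord_max) = 0.
  have -> : Y ord_max = fun w => 1 * Y' w + 1 * \sum_i b i * Y1 i w.
    by apply/funext => w; rewrite /Y'; ring.
  rewrite ip_combr; [|exact: l..|exact/l/sumH|exact: l].
  rewrite ZY' ipC.
  rewrite (_ : (fun w => \sum_i b i * Y1 i w) = lin Y1 [seq (b i, i) | i <- enum 'I_n]); last first.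
    by apply/funext => w; rewrite /lin big_map big_enum.
  rewrite ip_lin0//; [lra|by move=> i; exact: l|exact: l|].
  by move=> i; rewrite ipC.
exists (fun i => if unlift ord_max i is Some j then c j - be * b j else be) => j.
rewrite (_ : (fun w => _) = Z).
  have [j'|] := unliftP ord_max j; last by move=> ->.
  move=> ->; rewrite (_ : lift ord_max j' = widen_ord (leqnSn n) j') ?Z1//.
  by apply: val_inj; exact/lift_max.
apply/funext => w; rewrite big_ord_recr/= unlift_none /Z /X' /Y'.
have -> : \sum_(i < n) (if unlift ord_max (widen_ord (leqnSn n) i) is Some j then c j - be * b j else be) *
    Y (widen_ord (leqnSn n) i) w = \sum_i c i * Y1 i w - be * \sum_i b i * Y1 i w.
  rewrite mulr_sumr -sumrB; apply: eq_bigr => i _.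
  have -> : widen_ord (leqnSn n) i = lift ord_max i by apply: val_inj; exact/esym/lift_max.
  rewrite liftK /Y1 (_ : widen_ord _ _ = lift ord_max i); last by apply: val_inj; exact/esym/lift_max.
  by ring.
ring.
Qed.

End gaussian_space.

Section independence.
Context {d : measure_display} {O : measurableType d} {R : realType}.
Context (P : probability O R).
Implicit Types X Y h g : O -> R.

Lemma layer_sum (x : R) n : 0 <= x <= n%:R ->
  x - 1 <= \sum_(j < n) ((j.+1%:R <= x)%R : bool)%:R <= x.
Proof.
move=> /andP[x0 xn].
suff H m : (m%:R <= x -> \sum_(j < m) ((j.+1%:R <= x)%R : bool)%:R = m%:R :> R) /\
    (x <= m%:R -> x - 1 <= \sum_(j < m) ((j.+1%:R <= x)%R : bool)%:R <= x) by have [_ ->] := H n.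
elim: m => [|m [IH1 IH2]]; first by split=> [_|x0']; rewrite big_ord0//; lra.
split=> xm; rewrite big_ord_recr/=.
  rewrite xm IH1; first exact: natr1.
  by rewrite (le_trans _ xm)// ler_nat.
have [xm'|xm'] := leP x m%:R.
  have := IH2 xm'; have [h|h] := leP m.+1%:R x; rewrite ?addr0//.
  by exfalso; move: h; rewrite -natr1 => h; lra.
rewrite (IH1 (ltW xm')); have [h|h] := leP m.+1%:R x; rewrite ?addr0.
  by rewrite -[true%:R]/(1 : R); move: xm h; rewrite -natr1 => xm h; lra.
by move: xm xm'; rewrite -natr1; lra.
Qed.

(** The staircase [gn], built from level sets of [g], lies at most one step $1/(n+1)$ below [g]; the
    hypothesis factors each level set, and bounded convergence passes to [g]. *)
Lemma Ex_indep01 h g : bm h -> measurable_fun setT g -> (forall w, 0 <= g w <= 1) ->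
  (forall U : set R, measurable U ->
     Ex P (fun w => h w * \1_(g @^-1` U) w) = Ex P h * pr P (g @^-1` U)) ->
  Ex P (fun w => h w * g w) = Ex P h * Ex P g.
Proof.
move=> bh mg g01 ind; have [mh [M hM]] := bh.
pose U n (j : 'I_n.+1) := [set` `[j.+1%:R / n.+1%:R : R, +oo[].
pose gn n w : R := \sum_j n.+1%:R^-1 * \1_(g @^-1` (U n j)) w.
have mUU n j : measurable (U n j) by exact: measurable_itv.
have mU n j : measurable (g @^-1` (U n j)) by apply: measurable_preim => //; exact: measurable_itv.
have bU n j : bm (\1_(g @^-1` (U n j)) : O -> R) by exact: bm_indic.
have gnE n w : gn n w = n.+1%:R^-1 * \sum_(j < n.+1) ((j.+1%:R <= n.+1%:R * g w)%R : bool)%:R.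
  rewrite mulr_sumr; apply: eq_bigr => j _; congr (_ * _); rewrite indicE; congr ((_ : bool)%:R).
  rewrite -ler_pdivrMl ?ltr0n// mulrC.
  by apply/idP/idP; rewrite inE /U/= in_itv/= andbT.
have gnb n w : g w - n.+1%:R^-1 <= gn n w <= g w.
  have n0 : (0 : R) < n.+1%:R by rewrite ltr0n.
  have := @layer_sum (n.+1%:R * g w) n.+1; rewrite gnE; set S := \sum_(_ < _) _.
  have /andP[g0 g1] := g01 w.
  have h1 : 0 <= n.+1%:R * g w <= n.+1%:R by rewrite mulr_ge0//= ler_piMr.
  move=> /(_ h1) /andP[a b]; apply/andP; split; last by rewrite ler_pdivrMl.
  by rewrite ler_pdivlMl// mulrBr mulfV// gt_eqF.
have mgn n : measurable_fun setT (gn n).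
  have := L1_meas (L1_sum (index_enum _) (fun j => L1Z n.+1%:R^-1 (bm_L1 P (bU n j)))).
  by [].
have gn1 n w : `|gn n w| <= 1.
  have /andP[a b] := gnb n w; have /andP[g0 g1] := g01 w.
  rewrite ger0_norm; first exact: (le_trans b).
  by rewrite /gn sumr_ge0// => j _; rewrite mulr_ge0// indicE.
have gnc w : gn n w @[n --> \oo] --> g w.
  apply: (@squeeze_cvgr _ _ _ _ (fun n => g w - n.+1%:R^-1) (cst (g w))).
  - exact: nearW.
  - rewrite -[X in _ --> X]subr0; apply: cvgB; first exact: cvg_cst.
    exact: (@cvg_harmonic R).
  - exact: cvg_cst.
have e n : Ex P (fun w => h w * gn n w) = Ex P h * Ex P (gn n).
  rewrite /gn Ex_sum; last by move=> j; apply: L1Z; exact: bm_L1.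
  rewrite mulr_sumr (_ : (fun w => _) = fun w => \sum_j n.+1%:R^-1 * (h w * \1_(g @^-1` (U n j)) w)); last first.
    by apply/funext => w; rewrite mulr_sumr; apply: eq_bigr => j _; rewrite mulrCA.
  rewrite Ex_sum; last by move=> j; apply: L1Z; apply: bm_L1; exact: bmM.
  apply: eq_bigr => j _; rewrite !ExZ; [|exact: bm_L1|by apply: bm_L1; exact: bmM].
  by rewrite (ind _ (mUU n j)) pr_indic// mulrCA.
have c1 : Ex P (fun w => h w * gn n w) @[n --> \oo] --> Ex P (fun w => h w * g w).
  apply: (@Ex_cvg _ _ _ _ _ _ M).
  - by move=> n; exact: measurable_funM.
  - exact: measurable_funM.
  - by move=> n w; rewrite normrM (le_trans _ (hM w))// ler_piMr.
  - by apply: aeW => w; apply: cvgMr.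
have c2 : Ex P h * Ex P (gn n) @[n --> \oo] --> Ex P h * Ex P g.
  apply: cvgMr; apply: (@Ex_cvg _ _ _ _ _ _ 1) => //.
  by apply: aeW => w.
have ee : (fun n => Ex P h * Ex P (gn n)) = (fun n => Ex P (fun w => h w * gn n w)).
  by apply/funext => n; rewrite e.
by rewrite ee in c2; exact: (cvg_unique _ c1 c2).
Qed.

Lemma Ex_indep h g : bm h -> bm g ->
  (forall U : set R, measurable U ->
     Ex P (fun w => h w * \1_(g @^-1` U) w) = Ex P h * pr P (g @^-1` U)) ->
  Ex P (fun w => h w * g w) = Ex P h * Ex P g.
Proof.
move=> bh bg ind; have [mg [N gN]] := bg.
pose c : R := Num.max N 1.
have c0 : 0 < c by rewrite lt_max ltr01 orbT.
have gc w : `|g w| <= c by rewrite le_max gN.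
pose g' w := (2 * c)^-1 * (g w + c).
have mg' : measurable_fun setT g' by apply: measurable_funM => //; exact: measurable_funD.
have b1 w : 0 <= g' w <= 1.
  have := gc w; rewrite ler_norml => /andP[a b].
  rewrite /g' ler_pdivrMl ?mulr_gt0// mulr1; apply/andP; split; last by lra.
  by apply: mulr_ge0; [rewrite invr_ge0 mulr_ge0// ltW|lra].
have ind' U : measurable U -> Ex P (fun w => h w * \1_(g' @^-1` U) w) = Ex P h * pr P (g' @^-1` U).
  move=> mU; have -> : g' @^-1` U = g @^-1` ((fun x => (2 * c)^-1 * (x + c)) @^-1` U) by [].
  apply: ind; apply: measurable_preim mU.
  by apply: measurable_funM => //; exact: measurable_funD.
have lhg : L1 P (fun w => h w * g w) by apply: bm_L1; exact: bmM.
have lh := bm_L1 P bh; have lg := bm_L1 P bg; have lc := L1_cst P c.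
have e1 : Ex P (fun w => h w * g' w) = (2 * c)^-1 * (Ex P (fun w => h w * g w) + c * Ex P h).
  have -> : (fun w => h w * g' w) = fun w => (2 * c)^-1 * (h w * g w + c * h w).
    by apply/funext => w; rewrite /g'; ring.
  by rewrite ExZ; [rewrite ExD; [rewrite ExZ|exact: lhg|exact: L1Z]|apply: L1D; [exact: lhg|exact: L1Z]].
have e2 : Ex P g' = (2 * c)^-1 * (Ex P g + c).
  by rewrite ExZ; [rewrite ExD; [rewrite Ex_cst|exact: lg|exact: lc]|apply: L1D; [exact: lg|exact: lc]].
have e3 := Ex_indep01 bh mg' b1 ind'.
have c20 : (2 * c)^-1 != 0 by rewrite invr_eq0 mulf_neq0// gt_eqF.
move: e3; rewrite e1 e2 mulrCA => /(mulfI c20).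
by rewrite mulrDr [c * _]mulrC => /addIr.
Qed.

Lemma indep_cos X Y a b : measurable_fun setT X -> measurable_fun setT Y ->
  (forall U V : set R, measurable U -> measurable V ->
    pr P (X @^-1` U `&` Y @^-1` V) = pr P (X @^-1` U) * pr P (Y @^-1` V)) ->
  Ex P (fun w => cos (X w + a) * cos (Y w + b)) =
  Ex P (fun w => cos (X w + a)) * Ex P (fun w => cos (Y w + b)).
Proof.
move=> mX mY ind.
have mc (c : R) : measurable_fun setT (fun x : R => cos (x + c)).
  by apply: (bm_cos _).1; exact: measurable_funD.
have bc (Z : O -> R) c : measurable_fun setT Z -> bm (fun w => cos (Z w + c)).
  by move=> mZ; apply: bm_cos; exact: measurable_funD.
apply: (@Ex_indep (fun w => cos (X w + a)) (fun w => cos (Y w + b)) (bc X a mX) (bc Y b mY)) => V mV.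
have {mV} : measurable ((fun x => cos (x + b)) @^-1` V) by exact: measurable_preim (mc b) mV.
have -> : (fun w => cos (Y w + b)) @^-1` V = Y @^-1` ((fun x => cos (x + b)) @^-1` V) by [].
move: (_ @^-1` V) => {}V mV.
rewrite (_ : (fun w => _) = fun w => \1_(Y @^-1` V) w * cos (X w + a)); last by apply/funext => w; rewrite mulrC.
have mYV : measurable (Y @^-1` V) by exact: measurable_preim.
suff H : forall U : set R, measurable U ->
    Ex P (fun w => \1_(Y @^-1` V) w * \1_((fun w => cos (X w + a)) @^-1` U) w) =
    Ex P (\1_(Y @^-1` V)) * pr P ((fun w => cos (X w + a)) @^-1` U).
  have := @Ex_indep (\1_(Y @^-1` V)) (fun w => cos (X w + a)) (bm_indic mYV) (bc X a mX) H.
  by move=> ->; rewrite pr_indic// mulrC.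
move=> U mU.
have {mU} : measurable ((fun x => cos (x + a)) @^-1` U) by exact: measurable_preim (mc a) mU.
have -> : (fun w => cos (X w + a)) @^-1` U = X @^-1` ((fun x => cos (x + a)) @^-1` U) by [].
move: (_ @^-1` U) => {}U mU.
have mXU : measurable (X @^-1` U) by exact: measurable_preim.
rewrite (pr_indic P mYV) mulrC -ind// -pr_indic; last exact: measurableI.
by congr Ex; apply/funext => w; rewrite indicI/= mulrC.
Qed.

(** Expand $\cos(X+Y)$: the sine terms vanish because the laws are centered, so independence gives
    $e^{-\mathrm{Var}(X+Y)/2}=e^{-\mathrm{Var}X/2}e^{-\mathrm{Var}Y/2}$, hence zero covariance. This
    turns the independence in Assumption A into orthogonality. *)
Lemma indep_ip H X Y : gspace P H -> H X -> H Y ->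
  (forall U V : set R, measurable U -> measurable V ->
    pr P (X @^-1` U `&` Y @^-1` V) = pr P (X @^-1` U) * pr P (Y @^-1` V)) ->
  ip P X Y = 0.
Proof.
move=> gH HX HY ind; have [_ gg cH] := gH.
have lX := gspace_L2 gH HX; have lY := gspace_L2 gH HY.
have [mX _] := lX; have [mY _] := lY.
have e : Ex P (fun w => cos ((1 * X w + 1 * Y w) + 0)) =
    Ex P (fun w => cos (X w + 0)) * Ex P (fun w => cos (Y w + 0)) -
    Ex P (fun w => cos (X w + - (pi / 2))) * Ex P (fun w => cos (Y w + - (pi / 2))).
  rewrite -!indep_cos// -ExB.
  - congr Ex; apply/funext => w; rewrite !mul1r !addr0.
    have s x : cos (x + - (pi / 2)) = sin x :> R by rewrite cosD cosN sinN cos_pihalf sin_pihalf; ring.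
    by rewrite !s cosD.
  - by apply: bm_L1; apply: bmM; apply: bm_cos; exact: measurable_funD.
  - by apply: bm_L1; apply: bmM; apply: bm_cos; exact: measurable_funD.
have gX := gg _ HX; have gY := gg _ HY; have gXY := gg _ (cH 1 1 _ _ HX HY).
move: e; rewrite (gauss_cos 0 gXY) (gauss_cos 0 gX) (gauss_cos 0 gY) (gauss_cos _ gX) (gauss_cos _ gY).
rewrite cosN cos_pihalf cos0 !mul0r !mul1r subr0 -expRD => /expR_inj.
rewrite -!ip_sqr ip_expand// => e0; move: e0; lra.
Qed.

End independence.

Lemma L2norm_le {d} {O : measurableType d} {R : realType} (P : probability O R) (X : O -> R) (c : R) :
  L2 P X -> 0 <= c -> (L2norm P X <= c%:E)%E -> ip P X X <= c ^+ 2.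
Proof.
move=> [mX X2] c0; rewrite /L2norm unlock.
rewrite (_ : (\int[P]_x _)%E = (ip P X X)%:E); last first.
  rewrite ip_sqr /Ex /Rintegral fineK; last exact: integrable_fin_num X2.
  apply: eq_integral => w _ /=; rewrite -[(2%R : R)]/(2%:R) powR_mulrn//.
  by rewrite real_normK// num_real.
rewrite poweR_EFin lee_fin powR12_sqrt ?ip_ge0// => h.
by rewrite -(sqr_sqrtr (ip_ge0 P X)) lerXn2r// ?nnegrE// sqrtr_ge0.
Qed.

(** * The noise over the half-line *)

Section noise.
Context {d : measure_display} {Omega : measurableType d} {R : realType}.
Context (P : probability Omega R) {k : nat}.
Context (T : set 'rV[R]_k) (v : 'rV[R]_k -> {RV P >-> R}) (W : set R -> 'rV[R]_k -> {RV P >-> R}).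
Context (W1 : centered_gaussian_field (@borel_half_line R `*` T) (fun p => W p.1 p.2)).
Context (W2 : forall x, T x -> independently_scattered (fun A => W A x) /\
   {ae P, forall w, W half_line x w = v x w}).
Context (W3 : forall A B, borel_half_line A -> borel_half_line B ->
   A `&` B = set0 -> independent_processes T (W A) (W B)).

Definition noise_index := {q : set R * 'rV[R]_k | borel_half_line q.1 /\ T q.2}.
Definition noise_family (q : noise_index) : Omega -> R := W (sval q).1 (sval q).2.
(** Almost sure equality is built in because $v(x)$ is only almost surely the noise of the whole
    half-line; thus [v x] belongs to the same Gaussian space as the noise. *)
Definition noise_space : set (Omega -> R) := [set Z | measurable_fun setT Z /\
  exists s, {ae P, forall w, Z w = lin noise_family s w}].

Let mW A x : measurable_fun setT (W A x).
Proof. by []. Qed.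

Let mF q : measurable_fun setT (noise_family q).
Proof. exact: mW. Qed.

Lemma gauss_lin_noise s : gauss P (lin noise_family s).
Proof.
split; first exact: measurable_lin.
have := W1 (fun i : 'I_(size s) => (tnth (in_tuple s) i).1)
  (t := fun i : 'I_(size s) => sval (tnth (in_tuple s) i).2).
have h i : (@borel_half_line R `*` T) (sval (tnth (in_tuple s) i).2) by exact: svalP.
move/(_ h); congr centered_gaussian; apply/funext => w.
by rewrite /lin [in RHS]big_tnth.
Qed.

Lemma gspace_noise : gspace P noise_space.
Proof.
split.
- split=> //; exists [::]; apply: aeW => w; by rewrite /lin big_nil.
- move=> X [mX [s hs]]; apply: (gauss_ae mX _ (gauss_lin_noise s)).
  by apply: filterS hs => w ->.
- move=> a b X Y [mX [s hs]] [mY [t ht]]; split.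
    by apply: measurable_funD; exact: measurable_funM.
  exists ([seq (a * p.1, p.2) | p <- s] ++ [seq (b * p.1, p.2) | p <- t]).
  apply: filterS2 hs ht => w -> ->; rewrite /lin big_cat/= !big_map !mulr_sumr.
  by congr (_ + _); apply: eq_bigr => p _ /=; rewrite mulrA.
Qed.

Lemma noise_in A x : borel_half_line A -> T x -> noise_space (W A x).
Proof.
move=> bA Tx; split; first exact: mW.
exists [:: (1, exist _ (A, x) (conj bA Tx))]; apply: aeW => w.
by rewrite /lin big_seq1/= mul1r.
Qed.

Lemma borel_half : borel_half_line (@half_line R).
Proof.
split=> //; rewrite (_ : half_line = [set` `[0, +oo[])//.
by apply/seteqP; split=> x; rewrite /half_line /= in_itv/= andbT.
Qed.

Lemma field_in x : T x -> noise_space (v x).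
Proof.
move=> Tx; split; first by [].
have [_ [s hs]] := noise_in borel_half Tx; exists s.
by apply: filterS2 hs (W2 Tx).2 => w -> ->.
Qed.

Lemma borel_set0 : borel_half_line (@set0 R). Proof. by split. Qed.

Lemma borelD A B : borel_half_line A -> borel_half_line B -> borel_half_line (A `\` B : set R).
Proof. by move=> [mA hA] [mB hB]; split; [exact: measurableD|move=> x [/hA]]. Qed.

Lemma borel_right_open (a : R) b : 0 <= a -> borel_half_line (right_open a b).
Proof.
move=> a0; split; last by move=> x [ax _]; exact: le_trans ax.
case: b => [b||].
- rewrite (_ : right_open _ _ = [set` `[a, b[])//.
  by apply/seteqP; split=> x; rewrite /right_open /= in_itv/= lte_fin => /andP.
- rewrite (_ : right_open _ _ = [set` `[a, +oo[])//.
  by apply/seteqP; split=> x; rewrite /right_open /= in_itv/= andbT ltry => // -[].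
- by rewrite (_ : right_open _ _ = set0)//; apply/seteqP; split=> // x [_]; rewrite ltNge leNye.
Qed.

Lemma noise_ip A B x y : borel_half_line A -> borel_half_line B -> A `&` B = set0 -> T x -> T y ->
  ip P (W A x) (W B y) = 0.
Proof.
move=> bA bB AB Tx Ty.
apply: (indep_ip gspace_noise (noise_in bA Tx) (noise_in bB Ty)) => U V mU mV.
have mXU (Z : {RV P >-> R}) (U0 : set R) : measurable U0 -> measurable (Z @^-1` U0).
  by move=> mU0; apply: measurable_preim.
apply: EFin_inj; rewrite EFinM !prE; [|exact: mXU..|by apply: measurableI; exact: mXU].
apply: (W3 bA bB AB); apply: sub_sigma_algebra.
- by exists x => //; exists U => //; rewrite setTI.
- by exists y => //; exists V => //; rewrite setTI.
Qed.

(** Additivity along a sequence of empty sets makes the multiples $nc$ of a single value $c$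
    converge, which forces $c=0$. *)
Lemma noise0 x : T x -> {ae P, forall w, W set0 x w = 0}.
Proof.
move=> Tx; have [[_ H] _] := W2 Tx; have {H} := H (fun=> set0).
have [|tr] := pselect (trivIset setT (fun _ : nat => @set0 R)); last first.
  by exfalso; apply: tr => i j _ _; rewrite set0I => -[].
move=> tr /(_ (fun=> borel_set0) tr); apply: filterS => w.
rewrite (_ : (fun n => \sum_(i < n) W set0 x w) = fun n => W set0 x w *+ n); last first.
  by apply/funext => n; rewrite sumr_const card_ord.
set c := W set0 x w; set L := W _ x w => cv.
have cv1 : c *+ n.+1 @[n --> \oo] --> L by rewrite (cvg_shiftS (fun n => c *+ n)).
have : c *+ n.+1 - c *+ n @[n --> \oo] --> L - L by exact: cvgB.
rewrite subrr (_ : (fun n => c *+ n.+1 - c *+ n) = fun=> c); last first.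
  by apply/funext => n; rewrite mulrS addrK.
by move=> h; exact: (cvg_unique _ (cvg_cst c) h).
Qed.

Lemma noiseU A B x : borel_half_line A -> borel_half_line B -> A `&` B = set0 -> T x ->
  {ae P, forall w, W (A `|` B) x w = W A x w + W B x w}.
Proof.
move=> bA bB AB Tx; have [[_ H] _] := W2 Tx.
pose F (i : nat) := if i == 0%N then A else if i == 1%N then B else set0.
have bF i : borel_half_line (F i) by rewrite /F; case: ifP => // _; case: ifP => // _; exact: borel_set0.
have tF : trivIset setT F.
  move=> i j _ _; rewrite /F.
  case: (eqVneq i 0%N) => [->|i0]; case: (eqVneq j 0%N) => [->//|j0].
  - by case: ifP => [_|_]; rewrite ?AB ?setI0 => -[].
  - by case: ifP => [_|_]; rewrite ?[B `&` A]setIC ?AB ?set0I => -[].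
  - case: (eqVneq i 1%N) => [->|i1]; case: (eqVneq j 1%N) => [->//|j1]; rewrite ?setI0 ?set0I => -[] //.
have UF : \bigcup_i F i = A `|` B.
  apply/seteqP; split=> [y [i _]|y [Ay|By]].
  - by rewrite /F; case: ifP => _ => [|]; [left|case: ifP => // _; right].
  - by exists 0%N.
  - by exists 1%N.
have {H} := H F bF tF; rewrite UF => h.
apply: filterS2 h (noise0 Tx) => w cv w0.
have : \sum_(i < n) W (F i) x w @[n --> \oo] --> W A x w + W B x w.
  apply: cvg_near_cst; exists 2%N => // -[|[|n]]//= _.
  by rewrite !big_ord_recl/= big1 ?addr0.
by move/(cvg_unique _ cv) => ->.
Qed.

Definition incr A x y : Omega -> R := fun w => W A x w - W A y w.

Lemma incr_in A x y : borel_half_line A -> T x -> T y -> noise_space (incr A x y).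
Proof. by move=> bA Tx Ty; apply: (gspaceB gspace_noise); exact: noise_in. Qed.

Lemma noise_L2 X : noise_space X -> L2 P X.
Proof. exact: (gspace_L2 gspace_noise). Qed.

Lemma incr_ip A B x y x' y' : borel_half_line A -> borel_half_line B -> A `&` B = set0 ->
  T x -> T y -> T x' -> T y' -> ip P (incr A x y) (incr B x' y') = 0.
Proof.
move=> bA bB AB Tx Ty Tx' Ty'.
have e C z z' : incr C z z' = fun w => 1 * W C z w + (-1) * W C z' w.
  by apply/funext => w; rewrite /incr mul1r mulN1r.
have l C z : borel_half_line C -> T z -> L2 P (W C z) by move=> bC Tz; apply: noise_L2; exact: noise_in.
rewrite (e A) (e B) ip_combl; [|exact: l..|apply: L2_comb; exact: l].
rewrite !ip_combr; [|exact: l..].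
by rewrite (noise_ip bA bB AB Tx Tx') (noise_ip bA bB AB Tx Ty') (noise_ip bA bB AB Ty Tx') (noise_ip bA bB AB Ty Ty') !(mulr0, addr0).
Qed.

(** Pythagoras over disjoint parts of the half-line; monotonicity of the variance in the set,
    [incr_mono], follows. *)
Lemma incrU A B x y : borel_half_line A -> borel_half_line B -> A `&` B = set0 -> T x -> T y ->
  ip P (incr (A `|` B) x y) (incr (A `|` B) x y) =
  ip P (incr A x y) (incr A x y) + ip P (incr B x y) (incr B x y).
Proof.
move=> bA bB AB Tx Ty.
have m C : measurable_fun setT (incr C x y) by apply: measurable_funB.
have h : {ae P, forall w, incr (A `|` B) x y w = 1 * incr A x y w + 1 * incr B x y w}.
  apply: filterS2 (noiseU bA bB AB Tx) (noiseU bA bB AB Ty) => w; rewrite /incr => -> ->; ring.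
have mm : measurable_fun setT (fun w => 1 * incr A x y w + 1 * incr B x y w).
  by apply: measurable_funD; exact: measurable_funM.
rewrite (ip_ae _ mm _ h)// ipC (ip_ae _ mm _ h)// ip_expand; [|by apply: noise_L2; exact: incr_in..].
by rewrite (incr_ip bA bB AB Tx Ty Tx Ty); ring.
Qed.

Lemma incr_mono A B x y : borel_half_line A -> borel_half_line B -> A `<=` B -> T x -> T y ->
  ip P (incr A x y) (incr A x y) <= ip P (incr B x y) (incr B x y).
Proof.
move=> bA bB AB Tx Ty.
rewrite -[B in leRHS](setDUK AB) incrU//; [by rewrite lerDl ip_ge0|exact: borelD|].
by apply/seteqP; split=> // t [At []].
Qed.

Lemma noise_cvg x : T x ->
  {ae P, forall w, W (right_open 0 n%:R%:E) x w @[n --> \oo] --> v x w}.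
Proof.
move=> Tx; pose F (i : nat) : set R := right_open i%:R i.+1%:R%:E.
have bF i : borel_half_line (F i) by exact: borel_right_open.
have tF : trivIset setT F.
  move=> i j _ _ [t [[/= it ti] [jt tj]]]; rewrite !lte_fin in ti tj.
  have := le_lt_trans it tj; have := le_lt_trans jt ti; rewrite !ltr_nat !ltnS => a b.
  by apply/eqP; rewrite eqn_leq a b.
have UF : \bigcup_i F i = half_line.
  apply/seteqP; split=> [t [i _ [it _]]|t t0]; first by rewrite /half_line/= (le_trans _ it).
  exists (Num.truncn t) => //; have /andP[a b] := truncn_itv t0.
  by split=> //; rewrite lte_fin.
have [[_ H] h2] := W2 Tx; have {H} := H F bF tF; rewrite UF => h1.
have UN n : right_open 0 n.+1%:R%:E = right_open 0 n%:R%:E `|` F n :> set R.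
  apply/seteqP; split=> [t [t0]|t [[t0]|[nt]]]; rewrite /right_open /F/= !lte_fin => tn.
  - by have [a|a] := ltP t n%:R; [left|right].
  - by split=> //; rewrite (lt_trans tn)// ltr_nat.
  - by split=> //; rewrite (le_trans _ nt).
have UI n : right_open 0 n%:R%:E `&` F n = set0 :> set R.
  apply/seteqP; split=> // t [[_ a] [b _]]; move: a; rewrite lte_fin; move: b => /=.
  by move=> /le_lt_trans/[apply]; rewrite ltxx.
have h3 : {ae P, forall w n, W (right_open 0 n%:R%:E) x w = \sum_(i < n) W (F i) x w}.
  apply/ae_foralln => n; elim: n => [|n IH].
    rewrite (_ : right_open _ _ = set0).
      by apply: filterS (noise0 Tx) => w w0; rewrite big_ord0.
    by apply/seteqP; split=> // t [t0]; rewrite lte_fin => /(le_lt_trans t0); rewrite ltxx.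
  rewrite UN; have := noiseU (borel_right_open _ (lexx 0)) (bF n) (UI n) Tx.
  by move=> h; apply: filterS2 h IH => w -> ->; rewrite big_ord_recr.
apply: filterS3 h1 h2 h3 => w cv <- e.
by under eq_fun do rewrite e.
Qed.

End noise.

(** * Probabilities of boxes, from below *)

Section finite_sums.
Context {d : measure_display} {O : measurableType d} {R : realType}.
Context (P : probability O R).

Lemma bm_bigsum (J : Type) (r : seq J) (F : J -> O -> R) : (forall j, bm (F j)) ->
  bm (fun w => \sum_(j <- r) F j w).
Proof.
move=> bF; elim: r => [|j r IH].
  by under [X in bm X]funext do rewrite big_nil; exact: bm_cst.
by under [X in bm X]funext do rewrite big_cons; exact: bmD.
Qed.

Lemma bm_bigprod (J : Type) (r : seq J) (F : J -> O -> R) : (forall j, bm (F j)) ->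
  bm (fun w => \prod_(j <- r) F j w).
Proof.
move=> bF; elim: r => [|j r IH].
  by under [X in bm X]funext do rewrite big_nil; exact: bm_cst.
by under [X in bm X]funext do rewrite big_cons; exact: bmM.
Qed.

Lemma bm_bool (b : O -> bool) : measurable [set w | b w] -> bm (fun w => (b w)%:R : R).
Proof.
move=> mb; suff -> : (fun w => (b w)%:R : R) = \1_[set w | b w] by exact: bm_indic.
by apply/funext => w; rewrite indicE; congr (_%:R); congr nat_of_bool; apply/idP/idP; rewrite inE.
Qed.
End finite_sums.

Section product_space.
Context {d : measure_display} {O : measurableType d} {R : realType}.
Context (P : probability O R).

Definition square_prob : probability (O * O)%type R := (P \x P)%E.

Lemma bm_fst (f : O -> R) : bm f -> bm (fun z : O * O => f z.1).
Proof.
move=> [mf [M fM]]; split; last by exists M => z.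
exact: measurableT_comp mf measurable_fst.
Qed.

Lemma bm_snd (f : O -> R) : bm f -> bm (fun z : O * O => f z.2).
Proof.
move=> [mf [M fM]]; split; last by exists M => z.
exact: measurableT_comp mf measurable_snd.
Qed.

Lemma Ex_square f g : bm f -> bm g ->
  Ex square_prob (fun z => f z.1 * g z.2) = Ex P f * Ex P g.
Proof.
move=> bf bg.
have i1 : L1 square_prob (fun z => f z.1 * g z.2).
  by apply: bm_L1; apply: bmM; [exact: bm_fst | exact: bm_snd].
have := integral12_prod_meas1 i1.
rewrite {1}/Ex /Rintegral => <-.
have -> : fubini_F P (EFin \o (fun z : O * O => f z.1 * g z.2)%R) =
    EFin \o (fun x => Ex P g * f x).
  apply/funext => x; rewrite /fubini_F /=.
  have := @integrable_scale _ _ _ P setT g (f x) measurableT (bm_L1 P bg).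
  move=> /integrable_fin_num; rewrite mulrC -ExZ ?/Ex ?/Rintegral; last exact: bm_L1.
  by move=> h; rewrite fineK//; exact: (h measurableT).
transitivity (Ex P (fun x => Ex P g * f x)); first by [].
by rewrite ExZ; [rewrite mulrC | exact: bm_L1].
Qed.

(** Rotation invariance: the difference of two independent copies has twice the variance, which the
    factor $1/\sqrt2$ undoes. *)
Lemma square_same_trig H (I : Type) (D : I -> O -> R) : gspace P H -> (forall i, H (D i)) ->
  same_trig square_prob P (fun i (z : O * O) => (Num.sqrt 2)^-1 * (D i z.1 - D i z.2)) D
    (fun=> 1) (fun=> 1).
Proof.
move=> gH HD; split; [exact: bm_cst | exact: bm_cst | move=> s th].
(* The null second term only displays [U] as a combination of two elements of [H]. *)
pose U w := (Num.sqrt 2)^-1 * lin D s w + 0 * lin D s w.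
have HL : H (lin D s) by exact: gspace_lin gH HD.
have HU : H U by case: gH => _ _; apply.
have gU : gauss P U by case: gH => _ + _; apply.
have gL : gauss P (lin D s) by case: gH => _ + _; apply.
have mU : measurable_fun setT U by case: gU.
have e x : cos (x + - (pi / 2)) = sin x :> R.
  by rewrite cosD cosN sinN cos_pihalf sin_pihalf; ring.
transitivity (Ex square_prob (fun z => cos (U z.1 + th) * cos (U z.2 + 0) +
   cos (U z.1 + (th - pi / 2)) * cos (U z.2 + - (pi / 2)))).
  congr (Ex _ _); apply/funext => z; rewrite mul1r addrA !e addr0.
  have -> : lin (fun i (z : O * O) => (Num.sqrt 2)^-1 * (D i z.1 - D i z.2)) s z = U z.1 - U z.2.
    rewrite /U /lin !mulr_sumr -!big_split -sumrB /=; apply: eq_bigr => p _; ring.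
  by rewrite -cosB; congr cos; ring.
rewrite ExD; first last.
- by apply: bm_L1; apply: bmM; [apply: (@bm_fst (fun w => cos (U w + _))) | apply: (@bm_snd (fun w => cos (U w + _)))];
    apply: bm_cos; apply: measurable_funD => //.
- by apply: bm_L1; apply: bmM; [apply: (@bm_fst (fun w => cos (U w + _))) | apply: (@bm_snd (fun w => cos (U w + _)))];
    apply: bm_cos; apply: measurable_funD => //.
rewrite (@Ex_square (fun w => cos (U w + th)) (fun w => cos (U w + 0))); first last.
- by apply: bm_cos; apply: measurable_funD.
- by apply: bm_cos; apply: measurable_funD.
rewrite (@Ex_square (fun w => cos (U w + (th - pi / 2))) (fun w => cos (U w + - (pi/2)))); first last.
- by apply: bm_cos; apply: measurable_funD.
- by apply: bm_cos; apply: measurable_funD.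
rewrite (@gauss_cos _ _ _ P U th gU) (@gauss_cos _ _ _ P U 0 gU).
rewrite (@gauss_cos _ _ _ P U (- (pi/2)) gU) cosN cos_pihalf mul0r mulr0 addr0 cos0 mul1r.
rewrite -mulrA -expRD.
transitivity (Ex P (fun w => cos (lin D s w + th))); last first.
  by congr Ex; apply/funext => w; rewrite mul1r.
rewrite (@gauss_cos _ _ _ P (lin D s) th gL).
suff -> : Ex P (fun w => U w ^+ 2) = 2^-1 * Ex P (fun w => lin D s w ^+ 2).
  by congr (_ * expR _); field.
rewrite -ExZ; last exact: gauss_sqr.
congr Ex; apply/funext => w; rewrite /U mul0r addr0 exprMn exprVn sqr_sqrtr//.
Qed.
End product_space.

Section entropy.
Context {d : measure_display} {O : measurableType d} {R : realType}.
Context (P : probability O R) (H : set (O -> R)) (gH : gspace P H).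
Context (n : nat) (D : 'I_n -> O -> R) (HD : forall i, H (D i)).
Context (t : 'I_n -> R) (t0 : forall i, 0 < t i).

(* If an independent copy falls in the same cell, their difference divided by
   [sqrt 2], which has the law of [D i], lies in [[- t i, t i]]. *)
Definition cell i w : int := Num.floor (D i w / (Num.sqrt 2 * t i) + 2^-1).

Let mD i : measurable_fun setT (D i).
Proof. by case: gH => _ h _; case: (h _ (HD i)). Qed.

Lemma bm_cell i z : bm (fun w => (cell i w == z)%:R : R).
Proof.
apply: bm_bool.
have -> : [set w | cell i w == z] =
    (fun w => D i w / (Num.sqrt 2 * t i) + 2^-1) @^-1` `[z%:~R, (z + 1)%:~R[.
  by apply/funext => w; apply/propext; rewrite /cell /= floor_eq in_itv.
apply: measurable_preim; last exact: measurable_itv.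
by apply: measurable_funD => //; apply: measurable_funM.
Qed.

Let cells K (m : {ffun 'I_n -> 'I_(2 * K).+1}) w : R :=
  \prod_i (cell i w == (m i)%:Z - K%:Z)%:R.

Let cells01 K m w : 0 <= cells (K := K) m w <= 1.
Proof.
rewrite /cells; elim/big_ind : _ => //.
- by rewrite ler01 lexx.
- by move=> x y /andP[x0 x1] /andP[y0 y1]; rewrite mulr_ge0//= mulr_ile1.
- by move=> i _; case: eqP; rewrite ?ler01 ?lexx.
Qed.

Let bm_cells K m : bm (cells (K := K) m).
Proof. by apply: bm_bigprod => i; exact: bm_cell. Qed.

Let sum_cell K i w : \sum_(j < (2 * K).+1) ((cell i w == j%:Z - K%:Z)%:R : R) =
  (`|cell i w| <= K%:Z)%R%:R.
Proof.
have [h|h] := boolP (`|cell i w| <= K%:Z)%R.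
  have lt : (absz (cell i w + K%:Z)%R < (2 * K).+1)%N by lia.
  rewrite (bigD1 (Ordinal lt))//= big1 ?addr0; last first.
    move=> j /eqP jn; case: eqP => // e; exfalso; apply: jn; apply/val_inj => /=; lia.
  by case: eqP => // e; exfalso; lia.
rewrite big1// => j _; case: eqP => // e; exfalso; have := ltn_ord j; lia.
Qed.

Let sum_cells K w : \sum_m cells (K := K) m w = \prod_i (`|cell i w| <= K%:Z)%R%:R.
Proof.
by rewrite /cells -(bigA_distr_bigA (fun i j => (cell i w == (j : 'I_(2 * K).+1)%:Z - K%:Z)%:R));
  apply: eq_bigr => i _; exact: sum_cell.
Qed.

Let prod01 (b : 'I_n -> bool) : 0 <= \prod_i ((b i)%:R : R) <= 1.
Proof.
elim/big_ind : _ => //.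
- by rewrite ler01 lexx.
- by move=> x y /andP[x0 x1] /andP[y0 y1]; rewrite mulr_ge0//= mulr_ile1.
- by move=> i _; case: (b i); rewrite ?ler01 ?lexx.
Qed.

Let mass_cvg : Ex P (fun w => \sum_m cells (K := K) m w) @[K --> \oo] --> (1 : R).
Proof.
rewrite -[X in _ --> X](Ex_cst P 1).
apply: (@Ex_cvg _ _ _ P _ _ 1).
- by move=> K; case: (@bm_bigsum _ _ R _ (index_enum _) _ (fun m => @bm_cells K m)).
- exact: measurable_cst.
- by move=> K w; rewrite sum_cells; have /andP[h1 h2] := prod01 (fun i => (`|cell i w| <= K%:Z)%R);
    rewrite ger0_norm.
- apply: aeW => w; apply: cvg_near_cst.
  exists (\max_i absz (cell i w))%N => // K /= hK.
  rewrite sum_cells big1// => i _.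
  suff -> : (`|cell i w| <= K%:Z)%R by [].
  have h : (absz (cell i w) <= \max_j absz (cell j w))%N by exact: leq_bigmax.
  have h' := leq_trans h hK; lia.
Qed.

Let collide : Ex (square_prob P) (fun z => 1 * \prod_i
    (`|(Num.sqrt 2)^-1 * (D i z.1 - D i z.2)| <= t i)%R%:R) =
  Ex P (fun w => 1 * \prod_i (`|D i w| <= t i)%R%:R).
Proof.
apply: (@same_trig_box _ _ _ _ R (square_prob P) P 'I_n
  (fun i (z : O * O) => (Num.sqrt 2)^-1 * (D i z.1 - D i z.2)) D _ _ n (fun=> 1) (fun=> 1) id t).
- move=> i; apply: measurable_funM => //; apply: measurable_funB.
    exact: measurableT_comp (mD i) measurable_fst.
  exact: measurableT_comp (mD i) measurable_snd.
- exact: mD.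
- exact: square_same_trig gH HD.
Qed.

Lemma cell_close i w w' : cell i w = cell i w' ->
  `|(Num.sqrt 2)^-1 * (D i w - D i w')| <= t i.
Proof.
have s2 : 0 < Num.sqrt 2 :> R by rewrite sqrtr_gt0.
have st : 0 < Num.sqrt 2 * t i by rewrite mulr_gt0.
move=> e; have := floor_itv (D i w / (Num.sqrt 2 * t i) + 2^-1).
have := floor_itv (D i w' / (Num.sqrt 2 * t i) + 2^-1).
rewrite -!/(cell _ _) e; set z := (_%:~R : R) => /andP[h1 h2] /andP[h3 h4].
have h5 : (cell i w' + 1)%:~R = z + 1 by rewrite intrD.
rewrite normrM (ger0_norm (_ : 0 <= (Num.sqrt 2)^-1)) ?invr_ge0 ?(ltW s2)// ler_pdivrMl//.
have -> : D i w - D i w' = (D i w / (Num.sqrt 2 * t i) - D i w' / (Num.sqrt 2 * t i)) * (Num.sqrt 2 * t i).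
  by rewrite -mulrBl divfK// gt_eqF.
rewrite normrM (gtr0_norm st) ler_piMl ?(ltW st)// ler_norml; lra.
Qed.

(** The sum is the probability that two independent copies share all their cells, within the grid.
    On that event the rescaled difference lies in the box by [cell_close], and it has the law of
    [D]. *)
Lemma square_cells K : \sum_m Ex P (cells (K := K) m) ^+ 2 <=
  Ex P (fun w => \prod_i (`|D i w| <= t i)%R%:R).
Proof.
have -> : Ex P (fun w => \prod_i (`|D i w| <= t i)%R%:R) =
    Ex P (fun w => 1 * \prod_i (`|D i w| <= t i)%R%:R).
  by congr Ex; apply/funext => w; rewrite mul1r.
rewrite -collide.
under eq_bigr do rewrite expr2 -(Ex_square P (bm_cells _) (bm_cells _)).
rewrite -Ex_sum; last first.
  by move=> m; apply: bm_L1; apply: bmM; [exact: bm_fst | exact: bm_snd].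
apply: Ex_le.
- apply: bm_L1; apply: bm_bigsum => m; apply: bmM; [exact: bm_fst | exact: bm_snd].
- apply: bm_L1; apply: bmM; first exact: bm_cst.
  apply: bm_bigprod => i; apply: bm_bool.
  have -> : [set z : O * O | `|(Num.sqrt 2)^-1 * (D i z.1 - D i z.2)| <= t i] =
     (fun z : O * O => (Num.sqrt 2)^-1 * (D i z.1 - D i z.2)) @^-1` `[- t i, t i].
    by apply/funext => z; apply/propext; rewrite /= in_itv /= ler_norml.
  apply: measurable_preim; last exact: measurable_itv.
  apply: measurable_funM => //; apply: measurable_funB.
    exact: measurableT_comp (mD i) measurable_fst.
  exact: measurableT_comp (mD i) measurable_snd.
- move=> [w w'] /=; rewrite mul1r.
  have -> : \sum_m cells (K := K) m w * cells m w' = \sum_(m : {ffun 'I_n -> 'I_(2 * K).+1}) \prod_i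
      ((cell i w == (m i)%:Z - K%:Z)%:R * (cell i w' == (m i)%:Z - K%:Z)%:R).
    by apply: eq_bigr => m _; rewrite /cells big_split.
  rewrite -(bigA_distr_bigA (fun i j => (cell i w == (j : 'I_(2 * K).+1)%:Z - K%:Z)%:R *
     (cell i w' == (j : 'I_(2 * K).+1)%:Z - K%:Z)%:R)).
  apply: ler_prod => i _; rewrite sumr_ge0/=; last by move=> j _; rewrite mulr_ge0.
  have [e|ne] := eqVneq (cell i w) (cell i w').
    rewrite cell_close// e.
    have <- : \sum_(j < (2 * K).+1) ((cell i w' == j%:Z - K%:Z)%:R : R) =
       \sum_(j < (2 * K).+1) (cell i w' == j%:Z - K%:Z)%:R * (cell i w' == j%:Z - K%:Z)%:R.
      by apply: eq_bigr => j _; case: eqP; rewrite ?mulr1 ?mulr0.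
    by rewrite sum_cell; case: (`|cell i w'| <= K%:Z)%R; rewrite ?lexx ?ler01.
  rewrite big1// => j _.
  have [e1|_] := eqVneq (cell i w) (j%:Z - K%:Z); last by rewrite mul0r.
  by have [e2|_] := eqVneq (cell i w') (j%:Z - K%:Z); rewrite ?mulr0//; rewrite e1 e2 eqxx in ne.
Qed.

(* The sum of the squared cell probabilities is at least exp(-entropy), and the
   entropy is at most the mean length of a code whose lengths [ell] satisfy
   Kraft's inequality; this takes the place of the Gaussian correlation inequality. *)
Lemma small_ball_entropy (ell : 'I_n -> int -> R) (g : 'I_n -> O -> R) (b : 'I_n -> R) :
  (forall i K, \sum_(j < (2 * K).+1) expR (- ell i (j%:Z - K%:Z)) <= 1) ->
  (forall i w, 0 <= g i w) -> (forall i w, ell i (cell i w) <= g i w) ->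
  (forall i, L1 P (g i)) -> (forall i, Ex P (g i) <= b i) ->
  expR (- \sum_i b i) <= Ex P (fun w => \prod_i (`|D i w| <= t i)%R%:R).
Proof.
move=> ell1 g0 ellg g1 gb; set c := - _.
pose p K m := Ex P (cells (K := K) m).
pose L K (m : {ffun 'I_n -> 'I_(2 * K).+1}) : R := \sum_i ell i ((m i)%:Z - K%:Z).
have p0 K m : 0 <= p K m by apply: Ex_ge0 => w; case/andP: (cells01 m w).
(* The inequality $1+x\le e^x$, applied once at $\ln p-c$ and once at $-L-\ln p$, makes $\ln p$
   cancel. This is Jensen's bound in pointwise form, linear in $p$, $pL$ and $e^{-L}$, and it also
   covers cells of probability zero. *)
have key K m : expR c * ((2 - c) * p K m - p K m * L K m - expR (- L K m)) <= p K m ^+ 2.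
  have [->|pn0] := eqVneq (p K m) 0.
    rewrite expr0n/= !(mulr0,mul0r) subr0 sub0r mulrN oppr_le0 mulr_ge0// expR_ge0//.
  have pp : 0 < p K m by rewrite lt_neqAle eq_sym pn0 p0.
  have h1 : 1 + (ln (p K m) - c) <= expR (- c) * p K m.
    by rewrite (le_trans (expR_ge1Dx _))// expRD lnK ?posrE// mulrC.
  have h2 : 1 + (- L K m - ln (p K m)) <= expR (- L K m) / p K m.
    by rewrite (le_trans (expR_ge1Dx _))// expRD (expRN (ln _)) lnK ?posrE.
  rewrite -(@ler_pM2l _ (expR (- c)) _ _) ?expR_gt0//.
  rewrite mulrA -expRD addNr expR0 mul1r expr2 mulrA.
  have h3 := ler_wpM2r (p0 K m) h1.
  have h4 := ler_wpM2r (p0 K m) h2; rewrite divfK// in h4.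
  by apply: le_trans h3; lra.
have sumq K : \sum_m expR (- L K m) <= 1.
  under eq_bigr do rewrite /L raddf_sum /= expR_sum.
  rewrite -(bigA_distr_bigA (fun i (j : 'I_(2 * K).+1) => expR (- ell i (j%:Z - K%:Z)))).
  rewrite -[leRHS](@big1_eq _ 1 *%R _ (index_enum 'I_n) predT).
  by apply: ler_prod => i _; rewrite ell1 sumr_ge0// => j _; exact: expR_ge0.
have sumL K : \sum_m p K m * L K m <= - c.
  rewrite /c opprK.
  have i1 m : L1 P (fun w => L K m * cells m w) by apply: L1Z; exact: bm_L1.
  have -> : \sum_m p K m * L K m = Ex P (fun w => \sum_m L K m * cells m w).
    rewrite Ex_sum//; apply: eq_bigr => m _; rewrite mulrC ExZ//; exact: bm_L1.
  apply: (@le_trans _ _ (Ex P (fun w => \sum_i g i w))).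
    apply: Ex_le; [exact: L1_sum | exact: L1_sum | move=> w].
    apply: (@le_trans _ _ (\sum_m (\sum_i g i w) * cells (K := K) m w)).
      apply: ler_sum => m _.
      have [h|h] := boolP [forall i, cell i w == (m i)%:Z - K%:Z].
        apply: ler_wpM2r; first by case/andP: (cells01 m w).
        by apply: ler_sum => i _; rewrite -(eqP (forallP h i)); exact: ellg.
      have [i hi] := forallPn h.
      suff -> : cells m w = 0 by rewrite !mulr0.
      by rewrite /cells (bigD1 i)//= (negbTE hi) mul0r.
    rewrite -mulr_sumr sum_cells ler_piMr//; first exact: sumr_ge0.
    by case/andP: (prod01 (fun i => (`|cell i w| <= K%:Z)%R)).
  by rewrite Ex_sum//; exact: ler_sum.
(* The finite grids carry a mass that only tends to 1, so the bound is passed to the limit, where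
   the bracket $(2-c)+c-1$ equals 1. *)
have cvg : expR c * ((2 - c) * Ex P (fun w => \sum_m cells (K := K) m w) + c - 1) @[K --> \oo]
    --> expR c * ((2 - c) * 1 + c - 1).
  by apply: cvgMl_tmp; apply: cvgB; last exact: cvg_cst; apply: cvgD; last exact: cvg_cst; apply: cvgMl_tmp; exact: mass_cvg.
have -> : expR c = expR c * ((2 - c) * 1 + c - 1) by ring.
rewrite -(cvg_lim _ cvg)//; apply: limr_le.
  by apply/cvg_ex; eexists; exact: cvg.
near=> K.
apply: le_trans (square_cells K).
apply: le_trans (ler_sum _ (fun m _ => key K m)).
rewrite -mulr_sumr ler_wpM2l ?expR_ge0// !sumrB -mulr_sumr.
rewrite Ex_sum; last by move=> m; exact: bm_L1.
by have := sumq K; have := sumL K; rewrite -/(p K); lra.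
Unshelve. all: by end_near. Qed.
End entropy.

Section two_sided.
Context {R : realType}.

(** With truncated subtraction one of the two terms vanishes, so this is $|m-n|$. *)
Definition dist2 (m n : nat) : nat := ((m - n) + (n - m))%N.

Lemma geometric_two_sided (x : R) m N : 0 < x < 1 ->
  \sum_(n < N) x ^+ dist2 m n <= 2 / (1 - x).
Proof.
move=> /andP[x0 x1]; have y0 : 0 < 1 - x by lra.
pose c := (1 - x)^-1; have c0 : 0 < c by rewrite invr_gt0.
have cx : c * x = c - 1.
  have : c * (1 - x) = 1 by rewrite mulVf// gt_eqF.
  lra.
(* An explicit majorant of the partial sums, fit for induction: each summand is at most the
   increment of [phi]. *)
pose phi n := if (n <= m)%N then c * x ^+ (m - n) else 2 * c - c * x ^+ (n - m).
suff h : \sum_(n < N) x ^+ dist2 m n <= phi N.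
  apply: le_trans h _; rewrite /phi; case: ifP => _; rewrite -/c.
    have := exprn_ile1 (m - N) (ltW x0) (ltW x1); set y := x ^+ _ => h; nra.
  have : 0 <= c * x ^+ (N - m) by rewrite mulr_ge0 ?exprn_ge0 ?(ltW x0) ?(ltW c0).
  lra.
elim: N => [|N IH].
  by rewrite big_ord0 /phi leq0n mulr_ge0 ?exprn_ge0 ?(ltW x0) ?(ltW c0).
rewrite big_ord_recr /=; apply: le_trans (lerD IH (lexx _)) _.
rewrite /phi /dist2; case: (ltngtP N m) => [lt|lt|->].
- rewrite (_ : (m - N = (m - N.+1).+1)%N); last lia.
  rewrite (_ : (N - m = 0)%N); last lia.
  have : 0 <= x ^+ (m - N.+1) by rewrite exprn_ge0// (ltW x0).
  by rewrite addn0 exprS; set y := x ^+ _ => y00; rewrite mulrA cx; nra.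
- rewrite (_ : (N.+1 - m = (N - m).+1)%N); last lia.
  rewrite (_ : (m - N = 0)%N); last lia.
  by rewrite add0n exprS mulrA cx; lra.
- by rewrite subnn subSnn !expr0 expr1 mulr1; lra.
Qed.

Lemma sum_sym_int (F : int -> R) K :
  \sum_(j < (2 * K).+1) F (j%:Z - K%:Z) = F 0 + \sum_(i < K) (F i.+1%:Z + F (- i.+1%:Z)).
Proof.
elim: K => [|K IH]; first by rewrite big_ord_recl !big_ord0.
rewrite (_ : (2 * K.+1).+1 = (2 * K).+3)%N; last lia.
rewrite big_ord_recl big_ord_recr /= [in RHS]big_ord_recr/= [in RHS]addrA -IH.
have -> : F (0 - K.+1%:Z) = F (- K.+1%:Z) by congr F; lia.
have -> : F ((bump 0 (2 * K).+1)%:Z - K.+1%:Z) = F K.+1%:Z by congr F; rewrite /bump; lia.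
have -> : \sum_(i < (2 * K).+1) F ((bump 0 i)%:Z - K.+1%:Z) = \sum_(i < (2 * K).+1) F (i%:Z - K%:Z).
  by apply: eq_bigr => i _; congr F; rewrite /bump; lia.
lra.
Qed.

Lemma sum_inv_sqr K : \sum_(i < K) (i.+1%:R ^+ 2)^-1 <= 2 :> R.
Proof.
case: K => [|K]; first by rewrite big_ord0.
suff h : \sum_(i < K.+1) (i.+1%:R ^+ 2)^-1 <= 2 - K.+1%:R^-1 :> R.
  by apply: le_trans h _; rewrite lerBlDr lerDl invr_ge0.
elim: K => [|K IH]; first by rewrite big_ord1 expr1n invr1; lra.
rewrite big_ord_recr /=; apply: le_trans (lerD IH (lexx _)) _.
have a0 : 0 < K.+1%:R :> R by rewrite ltr0n.
have e : K.+2%:R = K.+1%:R + 1 :> R by rewrite -natr1.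
have H (A B C : R) : A <= B - C -> 2 - B + A <= 2 - C by move=> ?; lra.
apply: H.
rewrite e; have b0 : 0 < K.+1%:R + 1 :> R by lra.
have -> : (K.+1%:R^-1 - (K.+1%:R + 1)^-1 : R) = (K.+1%:R * (K.+1%:R + 1))^-1.
  by field; rewrite !gt_eqF.
rewrite lef_pV2 ?posrE ?exprn_gt0 ?mulr_gt0// expr2 ler_pM2r//; lra.
Qed.
End two_sided.

Section costs.
Context {d : measure_display} {O : measurableType d} {R : realType}.
Context (P : probability O R) (X : O -> R) (gX : gauss P X).

(* The weight [e] is shared by the nonzero integers, as [sum z^-2 < 4]. *)
Definition code_length (e : R) (z : int) : R :=
  if z == 0 then - ln (1 - e) else - ln (e / (4 * z%:~R ^+ 2)).

Lemma code_length_kraft e K : 0 < e <= 2^-1 ->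
  \sum_(j < (2 * K).+1) expR (- code_length e (j%:Z - K%:Z)) <= 1.
Proof.
move=> /andP[e0 e1].
rewrite (sum_sym_int (fun z => expR (- code_length e z))).
have h (i : nat) (z : int) : z = i.+1%:Z \/ z = - i.+1%:Z ->
    expR (- code_length e z) = e / 4 * (i.+1%:R ^+ 2)^-1.
  move=> hz; have zn : z != 0 by case: hz => ->; lia.
  have z2 : z%:~R ^+ 2 = i.+1%:R ^+ 2 :> R.
    by case: hz => -> ; rewrite ?mulrNz ?sqrrN -?pmulrn.
  rewrite /code_length (negbTE zn) opprK lnK ?z2 ?invfM ?mulrA// posrE.
  by rewrite !mulr_gt0 ?invr_gt0 ?exprn_gt0// ltr0n.
under [X in _ + X]eq_bigr => i _ do
  rewrite (h i _ (or_introl erefl)) (h i _ (or_intror erefl)).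
rewrite /code_length eqxx opprK lnK ?posrE; last by lra.
under eq_bigr do rewrite -mulrDr -mulr2n.
rewrite -mulr_sumr sumrMnl; have := sum_inv_sqr (R := R) K.
by set S := \sum_(i < K) _; rewrite mulr2n; nra.
Qed.

Context (t : R) (t0 : 0 < t).

Let z w : int := Num.floor (X w / (Num.sqrt 2 * t) + 2^-1).

(** A nonzero integer within $1/2$ of $a=X/(\sqrt2\,t)$ satisfies $|z|\le2|a|$, and
    $(2a)^2=2X^2/t^2$. *)
Lemma cell_sqr_le w : z w != 0 -> 1 <= (z w)%:~R ^+ 2 :> R /\ (z w)%:~R ^+ 2 <= 2 * X w ^+ 2 / t ^+ 2.
Proof.
move=> zn; have s2 : 0 < Num.sqrt 2 :> R by rewrite sqrtr_gt0.
have := floor_itv (X w / (Num.sqrt 2 * t) + 2^-1); rewrite -/(z w) intrD.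
set a := X w / _; set b : R := (z w)%:~R => /andP[h1 h2].
have b1 : b <= -1 \/ 1 <= b.
  by rewrite /b -[-1]/((-1)%:~R) -[1]/(1%:~R) !ler_int; lia.
have a2 : 2 * X w ^+ 2 / t ^+ 2 = (2 * a) ^+ 2.
  have e2 : (Num.sqrt 2) ^+ 2 = 2 :> R by rewrite sqr_sqrtr.
  have -> : (2 * a) ^+ 2 = 4 * X w ^+ 2 / ((Num.sqrt 2) ^+ 2 * t ^+ 2).
    by rewrite /a; field; rewrite !gt_eqF.
  by rewrite e2; field; rewrite gt_eqF.
by rewrite a2; split; case: b1 => b1; nra.
Qed.

(** The length $\ln(8z^2)$ is split into $2\ln\rho$ and the logarithm of $X^2/(\rho t)^2$, up to a
    constant; $\ln y<y$ then leaves a quantity of mean at most 1 when the deviation of $X$ is at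
    most $\rho t$. *)
Lemma coarse_cost w rho : 1 <= rho ->
  code_length 2^-1 (z w) <= 16 + 2 * ln rho + X w ^+ 2 / (rho * t) ^+ 2.
Proof.
move=> r1; have r0 : 0 < rho by lra.
have l0 : 0 <= ln rho by rewrite ln_ge0.
have q0 : 0 <= X w ^+ 2 / (rho * t) ^+ 2 by rewrite divr_ge0 ?sqr_ge0.
rewrite /code_length; case: ifPn => [_|zn].
  have -> : 1 - 2^-1 = 2^-1 :> R by lra.
  rewrite lnV ?posrE// opprK; have := @ln_sublinear R 2 ltac:(by []); lra.
have [h1 h2] := cell_sqr_le zn.
have -> : - ln (2^-1 / (4 * (z w)%:~R ^+ 2)) = ln (8 * (z w)%:~R ^+ 2) :> R.
  have pz : 0 < (z w)%:~R ^+ 2 :> R by lra.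
  rewrite -lnV; last by rewrite posrE; apply: divr_gt0 => //; apply: mulr_gt0.
  congr ln; set y := _ ^+ 2 in pz *; field; by rewrite gt_eqF.
apply: (@le_trans _ _ (ln ((16 * rho ^+ 2) * (X w ^+ 2 / (rho * t) ^+ 2)))).
  have pz : 0 < 8 * (z w)%:~R ^+ 2 :> R by apply: mulr_gt0 => //; lra.
  rewrite ler_ln ?posrE//.
    apply: le_trans (_ : 8 * (2 * X w ^+ 2 / t ^+ 2) <= _); first by rewrite ler_pM2l.
    by rewrite le_eqVlt; apply/orP; left; apply/eqP; field; rewrite !gt_eqF.
  apply: lt_le_trans (_ : 8 * (2 * X w ^+ 2 / t ^+ 2) <= _); first by apply: lt_le_trans pz _; rewrite ler_pM2l.
  by rewrite le_eqVlt; apply/orP; left; apply/eqP; field; rewrite !gt_eqF.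
have q1 : 0 < X w ^+ 2 / (rho * t) ^+ 2.
  have : 0 < 2 * X w ^+ 2 / t ^+ 2 by lra.
  rewrite pmulr_lgt0 ?invr_gt0 ?exprn_gt0// pmulr_rgt0// => x2.
  by apply: divr_gt0 => //; apply: exprn_gt0; exact: mulr_gt0.
rewrite lnM ?posrE//; last by apply: mulr_gt0 => //; exact: exprn_gt0.
have -> : ln (16 * rho ^+ 2) = ln 16 + 2 * ln rho.
  by rewrite expr2 lnM ?posrE ?mulr_gt0// lnM ?posrE//; lra.
have := @ln_sublinear R 16 ltac:(by []); have := ln_sublinear q1.
lra.
Qed.

(** The central cell costs at most $2e$. Elsewhere $2X^2/t^2\ge1$, so it may be raised to any power
    [M]: the mean cost is then small as soon as the deviation of $X$ is well below $t$. *)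
Lemma fine_cost w e M : 0 < e <= 2^-1 -> (0 < M)%N ->
  code_length e (z w) <= 2 * e + 4 / e * (2 * X w ^+ 2 / t ^+ 2) ^+ M.
Proof.
move=> /andP[e0 e1] M0.
have q0 : 0 <= 2 * X w ^+ 2 / t ^+ 2 by apply: divr_ge0; [apply: mulr_ge0 => //|]; exact: sqr_ge0.
have q1 : 0 <= 4 / e * (2 * X w ^+ 2 / t ^+ 2) ^+ M.
  by apply: mulr_ge0; [exact: divr_ge0 _ (ltW e0) | exact: exprn_ge0].
rewrite /code_length; case: ifPn => [_|zn].
  suff : - ln (1 - e) <= 2 * e by lra.
  have p : 0 < 1 - e by lra.
  rewrite -lnV ?posrE//; apply: (@le_trans _ _ ((1 - e)^-1 - 1)).
    have := expR_ge1Dx (ln (1 - e)^-1); rewrite lnK ?posrE ?invr_gt0//.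
    have : 0 < (1 - e)^-1 by rewrite invr_gt0.
    lra.
  have : (1 - e) * (1 - e)^-1 = 1 by rewrite divff// gt_eqF.
  by have : 0 < (1 - e)^-1; [rewrite invr_gt0 | nra].
have [h1 h2] := cell_sqr_le zn.
have pz : 0 < (z w)%:~R ^+ 2 :> R by lra.
have -> : - ln (e / (4 * (z w)%:~R ^+ 2)) = ln (4 / e * (z w)%:~R ^+ 2) :> R.
  rewrite -lnV; last by rewrite posrE; apply: divr_gt0 => //; apply: mulr_gt0.
  by congr ln; set y := _ ^+ 2 in pz *; field; rewrite !gt_eqF.
have p1 : 0 < 4 / e * (z w)%:~R ^+ 2 by rewrite mulr_gt0// divr_gt0.
apply: (@le_trans _ _ (4 / e * (z w)%:~R ^+ 2)).
  by apply: ltW; exact: ln_sublinear.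
apply: ler_wpDl; first lra.
have h3 := le_trans h1 h2; rewrite ler_pM2l ?divr_gt0//; apply: le_trans h2 _.
by rewrite -[leLHS]expr1; apply: ler_weXn2l => //; lra.
Qed.

(** A single term of the exponential series bounds $y^M$ by $M!\,e^y$, here at $y=X^2/(4\sigma^2)$
    with $\sigma$ = [sg]. *)
Lemma gauss_moment sg M : 0 < sg -> Ex P (fun w => X w ^+ 2) <= sg ^+ 2 ->
  L1 P (fun w => (X w ^+ 2) ^+ M) /\
  Ex P (fun w => (X w ^+ 2) ^+ M) <= (4 * sg ^+ 2) ^+ M * M`!%:R * 2.
Proof.
move=> s0 hs; have [l1 e1] := gauss_exp gX s0 hs.
have mX : measurable_fun setT X by case: gX.
have s4 : 0 < 4 * sg ^+ 2 by rewrite mulr_gt0// exprn_gt0.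
have c0 : 0 < (4 * sg ^+ 2) ^+ M * M`!%:R by rewrite mulr_gt0 ?exprn_gt0 ?ltr0n ?fact_gt0.
have bnd w : (X w ^+ 2) ^+ M <= (4 * sg ^+ 2) ^+ M * M`!%:R * expR (X w ^+ 2 / (sg ^+ 2 *+ 4)).
  have q0 : 0 <= X w ^+ 2 / (sg ^+ 2 *+ 4) by rewrite divr_ge0 ?sqr_ge0// mulrn_wge0 ?sqr_ge0.
  have -> : (X w ^+ 2) ^+ M = (4 * sg ^+ 2) ^+ M * (X w ^+ 2 / (sg ^+ 2 *+ 4)) ^+ M.
    by rewrite -exprMn; congr (_ ^+ _); rewrite -mulr_natl; field; rewrite gt_eqF.
  rewrite -[leRHS]mulrA ler_pM2l ?exprn_gt0// [leRHS]mulrC -ler_pdivrMr ?ltr0n ?fact_gt0//.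
  case: M {c0} => [|M]; first by rewrite expr0 fact0 divr1 -[leLHS]expR0 ler_expR.
  by have := expR_ge1Dxn M q0; lra.
have l2 : L1 P (fun w => (X w ^+ 2) ^+ M).
  apply: (@L1_le _ _ _ P _ (fun w => (4 * sg ^+ 2) ^+ M * M`!%:R * expR (X w ^+ 2 / (sg ^+ 2 *+ 4)))).
  - by apply: measurable_funX; exact: measurable_sqr.
  - exact: L1Z.
  - by move=> w; rewrite ger0_norm; [exact: bnd | exact/exprn_ge0/sqr_ge0].
split=> //; apply: le_trans (Ex_le l2 (L1Z _ l1) bnd) _.
rewrite ExZ// ler_pM2l// (le_trans e1)// -[leRHS]ger0_norm// -sqrtr_sqr ler_sqrt//; lra.
Qed.
End costs.

Section chain_box.
Context {d : measure_display} {O : measurableType d} {R : realType}.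
Context (P : probability O R).

(* The first case prices links whose deviation exceeds the box, the second one
   links far below it, for which a high moment bounds the chance of leaving
   the central cell. *)
Definition link_cost (X : O -> R) (t b : R) : Prop :=
  (exists2 rho, 1 <= rho & Ex P (fun w => X w ^+ 2) <= (rho * t) ^+ 2 /\ 17 + 2 * ln rho <= b) \/
  (exists rho e M, [/\ 0 < rho, 0 < e <= 2^-1, (0 < M)%N,
     Ex P (fun w => X w ^+ 2) <= (rho * t) ^+ 2 &
     2 * e + 4 / e * ((8 * rho ^+ 2) ^+ M * M`!%:R * 2) <= b]).

Lemma link_code X t b : gauss P X -> 0 < t -> link_cost X t b ->
  exists p : (int -> R) * (O -> R),
  [/\ forall K, \sum_(j < (2 * K).+1) expR (- p.1 (j%:Z - K%:Z)) <= 1,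
      forall w, 0 <= p.2 w,
      forall w, p.1 (Num.floor (X w / (Num.sqrt 2 * t) + 2^-1)) <= p.2 w,
      L1 P p.2 & Ex P p.2 <= b].
Proof.
move=> gX t0 [[rho r1 [v c]]|[rho [e [M [r0 e01 M0 v c]]]]].
- have r0 : 0 < rho by lra.
  have l0 : 0 <= ln rho by rewrite ln_ge0.
  exists (code_length 2^-1, fun w => 16 + 2 * ln rho + (X w ^+ 2 / (rho * t) ^+ 2)); split => /=.
  + by move=> K; apply: code_length_kraft; rewrite invr_gt0 lexx andbT.
  + move=> w; have : 0 <= X w ^+ 2 / (rho * t) ^+ 2 by apply: divr_ge0; exact: sqr_ge0.
    lra.
  + by move=> w; exact: coarse_cost.
  + apply: L1D; first exact: L1_cst.
    have : L1 P (fun w => (rho * t) ^- 2 * X w ^+ 2) by apply: L1Z; exact: gauss_sqr.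
    by congr L1; apply/funext => w; rewrite mulrC.
  + have l1 : L1 P (fun w => (rho * t) ^- 2 * X w ^+ 2) by apply: L1Z; exact: gauss_sqr.
    have -> : (fun w => 16 + 2 * ln rho + X w ^+ 2 / (rho * t) ^+ 2) =
       (fun w => cst (16 + 2 * ln rho) w + (rho * t) ^- 2 * X w ^+ 2).
      by apply/funext => w; rewrite [_ / _]mulrC.
    rewrite ExD//; last exact: L1_cst.
    rewrite Ex_cst ExZ; last exact: gauss_sqr.
    have : (rho * t) ^- 2 * Ex P (fun w => X w ^+ 2) <= 1.
      by rewrite ler_pdivrMl ?mulr1// exprn_gt0// mulr_gt0.
    lra.
- have rt : 0 < rho * t by rewrite mulr_gt0.
  have /andP[e0 _] := e01.
  have [l1 m1] := gauss_moment gX M rt v.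
  have e2 : (fun w => 2 * e + 4 / e * (2 * X w ^+ 2 / t ^+ 2) ^+ M) =
       (fun w => cst (2 * e) w + 4 / e * (2 / t ^+ 2) ^+ M * (X w ^+ 2) ^+ M).
    by apply/funext => w; rewrite -[in RHS]mulrA -exprMn; congr (_ + _ * _ ^+ _); rewrite mulrAC.
  exists (code_length e, fun w => 2 * e + 4 / e * (2 * X w ^+ 2 / t ^+ 2) ^+ M); split => /=.
  + by move=> K; exact: code_length_kraft.
  + move=> w; apply: addr_ge0; first by rewrite mulr_ge0// ltW.
    apply: mulr_ge0; first by rewrite divr_ge0// ltW.
    apply: exprn_ge0; apply: divr_ge0; last exact: sqr_ge0.
    by apply: mulr_ge0 => //; exact: sqr_ge0.
  + by move=> w; exact: fine_cost.
  + by rewrite e2; apply: L1D; [exact: L1_cst | exact: L1Z].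
  + rewrite e2 ExD; [|exact: L1_cst|exact: L1Z].
    rewrite Ex_cst ExZ//; apply: le_trans c; rewrite lerD2l -[leLHS]mulrA ler_pM2l ?divr_gt0//.
    have t2 : 0 < 2 / t ^+ 2 by rewrite divr_gt0 ?exprn_gt0.
    apply: le_trans (ler_wpM2l (exprn_ge0 _ (ltW t2)) m1) _.
    rewrite mulrA [_ * (_ * M`!%:R)]mulrA -exprMn.
    have -> : 2 / t ^+ 2 * (4 * (rho * t) ^+ 2) = 8 * rho ^+ 2 by field; rewrite gt_eqF.
    exact: lexx.
Qed.

Lemma box_bound H (J : finType) (D : J -> O -> R) (t b : J -> R) : gspace P H ->
  (forall j, H (D j)) -> (forall j, 0 < t j) -> (forall j, link_cost (D j) (t j) (b j)) ->
  expR (- \sum_j b j) <= Ex P (fun w => \prod_j (`|D j w| <= t j)%R%:R).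
Proof.
move=> gH HD t0 lc; have gD j : gauss P (D j) by case: gH => _ h _; exact: h.
have /choice[p hp] : forall j, exists q : (int -> R) * (O -> R),
  [/\ forall K, \sum_(j < (2 * K).+1) expR (- q.1 (j%:Z - K%:Z)) <= 1,
      forall w, 0 <= q.2 w,
      forall w, q.1 (Num.floor (D j w / (Num.sqrt 2 * t j) + 2^-1)) <= q.2 w,
      L1 P q.2 & Ex P q.2 <= b j].
  by move=> j; exact: link_code.
have bij : {on predT, bijective (@enum_val J predT)} by apply: onW_bij; exact: enum_val_bij.
rewrite (reindex (@enum_val J predT) bij) /=.
have -> : (fun w => \prod_j (`|D j w| <= t j)%R%:R) =
    (fun w => \prod_(i < #|J|) ((`|D (enum_val i) w| <= t (enum_val i))%R%:R : R)).
  by apply/funext => w; rewrite (reindex (@enum_val J predT) bij).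
apply: (@small_ball_entropy _ _ _ P H gH _ (fun i => D (enum_val i)) _ (fun i => t (enum_val i)) _
   (fun i => (p (enum_val i)).1) (fun i => (p (enum_val i)).2) (fun i => b (enum_val i))) => //.
- by move=> i; case: (hp (enum_val i)).
- by move=> i; case: (hp (enum_val i)).
- by move=> i; case: (hp (enum_val i)).
- by move=> i; case: (hp (enum_val i)).
- by move=> i; case: (hp (enum_val i)).
Qed.

(* Any ratio strictly between 1/2 and 1 would serve for the chaining thresholds. *)
Definition root_half : R := Num.sqrt 2^-1.

Lemma root_half_sqr : root_half ^+ 2 = 2^-1.
Proof. by rewrite sqr_sqrtr// invr_ge0. Qed.

Lemma root_half_gt0 : 0 < root_half. Proof. by rewrite sqrtr_gt0 invr_gt0. Qed.

Lemma root_half_bounds : 2^-1 <= root_half < 1.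
Proof. by have := root_half_sqr; have := root_half_gt0; nra. Qed.

(** At distance $i$ below level [m] a link costs $O(1+i)$, but the bound on the number of links is
    smaller by at least $2^i$, which leaves room for $(3/4)^i$. At distance $i$ above, the number
    grows at most like $2^{qi}$, while the moment of order $2(q+1)$ makes each link cost
    $O(2^{-(q+1)i})$. *)
Lemma chain_cost (q : nat) (Bd G w : R) (dl s : R) (m n : nat) X (c : R) :
  1 <= Bd -> 1 <= G -> 2 <= w <= 2 ^+ q -> 0 < dl -> 0 <= s <= G * dl * 2 ^+ m ->
  Ex P (fun o => X o ^+ 2) <= (s / 2 ^+ n) ^+ 2 ->
  0 <= c <= Bd * w ^+ n ->
  exists2 b, link_cost X (dl * root_half ^+ dist2 m n) b &
   c * b <= Bd * (2 * (25 + 2 * ln G) + (1 + 16 * ((8 * G ^+ 2) ^+ (2 * q.+1) * (2 * q.+1)`!%:R)))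
     * w ^+ m * (3 / 4) ^+ dist2 m n.
Proof.
have split_index : (exists i, m = (n + i)%N /\ dist2 m n = i) \/
    (exists i, n = (m + i)%N /\ dist2 m n = i).
  rewrite /dist2; have [le|lt] := leqP n m; [left; exists (m - n)%N | right; exists (n - m)%N];
    split; lia.
move=> B1 G1 /andP[w2 wq] dl0 /andP[s0 sG] vX /andP[c0 cB].
have := root_half_bounds; have := root_half_sqr; have := root_half_gt0.
set z := root_half => z0 z2 /andP[z12 z1].
have G0 : 0 < G by lra.
have lG : 0 <= ln G by rewrite ln_ge0.
have [K1 K1E] : exists K1, K1 = 2 * (25 + 2 * ln G) by eexists.
have [K2 K2E] : exists K2, K2 = 16 * ((8 * G ^+ 2) ^+ (2 * q.+1) * (2 * q.+1)`!%:R) by eexists.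
rewrite -K1E -K2E.
have K10 : 0 <= K1 by rewrite K1E; lra.
have K20 : 0 <= K2.
  rewrite K2E; apply: mulr_ge0 => //; apply: mulr_ge0 => //; apply: exprn_ge0; apply: mulr_ge0 => //; exact: sqr_ge0.
have w0 : 0 < w by lra.
have wm0 : 0 < w ^+ m by rewrite exprn_gt0.
have B0 : 0 < Bd by lra.
have sn : s / 2 ^+ n <= G * dl * (2 ^+ m / 2 ^+ n) by rewrite mulrA ler_pM2r ?invr_gt0 ?exprn_gt0.
have sn0 : 0 <= s / 2 ^+ n by rewrite divr_ge0// exprn_ge0.
case: split_index => [[i [em ->]]|[i [en ->]]].
- clear K2E.
  (* The deviation may exceed the threshold by $G(2/z)^i$ with $z$ = [root_half] at least $1/2$,
     hence the ratio $G\,4^i$. *)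
  exists (17 + 2 * ln (G * 4 ^+ i)).
    left; exists (G * 4 ^+ i); first by rewrite mulr_ege1// exprn_ege1// ler1n.
    split => //; apply: le_trans vX _; rewrite ler_sqr ?nnegrE//; last first.
      by rewrite !mulr_ge0// ?exprn_ge0 ?(ltW G0) ?(ltW dl0) ?(ltW z0).
    apply: le_trans sn _; rewrite em exprD [_ * _ / _]mulrAC mulfV ?mul1r ?gt_eqF ?exprn_gt0//.
    have -> : G * 4 ^+ i * (dl * z ^+ i) = G * dl * (4 * z) ^+ i by rewrite exprMn; ring.
    by rewrite ler_pM2l ?mulr_gt0// lerXn2r ?nnegrE//; lra.
  rewrite lnM ?posrE ?exprn_gt0// lnXn// -[_ *+ i]mulr_natr.
  have l4 : ln 4 < 4 :> R by apply: ln_sublinear.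
  have i0 : 0 <= i%:R :> R by [].
  have b1 : 1 + i%:R / 2 <= (3 / 2) ^+ i :> R.
    elim: (i) => [|j IH]; first by rewrite mul0r addr0.
    rewrite exprS -natr1; have : 0 <= j%:R :> R by []. 
    by move: ((3 / 2) ^+ j : R) (j%:R : R) IH => ? ? ? ?; lra.
  have b2 : 17 + 2 * (ln G + ln 4 * i%:R) <= K1 * (3 / 2) ^+ i.
    have : K1 * (1 + i%:R / 2) <= K1 * (3 / 2) ^+ i by rewrite ler_wpM2l.
    apply: le_trans; rewrite K1E; clear - lG i0 l4; nra.
  have b3 : c <= Bd * (w ^+ m * (1 / 2) ^+ i).
    apply: le_trans cB _; rewrite ler_pM2l// em exprD -mulrA ler_peMr ?exprn_ge0 ?(ltW w0)//.
    by rewrite -exprMn exprn_ege1//; lra.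
  have h34 : (3 / 4) ^+ i = (1 / 2) ^+ i * (3 / 2) ^+ i :> R by rewrite -exprMn; congr (_ ^+ _); lra.
  have p0 : 0 <= (3 / 2) ^+ i :> R by apply: exprn_ge0; lra.
  have p1 : 0 <= (1 / 2) ^+ i :> R by apply: exprn_ge0; lra.
  have l40 : 0 <= ln 4 * i%:R :> R by rewrite mulr_ge0// ln_ge0// ler1n.
  apply: le_trans (ler_pM c0 _ b3 b2) _; first by lra.
  rewrite h34 [Bd * (K1 + _)]mulrDr !mulrDl.
  apply: ler_wpDr; last by rewrite le_eqVlt; apply/orP; left; apply/eqP; ring.
  by repeat (apply: mulr_ge0 => //; try lra); apply: ltW.
(* Half of $y^i$ is the weight given to the nonzero cells. As $z^2=1/2$, the moment of order
   $2(q+1)$ contributes $y^{2i}$, and dividing by the weight leaves $y^i$. *)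
- pose y := (2^-1 : R) ^+ q.+1.
  have y0 : 0 < y by rewrite exprn_gt0// invr_gt0.
  have yi0 : 0 < y ^+ i by rewrite exprn_gt0.
  have yi1 : y ^+ i <= 1.
    rewrite exprn_ile1// ?(ltW y0)// exprn_ile1// ?invr_ge0//; lra.
  exists (2 * (2^-1 * y ^+ i) + 4 / (2^-1 * y ^+ i) *
     ((8 * (G * z ^+ i) ^+ 2) ^+ (2 * q.+1) * (2 * q.+1)`!%:R * 2)).
    right; exists (G * z ^+ i), (2^-1 * y ^+ i), (2 * q.+1)%N; split => //.
    + by rewrite mulr_gt0// exprn_gt0.
    + by rewrite mulr_gt0// ?invr_gt0//= ler_piMr// invr_ge0.
    + apply: le_trans vX _; rewrite ler_sqr ?nnegrE//; last first.
        by rewrite !mulr_ge0// ?exprn_ge0 ?(ltW G0) ?(ltW dl0) ?(ltW z0).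
      apply: le_trans sn _.
      have -> : G * z ^+ i * (dl * z ^+ i) = G * dl * (z ^+ 2) ^+ i by rewrite expr2 exprMn; ring.
      have -> : 2 ^+ m / 2 ^+ n = 2^-1 ^+ i :> R.
        by rewrite en exprD exprVn invfM mulrA divff ?mul1r// gt_eqF// exprn_gt0.
      by rewrite z2.
  have e1 : 4 / (2^-1 * y ^+ i) * ((8 * (G * z ^+ i) ^+ 2) ^+ (2 * q.+1) * (2 * q.+1)`!%:R * 2) =
     K2 * y ^+ i.
    have -> : (8 * (G * z ^+ i) ^+ 2) ^+ (2 * q.+1) = (8 * G ^+ 2) ^+ (2 * q.+1) * (y ^+ i) ^+ 2.
      have -> : (G * z ^+ i) ^+ 2 = G ^+ 2 * 2^-1 ^+ i by rewrite exprMn -exprM mulnC exprM z2.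
      rewrite mulrA exprMn -!exprM.
      by have -> : (i * (2 * q.+1) = q.+1 * (i * 2))%N by rewrite mulnA mulnC.
    rewrite K2E; field; by rewrite gt_eqF.
  rewrite e1 mulrA mulfV// mul1r.
  have cy : c * y ^+ i <= Bd * w ^+ m * (3 / 4) ^+ i.
    apply: le_trans (ler_wpM2r (ltW yi0) cB) _.
    rewrite -!mulrA ler_pM2l// en exprD -mulrA ler_pM2l// -exprMn.
    apply: lerXn2r; rewrite ?nnegrE; [by rewrite mulr_ge0// ltW| lra |].
    rewrite /y exprS; have : w * 2^-1 ^+ q <= 1.
      by rewrite exprVn ler_pdivrMr ?mul1r// exprn_gt0.
    by move: (2^-1 ^+ q) => ? ?; lra.
  rewrite -[X in c * (X + _)]mul1r -mulrDl mulrCA.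
  have h : (1 + K2) * (c * y ^+ i) <= (1 + K2) * (Bd * w ^+ m * (3 / 4) ^+ i) by rewrite ler_wpM2l//; lra.
  apply: le_trans h _.
  have h2 : 0 <= Bd * w ^+ m * (3 / 4) ^+ i.
    by apply: mulr_ge0; [apply: mulr_ge0; apply: ltW | apply: exprn_ge0; lra].
  have -> : Bd * (K1 + (1 + K2)) * w ^+ m * (3 / 4) ^+ i = (K1 + (1 + K2)) * (Bd * w ^+ m * (3 / 4) ^+ i) by ring.
  by rewrite ler_wpM2r//; lra.
Qed.

(** Levels on both sides of [m] cost a geometric fraction of $w^m$, so the total is of the order of
    level [m] alone, with a constant independent of the number [N] of levels and of the base [w] up
    to $2^q$. *)
Lemma chain_box (q : nat) (Bd G : R) : 1 <= Bd -> 1 <= G -> exists2 A, 0 < A &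
  forall H (w dl s : R) (m : nat) (J : nat -> finType) (L : forall n, J n -> O -> R),
  gspace P H -> 2 <= w <= 2 ^+ q -> 0 < dl -> 0 <= s <= G * dl * 2 ^+ m ->
  (forall n j, H (L n j)) ->
  (forall n j, Ex P (fun o => L n j o ^+ 2) <= (s / 2 ^+ n) ^+ 2) ->
  (forall n, #|J n|%:R <= Bd * w ^+ n) ->
  forall N, expR (- (A * w ^+ m)) <=
    Ex P (fun o => \prod_(n < N) \prod_(j : J n) (`|L n j o| <= dl * root_half ^+ dist2 m n)%R%:R).
Proof.
move=> B1 G1.
have lG : 0 <= ln G by rewrite ln_ge0.
pose K := Bd * (2 * (25 + 2 * ln G) + (1 + 16 * ((8 * G ^+ 2) ^+ (2 * q.+1) * (2 * q.+1)`!%:R))).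
have K0 : 0 < K.
  apply: mulr_gt0; first lra.
  apply: ltr_wpDr; last by lra.
  have : 0 <= 16 * ((8 * G ^+ 2) ^+ (2 * q.+1) * (2 * q.+1)`!%:R).
    apply: mulr_ge0 => //; apply: mulr_ge0 => //; apply: exprn_ge0; apply: mulr_ge0 => //; exact: sqr_ge0.
  lra.
(* The value 8 is $2/(1-3/4)$, the bound of [geometric_two_sided] at ratio $3/4$. *)
exists (8 * K); first by rewrite mulr_gt0.
move=> H w dl s m J L gH w2 dl0 sG HL vL cJ N.
have w0 : 0 < w by lra.
have wm0 : 0 < w ^+ m by rewrite exprn_gt0.
have hbex : forall n, exists b : J n -> R,
    (forall j, link_cost (L n j) (dl * root_half ^+ dist2 m n) (b j)) /\
    \sum_j b j <= K * w ^+ m * (3 / 4) ^+ dist2 m n.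
  move=> n; case: (pickP (fun _ : J n => true)) => [j0 _|no]; last first.
    exists (fun _ => 0); split; first by move=> j; have := no j.
    rewrite big1//; apply: mulr_ge0; first by apply: mulr_ge0; apply: ltW.
    by apply: exprn_ge0; lra.
  have /choice[b' hb'] : forall j : J n, exists b, link_cost (L n j) (dl * root_half ^+ dist2 m n) b /\
     #|J n|%:R * b <= K * w ^+ m * (3 / 4) ^+ dist2 m n.
    move=> j; have [] := @chain_cost q Bd G w dl s m n (L n j) #|J n|%:R B1 G1 w2 dl0 sG (vL n j) _.
      by rewrite ler0n cJ.
    by move=> b b1 b2; exists b.
  exists b'; split; first by move=> j; case: (hb' j).
  have c0 : 0 < #|J n|%:R :> R by rewrite ltr0n; apply/card_gt0P; exists j0.
  apply: (@le_trans _ _ (\sum_(j : J n) (K * w ^+ m * (3 / 4) ^+ dist2 m n) / #|J n|%:R)).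
    by apply: ler_sum => j _; rewrite ler_pdivlMr// mulrC; case: (hb' j).
  by rewrite sumr_const -[leLHS]mulr_natr divfK// gt_eqF.
pose b n := sval (cid (hbex n)).
have hb n : (forall j, link_cost (L n j) (dl * root_half ^+ dist2 m n) (b n j)) /\
    \sum_j b n j <= K * w ^+ m * (3 / 4) ^+ dist2 m n := svalP (cid (hbex n)).
pose D (p : {n : 'I_N & J n}) := L (tag p) (tagged p).
pose t (p : {n : 'I_N & J n}) := dl * root_half ^+ dist2 m (tag p).
pose c (p : {n : 'I_N & J n}) := b (tag p) (tagged p).
have := @box_bound H _ D t c gH _ _ _.
have -> : (fun o => \prod_j (`|D j o| <= t j)%R%:R) = (fun o =>
   \prod_(n < N) \prod_(j : J n) ((`|L n j o| <= dl * root_half ^+ dist2 m n)%R%:R : R)).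
  by apply/funext => o; rewrite sig_big_dep /=; apply: eq_bigr.
have -> : \sum_j c j = \sum_(n < N) \sum_(j : J n) b n j.
  by rewrite sig_big_dep /=; apply: eq_bigr.
move=> h; apply: le_trans (h _ _ _); first 1 last.
- by move=> j; exact: HL.
- by move=> j; rewrite mulr_gt0// exprn_gt0// root_half_gt0.
- by move=> [n j]; case: (hb n) => + _; apply.
rewrite ler_expR lerN2.
apply: (@le_trans _ _ (\sum_(n < N) K * w ^+ m * (3 / 4) ^+ dist2 m n)).
  by apply: ler_sum => n _; case: (hb n).
rewrite -mulr_sumr.
have := @geometric_two_sided R (3 / 4) m N ltac:(lra).
have -> : 2 / (1 - 3 / 4) = 8 :> R by rewrite (_ : 1 - 3 / 4 = 4^-1) ?invrK; lra.
have -> : 8 * K * w ^+ m = K * w ^+ m * 8 by ring.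
by move=> h8; rewrite ler_wpM2l//; apply: ltW; exact: mulr_gt0.
Qed.
End chain_box.

(** * Anisotropic meshes and chaining *)

Section anisotropic.
Context {R : realType} {k : nat} (gamma : 'I_k -> R) (g0 : forall j, 0 < gamma j).
Implicit Types x y z : 'rV[R]_k.

Definition beta j : R := gamma j + 1.

Lemma beta_ge1 j : 1 <= beta j. Proof. by have := g0 j; rewrite /beta; lra. Qed.

Lemma beta_gt0 j : 0 < beta j. Proof. by have := beta_ge1 j; lra. Qed.

Lemma alpha_beta j : alpha gamma j * beta j = 1.
Proof. by rewrite /alpha mulVf// gt_eqF// beta_gt0. Qed.

Lemma alpha_gt0 j : 0 < alpha gamma j.
Proof. by rewrite invr_gt0 beta_gt0. Qed.

Lemma alpha_le1 j : alpha gamma j <= 1.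
Proof. by rewrite invf_le1 ?beta_gt0// beta_ge1. Qed.

Lemma powR_betaK (a : R) j : 0 <= a -> (a `^ beta j) `^ alpha gamma j = a.
Proof. by move=> a0; rewrite -powRrM mulrC alpha_beta powRr1. Qed.

Lemma powR_alphaK (a : R) j : 0 <= a -> (a `^ alpha gamma j) `^ beta j = a.
Proof. by move=> a0; rewrite -powRrM alpha_beta powRr1. Qed.

Lemma powR_alpha_le (d a : R) j : 0 <= d -> 0 <= a -> (d `^ alpha gamma j <= a) = (d <= a `^ beta j).
Proof.
move=> d0 a0; apply/idP/idP => h.
  rewrite -(powR_alphaK j d0); apply: ge0_ler_powR; rewrite ?nnegrE ?powR_ge0//.
  exact: ltW (beta_gt0 j).
rewrite -(powR_betaK j a0); apply: ge0_ler_powR; rewrite ?nnegrE ?powR_ge0//.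
exact: ltW (alpha_gt0 j).
Qed.

(** A fraction $t$ in $[0,1]$ satisfies $t\le t^{\alpha_j}$ because $\alpha_j\le1$; this is summed
    over the two fractions of $a+b$. It gives the triangle inequality for [Delta]. *)
Lemma powR_alphaD (a b : R) j : 0 <= a -> 0 <= b ->
  (a + b) `^ alpha gamma j <= a `^ alpha gamma j + b `^ alpha gamma j.
Proof.
move=> a0 b0; have [s0|s0] := eqVneq (a + b) 0.
  by rewrite s0 powR0 ?addr_ge0 ?powR_ge0// gt_eqF// alpha_gt0.
have sp : 0 < a + b by rewrite lt_neqAle eq_sym s0 addr_ge0.
have h (c : R) : 0 <= c -> c <= a + b -> c / (a + b) * (a + b) `^ alpha gamma j <= c `^ alpha gamma j.
  move=> c0 cs; have q0 : 0 <= c / (a + b) by rewrite divr_ge0// ltW.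
  have q1 : c / (a + b) <= 1 by rewrite ler_pdivrMr// mul1r.
  have -> : c `^ alpha gamma j = (c / (a + b)) `^ alpha gamma j * (a + b) `^ alpha gamma j.
    by rewrite -powRM ?divfK// ltW.
  rewrite ler_wpM2r ?powR_ge0//.
  have [->|qn] := eqVneq (c / (a + b)) 0; first exact: powR_ge0.
  rewrite -[leLHS]powRr1//; apply: ger_powR (alpha_le1 j).
  by rewrite lt_neqAle eq_sym qn q0.
have := h a a0 ltac:(lra); have := h b b0 ltac:(lra).
have e : a / (a + b) + b / (a + b) = 1 by rewrite -mulrDl divff.
by move=> h1 h2; rewrite -[leLHS]mul1r -e mulrDl; lra.
Qed.

Lemma Delta_ge0 x y : 0 <= Delta gamma x y.
Proof. by apply: sumr_ge0 => j _; exact: powR_ge0. Qed.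

Lemma Delta_sym x y : Delta gamma x y = Delta gamma y x.
Proof. by apply: eq_bigr => j _; rewrite distrC. Qed.

Lemma Delta_triangle y x z : Delta gamma x z <= Delta gamma x y + Delta gamma y z.
Proof.
rewrite -big_split; apply: ler_sum => j _; apply: le_trans (powR_alphaD _ _ _) => //.
apply: ge0_ler_powR; rewrite ?nnegrE//; first exact: ltW (alpha_gt0 j).
by rewrite (_ : x 0 j - z 0 j = (x 0 j - y 0 j) + (y 0 j - z 0 j)) ?ler_normD//; ring.
Qed.

Lemma Delta_coord x y j : `|x 0 j - y 0 j| <= Delta gamma x y `^ beta j.
Proof.
rewrite -powR_alpha_le ?Delta_ge0// /Delta (bigD1 j)//= lerDl.
by apply: sumr_ge0 => i _; exact: powR_ge0.
Qed.

Lemma Delta_le x y (a : R) : 0 <= a -> (forall j, `|x 0 j - y 0 j| <= a `^ beta j) ->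
  Delta gamma x y <= k%:R * a.
Proof.
move=> a0 h; apply: (@le_trans _ _ (\sum_(j < k) a)).
  by apply: ler_sum => j _; rewrite powR_alpha_le.
by rewrite sumr_const card_ord mulr_natl.
Qed.

Lemma hom_dimE : hom_dim gamma = \sum_j beta j.
Proof. by apply: eq_bigr => j _; rewrite /alpha invrK. Qed.

Lemma hom_dim_ge1 : (0 < k)%N -> 1 <= hom_dim gamma.
Proof.
move=> k0; rewrite hom_dimE (bigD1 (Ordinal k0))//=.
have := beta_ge1 (Ordinal k0); have : 0 <= \sum_(i | i != Ordinal k0) beta i.
  by apply: sumr_ge0 => i _; exact: ltW (beta_gt0 i).
lra.
Qed.

Lemma powR_prod (a : R) : 0 < a -> a `^ hom_dim gamma = \prod_j a `^ beta j.
Proof.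
move=> a0; rewrite hom_dimE; elim/big_ind2 : _ => //; first by rewrite powRr0.
by move=> x x' y y' <- <-; rewrite powRD//; apply/implyP => _; rewrite gt_eqF.
Qed.

Section truncation.
Context (l h x0 : 'rV[R]_k) (Tx0 : rectangle l h x0) (r : R) (r0 : 0 < r).

(** The factor 2 puts the whole ball of radius [r] strictly within one step of [x0], so truncation
    at level 0 gives [x0] itself and chains start there. *)
Definition step n j : R := (2 * r / 2 ^+ n) `^ beta j.

Lemma mesh_gt0 n : 0 < 2 * r / 2 ^+ n.
Proof. by rewrite divr_gt0 ?mulr_gt0// exprn_gt0. Qed.

Lemma step_gt0 n j : 0 < step n j.
Proof. exact/powR_gt0/mesh_gt0. Qed.

(* Each coordinate is truncated towards [x0], so the point stays in the
   rectangle and in the ball and [x0] is fixed. *)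
Definition trunc_pt n x : 'rV[R]_k := \row_j (x0 0 j + (-1) ^+ (x 0 j < x0 0 j)%R *
  ((Num.truncn (`|x0 0 j - x 0 j| / step n j))%:R * step n j)).

Lemma trunc_ptE n x j : exists2 c, 0 <= c <= `|x0 0 j - x 0 j| &
   trunc_pt n x 0 j = x0 0 j + (-1) ^+ (x 0 j < x0 0 j)%R * c /\ `|x0 0 j - x 0 j| - step n j <= c.
Proof.
exists ((Num.truncn (`|x0 0 j - x 0 j| / step n j))%:R * step n j); last first.
  split; first by rewrite mxE.
  have := @truncn_itv _ (`|x0 0 j - x 0 j| / step n j); rewrite divr_ge0 ?(ltW (step_gt0 _ _))//.
  move=> /(_ isT)/andP[_]; rewrite ltr_pdivrMr ?step_gt0// -natr1 mulrDl mul1r => /ltW; lra.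
rewrite mulr_ge0 ?(ltW (step_gt0 _ _))//= -ler_pdivlMr ?step_gt0//.
by rewrite truncn_le divr_ge0 ?(ltW (step_gt0 _ _)).
Qed.

Let S := rectangle l h `&` Delta_ball gamma x0 r.

Lemma trunc_pt_in n x : S x -> S (trunc_pt n x).
Proof.
move=> [Tx Bx]; split.
  move=> j; have [c /andP[c0 c1] [-> _]] := trunc_ptE n x j.
  have /andP[a1 a2] := Tx j; have /andP[b1 b2] := Tx0 j.
  move: c1; case: ltP => h1; rewrite ?expr1 ?expr0.
    by rewrite gtr0_norm; lra.
  by rewrite ler0_norm; lra.
apply: le_trans Bx; apply: ler_sum => j _; apply: ge0_ler_powR; rewrite ?nnegrE//.
  exact: ltW (alpha_gt0 j).
have [c /andP[c0 c1] [-> _]] := trunc_ptE n x j.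
by rewrite opprD addrA subrr add0r normrN normrM normrX normrN1 expr1n mul1r ger0_norm.
Qed.

Lemma trunc_pt_coord n x j : `|x 0 j - trunc_pt n x 0 j| <= step n j.
Proof.
have [c /andP[c0 c1] [-> c2]] := trunc_ptE n x j; move: c1 c2.
have := step_gt0 n j.
case: (ltP (x 0 j) (x0 0 j)) => h1; rewrite ?expr1 ?expr0.
  by rewrite gtr0_norm; [rewrite ler_norml; lra | lra].
by rewrite ler0_norm; [rewrite ler_norml; lra | lra].
Qed.

Lemma Delta_trunc n x : Delta gamma x (trunc_pt n x) <= k%:R * (2 * r / 2 ^+ n).
Proof. by apply: Delta_le => [|j]; [exact: ltW (mesh_gt0 n) | exact: trunc_pt_coord]. Qed.

Lemma coord_ball x j : S x -> `|x0 0 j - x 0 j| <= r `^ beta j.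
Proof.
move=> [_ Bx]; apply: le_trans (Delta_coord _ _ _) _.
apply: ge0_ler_powR; rewrite ?nnegrE ?Delta_ge0 ?(ltW r0)//; exact: ltW (beta_gt0 j).
Qed.

Lemma trunc_pt0 x : S x -> trunc_pt 0 x = x0.
Proof.
move=> Sx; apply/rowP => j; rewrite mxE.
suff -> : Num.truncn (`|x0 0 j - x 0 j| / step 0 j) = 0%N by rewrite mul0r mulr0 addr0.
apply/eqP; rewrite -leqn0 truncn_le_nat ltr_pdivrMr ?step_gt0// mul1r.
apply: le_lt_trans (coord_ball j Sx) _.
rewrite /step expr0 divr1 powRM ?(ltW r0)// ltr_pMl ?powR_gt0//.
rewrite (lt_le_trans (_ : 1 < 2 `^ 1))//; first by rewrite powRr1// ltr1n.
by rewrite ler_powR ?ler1n// beta_ge1.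
Qed.

Definition mesh_count n j : nat := Num.truncn ((2 `^ beta j) ^+ n : R).

Definition mesh_index n : finType := {dffun forall j : 'I_k, (bool * 'I_(mesh_count n j).+1)%type}.

Definition mesh_pt n (f : mesh_index n) : 'rV[R]_k :=
  \row_j (x0 0 j + (-1) ^+ (f j).1 * ((f j).2%:R * step n j)).

Lemma trunc_mesh n x : S x -> exists f, trunc_pt n x = mesh_pt (n := n) f.
Proof.
move=> Sx; exists [ffun j => ((x 0 j < x0 0 j), inord (Num.truncn (`|x0 0 j - x 0 j| / step n j)))].
apply/rowP => j; rewrite !mxE ffunE /= inordK// ltnS.
apply: le_truncn; rewrite ler_pdivrMr ?step_gt0//.
apply: le_trans (coord_ball j Sx) _; rewrite /step.
rewrite -powR_mulrn ?powR_ge0// powRAC -powRM ?powR_ge0 ?(ltW (mesh_gt0 _))//.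
apply: ge0_ler_powR; rewrite ?nnegrE ?mulr_ge0 ?powR_ge0 ?(ltW r0) ?(ltW (mesh_gt0 _))//.
  exact: ltW (beta_gt0 j).
have -> : 2 `^ n%:R * (2 * r / 2 ^+ n) = 2 * r.
  by rewrite powR_mulrn// mulrC divfK// gt_eqF// exprn_gt0.
by rewrite ler_peMl ?ler1n// ltW.
Qed.

(** Each coordinate contributes a sign and an index, at most
    $2(2^{\beta_jn}+1)\le4\cdot2^{\beta_jn}$ choices; the product over $j$ produces the homogeneous
    dimension. *)
Lemma card_mesh n : #|mesh_index n|%:R <= 4 ^+ k * (2 `^ hom_dim gamma) ^+ n :> R.
Proof.
rewrite card_dep_ffun foldrE big_image /= natr_prod powR_prod// -prodrXl.
have -> : 4 ^+ k = \prod_(j < k) 4 :> R by rewrite prodr_const card_ord.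
rewrite -big_split /=; apply: ler_prod => j _; rewrite ler0n/= card_prod card_bool card_ord natrM.
have h1 : 1 <= (2 `^ beta j) ^+ n :> R.
  rewrite exprn_ege1// -[leLHS](powRr0 2) ler_powR ?ler1n//; exact: ltW (beta_gt0 j).
have : (mesh_count n j)%:R <= (2 `^ beta j) ^+ n :> R by rewrite truncn_le; lra.
rewrite -natr1; lra.
Qed.

Lemma trunc_pt_cvg x : trunc_pt n x @[n --> \oo] --> x.
Proof.
apply/cvg_ballP => e e0.
have s0 j : step n j @[n --> \oo] --> (0 : R).
  apply: (@squeeze_cvgr _ _ _ _ (fun=> 0) (fun n => (2 * r) `^ beta j * (2^-1) ^+ n)).
  - near=> n; rewrite (ltW (step_gt0 _ _)) /= /step powRM ?mulr_ge0 ?(ltW r0) ?invr_ge0 ?exprn_ge0//.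
    rewrite ler_wpM2l ?powR_ge0// -exprVn.
    have i1 : 0 <= (2^-1 : R) ^+ n <= 1 by rewrite exprn_ge0 ?exprn_ile1 ?invr_ge0 ?invf_le1 ?ler1n.
    have := @powRr1 R (2^-1 ^+ n); rewrite exprn_ge0 ?invr_ge0// => /(_ isT) {2}<-.
    by apply: ger_powR; [rewrite exprn_gt0 ?invr_gt0//=; case/andP: i1 | exact: beta_ge1].
  - exact: cvg_cst.
  - rewrite -[X in _ --> X](mulr0 ((2 * r) `^ beta j)); apply: cvgMl_tmp.
    by apply: cvg_expr; rewrite ger0_norm ?invr_ge0// invf_lt1// ltr1n.
have hj j : \forall n \near \oo, step n j < e.
  by have /cvgr_lt := s0 j; apply.
have : \forall n \near \oo, forall j, step n j < e by apply: filter_forall.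
apply: filterS => n hn; split=> // i j; rewrite ord1; apply: le_lt_trans (hn j).
exact: trunc_pt_coord.
Unshelve. all: by end_near. Qed.
End truncation.
End anisotropic.

Section countable_events.
Context {d : measure_display} {O : measurableType d} {R : realType}.
Context (P : probability O R).

Lemma pr_bigcap_ge (B : nat -> set O) (a : R) : (forall n, measurable (B n)) ->
  (forall N, a <= pr P (\big[setI/setT]_(n < N) B n)) -> a <= pr P (\bigcap_n B n).
Proof.
move=> mB h; have mF N : measurable (\big[setI/setT]_(n < N) B n).
  by apply: bigsetI_measurable => // n _; exact: mB.
have mC : measurable (\bigcap_n B n) by exact: bigcapT_measurable.
have cv : Ex P (\1_(\big[setI/setT]_(n < N) B n)) @[N --> \oo] --> Ex P (\1_(\bigcap_n B n)).
  apply: (@Ex_cvg _ _ _ P _ _ 1).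
  - by move=> N; exact: measurable_indic.
  - exact: measurable_indic.
  - by move=> N w; rewrite indicE; case: (_ \in _); rewrite ?normr1 ?normr0.
  - apply: aeW => w; apply: cvg_near_cst.
    have [wC|wC] := pselect ((\bigcap_n B n) w).
      exists 0%N => // N _ /=; rewrite !indicE !mem_set//.
      by rewrite -bigcap_mkord => n _; exact: wC.
    have [n nB] : exists n, ~ B n w by apply/existsNP => hB; apply: wC => n _; exact: hB.
    exists n.+1 => // N /= nN; rewrite !indicE !memNset// -bigcap_mkord => hB.
    by apply: nB; apply: hB => /=.
rewrite -pr_indic// -(cvg_lim _ cv)//; apply: limr_ge; first by apply/cvg_ex; eexists; exact: cv.
by apply: nearW => N; rewrite pr_indic.
Qed.

Lemma pr_bigcup_le (B : nat -> set O) (a : R) : (forall n, measurable (B n)) -> 0 <= a ->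
  (forall n, pr P (B n) <= a / 2 ^+ n.+1) -> pr P (\bigcup_n B n) <= a.
Proof.
move=> mB a0 h; have mU : measurable (\bigcup_n B n) by exact: bigcup_measurable.
rewrite -lee_fin prE//.
have s1 : (P (\bigcup_n B n) <= \sum_(n <oo) P (B n))%E.
  by apply: measure_sigma_subadditive => //; exact: bigcup_measurable.
apply: le_trans s1 _.
have s2 := @epsilon_trick0 R a xpredT a0.
apply: le_trans s2; apply: lee_nneseries => // n _.
by rewrite -prE// lee_fin natrX; exact: h.
Qed.

Lemma measurable_fin_ex (J : finType) (B : J -> set O) : (forall j, measurable (B j)) ->
  measurable [set w | exists j, B j w].
Proof.
move=> mB; have -> : [set w | exists j, B j w] = \bigcup_(j in [set: J]) B j.
  by apply/seteqP; split => w; [move=> [j Bj]; exists j | move=> [j _ Bj]; exists j].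
by apply: fin_bigcup_measurable => // j _; exact: mB.
Qed.

Lemma measurable_fin_all (J : finType) (B : J -> set O) : (forall j, measurable (B j)) ->
  measurable [set w | forall j, B j w].
Proof.
move=> mB; have -> : [set w | forall j, B j w] = ~` [set w | exists j, ~ B j w].
  apply/seteqP; split => w /=; first by move=> h [j]; apply.
  by move=> h j; apply: contrapT => nB; apply: h; exists j.
by apply: measurableC; apply: measurable_fin_ex => j; exact: measurableC.
Qed.

Lemma pr_fin_ex_le (J : finType) (B : J -> set O) (a : R) : (forall j, measurable (B j)) ->
  (forall j, pr P (B j) <= a) -> pr P [set w | exists j, B j w] <= #|J|%:R * a.
Proof.
move=> mB h; rewrite -pr_indic; last exact: measurable_fin_ex.
apply: (@le_trans _ _ (Ex P (fun w => \sum_j \1_(B j) w))).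
  apply: Ex_le.
  - by apply: bm_L1; apply: bm_indic; exact: measurable_fin_ex.
  - by apply: L1_sum => j; apply: bm_L1; exact: bm_indic.
  - move=> w; rewrite [leLHS]indicE.
    have [/set_mem[j Bj]|] := boolP (_ \in _); last by move=> _; exact: sumr_ge0.
    by rewrite (bigD1 j)//= indicE mem_set//= lerDl; exact: sumr_ge0.
rewrite Ex_sum; last by move=> j; apply: bm_L1; exact: bm_indic.
apply: (@le_trans _ _ (\sum_(j : J) a)); last by rewrite sumr_const mulr_natl.
by apply: ler_sum => j _; rewrite pr_indic.
Qed.

Lemma measurable_norm_gt (X : O -> R) (t : R) : measurable_fun setT X -> measurable [set w | t < `|X w|].
Proof.
move=> mX; have -> : [set w | t < `|X w|] = (fun w => `|X w|) @^-1` `]t, +oo[.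
  by apply/seteqP; split => w; rewrite /= in_itv /= andbT.
by apply: measurable_preim; [exact: measurableT_comp | exact: measurable_itv].
Qed.

Lemma measurable_norm_le (X : O -> R) (t : R) : measurable_fun setT X -> measurable [set w | `|X w| <= t].
Proof.
move=> mX; have -> : [set w | `|X w| <= t] = ~` [set w | t < `|X w|].
  by apply/seteqP; split => w /=; rewrite leNgt => /negP.
by apply: measurableC; exact: measurable_norm_gt.
Qed.

Lemma gauss_tail (X : O -> R) (s t : R) M : gauss P X -> 0 < s -> 0 < t ->
  Ex P (fun w => X w ^+ 2) <= s ^+ 2 ->
  pr P [set w | t < `|X w|] <= (4 * (s / t) ^+ 2) ^+ M * M`!%:R * 2.
Proof.
move=> gX s0 t0 h; have [l1 m1] := gauss_moment gX M s0 h.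
have mX : measurable_fun setT X by case: gX.
have t2 : 0 < (t ^+ 2) ^+ M by rewrite !exprn_gt0.
rewrite -(ler_pM2l t2) -pr_indic; last exact: measurable_norm_gt.
rewrite -ExZ; last by apply: bm_L1; apply: bm_indic; exact: measurable_norm_gt.
apply: (@le_trans _ _ (Ex P (fun w => (X w ^+ 2) ^+ M))).
  apply: Ex_le => //.
    by apply: L1Z; apply: bm_L1; apply: bm_indic; exact: measurable_norm_gt.
  move=> w; rewrite indicE; have [/set_mem/= tX|_] := boolP (_ \in _); last first.
    by rewrite mulr0 exprn_ge0 ?sqr_ge0.
  rewrite mulr1 lerXn2r ?nnegrE ?sqr_ge0//.
  by rewrite -[X in _ <= X]real_normK ?num_real// ler_sqr ?nnegrE ?ltW// (lt_trans t0).
apply: le_trans m1 _; rewrite [leRHS]mulrA [X in _ <= X * _]mulrA -exprMn.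
have -> : t ^+ 2 * (4 * (s / t) ^+ 2) = 4 * s ^+ 2 by field; rewrite gt_eqF.
exact: lexx.
Qed.
End countable_events.

Section chaining.
Context {d : measure_display} {O : measurableType d} {R : realType}.
Context (P : probability O R) (H : set (O -> R)) (gH : gspace P H).
Context {k : nat} (gamma : 'I_k -> R) (g0 : forall j, 0 < gamma j) (k0 : (0 < k)%N).
Context (l h x0 : 'rV[R]_k) (Tx0 : rectangle l h x0) (r : R) (r0 : 0 < r).

Definition local_ball : set 'rV[R]_k := rectangle l h `&` Delta_ball gamma x0 r.
Local Notation S := local_ball.
Local Notation tp := (trunc_pt gamma x0 r).
Local Notation mp := (@mesh_pt _ _ gamma x0 r _).

Context (Y : 'rV[R]_k -> O -> R) (mY : forall x, measurable_fun setT (Y x)).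
Context (HY : forall x y, S x -> S y -> H (fun w => Y x w - Y y w)).

(** Indexing by all mesh points keeps the index a finite type; a mesh point outside the ball gets
    the zero link, which satisfies every variance bound. *)
Definition link n (f : mesh_index gamma n.+1) w : R :=
  if `[< S (mp f) >] then Y (mp f) w - Y (tp n (mp f)) w else 0.

Lemma link_in n f : H (@link n f).
Proof.
rewrite /link; case: asboolP => [Sf|_]; last by case: gH.
exact: (HY Sf (trunc_pt_in g0 Tx0 r0 n Sf)).
Qed.

Lemma measurable_link n f : measurable_fun setT (@link n f).
Proof. by case: gH => _ g _; case: (g _ (link_in f)). Qed.

Lemma link_sqr_le n f (a : R) : 0 <= a ->
  (S (mp f) -> ip P (fun w => Y (mp f) w - Y (tp n (mp f)) w)
     (fun w => Y (mp f) w - Y (tp n (mp f)) w) <= a) ->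
  Ex P (fun w => @link n f w ^+ 2) <= a.
Proof.
move=> a0; rewrite /link; case: asboolP => [Sf /(_ Sf)|_ _]; first by rewrite ip_sqr.
have -> : (fun w : O => 0 ^+ 2) = cst (0 : R) by apply/funext => w; rewrite expr0n.
by rewrite Ex_cst.
Qed.

(** The next point of the chain is the truncation of the already truncated point, which is why the
    induction quantifies over all points of the ball. *)
Lemma chain_le w (t : nat -> R) : (forall n f, `|@link n f w| <= t n) ->
  forall N x, S x -> `|Y (tp N x) w - Y x0 w| <= \sum_(n < N) t n.
Proof.
move=> ht; elim=> [|N IH] x Sx; first by rewrite (trunc_pt0 g0 r0 Sx) subrr normr0 big_ord0.
have Sq := trunc_pt_in g0 Tx0 r0 N.+1 Sx.
have [f ef] := trunc_mesh g0 r0 N.+1 Sx.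
rewrite big_ord_recr /= addrC.
have -> : Y (tp N.+1 x) w - Y x0 w =
  (Y (tp N.+1 x) w - Y (tp N (tp N.+1 x)) w) + (Y (tp N (tp N.+1 x)) w - Y x0 w) by ring.
apply: le_trans (ler_normD _ _) _; apply: lerD; last exact: IH.
by have := ht N f; rewrite /link -ef; case: asboolP.
Qed.

Definition excess (t : nat -> R) : set O := [set w | exists n f, t n < `|@link n f w|].

Lemma measurable_excess t : measurable (excess t).
Proof.
have -> : excess t = \bigcup_n [set w | exists f, t n < `|@link n f w|].
  by apply/seteqP; split => w; [move=> [n hn]; exists n | move=> [n _ hn]; exists n].
apply: bigcup_measurable => n _; apply: (@measurable_fin_ex _ _ _ (fun f => [set w | t n < `|@link n f w|])) => f.
by apply: measurable_norm_gt; exact: measurable_link.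
Qed.

(** Deviations decay like $z^n$ and thresholds like $z^{n/2}$, with $z$ = [root_half], so the moment
    of order $2(q+1)$ gains $2^{-(q+1)n}$ against a mesh of size of order $2^{q(n+1)}$; the
    remaining $2^{-n}$ is summable. *)
Lemma sup_tail (q : nat) (s t : R) : 2 `^ hom_dim gamma <= 2 ^+ q -> 0 < s -> 0 < t ->
  (forall n f, Ex P (fun w => @link n f w ^+ 2) <= (s * root_half ^+ n) ^+ 2) ->
  pr P (excess (fun n => t * (Num.sqrt root_half) ^+ n)) <=
    4 ^+ k * 2 ^+ q * ((4 * (s / t) ^+ 2) ^+ (2 * q.+1) * (2 * q.+1)`!%:R * 2) * 2.
Proof.
move=> wq s0 t0 hs; set M := (2 * q.+1)%N; set C := _ * 2 ^+ q * _.
have z0 := @root_half_gt0 R; have z2 := @root_half_sqr R.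
have y0 : 0 < Num.sqrt root_half :> R by rewrite sqrtr_gt0.
have y2 : Num.sqrt root_half ^+ 2 = root_half :> R by rewrite sqr_sqrtr// ltW.
have C0 : 0 <= C.
  apply: mulr_ge0; first by rewrite mulr_ge0 ?exprn_ge0.
  by apply: mulr_ge0 => //; apply: mulr_ge0 => //; apply: exprn_ge0; apply: mulr_ge0 => //; exact: sqr_ge0.
have -> : excess (fun n => t * (Num.sqrt root_half) ^+ n) =
    \bigcup_n [set w | exists f, t * (Num.sqrt root_half) ^+ n < `|@link n f w|].
  by apply/seteqP; split => w; [move=> [n hn]; exists n | move=> [n _ hn]; exists n].
apply: pr_bigcup_le; [|by rewrite mulr_ge0|].
  move=> n; apply: (@measurable_fin_ex _ _ _ (fun f => [set w | t * (Num.sqrt root_half) ^+ n < `|@link n f w|])) => f.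
  by apply: measurable_norm_gt; exact: measurable_link.
move=> n.
have tn0 : 0 < t * Num.sqrt root_half ^+ n :> R by rewrite mulr_gt0 ?exprn_gt0.
have sn0 : 0 < s * root_half ^+ n :> R by rewrite mulr_gt0 ?exprn_gt0.
apply: le_trans (pr_fin_ex_le (a := (4 * (s / t) ^+ 2) ^+ M * M`!%:R * 2 * (2^-1 ^+ q.+1) ^+ n) _ _) _.
- by move=> f; apply: measurable_norm_gt; exact: measurable_link.
- move=> f; have gf : gauss P (@link n f) by case: gH => _ g _; exact: g (link_in f).
  apply: le_trans (gauss_tail M gf sn0 tn0 (hs n f)) _.
  have -> : 4 * (s * root_half ^+ n / (t * Num.sqrt root_half ^+ n)) ^+ 2 =
      4 * (s / t) ^+ 2 * root_half ^+ n :> R.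
    have bn : 0 < Num.sqrt root_half ^+ n :> R by rewrite exprn_gt0.
    have <- : (Num.sqrt root_half ^+ n) ^+ 2 = root_half ^+ n :> R by rewrite -exprM mulnC exprM y2.
    move: bn; set b := _ ^+ n => bn; field; rewrite !gt_eqF//.
  rewrite [X in X * _ * _]exprMn.
  have -> : (root_half ^+ n) ^+ M = (2^-1 ^+ q.+1) ^+ n :> R.
    by rewrite -exprM mulnC /M -mulnA exprM z2 exprM.
  by rewrite le_eqVlt; apply/orP; left; apply/eqP; ring.
set c := _ * M`!%:R * 2.
have c0 : 0 <= c.
  by apply: mulr_ge0 => //; apply: mulr_ge0 => //; apply: exprn_ge0; apply: mulr_ge0 => //; exact: sqr_ge0.
have i0 : 0 <= (2^-1 ^+ q.+1) ^+ n :> R by rewrite !exprn_ge0 ?invr_ge0.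
have w0 : 0 <= 2 `^ hom_dim gamma by exact: powR_ge0.
apply: le_trans (ler_wpM2r (mulr_ge0 c0 i0) (card_mesh g0 n.+1)) _.
rewrite /C -/c; clearbody c; rewrite -!mulrA ler_pM2l ?exprn_gt0//.
have -> : 2 ^+ q * (c * (2 / 2 ^+ n.+1)) = c * (2 ^+ q * 2^-1 ^+ n).
  have -> : 2 / 2 ^+ n.+1 = 2^-1 ^+ n :> R.
    by rewrite exprVn exprS; field; rewrite gt_eqF// exprn_gt0.
  ring.
rewrite mulrCA ler_wpM2l//.
apply: (@le_trans _ _ ((2 ^+ q) ^+ n.+1 * (2^-1 ^+ q.+1) ^+ n)).
  by rewrite ler_wpM2r// lerXn2r ?nnegrE ?exprn_ge0.
rewrite exprS -mulrA ler_pM2l ?exprn_gt0// -exprMn exprS mulrCA -exprMn divff ?expr1n ?mulr1//.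
Qed.
End chaining.

Lemma prod_itv01 {R : realDomainType} (J : finType) (F : J -> R) : (forall j, 0 <= F j <= 1) ->
  0 <= \prod_j F j <= 1.
Proof.
move=> F01; elim/big_rec : _ => [|j x _ /andP[x0 x1]]; first by rewrite ler01 lexx.
have /andP[f0 f1] := F01 j.
by rewrite mulr_ge0//= mulr_ile1.
Qed.

Section continuous_field.
Context {d : measure_display} {O : measurableType d} {R : realType}.
Context (P : probability O R).
Context {k : nat} (gamma : 'I_k -> R) (g0 : forall j, 0 < gamma j).
Context (l h : 'rV[R]_k).
Local Notation ball_at := (local_ball gamma l h).

Lemma osc_le_trunc x0 r (f : 'rV[R]_k -> R) (u : R) : rectangle l h x0 -> 0 < r -> continuous f ->
  (forall n y, ball_at x0 r y -> `|f (trunc_pt gamma x0 r n y) - f x0| <= u) ->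
  (osc (ball_at x0 r) f x0 <= u%:E)%E.
Proof.
move=> Tx0 r0 cf hm; apply: ge_ereal_sup => _ [y Sy <-]; rewrite lee_fin.
have cv : `|f (trunc_pt gamma x0 r n y) - f x0| @[n --> \oo] --> `|f y - f x0|.
  apply: cvg_norm; apply: cvgB; last exact: cvg_cst.
  apply: continuous_cvg; [exact: cf | exact: (trunc_pt_cvg g0 x0 r0)].
rewrite -(cvg_lim _ cv)//; apply: limr_le; first by apply/cvg_ex; eexists; exact: cv.
by apply: nearW => n; exact: hm.
Qed.

(** Continuity reduces the supremum to the countable union of the meshes, whence the measurability
    of oscillation events. *)
Lemma osc_le_mesh x0 r (f : 'rV[R]_k -> R) (u : R) : rectangle l h x0 -> 0 < r -> continuous f ->
  (osc (ball_at x0 r) f x0 <= u%:E)%E <->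
  (forall n (g : mesh_index gamma n), ball_at x0 r (mesh_pt x0 r g) ->
     `|f (mesh_pt x0 r g) - f x0| <= u).
Proof.
move=> Tx0 r0 cf; split.
  move=> hu n g Sg; rewrite -lee_fin; apply: le_trans hu.
  by apply: ereal_sup_ubound; exists (mesh_pt x0 r g).
move=> hm; apply: osc_le_trunc => // n y Sy; have [g eg] := trunc_mesh g0 r0 n Sy.
by rewrite eg; apply: hm; rewrite -eg; exact: (trunc_pt_in g0 Tx0 r0 n Sy).
Qed.

Context (Y : 'rV[R]_k -> O -> R) (mY : forall x, measurable_fun setT (Y x)).
Context (cY : forall w, continuous (fun x => Y x w)).

Definition osc_event x0 r (u : R) : set O := [set w | (osc (ball_at x0 r) (fun x => Y x w) x0 <= u%:E)%E].

Lemma osc_eventE x0 r u : rectangle l h x0 -> 0 < r -> osc_event x0 r u =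
  \bigcap_n [set w | forall g : mesh_index gamma n,
    (~ ball_at x0 r (mesh_pt x0 r g)) \/ `|Y (mesh_pt x0 r g) w - Y x0 w| <= u].
Proof.
move=> Tx0 r0; apply/seteqP; split => w /=.
  move=> /(osc_le_mesh _ Tx0 r0 (@cY w)) hw n _ g.
  by have [Sg|] := pselect (ball_at x0 r (mesh_pt x0 r g)); [right; exact: hw | left].
move=> hw; apply/(osc_le_mesh _ Tx0 r0 (@cY w)) => n g Sg.
by case: (hw n I g).
Qed.

Lemma measurable_osc_event x0 r u : rectangle l h x0 -> 0 < r -> measurable (osc_event x0 r u).
Proof.
move=> Tx0 r0; rewrite osc_eventE//; apply: bigcapT_measurable => n.
apply: (@measurable_fin_all _ _ (mesh_index gamma n) (fun g => [set w |
   (~ ball_at x0 r (mesh_pt x0 r g)) \/ `|Y (mesh_pt x0 r g) w - Y x0 w| <= u])) => g.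
have [Sg|Sg] := pselect (ball_at x0 r (mesh_pt x0 r g)).
  rewrite (_ : [set w | _] = [set w | `|Y (mesh_pt x0 r g) w - Y x0 w| <= u]).
    by apply: measurable_norm_le; exact: measurable_funB.
  by apply/seteqP; split => w /=; [case | right].
rewrite (_ : [set w | _] = setT)//.
by apply/seteqP; split => w //= _; left.
Qed.

Lemma dyadic_bracket (x : R) : 1 <= x -> exists m : nat, 2 ^+ m <= x /\ x <= 2 ^+ m.+1.
Proof.
move=> x1; have x0 : 0 <= x by lra.
have /andP[t1 t2] := truncn_itv x0.
have n0 : (0 < Num.truncn x)%N by rewrite -ltnS -(ltr_nat R); exact: le_lt_trans x1 t2.
have /andP[b1 b2] := trunc_log_bounds (isT : (1 < 2)%N) n0.
exists (trunc_log 2 (Num.truncn x)); split; rewrite -natrX.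
  by apply: le_trans t1; rewrite ler_nat.
by apply: le_trans (ltW t2) _; rewrite ler_nat.
Qed.

(** The balance level [m] satisfies $2^m\le r/u\le2^{m+1}$, so links at that level deviate by a
    multiple of $u$, and the cost $2^{Qm}$ from [chain_box] is at most $(r/u)^Q$. The constant is
    uniform in the center, the radius and $u$. *)
Lemma small_ball_lower (q : nat) (c : R) : (0 < k)%N -> 2 `^ hom_dim gamma <= 2 ^+ q -> 0 < c ->
  exists2 A, 0 < A & forall H x0 r u, gspace P H -> rectangle l h x0 -> 0 < u -> u < r ->
  (forall x y, ball_at x0 r x -> ball_at x0 r y -> H (fun w => Y x w - Y y w)) ->
  (forall x y, rectangle l h x -> rectangle l h y -> Delta gamma x y <= k%:R * (2 * r) ->
    ip P (fun w => Y x w - Y y w) (fun w => Y x w - Y y w) <= (c * Delta gamma x y) ^+ 2) ->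
  expR (- (A * (r / u) `^ hom_dim gamma)) <= pr P (osc_event x0 r u).
Proof.
move=> k0 wq c0.
have /andP[z12 z1] := @root_half_bounds R; have z0 := @root_half_gt0 R.
(* The thresholds add up to at most [dl * u] times $2/(1-z)$ with $z$ = [root_half], which is
   exactly $u$. *)
pose dl : R := (1 - root_half) / 2.
have dl0 : 0 < dl by rewrite /dl; lra.
have kk0 : 0 < k%:R :> R by rewrite ltr0n.
pose G := Num.max 1 (4 * c * k%:R / dl).
have G1 : 1 <= G by rewrite le_max lexx.
pose Bd : R := 4 ^+ k * 2 ^+ q.
have B1 : 1 <= Bd by rewrite mulr_ege1// exprn_ege1// ler1n.
have [A A0 hA] := @chain_box _ _ _ P q Bd G B1 G1.
exists A => // H x0 r u gH Tx0 u0 ur HY vY.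
have r0 : 0 < r by exact: lt_trans ur.
have ru : 1 <= r / u by rewrite ler_pdivlMr// mul1r ltW.
have [m [m1 m2]] := dyadic_bracket ru.
have w2 : 2 <= 2 `^ hom_dim gamma <= 2 ^+ q.
  by rewrite wq andbT -[leLHS]powRr1// ler_powR ?ler1n// hom_dim_ge1.
pose L n := @link _ _ R k gamma l h x0 r Y n.
have dlu : 0 < dl * u by rewrite mulr_gt0.
have HYS x y : ball_at x0 r x -> ball_at x0 r y -> H (fun w => Y x w - Y y w) by exact: HY.
have mL n g : measurable_fun setT (L n g) := measurable_link gH g0 Tx0 r0 HYS g.
have key : forall N, expR (- (A * (2 `^ hom_dim gamma) ^+ m)) <=
    Ex P (fun o => \prod_(n < N) \prod_(j : mesh_index gamma n.+1)
      (`|L n j o| <= dl * u * root_half ^+ dist2 m n)%R%:R).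
  apply: (hA H _ _ (2 * c * k%:R * r) m (fun n => mesh_index gamma n.+1) L gH w2 dlu).
  - apply/andP; split; first by rewrite !mulr_ge0// ?(ltW c0) ?(ltW r0).
    apply: (@le_trans _ _ (4 * c * k%:R / dl * (dl * u) * 2 ^+ m)).
      have -> : 4 * c * k%:R / dl * (dl * u) * 2 ^+ m = 2 * c * k%:R * (u * 2 ^+ m.+1).
        by rewrite exprS; field; rewrite gt_eqF.
      by rewrite ler_pM2l ?mulr_gt0// mulrC -ler_pdivrMr.
    by rewrite ler_wpM2r ?exprn_ge0// ler_wpM2r ?(ltW dlu)// le_max lexx orbT.
  - by move=> n j; exact: (link_in gH g0 Tx0 r0 HYS j).
  - move=> n j; apply: link_sqr_le; first exact: sqr_ge0.
    move=> Sj; have Dl := Delta_trunc g0 x0 r0 n (mesh_pt x0 r j).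
    have St := (trunc_pt_in g0 Tx0 r0 n Sj).
    apply: le_trans (vY _ _ _ _ _) _; [by case: Sj | by case: St | |].
      apply: le_trans Dl _; rewrite ler_pM2l// ler_pdivrMr ?exprn_gt0//.
      by rewrite ler_peMr ?exprn_ege1 ?ler1n// mulr_ge0// ltW.
    rewrite ler_sqr ?nnegrE; last 2 first.
    + by rewrite mulr_ge0 ?Delta_ge0// ltW.
    + by rewrite divr_ge0 ?exprn_ge0// !mulr_ge0// ?(ltW c0) ?(ltW r0).
    have -> : 2 * c * k%:R * r / 2 ^+ n = c * (k%:R * (2 * r / 2 ^+ n)) by ring.
    by rewrite ler_pM2l.
  - move=> n; apply: le_trans (card_mesh g0 n.+1) _.
    rewrite exprS mulrA /Bd ler_wpM2r ?exprn_ge0 ?powR_ge0// ler_pM2l ?exprn_gt0//.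
have wm : (2 `^ hom_dim gamma) ^+ m <= (r / u) `^ hom_dim gamma.
  rewrite -powR_mulrn ?powR_ge0// powRAC powR_mulrn//.
  have Q1 := hom_dim_ge1 g0 k0.
  by apply: ge0_ler_powR; rewrite ?nnegrE ?exprn_ge0 ?divr_ge0 ?(ltW r0) ?(ltW u0)//; lra.
apply: (@le_trans _ _ (expR (- (A * (2 `^ hom_dim gamma) ^+ m)))).
  by rewrite ler_expR lerN2 ler_pM2l.
pose B n := [set w | forall g : mesh_index gamma n.+1, `|L n g w| <= dl * u * root_half ^+ dist2 m n].
have mB n : measurable (B n).
  apply: (@measurable_fin_all _ _ (mesh_index gamma n.+1)
    (fun g => [set w | `|L n g w| <= dl * u * root_half ^+ dist2 m n])) => g.
  exact: measurable_norm_le.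
apply: (@le_trans _ _ (pr P (\bigcap_n B n))).
  apply: pr_bigcap_ge => // N; apply: le_trans (key N) _.
  rewrite -pr_indic; last by apply: bigsetI_measurable => // n _; exact: mB.
  apply: Ex_le.
  - apply: bm_L1; apply: bm_bigprod => n; apply: bm_bigprod => j; apply: bm_bool.
    exact: measurable_norm_le.
  - by apply: bm_L1; apply: bm_indic; apply: bigsetI_measurable => // n _; exact: mB.
  - move=> w; rewrite indicE.
    have [wB|wB] := pselect ((\big[setI/setT]_(n < N) B n) w).
      rewrite mem_set//=.
      have [] := andP (@prod_itv01 R _ (fun n : 'I_N => \prod_(j : mesh_index gamma n.+1)
        (`|L n j w| <= dl * u * root_half ^+ dist2 m n)%R%:R) _) => // n.
      by apply: prod_itv01 => j; case: (`|L n j w| <= dl * u * root_half ^+ dist2 m n); rewrite ?lexx ?ler01.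
    rewrite memNset//.
    have [n nB] : exists n : 'I_N, ~ B n w.
      by apply/existsNP => hB; apply: wB; rewrite -bigcap_mkord => n /= nN; exact: (hB (Ordinal nN)).
    have [j nj] : exists j, ~ (`|L n j w| <= dl * u * root_half ^+ dist2 m n).
      by apply/existsNP => hB; apply: nB => j; exact: hB.
    by rewrite (bigD1 n)//= (bigD1 j)//= (negbTE (introN idP nj)) !mul0r.
apply: pr_le; [exact: bigcapT_measurable | exact: measurable_osc_event |].
move=> w wB; apply: osc_le_trunc => // n y Sy.
have := @chain_le _ O R k gamma g0 l h x0 Tx0 r r0 Y w (fun n => dl * u * root_half ^+ dist2 m n)
  (fun n f => wB n I f) n y Sy.
move=> /le_trans; apply; rewrite -mulr_sumr.
apply: le_trans (ler_wpM2l (ltW dlu) (geometric_two_sided m n _)) _; first by rewrite z0.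
rewrite le_eqVlt; apply/orP; left; apply/eqP.
by rewrite /dl; field; rewrite gt_eqF// subr_gt0.
Qed.
End continuous_field.

(** * Variances of the increments of the noise *)

Section weights.
Context {R : realType} {k : nat} (gamma : 'I_k -> R) (g0 : forall j, 0 < gamma j).

(** The initial value 1 caps the exponent, which [band_scale] relies on when comparing decay
    rates. *)
Definition gamma_min : R := \big[Num.min/1]_j gamma j.

Lemma gamma_min_gt0 : 0 < gamma_min.
Proof. by rewrite /gamma_min; elim/big_rec : _ => // j x _ x0; rewrite lt_min g0 x0. Qed.

Lemma gamma_min_le j : gamma_min <= gamma j.
Proof. by rewrite /gamma_min (bigD1 j)//= ge_min lexx. Qed.

(** Since $\beta_j=\gamma_j+1$, each term is at most $(a\rho)^{\gamma_j}\rho$, and $a\rho\le1$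
    allows the exponent to be lowered to [gamma_min]. Noise below the frequency $1/\rho$ is thus
    smaller than $\rho$ by a power of $a\rho$. *)
Lemma weighted_le (a rho : R) (x y : 'rV[R]_k) : 0 <= a -> 0 <= rho -> a * rho <= 1 ->
  (forall j, `|x 0 j - y 0 j| <= rho `^ beta gamma j) ->
  \sum_j a `^ gamma j * `|x 0 j - y 0 j| <= k%:R * ((a * rho) `^ gamma_min * rho).
Proof.
move=> a0 rho0 ar1 h.
apply: (@le_trans _ _ (\sum_(j < k) (a * rho) `^ gamma_min * rho)); last first.
  by rewrite sumr_const card_ord mulr_natl.
apply: ler_sum => j _; apply: le_trans (ler_wpM2l (powR_ge0 _ _) (h j)) _.
have bE : rho `^ beta gamma j = rho `^ gamma j * rho.
  by rewrite /beta powRD ?powRr1//; apply/implyP; rewrite gt_eqF// ltr_wpDr.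
rewrite bE mulrA -powRM// ler_wpM2r//.
have [->|ar0] := eqVneq (a * rho) 0; first by rewrite !powR0// gt_eqF// gamma_min_gt0.
apply: ger_powR; last exact: gamma_min_le.
by rewrite lt_neqAle eq_sym ar0 mulr_ge0.
Qed.

Lemma weighted_le_Delta (a : R) (x y : 'rV[R]_k) : 0 <= a -> a * Delta gamma x y <= 1 ->
  \sum_j a `^ gamma j * `|x 0 j - y 0 j| <= k%:R * Delta gamma x y.
Proof.
move=> a0 ad.
apply: le_trans (weighted_le a0 (Delta_ge0 gamma x y) ad (fun j => Delta_coord g0 x y j)) _.
rewrite ler_wpM2l// ler_piMl ?Delta_ge0//.
have -> : 1 = 1 `^ gamma_min :> R by rewrite powR1.
apply: ge0_ler_powR; rewrite ?nnegrE ?mulr_ge0 ?Delta_ge0//; exact: ltW gamma_min_gt0.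
Qed.
End weights.

Section variances.
Context {d : measure_display} {Omega : measurableType d} {R : realType}.
Context (P : probability Omega R) {k : nat} (gamma : 'I_k -> R) (g0 : forall j, 0 < gamma j).
Context (T : set 'rV[R]_k) (v : 'rV[R]_k -> {RV P >-> R}) (W : set R -> 'rV[R]_k -> {RV P >-> R}).
Context (W1 : centered_gaussian_field (@borel_half_line R `*` T) (fun p => W p.1 p.2)).
Context (W2 : forall x, T x -> independently_scattered (fun A => W A x) /\
   {ae P, forall w, W half_line x w = v x w}).
Context (W3 : forall A B, borel_half_line A -> borel_half_line B ->
   A `&` B = set0 -> independent_processes T (W A) (W B)).
Context (c0 a0 : R) (c00 : 0 < c0) (a00 : 0 <= a0).
Context (hb : forall (a : R) (b : \bar R) x y,
  a0 <= a -> (a%:E < b)%E -> T x -> T y ->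
  (L2norm P (fun w => (W (right_open a b) x w - v x w
                     - W (right_open a b) y w + v y w)%R)
   <= (c0 * (\sum_j a `^ gamma j * `|x 0 j - y 0 j| + inv_ext b))%:E)%E).

Definition var_on (A : set R) x y : R := ip P (incr W A x y) (incr W A x y).

Lemma var_mono A B x y : borel_half_line A -> borel_half_line B -> A `<=` B -> T x -> T y ->
  var_on A x y <= var_on B x y.
Proof. exact: (incr_mono W1 W2 W3). Qed.

Lemma var_split A x y : borel_half_line A -> T x -> T y ->
  var_on half_line x y = var_on A x y + var_on (half_line `\` A) x y.
Proof.
move=> bA Tx Ty; have bD : borel_half_line (half_line `\` A) by apply: borelD => //; exact: borel_half.
rewrite /var_on -(incrU W1 W2 W3)//; first by rewrite setDUK//; case: bA.
by apply/seteqP; split=> // t [At []].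
Qed.

Lemma incr_half x y : T x -> T y -> {ae P, forall w, incr W half_line x y w = v x w - v y w}.
Proof.
move=> Tx Ty; have [_ h1] := W2 Tx; have [_ h2] := W2 Ty.
by apply: filterS2 h1 h2 => w; rewrite /incr => -> ->.
Qed.

Lemma incr_field x y : T x -> T y ->
  ip P (fun w => v x w - v y w) (fun w => v x w - v y w) = var_on half_line x y.
Proof.
move=> Tx Ty; rewrite /var_on !ip_sqr; apply: Ex_eq_ae.
- by apply: measurable_sqr; apply: measurable_funB.
- by apply: measurable_sqr; apply: measurable_funB.
- by apply: filterS (incr_half Tx Ty) => w ->.
Qed.

Lemma incr_split A x y : borel_half_line A -> T x -> T y ->
  {ae P, forall w, incr W (half_line `\` A) x y w = v x w - v y w - incr W A x y w}.
Proof.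
move=> bA Tx Ty; have [_ h1] := W2 Tx; have [_ h2] := W2 Ty.
have bD : borel_half_line (half_line `\` A) by apply: borelD => //; exact: borel_half.
have dis : A `&` (half_line `\` A) = set0 by apply/seteqP; split=> // t [At []].
have u1 := noiseU W2 bA bD dis Tx.
have u2 := noiseU W2 bA bD dis Ty.
have e : A `|` half_line `\` A = half_line by rewrite setDUK//; case: bA.
rewrite e in u1 u2.
near=> w; rewrite /incr.
have <- : W half_line x w = v x w by near: w.
have <- : W half_line y w = v y w by near: w.
have -> : W half_line x w = W A x w + W (half_line `\` A) x w by near: w.
have -> : W half_line y w = W A y w + W (half_line `\` A) y w by near: w.
ring.
Unshelve. all: by end_near. Qed.

(** By additivity the quantity bounded in Assumption A is, up to sign, the increment of the noise
    over the complement of $[a,b)$. *)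
Lemma var_compl (a : R) (b : \bar R) x y : a0 <= a -> (a%:E < b)%E -> 0 <= inv_ext b -> T x -> T y ->
  var_on (half_line `\` right_open a b) x y <=
    (c0 * (\sum_j a `^ gamma j * `|x 0 j - y 0 j| + inv_ext b)) ^+ 2.
Proof.
move=> aa ab b0 Tx Ty.
have bA : borel_half_line (right_open a b) by apply: borel_right_open; exact: le_trans aa.
have bD : borel_half_line (half_line `\` right_open a b) by apply: borelD => //; exact: borel_half.
pose Z w := W (right_open a b) x w - v x w - W (right_open a b) y w + v y w.
have HZ : noise_space T W Z.
  have gn := gspace_noise W1.
  exact: (gspaceD gn (gspaceB gn (gspaceB gn (noise_in W bA Tx) (field_in W2 Tx))
    (noise_in W bA Ty)) (field_in W2 Ty)).
have -> : var_on (half_line `\` right_open a b) x y = ip P Z Z.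
  rewrite /var_on !ip_sqr; apply: Ex_eq_ae.
  - by apply: measurable_sqr; apply: measurable_funB.
  - by apply: measurable_sqr; case: HZ.
  - by apply: filterS (incr_split bA Tx Ty) => w ->; rewrite /Z /incr; ring.
apply: L2norm_le; [exact: (noise_L2 W1 HZ) | | exact: hb].
apply: mulr_ge0; first exact: ltW.
by apply: addr_ge0 => //; apply: sumr_ge0 => j _; rewrite mulr_ge0 ?powR_ge0.
Qed.

(** The head $[0,b)$ lies in the complement of $[b,\infty)$, for which the second term of the bound
    is zero. *)
Lemma var_head (b : R) x y : a0 <= b -> T x -> T y ->
  var_on (right_open 0 b%:E) x y <= (c0 * (\sum_j b `^ gamma j * `|x 0 j - y 0 j|)) ^+ 2.
Proof.
move=> ab Tx Ty; have b0 : 0 <= b by exact: le_trans ab.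
apply: (@le_trans _ _ (var_on (half_line `\` right_open b +oo%E) x y)).
  apply: var_mono => //; first exact: borel_right_open.
    by apply: borelD; [exact: borel_half | exact: borel_right_open].
  move=> t [/= t0]; rewrite lte_fin => tb; split => // -[/= bt _].
  by have := le_lt_trans bt tb; rewrite ltxx.
by have := @var_compl b +oo%E x y ab (ltry _) (lexx _) Tx Ty; rewrite addr0.
Qed.

Lemma var_tail (b : R) x y : a0 < b -> T x -> T y ->
  var_on (half_line `\` right_open 0 b%:E) x y <=
    (c0 * (\sum_j a0 `^ gamma j * `|x 0 j - y 0 j| + b^-1)) ^+ 2.
Proof.
move=> ab Tx Ty; have b0 : 0 < b by exact: le_lt_trans ab.
apply: (@le_trans _ _ (var_on (half_line `\` right_open a0 b%:E) x y)).
  apply: var_mono => //; try by (apply: borelD; [exact: borel_half | exact: borel_right_open]).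
  move=> t [/= t0 nt]; split => // -[/= at0 tb]; apply: nt; split => //=.
by apply: var_compl => //; rewrite ?lte_fin//= invr_ge0 ltW.
Qed.

(** The half-line is cut at $1/\Delta(x,y)$, where the bounds for the head and for the tail are both
    of order $\Delta(x,y)$; the hypothesis on [a0] puts the cut beyond [a0]. *)
Lemma field_var x y : T x -> T y -> a0 * Delta gamma x y < 1 ->
  ip P (fun w => v x w - v y w) (fun w => v x w - v y w) <=
    (c0 * (2 * k%:R + 1) * Delta gamma x y) ^+ 2.
Proof.
move=> Tx Ty aD; set D := Delta gamma x y in aD *.
have D0 : 0 <= D by exact: Delta_ge0.
rewrite incr_field//; have kk : 0 <= k%:R :> R by [].
have [DD|Dn] := eqVneq D 0.
  have exy : x = y.
    apply/rowP => j; have := Delta_coord g0 x y j.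
    rewrite -/D DD powR0 ?gt_eqF ?beta_gt0// normr_le0 subr_eq0 => /eqP.
    by [].
  rewrite DD mulr0 expr0n/= exy /var_on /ip.
  suff -> : (fun w => incr W half_line y y w * incr W half_line y y w) = cst 0 by rewrite Ex_cst.
  by apply/funext => w; rewrite /incr subrr mulr0.
have Dp : 0 < D by rewrite lt_neqAle eq_sym Dn.
have ab : a0 < D^-1 by rewrite -[D^-1]mul1r ltr_pdivlMr.
rewrite (var_split (borel_right_open D^-1%:E (lexx 0)) Tx Ty).
have s1 : \sum_j D^-1 `^ gamma j * `|x 0 j - y 0 j| <= k%:R * D.
  by apply: weighted_le_Delta => //; rewrite ?invr_ge0// -/D mulVf.
have s2 : \sum_j a0 `^ gamma j * `|x 0 j - y 0 j| <= k%:R * D.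
  by apply: weighted_le_Delta => //; exact: ltW.
have p1 (a : R) : 0 <= \sum_j a `^ gamma j * `|x 0 j - y 0 j|.
  by apply: sumr_ge0 => j _; rewrite mulr_ge0 ?powR_ge0.
have h1 := var_head (ltW ab) Tx Ty; have h2 := var_tail ab Tx Ty; rewrite invrK in h2.
apply: le_trans (lerD h1 h2) _.
apply: (@le_trans _ _ ((c0 * (k%:R * D)) ^+ 2 + (c0 * (k%:R * D + D)) ^+ 2)).
  apply: lerD; rewrite ler_sqr ?nnegrE.
  - by rewrite ler_pM2l.
  - by rewrite mulr_ge0// ltW.
  - by rewrite !mulr_ge0// ltW.
  - by rewrite ler_pM2l// lerD2r.
  - by rewrite mulr_ge0 ?addr_ge0// ltW.
  - by rewrite mulr_ge0 ?addr_ge0 ?mulr_ge0// ltW.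
have -> : (c0 * (2 * k%:R + 1) * D) ^+ 2 = (c0 * (k%:R * D)) ^+ 2 + (c0 * (k%:R * D + D)) ^+ 2
   + 2 * (c0 * (k%:R * D)) * (c0 * (k%:R * D + D)) by ring.
rewrite lerDl; apply: mulr_ge0; last by rewrite mulr_ge0 ?addr_ge0 ?mulr_ge0// ltW.
by rewrite !mulr_ge0// ltW.
Qed.
End variances.

(** * Small balls, from above *)

Section conditioning.
Context {d : measure_display} {O : measurableType d} {R : realType}.
Context (P : probability O R).

Lemma Ex_dominated (f_ : nat -> O -> R) (f g : O -> R) : (forall n, measurable_fun setT (f_ n)) ->
  measurable_fun setT f -> L1 P g -> (forall n w, `|f_ n w| <= g w) ->
  (forall w, f_ ^~ w @ \oo --> f w) -> Ex P (f_ n) @[n --> \oo] --> Ex P f.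
Proof.
move=> mf_ mf g1 fg ff.
have [] := @dominated_convergence _ O R P setT measurableT (fun n w => (f_ n w)%:E)
  (fun w => (f w)%:E) (fun w => (g w)%:E).
- by move=> n; exact/measurable_EFinP/mf_.
- exact/measurable_EFinP.
- by apply: aeW => w _; apply: cvg_EFin; [exact: nearW | exact: ff].
- exact: g1.
- by apply: aeW => w n _; rewrite lee_fin; exact: fg.
move=> f1 _ cv.
have -> : Ex P f = fine (\int[P]_x (f x)%:E) by [].
apply: fine_cvg; rewrite fineK//.
by apply: integrable_fin_num.
Qed.

Lemma Ex_indep_L1 h X : bm h -> L1 P X ->
  (forall U : set R, measurable U ->
     Ex P (fun w => h w * \1_(X @^-1` U) w) = Ex P h * pr P (X @^-1` U)) ->
  Ex P (fun w => h w * X w) = Ex P h * Ex P X.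
Proof.
move=> bh X1 ind; have mX := L1_meas X1.
pose c n (x : R) := Num.max (- n%:R) (Num.min n%:R x).
have mc n : measurable_fun setT (c n).
  by apply: measurable_maxr => //; exact: measurable_minr.
have cX n w : `|c n (X w)| <= `|X w|.
  have n0 : - n%:R <= `|X w| by rewrite (le_trans _ (normr_ge0 _))// oppr_le0.
  have n1 : - `|X w| <= n%:R by rewrite (le_trans _ (ler0n _ _))// oppr_le0.
  have n2 : - `|X w| <= X w by exact: (lerNnormlW (lexx _)).
  by rewrite ler_norml le_max le_min ge_max ge_min ler_norm n0 n1 n2 !orbT.
have bc n : bm (fun w => c n (X w)).
  split; first exact: measurableT_comp (mc n) mX.
  exists n%:R => w; have n0 : - n%:R <= n%:R :> R by rewrite (le_trans _ (ler0n _ _))// oppr_le0.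
  by rewrite ler_norml le_max ge_max ge_min !lexx n0.
have cc w : c n (X w) @[n --> \oo] --> X w.
  apply: cvg_near_cst; exists (Num.truncn `|X w|).+1 => // n /= hn.
  have h1 : `|X w| <= n%:R.
    have /andP[_ t2] := truncn_itv (normr_ge0 (X w)).
    by apply: le_trans (ltW t2) _; rewrite ler_nat.
  move: h1; rewrite ler_norml => /andP[h1 h2].
  by rewrite /c (min_idPr h2) (max_idPr h1).
have ei n : Ex P (fun w => h w * c n (X w)) = Ex P h * Ex P (fun w => c n (X w)).
  apply: Ex_indep => // U mU.
  have -> : (fun w => c n (X w)) @^-1` U = X @^-1` (c n @^-1` U) by [].
  by apply: ind; apply: measurable_preim.
have [mh [M hM]] := bh.
have cv1 : Ex P (fun w => h w * c n (X w)) @[n --> \oo] --> Ex P (fun w => h w * X w).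
  apply: (@Ex_dominated _ _ (fun w => M * `|X w|)).
  - by move=> n; apply: measurable_funM => //; case: (bc n).
  - exact: measurable_funM.
  - by apply: L1Z; exact: integrable_norm.
  - by move=> n w; rewrite normrM ler_pM.
  - by move=> w; apply: cvgMl_tmp; exact: cc.
have cv2 : Ex P (fun w => c n (X w)) @[n --> \oo] --> Ex P X.
  apply: (@Ex_dominated _ _ (fun w => `|X w|)) => //.
  - by move=> n; case: (bc n).
  - exact: integrable_norm.
have cv3 : Ex P (fun w => h w * c n (X w)) @[n --> \oo] --> Ex P h * Ex P X.
  by under eq_fun do rewrite ei; apply: cvgMl_tmp; exact: cv2.
exact: (cvg_unique _ cv1 cv3).
Qed.

Section residual.
Context (H : set (O -> R)) (gH : gspace P H) (n : nat) (X : O -> R) (HX : H X).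
Context (Y : 'I_n -> O -> R) (HY : forall i, H (Y i)).

Lemma sigma_of_comb (c : 'I_n -> R) (U : set R) : measurable U ->
  sigma_of Y ((fun w => \sum_i c i * Y i w) @^-1` U).
Proof.
move=> mU; pose T := g_sigma_algebraType (\bigcup_i preimage_set_system [set: O] (Y i) measurable).
have mYT i : measurable_fun [set: T] (Y i : T -> R).
  move=> _ B mB; rewrite setTI; apply: sub_sigma_algebra.
  by exists i => //; exists B => //; rewrite setTI.
have ms : measurable_fun [set: T] (fun w : T => \sum_i c i * Y i w).
  by apply: measurable_sum => i; exact: measurable_funM.
by have := ms measurableT U mU; rewrite setTI.
Qed.

Lemma residual_indep (c : 'I_n -> R) :
  (forall j, ip P (fun w => X w - \sum_i c i * Y i w) (Y j) = 0) ->
  forall (U : set R) A, measurable U -> sigma_of Y A ->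
  pr P (A `&` (fun w => X w - \sum_i c i * Y i w) @^-1` U) =
  pr P A * pr P ((fun w => X w - \sum_i c i * Y i w) @^-1` U).
Proof.
move=> orth U A mU sA; set Z := fun w => _.
have HZ : H Z.
  apply: (gspaceB gH HX).
  have := @gspace_lin _ _ _ P H _ Y [seq (c i, i) | i <- index_enum 'I_n] gH HY.
  by congr H; apply/funext => w; rewrite /lin big_map.
have := @gspace_indep _ _ _ P H _ unit Y (fun _ => Z) gH HY (fun _ => HZ).
apply => //; first by move=> i _; rewrite ipC; exact: orth.
apply: sub_sigma_algebra; exists tt => //; exists U => //; by rewrite setTI.
Qed.

Lemma integral_Ex (f : O -> R) A : L1 P f -> measurable A ->
  (\int[P]_(w in A) (f w)%:E)%E = (Ex P (fun w => \1_A w * f w))%:E.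
Proof.
move=> f1 mA; rewrite integral_mkcond.
have e : (fun w => (f w)%:E) \_ A = EFin \o (fun w => \1_A w * f w).
  apply/funext => w; rewrite patchE /= indicE; case: (w \in A); rewrite ?mul1r ?mul0r//.
rewrite e /Ex /Rintegral fineK//; apply: integrable_fin_num => //.
have := L1M f1 (bm_indic (R := R) mA); rewrite /L1; congr (P.-integrable _ _).
by apply/funext => w /=; rewrite mulrC.
Qed.

(** In a Gaussian family the conditional expectation is almost surely the linear projection, so the
    variance of the residual is the mean of the conditional variance [V]. *)
Lemma residual_sqr_ge (V : O -> R) (a : R) : cond_variance P (sigma_of Y) X V ->
  {ae P, forall w, a <= V w} -> exists c : 'I_n -> R,
  (forall j, ip P (fun w => X w - \sum_i c i * Y i w) (Y j) = 0) /\
  a <= Ex P (fun w => (X w - \sum_i c i * Y i w) ^+ 2).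
Proof.
move=> [Z [X1 Z1 mZ cZ] [q1 V1 _ cV]] aV.
have [c orth] := projection gH HX HY; exists c; split=> //.
pose L w := \sum_i c i * Y i w; pose U w := X w - L w.
have HL : H L.
  have := @gspace_lin _ _ _ P H _ Y [seq (c i, i) | i <- index_enum 'I_n] gH HY.
  by congr H; apply/funext => w; rewrite /lin big_map.
have HU : H U by exact: (gspaceB gH HX HL).
have gU : gauss P U by case: gH => _ g _; exact: g.
have gL : gauss P L by case: gH => _ g _; exact: g.
have mY i : measurable_fun setT (Y i) by case: gH => _ g _; case: (g _ (HY i)).
have mA A : sigma_of Y A -> measurable A by exact: sigma_of_measurable.
have [U1 EU] := gauss_mean gU; have [L1L _] := gauss_mean gL.
have zero A : sigma_of Y A -> Ex P (fun w => \1_A w * U w) = 0.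
  move=> sA; rewrite (@Ex_indep_L1 (\1_A) U) ?EU ?mulr0//; first exact/bm_indic/mA.
  move=> B mB; rewrite pr_indic; last exact: mA.
  rewrite -(residual_indep orth mB sA) -pr_indic; last first.
    by apply: measurableI; [exact: mA | apply: measurable_preim => //; exact: (L1_meas U1)].
  by congr Ex; apply/funext => w; rewrite indicI.
have same A : sigma_of Y A -> Ex P (fun w => \1_A w * (Z w - L w)) = 0.
  move=> sA; have := cZ A sA; rewrite !integral_Ex//; [|exact: mA..].
  move=> ee; have e := EFin_inj ee; have := zero A sA.
  have l1 f : L1 P f -> L1 P (fun w => \1_A w * f w).
    move=> f1; have := L1M f1 (bm_indic (R := R) (mA _ sA)).
    by congr L1; apply/funext => w; rewrite mulrC.
  have -> : (fun w => \1_A w * U w) = (fun w => \1_A w * X w - \1_A w * L w).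
    by apply/funext => w; rewrite mulrBr.
  have -> : (fun w => \1_A w * (Z w - L w)) = (fun w => \1_A w * Z w - \1_A w * L w).
    by apply/funext => w; rewrite mulrBr.
  by rewrite !ExB ?e//; exact: l1.
(* Equal integrals over the events of the conditioning family force $f\le g$: otherwise some
   rational level lies between $g$ and $f$ on an event where $f-g$ has positive integral. *)
have sep (f g : O -> R) : L1 P f -> L1 P g ->
    (forall B : set R, measurable B -> sigma_of Y (f @^-1` B)) ->
    (forall B : set R, measurable B -> sigma_of Y (g @^-1` B)) ->
    (forall A, sigma_of Y A -> Ex P (fun w => \1_A w * (f w - g w)) = 0) ->
    {ae P, forall w, f w <= g w}.
  move=> f1 g1 sf sg fg.
  have sI A B : sigma_of Y A -> sigma_of Y B -> sigma_of Y (A `&` B).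
    move=> sA sB.
    exact: (@measurableI _ (g_sigma_algebraType (\bigcup_i preimage_set_system [set: O] (Y i) measurable)) A B sA sB).
  have null (x : rat) : {ae P, forall w, ~ ((ratr x < f w) /\ (g w <= ratr x))}.
    pose A := [set w | ratr x < f w] `&` [set w | g w <= ratr x].
    have sA : sigma_of Y A.
      apply: sI.
        have -> : [set w | ratr x < f w] = f @^-1` `]ratr x, +oo[.
          by apply/seteqP; split => w; rewrite /= in_itv /= andbT.
        by apply: sf; exact: measurable_itv.
      have -> : [set w | g w <= ratr x] = g @^-1` `]-oo, ratr x].
        by apply/seteqP; split => w; rewrite /= in_itv.
      by apply: sg; exact: measurable_itv.
    have := fg A sA => e0.
    have l1 : L1 P (fun w => \1_A w * (f w - g w)).
      have := L1M (L1B f1 g1) (bm_indic (R := R) (mA _ sA)).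
      by congr L1; apply/funext => w; rewrite mulrC.
    have pos w : 0 <= \1_A w * (f w - g w).
      rewrite indicE; have [/set_mem[/= a1 a2]|] := boolP (_ \in _); rewrite ?mul1r ?mul0r//; lra.
    have i0 : (\int[P]_(w in setT) `|(\1_A w * (f w - g w))%:E| = 0)%E.
      under eq_integral do rewrite gee0_abs ?lee_fin//.
      by have := integrable_fin_num measurableT l1 => /fineK <-; rewrite -[fine _]/(Ex P _) e0.
    have := proj1 (@ae_eq_integral_abs _ O R P setT measurableT (EFin \o (fun w => \1_A w * (f w - g w)))
      (measurable_int P l1)) i0.
    apply: filterS => w h0 [h1 h2]; have := EFin_inj (h0 I).
    by rewrite indicE mem_set// mul1r => /eqP; rewrite subr_eq0 => /eqP e; move: h1; rewrite e ltNge h2.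
  have all_null : {ae P, forall w, forall m : nat, if @unpickle rat m is Some x then
      ~ ((ratr x < f w) /\ (g w <= ratr x)) else True}.
    apply/ae_foralln => m; case: (unpickle m) => [x|]; first exact: null.
    exact: aeW.
  apply: filterS all_null => w hw; rewrite leNgt; apply/negP => gf.
  have [x] := rat_in_itvoo gf; rewrite in_itv/= => /andP[x1 x2].
  by have := hw (pickle x); rewrite pickleK; apply; split=> //; exact: ltW.
have sL (B : set R) : measurable B -> sigma_of Y (L @^-1` B) by exact: sigma_of_comb.
have ZL : {ae P, forall w, Z w <= L w} by exact: sep.
have LZ : {ae P, forall w, L w <= Z w}.
  apply: sep => // A sA.
  have -> : (fun w => \1_A w * (L w - Z w)) = (fun w => - (\1_A w * (Z w - L w))).
    by apply/funext => w; ring.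
  rewrite ExN ?same ?oppr0//.
  have := L1M (L1B Z1 L1L) (bm_indic (R := R) (mA _ sA)).
  by congr L1; apply/funext => w; rewrite mulrC.
have mX : measurable_fun setT X := L1_meas X1.
have mZZ : measurable_fun setT Z := L1_meas Z1.
have mV : measurable_fun setT V := L1_meas V1.
have -> : Ex P (fun w => U w ^+ 2) = Ex P (fun w => (X w - Z w) ^+ 2).
  apply: Ex_eq_ae.
  - by apply: measurable_sqr; exact: (L1_meas U1).
  - by apply: measurable_sqr; exact: measurable_funB.
  - by apply: filterS2 ZL LZ => w h1 h2; rewrite /U (le_anti (introT andP (conj h1 h2))).
have sT : sigma_of Y setT.
  exact: (@measurableT _ (g_sigma_algebraType (\bigcup_i preimage_set_system [set: O] (Y i) measurable))).
have := cV setT sT; rewrite !integral_Ex// => ee; have := EFin_inj ee.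
have e1 f : (fun w : O => \1_setT w * f w) = f by apply/funext => w; rewrite indicE in_setT mul1r.
rewrite !e1 => <-.
(* Truncating [V] from below turns the almost sure bound into a pointwise one, as [Ex_le]
   requires. *)
have -> : Ex P V = Ex P (fun w => Num.max a (V w)).
  apply: Ex_eq_ae => //; first exact: measurable_maxr.
  by apply: filterS aV => w h; rewrite (max_idPr h).
rewrite -[leLHS](Ex_cst P a); apply: Ex_le.
- exact: L1_cst.
- apply: (@L1_le _ _ _ P _ (fun w => `|V w| + `|a|)).
  + exact: measurable_maxr.
  + by apply: L1D; [exact: integrable_norm | exact: L1_cst].
  + move=> w; have := ler_norm a; have := ler_norm (V w).
    have := lerNnormlW (lexx `|V w|); have := lerNnormlW (lexx `|a|).
    by rewrite /Num.max; case: (ltP a (V w)) => ? ? ? ? ?; rewrite ler_norml; lra.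
- by move=> w; rewrite le_max lexx.
Qed.
End residual.
End conditioning.

Lemma sum_delta {R : pzRingType} n (i0 : 'I_n) (f : 'I_n -> R) :
  \sum_i (i == i0)%:R * f i = f i0.
Proof. by rewrite (bigD1 i0)//= eqxx mul1r big1 ?addr0// => i /negbTE ->; exact: mul0r. Qed.

Section small_ball_upper.
Context {d : measure_display} {O : measurableType d} {R : realType}.
Context (P : probability O R) (H : set (O -> R)) (gH : gspace P H).
Context {k : nat} (gamma : 'I_k -> R) (g0 : forall j, 0 < gamma j) (k0 : (0 < k)%N).
Context (T : set 'rV[R]_k) (v : 'rV[R]_k -> {RV P >-> R}).
Context (Hv : forall x, T x -> H (v x)).
Context (c2 : R) (c20 : 0 < c2).
Context (hB : forall (n : nat) (x : 'rV[R]_k) (xs : 'I_n -> 'rV[R]_k),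
    (0 < n)%N -> T x -> (forall i, T (xs i)) ->
    exists2 V : O -> R,
      cond_variance P (process_sigma_algebra setT (fun i => v (xs i))) (v x) V &
      {ae P, forall w,
         c2 * \big[Num.min/Delta gamma x 0 ^+ 2]_(i < n)
                Delta gamma x (xs i) ^+ 2 <= V w}).

(* Lower bound for the standard normal mass of [[b, b + 1]]. *)
Definition gap (b : R) : R := expR (- ((b + 1) ^+ 2 / 2)) / Num.sqrt (pi *+ 2).

Lemma gap_gt0 b : 0 < gap b.
Proof. by rewrite divr_gt0 ?expR_gt0// sqrtr_gt0 mulrn_wgt0// pi_gt0. Qed.

Lemma gap_le1 b : 0 <= b -> gap b <= 1.
Proof.
move=> b0; have s1 : 1 <= Num.sqrt (pi *+ 2) :> R.
  have p1 : 1 <= pi *+ 2 :> R by rewrite mulr2n; have := pi_ge2 R; lra.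
  by rewrite -[leLHS]sqrtr1 ler_sqrt// (le_trans ler01).
have s0 : 0 < Num.sqrt (pi *+ 2) :> R by exact: lt_le_trans s1.
rewrite /gap ler_pdivrMr// mul1r (le_trans _ s1)//.
by rewrite -expR0 ler_expR oppr_le0 divr_ge0 ?sqr_ge0.
Qed.

Lemma gauss_gap X s u : gauss P X -> 0 < s -> 0 <= u -> s ^+ 2 <= Ex P (fun w => X w ^+ 2) ->
  gap (u / s) <= pr P [set w | u < X w].
Proof.
move=> gX s0 u0 hs; have mX : measurable_fun setT X by case: gX.
have e0 : 0 < Ex P (fun w => X w ^+ 2) by apply: lt_le_trans hs; rewrite exprn_gt0.
have us : 0 <= u / s by rewrite divr_ge0// ltW.
apply: le_trans (gauss_lower_tail gX us e0) _.
have mm (a : R) : measurable [set w | a < X w].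
  have -> : [set w | a < X w] = X @^-1` `]a, +oo[.
    by apply/seteqP; split => w; rewrite /= in_itv /= andbT.
  by apply: measurable_preim => //; exact: measurable_itv.
apply: pr_le => // w /=; apply: le_lt_trans.
rewrite -[leLHS](divfK (lt0r_neq0 s0)) ler_wpM2l//.
by rewrite -[leLHS]ger0_norm ?(ltW s0)// -sqrtr_sqr ler_sqrt// ltW.
Qed.

Lemma prU_disj A B : measurable A -> measurable B -> A `&` B = set0 ->
  pr P (A `|` B) = pr P A + pr P B.
Proof.
move=> mA mB AB; apply: EFin_inj; rewrite EFinD !prE//; last exact: measurableU.
by rewrite measureU.
Qed.

(** Given the previous points, $v(x)$ is a prediction plus an independent residual of deviation at
    least $\sqrt{c_2}\,\rho$. Where the prediction is at least [v (xs i0)] the event forces the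
    residual to be at most $u$, elsewhere at least $-u$; either has probability at most one minus
    the gap. This split by sign takes the place of Anderson's inequality. *)
Lemma small_ball_step n (xs : 'I_n -> 'rV[R]_k) (i0 : 'I_n) x (rho u : R) A :
  (forall i, T (xs i)) -> T x -> 0 < rho -> 0 < u -> rho <= Delta gamma x 0 ->
  (forall i, rho <= Delta gamma x (xs i)) -> sigma_of (fun i => v (xs i) : O -> R) A ->
  pr P (A `&` [set w | `|v x w - v (xs i0) w| <= u]) <=
    (1 - gap (u / (Num.sqrt c2 * rho))) * pr P A.
Proof.
move=> Txs Tx rho0 u0 d0 di sA.
pose Y i : O -> R := v (xs i).
have HY i : H (Y i) by exact: Hv.
have n0 : (0 < n)%N by exact: leq_ltn_trans (ltn_ord i0).
have [V cV aV] := hB n0 Tx Txs.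
have aV' : {ae P, forall w, c2 * rho ^+ 2 <= V w}.
  apply: filterS aV => w; apply: le_trans; rewrite ler_pM2l//.
  elim/big_rec : _ => [|i b _ hb]; first by rewrite ler_sqr ?nnegrE ?Delta_ge0// ltW.
  by rewrite le_min hb andbT ler_sqr ?nnegrE ?Delta_ge0// ltW.
have [c [orth Rge]] := residual_sqr_ge gH (Hv Tx) HY cV aV'.
pose L w := \sum_i c i * Y i w; pose X w := v x w - L w.
have HL : H L.
  have := @gspace_lin _ _ _ P H _ Y [seq (c i, i) | i <- index_enum 'I_n] gH HY.
  by congr H; apply/funext => w; rewrite /lin big_map.
have HX : H X by exact: (gspaceB gH (Hv Tx) HL).
have gX : gauss P X by case: gH => _ g _; exact: g.
have mX : measurable_fun setT X by case: gX.
have HNX : H (fun w => 0 - X w) by apply: (gspaceB gH _ HX); case: gH.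
have gNX : gauss P (fun w => 0 - X w) by case: gH => _ g _; exact: g.
have s0 : 0 < Num.sqrt c2 * rho by rewrite mulr_gt0// sqrtr_gt0.
have s2 : (Num.sqrt c2 * rho) ^+ 2 <= Ex P (fun w => X w ^+ 2).
  by rewrite exprMn sqr_sqrtr// ltW.
have s3 : (Num.sqrt c2 * rho) ^+ 2 <= Ex P (fun w => (0 - X w) ^+ 2).
  by apply: le_trans s2 _; under [leRHS]eq_Rintegral do rewrite sub0r sqrrN.
have gap1 := gauss_gap gX s0 (ltW u0) s2.
have gap2 := gauss_gap gNX s0 (ltW u0) s3.
set q := gap _ in gap1 gap2 *.
have mA B : sigma_of Y B -> measurable B.
  apply: sigma_of_measurable => i; exact: measurable_funP.
pose Bp := [set w | 0 <= L w - Y i0 w].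
have sBp : sigma_of Y Bp.
  have := @sigma_of_comb _ O R n Y (fun i => c i - (i == i0)%:R) `[0, +oo[ (measurable_itv _).
  congr (sigma_of Y _); apply/funext => w; rewrite /= in_itv /= andbT.
  by under eq_bigr do rewrite mulrBl; rewrite sumrB sum_delta.
pose GT := g_sigma_algebraType (\bigcup_i preimage_set_system [set: O] (Y i) measurable).
have sI B C : sigma_of Y B -> sigma_of Y C -> sigma_of Y (B `&` C).
  by move=> sB sC; exact: (@measurableI _ GT B C sB sC).
have sC B : sigma_of Y B -> sigma_of Y (~` B).
  by move=> sB; exact: (@measurableC _ GT B sB).
pose F := [set w | `|v x w - v (xs i0) w| <= u].
have mF : measurable F by apply: measurable_norm_le; exact: measurable_funB.
have sAp := sI _ _ sA sBp; have sAm := sI _ _ sA (sC _ sBp).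
have mUle : measurable (X @^-1` `]-oo, u]) by apply: measurable_preim => //; exact: measurable_itv.
have mUge : measurable (X @^-1` `[- u, +oo[) by apply: measurable_preim => //; exact: measurable_itv.
have p1 : pr P (X @^-1` `]-oo, u]) <= 1 - q.
  have -> : X @^-1` `]-oo, u] = ~` [set w | u < X w].
    by apply/seteqP; split => w; rewrite /= in_itv /= leNgt => /negP.
  rewrite prC; first lra.
  have -> : [set w | u < X w] = X @^-1` `]u, +oo[.
    by apply/seteqP; split => w; rewrite /= in_itv /= andbT.
  by apply: measurable_preim => //; exact: measurable_itv.
have p2 : pr P (X @^-1` `[- u, +oo[) <= 1 - q.
  have -> : X @^-1` `[- u, +oo[ = ~` [set w | u < 0 - X w].
    by apply/seteqP; split => w; rewrite /= in_itv /= andbT sub0r leNgt ltrNr => /negP.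
  rewrite prC; first lra.
  have -> : [set w | u < 0 - X w] = X @^-1` `]-oo, - u[.
    by apply/seteqP; split => w; rewrite /= in_itv /= sub0r ltrNr.
  by apply: measurable_preim => //; exact: measurable_itv.
have h1 : pr P ((A `&` Bp) `&` F) <= (1 - q) * pr P (A `&` Bp).
  apply: (@le_trans _ _ (pr P ((A `&` Bp) `&` X @^-1` `]-oo, u]))).
    apply: pr_le.
    + by apply: measurableI => //; exact: mA.
    + by apply: measurableI => //; exact: mA.
    + move=> w [[Aw Bw] Fw]; split => //; rewrite /= in_itv /=; move: Fw Bw.
      by rewrite /F /Bp /X /Y /= ler_norml => /andP[_ f2] b; lra.
  rewrite (residual_indep gH (Hv Tx) HY orth (measurable_itv `]-oo, u]) sAp).
  by rewrite mulrC ler_wpM2r// pr_ge0.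
have h2 : pr P ((A `&` ~` Bp) `&` F) <= (1 - q) * pr P (A `&` ~` Bp).
  apply: (@le_trans _ _ (pr P ((A `&` ~` Bp) `&` X @^-1` `[- u, +oo[))).
    apply: pr_le.
    + by apply: measurableI => //; exact: mA.
    + by apply: measurableI => //; exact: mA.
    + move=> w [[Aw Bw] Fw]; split; first by split.
      move: Bw => /negP Bw; rewrite /= in_itv /= andbT; move: Fw Bw.
      by rewrite /F /Bp /X /Y /= ler_norml -ltNge => /andP[f1 _] b; lra.
  rewrite (residual_indep gH (Hv Tx) HY orth (measurable_itv `[- u, +oo[) sAm).
  by rewrite mulrC ler_wpM2r// pr_ge0.
have eA : A = (A `&` Bp) `|` (A `&` ~` Bp) by rewrite -setIUr setUv setIT.
have eF : A `&` F = ((A `&` Bp) `&` F) `|` ((A `&` ~` Bp) `&` F) by rewrite -setIUl -eA.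
have dis : (A `&` Bp) `&` (A `&` ~` Bp) = set0 by apply/seteqP; split=> // w [[_ b] [_]].
rewrite -/F eF prU_disj; first last.
- by apply/seteqP; split=> // w [[[_ b] _] [[_]]].
- by apply: measurableI => //; exact: mA.
- by apply: measurableI => //; exact: mA.
rewrite {3}eA prU_disj//; [|exact: mA..].
by rewrite mulrDr; exact: lerD.
Qed.

(** Points are added one at a time: the event for the earlier points belongs to the $\sigma$-algebra
    generated by them and [x0], so each new point contributes one factor. *)
Lemma small_ball_list (J : eqType) (pt : J -> 'rV[R]_k) (s : seq J) x0 (rho u : R) :
  T x0 -> 0 < rho -> 0 < u -> uniq s ->
  (forall m, m \in s -> [/\ T (pt m), rho <= Delta gamma (pt m) 0 & rho <= Delta gamma (pt m) x0]) ->
  (forall m m', m \in s -> m' \in s -> m != m' -> rho <= Delta gamma (pt m) (pt m')) ->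
  pr P [set w | forall m, m \in s -> `|v (pt m) w - v x0 w| <= u] <=
    (1 - gap (u / (Num.sqrt c2 * rho))) ^+ size s.
Proof.
move=> Tx0 rho0 u0; set q := gap _.
elim: s => [|m s IH] us hs sep.
  rewrite expr0; apply: pr_le1.
  by rewrite (_ : [set w | _] = setT)//; apply/seteqP; split => w //= _ m'; rewrite in_nil.
move: us => /= /andP[ms us].
have mem_s m' : m' \in s -> m' \in m :: s by move=> ?; rewrite in_cons orbC; apply/orP; left.
pose xs (i : 'I_(size s).+1) := nth x0 (x0 :: map pt s) i.
have tin (j : 'I_(size s)) : tnth (in_tuple s) j \in s by exact: (mem_tnth j (in_tuple s)).
have xsS (i : 'I_(size s)) : xs (lift ord0 i) = pt (tnth (in_tuple s) i).
  by rewrite /xs /= (nth_map m) ?ltn_ord//; congr pt; rewrite (tnth_nth m).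
have Txs i : T (xs i).
  have [j ->|->] := unliftP ord0 i; last by [].
  by rewrite xsS; have [] := hs (tnth (in_tuple s) j) (mem_s _ (tin j)).
pose Y i : O -> R := v (xs i).
pose A := [set w | forall m, m \in s -> `|v (pt m) w - v x0 w| <= u].
have sA : sigma_of Y A.
  pose GT := g_sigma_algebraType (\bigcup_i preimage_set_system [set: O] (Y i) measurable).
  have -> : A = [set w | forall j : 'I_(size s), [set w | `|Y (lift ord0 j) w - Y ord0 w| <= u] w].
    apply/seteqP; split => w hw.
      move=> j; rewrite /= /Y xsS; apply: hw; exact: tin.
    move=> m' m's; have lt : (index m' s < size s)%N by rewrite index_mem.
    have := hw (Ordinal lt); rewrite /= /Y xsS.
    by rewrite (tnth_nth m) /= nth_index.
  apply: (@measurable_fin_all _ GT 'I_(size s) (fun j => [set w | `|Y (lift ord0 j) w - Y ord0 w| <= u])) => j.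
  have := @sigma_of_comb _ O R _ Y (fun i => (i == lift ord0 j)%:R - (i == ord0)%:R) `[- u, u] (measurable_itv _).
  rewrite (_ : _ @^-1` _ = [set w | `|Y (lift ord0 j) w - Y ord0 w| <= u])//.
  apply/funext => w; apply/propext; rewrite /= in_itv /= -ler_norml.
  under eq_bigr do rewrite mulrBl.
  by rewrite sumrB !sum_delta.
have [Tm d0 dx0] := hs m (mem_head _ _).
have di i : rho <= Delta gamma (pt m) (xs i).
  have [j ->|->] := unliftP ord0 i; last by [].
  rewrite xsS; apply: sep; [exact: mem_head | exact/mem_s/tin |].
  by apply: contraNneq ms => ->; exact: tin.
have := @small_ball_step _ xs ord0 (pt m) rho u A Txs Tm rho0 u0 d0 di sA.
have -> : A `&` [set w | `|v (pt m) w - v (xs ord0) w| <= u] =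
    [set w | forall m', m' \in m :: s -> `|v (pt m') w - v x0 w| <= u].
  apply/seteqP; split => w.
    by move=> [Aw Fw] m'; rewrite in_cons => /orP[/eqP ->|]; [exact: Fw | exact: Aw].
  by move=> hw; split; [move=> m' m's; apply: hw; exact: mem_s | apply: hw; exact: mem_head].
move=> h; apply: le_trans h _; rewrite /= exprS.
apply: ler_pM => //; rewrite ?pr_ge0//.
  by rewrite subr_ge0 gap_le1// divr_ge0 ?mulr_ge0 ?sqrtr_ge0// ltW.
apply: IH => // [m' m's|m1 m2 h1 h2]; [exact/hs/mem_s | apply: sep; exact: mem_s].
Qed.
End small_ball_upper.

Section separated_points.
Context {R : realType} {k : nat} (gamma : 'I_k -> R) (g0 : forall j, 0 < gamma j) (k0 : (0 < k)%N).
Context (l h : 'rV[R]_k) (hlh : forall j, l 0 j < h 0 j).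
Context (x0 : 'rV[R]_k) (Tx0 : rectangle l h x0).
Context (u r : R) (u0 : 0 < u) (ur : u < r) (r1 : r <= 1) (rlh : forall j, r <= (h 0 j - l 0 j) / 2).

Let r0 : 0 < r. Proof. exact: lt_trans ur. Qed.
Let kk : 0 < k%:R :> R. Proof. by rewrite ltr0n. Qed.

Lemma Delta_ge_coord (x y : 'rV[R]_k) j (a : R) : 0 <= a -> a `^ beta gamma j <= `|x 0 j - y 0 j| ->
  a <= Delta gamma x y.
Proof.
move=> a0 ha; rewrite -(powR_betaK g0 j a0).
apply: (@le_trans _ _ (`|x 0 j - y 0 j| `^ alpha gamma j)).
  by apply: ge0_ler_powR; rewrite ?nnegrE ?powR_ge0//; exact: ltW (alpha_gt0 g0 j).
by rewrite /Delta (bigD1 j)//= lerDl; apply: sumr_ge0 => i _; exact: powR_ge0.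
Qed.

(** Chosen so that $2r/u$ times this radius is $r/k$: with offsets up to $(r/k)^{\beta_j}$ in every
    direction the points stay in the ball of radius [r]. The factor 2 makes every count at least
    2. *)
Definition sep_radius : R := u / (2 * k%:R).
Local Notation rho := sep_radius.

Lemma sep_radius_gt0 : 0 < rho. Proof. by rewrite divr_gt0 ?mulr_gt0. Qed.

Definition sep_count j : nat := Num.truncn ((2 * r / u) `^ beta gamma j).

Lemma ratio_ge2 j : 2 <= (2 * r / u) `^ beta gamma j.
Proof.
have h1 : 2 <= 2 * r / u by rewrite ler_pdivlMr// ler_pM2l// ltW.
apply: le_trans h1 _; rewrite -[leLHS]powRr1; last by rewrite divr_ge0 ?mulr_ge0// ltW.
apply: ler_powR; last exact: beta_ge1.
by rewrite ler_pdivlMr// mul1r (le_trans (ltW ur))// ler_peMl ?ler1n// ltW.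
Qed.

Definition sep_index : finType := {dffun forall j : 'I_k, 'I_(sep_count j)}.

(* Pointing towards the centre of the rectangle keeps the separated points in it. *)
Definition inward j : R := if x0 0 j <= (l 0 j + h 0 j) / 2 then 1 else -1.

Definition sep_pt (m : sep_index) : 'rV[R]_k :=
  \row_j (x0 0 j + inward j * ((m j).+1%:R * rho `^ beta gamma j)).

Lemma inward_norm j : `|inward j| = 1.
Proof. by rewrite /inward; case: ifP; rewrite ?normrN normr1. Qed.

Lemma sep_offset (m : sep_index) j :
  rho `^ beta gamma j <= (m j).+1%:R * rho `^ beta gamma j <= (r / k%:R) `^ beta gamma j.
Proof.
rewrite ler_peMl ?powR_ge0 ?ler1n//=.
apply: (@le_trans _ _ ((sep_count j)%:R * rho `^ beta gamma j)).
  by rewrite ler_wpM2r ?powR_ge0// ler_nat.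
apply: (@le_trans _ _ ((2 * r / u) `^ beta gamma j * rho `^ beta gamma j)).
  by rewrite ler_wpM2r ?powR_ge0// truncn_le powR_ge0.
rewrite -powRM; last 2 first.
- by rewrite divr_ge0 ?mulr_ge0// ltW.
- exact: ltW sep_radius_gt0.
by rewrite /sep_radius le_eqVlt; apply/orP; left; apply/eqP; congr (_ `^ _); field; rewrite !gt_eqF.
Qed.

Lemma sep_pt_in m : local_ball gamma l h x0 r (sep_pt m).
Proof.
split.
  move=> j; have /andP[a1 a2] := sep_offset m j; rewrite mxE.
  have c1 : (r / k%:R) `^ beta gamma j <= (h 0 j - l 0 j) / 2.
    apply: le_trans (rlh j).
    have rk : r / k%:R <= r by rewrite ler_pdivrMr// ler_peMr ?ler1n// ltW.
    apply: le_trans rk.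
    rewrite -[leRHS]powRr1 ?divr_ge0 ?(ltW r0)//; apply: ger_powR; last exact: beta_ge1.
    by rewrite divr_gt0//= ler_pdivrMr// mul1r (le_trans r1)// ler1n.
  have p0 : 0 <= rho `^ beta gamma j by exact: powR_ge0.
  have /andP[b1 b2] := Tx0 j; rewrite /inward.
  by move: a1 a2; set c := _.+1%:R * _ => a1 a2;
    case: (leP (x0 0 j) ((l 0 j + h 0 j) / 2)) => hm; apply/andP; split; lra.
apply: le_trans (Delta_le g0 (a := r / k%:R) _ _) _; first by rewrite divr_ge0// ltW.
  move=> j; have /andP[a1 a2] := sep_offset m j; rewrite mxE opprD addrA subrr add0r normrN normrM.
  by rewrite inward_norm mul1r ger0_norm// mulr_ge0// powR_ge0.
by rewrite mulrC divfK// gt_eqF.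
Qed.

(** Offsets start at one step rather than at zero, so the center too is separated from all the
    points. *)
Lemma sep_pt_center m : rho <= Delta gamma (sep_pt m) x0.
Proof.
apply: (@Delta_ge_coord _ _ (Ordinal k0)); first exact: ltW sep_radius_gt0.
rewrite mxE addrAC subrr add0r normrM inward_norm mul1r ger0_norm ?mulr_ge0 ?powR_ge0//.
by have /andP[] := sep_offset m (Ordinal k0).
Qed.

Lemma sep_pt_sep m m' : m != m' -> rho <= Delta gamma (sep_pt m) (sep_pt m').
Proof.
move=> mm'; have [j mj] : exists j, m j != m' j.
  apply/existsP; rewrite -negb_forall; apply: contra mm' => /forallP e.
  by apply/eqP/ffunP => j; apply/eqP.
apply: (@Delta_ge_coord _ _ j); first exact: ltW sep_radius_gt0.
rewrite !mxE; have -> : x0 0 j + inward j * ((m j).+1%:R * rho `^ beta gamma j) -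
    (x0 0 j + inward j * ((m' j).+1%:R * rho `^ beta gamma j)) =
    inward j * (((m j)%:R - (m' j)%:R) * rho `^ beta gamma j) by rewrite -!natr1; ring.
rewrite normrM inward_norm mul1r normrM [X in _ * X]ger0_norm ?powR_ge0// ler_peMl ?powR_ge0//.
have nmj : (m j : nat) <> m' j by move=> e; move/eqP: mj; apply; exact: val_inj.
have [lt|lt|//] := ltngtP (m j) (m' j).
  by rewrite distrC -natrB ?(ltnW lt)// ger0_norm// ler1n subn_gt0.
by rewrite -natrB ?(ltnW lt)// ger0_norm// ler1n subn_gt0.
Qed.

(** Rounding down a number that is at least 2 loses at most half of it, whence the factor
    $2^{-k}$. *)
Lemma card_sep : 2 <= #|sep_index|%:R :> R /\ (r / u) `^ hom_dim gamma / 2 ^+ k <= #|sep_index|%:R :> R.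
Proof.
rewrite card_dep_ffun foldrE big_image /= natr_prod.
have c2 j : 2 <= #|'I_(sep_count j)|%:R :> R.
  have : (Num.truncn (2%:R : R) <= sep_count j)%N by apply: le_truncn; exact: (ratio_ge2 j).
  by rewrite natrK card_ord ler_nat.
have cx j : (2 * r / u) `^ beta gamma j / 2 <= #|'I_(sep_count j)|%:R.
  rewrite card_ord; have := ratio_ge2 j => h2.
  have /andP[_] := truncn_itv (le_trans (ler0n _ 2) h2); rewrite -/(sep_count j).
  have -> : (sep_count j).+1%:R = (sep_count j)%:R + 1 :> R by rewrite natr1.
  by move=> h3; lra.
split.
  rewrite (bigD1 (Ordinal k0))//= -[leLHS]mulr1; apply: ler_pM => //.
  by elim/big_rec : _ => // j x _ hx; rewrite mulr_ege1//; have := c2 j; lra.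
have -> : 2 ^+ k = \prod_(j < k) 2 :> R by rewrite prodr_const card_ord.
rewrite powR_prod ?divr_gt0// -prodf_div.
apply: ler_prod => j _; rewrite divr_ge0 ?powR_ge0//=; apply: le_trans (cx j).
rewrite ler_pM2r ?invr_gt0//; apply: ge0_ler_powR; rewrite ?nnegrE.
- exact: ltW (beta_gt0 g0 j).
- by rewrite divr_ge0// ltW.
- by rewrite divr_ge0 ?mulr_ge0// ltW.
- by rewrite ler_pM2r ?invr_gt0// ler_peMl ?ler1n// ltW.
Qed.
End separated_points.

(** Dropping one of at least two points keeps at least half of them. *)
Lemma half_count {R : realFieldType} (g a N : R) (n k : nat) : 0 <= g -> 2 <= N -> a / 2 ^+ k <= N ->
  N <= n%:R + 1 -> g / 2 ^+ k.+1 * a <= g *+ n.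
Proof.
move=> gp N2 aN Nn; rewrite -[g *+ n]mulr_natr.
have -> : g / 2 ^+ k.+1 * a = g * (a / 2 ^+ k / 2).
  by rewrite exprS; field; rewrite gt_eqF// exprn_gt0.
rewrite ler_wpM2l// ; move: aN Nn; set b := a / _; set m := n%:R => aN Nn; lra.
Qed.

Section small_ball_upper_bound.
Context {d : measure_display} {O : measurableType d} {R : realType}.
Context (P : probability O R) (H : set (O -> R)) (gH : gspace P H).
Context {k : nat} (gamma : 'I_k -> R) (g0 : forall j, 0 < gamma j) (k0 : (0 < k)%N).
Context (l h : 'rV[R]_k) (hlh : forall j, l 0 j < h 0 j).
Context (v : 'rV[R]_k -> {RV P >-> R}) (cv : forall w, continuous (fun x => v x w)).
Context (Hv : forall x, rectangle l h x -> H (v x)).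
Context (c2 : R) (c20 : 0 < c2).
Context (hB : forall (n : nat) (x : 'rV[R]_k) (xs : 'I_n -> 'rV[R]_k),
    (0 < n)%N -> rectangle l h x -> (forall i, rectangle l h (xs i)) ->
    exists2 V : O -> R,
      cond_variance P (process_sigma_algebra setT (fun i => v (xs i))) (v x) V &
      {ae P, forall w,
         c2 * \big[Num.min/Delta gamma x 0 ^+ 2]_(i < n)
                Delta gamma x (xs i) ^+ 2 <= V w}).

Lemma small_ball_upper : exists2 C, 0 < C & forall x0 u r, rectangle l h x0 -> 0 < u -> u < r ->
  r <= 1 -> (forall j, r <= (h 0 j - l 0 j) / 2) ->
  pr P (osc_event gamma l h (fun x => v x : O -> R) x0 r u) <= expR (- (C * (r / u) `^ hom_dim gamma)).
Proof.
have kk : 0 < k%:R :> R by rewrite ltr0n.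
(* The ratio of the level [u] to the residual deviation at separation [rho / 2]; it is free of [u]
   and [r], so every point costs the same factor. *)
pose b : R := 4 * k%:R / Num.sqrt c2.
have sc : 0 < Num.sqrt c2 by rewrite sqrtr_gt0.
exists (gap b / 2 ^+ k.+1); first by rewrite divr_gt0 ?gap_gt0// exprn_gt0.
move=> x0 u r Tx0 u0 ur r1 rlh; have r0 : 0 < r by exact: lt_trans ur.
set rho := sep_radius (k := k) u; have rho0 : 0 < rho := sep_radius_gt0 k0 u0.
have rho20 : 0 < rho / 2 by rewrite divr_gt0.
pose J := sep_index gamma u r; pose pt : J -> 'rV[R]_k := sep_pt l h x0 (u := u) (r := r).
(* Assumption B also compares with the distance to the origin. As the points are [rho]-separated, at
   most one lies closer than [rho / 2] to the origin, and it is dropped. *)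
pose good m := rho / 2 <= Delta gamma (pt m) 0.
pose s := [seq m <- enum J | good m].
have sepJ (m m' : J) : m != m' -> rho <= Delta gamma (pt m) (pt m') by exact: sep_pt_sep.
have half : rho / 2 <= rho by rewrite ler_pdivrMr// ler_peMr ?ler1n// ltW.
have cJ (m : J) : rho <= Delta gamma (pt m) x0 by exact: sep_pt_center.
have inJ (m : J) : local_ball gamma l h x0 r (pt m) by exact: sep_pt_in.
have size_s : (#|J| <= (size s).+1)%N.
  have -> : size s = #|[pred m | good m]|.
    by rewrite /s cardE /enum_mem size_filter -size_filter; congr (size _); rewrite -filter_predI; apply: eq_filter => m /=; rewrite andbT.
  rewrite -(cardC [pred m | good m]) addnC -addn1 addnC leq_add2l.
  apply/card_le1_eqP => m m'; rewrite !inE /good -!ltNge => h1 h2.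
  apply: contrapT => /eqP /sepJ h3.
  have := Delta_triangle g0 0 (pt m') (pt m); rewrite (Delta_sym gamma 0 (pt m)); lra.
have := @small_ball_list _ O R P H gH k gamma (rectangle l h) v Hv c2 c20 hB J pt s x0 (rho / 2) u
  Tx0 rho20 u0 (filter_uniq _ (enum_uniq _)).
have -> : u / (Num.sqrt c2 * (rho / 2)) = b.
  by rewrite /b /rho /sep_radius; field; rewrite !gt_eqF.
move=> hl; apply: (@le_trans _ _ ((1 - gap b) ^+ size s)).
  apply: le_trans (hl _ _).
  - apply: pr_le.
    + exact: measurable_osc_event.
    + have -> : [set w | forall m, m \in s -> `|v (pt m) w - v x0 w| <= u] =
         [set w | forall m, [set w | m \in s -> `|v (pt m) w - v x0 w| <= u] w] by [].
      apply: (@measurable_fin_all _ O J (fun m => [set w | m \in s -> `|v (pt m) w - v x0 w| <= u])) => m.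
      have [ms|ms] := boolP (m \in s).
        rewrite (_ : [set w | _] = [set w | `|v (pt m) w - v x0 w| <= u]).
          by apply: measurable_norm_le; exact: measurable_funB.
        by apply/seteqP; split => w /=; [apply | move=> ? _].
      by rewrite (_ : [set w | _] = setT)//; apply/seteqP; split.
    + move=> w hw m _; rewrite -lee_fin; apply: le_trans hw.
      by apply: ereal_sup_ubound; exists (pt m).
  - move=> m; rewrite mem_filter => /andP[gm _]; split => //.
    + by case: (inJ m).
    + exact: le_trans half (cJ m).
  - by move=> m m' _ _ mm'; exact: le_trans half (sepJ _ _ mm').
have /andP[q0 q1] : 0 < gap b <= 1 by rewrite gap_gt0 gap_le1// divr_ge0// ltW// mulr_gt0.
apply: le_trans (expr_le_expR _ _) _; first by rewrite subr_ge0.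
rewrite ler_expR lerN2 opprB addrCA subrr addr0.
have [N2 NQ] := @card_sep R k gamma g0 k0 u r u0 ur.
have sN : #|J|%:R <= (size s)%:R + 1 :> R by rewrite natr1 ler_nat.
exact: (half_count (ltW q0) N2 NQ sN).
Qed.
End small_ball_upper_bound.

(** * The law of the iterated logarithm *)

Section net_events.
Context {d : measure_display} {O : measurableType d} {R : realType}.
Context {k : nat} (gamma : 'I_k -> R) (g0 : forall j, 0 < gamma j).
Context (l h : 'rV[R]_k).
Local Notation ball_at := (local_ball gamma l h).

(* The oscillation event for a field whose paths need not be continuous. *)
Definition net_event (Y : 'rV[R]_k -> O -> R) x0 r (a : R) : set O := [set w |
  forall n x, ball_at x0 r x -> `|Y (trunc_pt gamma x0 r n x) w - Y x0 w| <= a].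

Lemma osc_event_net (Y : 'rV[R]_k -> O -> R) x0 r a : (forall w, continuous (fun x => Y x w)) ->
  rectangle l h x0 -> 0 < r -> osc_event gamma l h Y x0 r a = net_event Y x0 r a.
Proof.
move=> cY Tx0 r0; apply/seteqP; split => w hw.
  move=> n x Sx; rewrite -lee_fin; apply: le_trans hw; apply: ereal_sup_ubound.
  by exists (trunc_pt gamma x0 r n x) => //; exact: (trunc_pt_in g0 Tx0 r0).
by apply: (osc_le_trunc g0) => // n y Sy; exact: hw.
Qed.

Lemma net_event_sigma (J : Type) (X : J -> O -> R) (Y : 'rV[R]_k -> O -> R) x0 r a :
  rectangle l h x0 -> 0 < r ->
  (forall x, ball_at x0 r x -> exists j, X j = fun w => Y x w - Y x0 w) ->
  sigma_of X (net_event Y x0 r a).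
Proof.
move=> Tx0 r0 HX; pose GT := g_sigma_algebraType (\bigcup_i preimage_set_system [set: O] (X i) measurable).
pose ok n (g : mesh_index gamma n) := exists2 x, ball_at x0 r x & trunc_pt gamma x0 r n x = mesh_pt x0 r g.
have -> : net_event Y x0 r a = \bigcap_n [set w | forall g : mesh_index gamma n,
    [set w | ok n g -> `|Y (mesh_pt x0 r g) w - Y x0 w| <= a] w].
  apply/seteqP; split => w hw.
    by move=> n _ g [x Sx <-]; exact: hw.
  by move=> n x Sx; have [g eg] := trunc_mesh g0 r0 n Sx; rewrite eg; apply: (hw n I g); exists x.
apply: (@bigcapT_measurable _ GT) => n.
apply: (@measurable_fin_all _ GT (mesh_index gamma n)
  (fun g => [set w | ok n g -> `|Y (mesh_pt x0 r g) w - Y x0 w| <= a])) => g.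
have [[x Sx ex]|nok] := pselect (ok n g); last first.
  rewrite (_ : [set w | _] = setT); first exact: (@measurableT _ GT).
  by apply/seteqP; split => // w _ /nok.
have [j Xj] := HX _ (trunc_pt_in g0 Tx0 r0 n Sx).
rewrite (_ : [set w | _] = X j @^-1` `[- a, a]).
  by apply: sub_sigma_algebra; exists j => //; exists `[- a, a]%classic; rewrite ?setTI//; exact: measurable_itv.
rewrite Xj ex; apply/seteqP; split => w /=; rewrite in_itv /= -ler_norml; first by apply; exists x.
by [].
Qed.

Lemma measurable_net_event (Y : 'rV[R]_k -> O -> R) x0 r a : (forall x, measurable_fun setT (Y x)) ->
  rectangle l h x0 -> 0 < r -> measurable (net_event Y x0 r a).
Proof.
move=> mY Tx0 r0.
apply: (@sigma_of_measurable _ _ R _ (fun x w => Y x w - Y x0 w)).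
  by move=> x; exact: measurable_funB.
by apply: net_event_sigma => // x _; exists x.
Qed.
End net_events.

Section zero_one_law.
Context {d : measure_display} {O : measurableType d} {R : realType}.
Context (P : probability O R).

Lemma sigma_of_lin (I : Type) (X : I -> O -> R) s (U : set R) : measurable U ->
  sigma_of X (lin X s @^-1` U).
Proof.
move=> mU; pose T := g_sigma_algebraType (\bigcup_i preimage_set_system [set: O] (X i) measurable).
have mXT i : measurable_fun [set: T] (X i : T -> R).
  move=> _ B mB; rewrite setTI; apply: sub_sigma_algebra.
  by exists i => //; exists B => //; rewrite setTI.
have ms : measurable_fun [set: T] (lin X s : T -> R) by exact: measurable_lin.
by have := ms measurableT U mU; rewrite setTI.
Qed.

(* [E] is independent of every [X m], hence of the limit [V], hence of itself. *)
Lemma zero_one (I : Type) (V : I -> O -> R) (X : nat -> I -> O -> R) E :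
  (forall i, measurable_fun setT (V i)) -> (forall m i, measurable_fun setT (X m i)) ->
  sigma_of V E -> (forall m A, sigma_of (X m) A -> pr P (A `&` E) = pr P A * pr P E) ->
  (forall i, {ae P, forall w, X m i w @[m --> \oo] --> V i w}) -> pr P E = 0 \/ pr P E = 1.
Proof.
move=> mV mX sE ind XV.
have mE : measurable E by exact: sigma_of_measurable sE.
have linXV s : {ae P, forall w, lin (X m) s w @[m --> \oo] --> lin V s w}.
  elim: s => [|p s IH].
    apply: aeW => w; rewrite /lin big_nil.
    by under eq_fun do rewrite big_nil; exact: cvg_cst.
  apply: filterS2 (XV p.2) IH => w h1 h2; rewrite /lin big_cons.
  by under eq_fun do rewrite big_cons; apply: cvgD => //; exact: cvgMl_tmp.
have mcos (Z : O -> R) th : measurable_fun setT Z -> measurable_fun setT (fun w => cos (Z w + th)).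
  by move=> mZ; case: (@bm_cos _ _ R (fun w => Z w + th)) => //; exact: measurable_funD.
(* For each [m] independence factors the expectation of a cosine of [X m] over [E]; the
   factorization survives the almost sure limit by bounded convergence. *)
have st : same_trig P P V V (\1_E) (fun=> pr P E).
  split; [exact: bm_indic | exact: bm_cst | move=> s th].
  have e m : Ex P (fun w => \1_E w * cos (lin (X m) s w + th)) =
      pr P E * Ex P (fun w => cos (lin (X m) s w + th)).
    rewrite (@Ex_indep _ _ _ P (\1_E) (fun w => cos (lin (X m) s w + th))); first by rewrite pr_indic.
    - exact: bm_indic.
    - by apply: bm_cos; apply: measurable_funD => //; exact: measurable_lin.
    - move=> U mU; rewrite pr_indic//.
      have sU : sigma_of (X m) ((fun w => cos (lin (X m) s w + th)) @^-1` U).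
        have -> : (fun w => cos (lin (X m) s w + th)) @^-1` U =
           lin (X m) s @^-1` ((fun x => cos (x + th)) @^-1` U) by [].
        apply: sigma_of_lin; apply: measurable_preim => //.
        by case: (@bm_cos _ (measurableTypeR R) R (fun x : R => x + th)) => //; exact: measurable_funD.
      rewrite mulrC -(ind m _ sU) -pr_indic; last first.
        apply: measurableI => //; exact: sigma_of_measurable sU.
      by congr Ex; apply/funext => w; rewrite indicI mulrC.
  have bnd (f : O -> R) w : `|\1_E w * cos (f w)| <= 1.
    by rewrite normrM mulr_ile1 ?cos_max// indicE; case: (_ \in _); rewrite ?normr1 ?normr0.
  have cc : continuous (@cos R) by exact: continuous_cos.
  have cv1 : Ex P (fun w => \1_E w * cos (lin (X m) s w + th)) @[m --> \oo] -->
      Ex P (fun w => \1_E w * cos (lin V s w + th)).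
    apply: (@Ex_cvg _ _ _ P _ _ 1).
    - by move=> m; apply: measurable_funM; [exact: measurable_indic | apply: mcos; exact: measurable_lin].
    - by apply: measurable_funM; [exact: measurable_indic | apply: mcos; exact: measurable_lin].
    - by move=> m w; exact: (bnd (fun w => lin (X m) s w + th)).
    - apply: filterS (linXV s) => w hw; apply: cvgMl_tmp.
      by apply: continuous_cvg; [exact: cc | apply: cvgD => //; exact: cvg_cst].
  have cv2 : Ex P (fun w => cos (lin (X m) s w + th)) @[m --> \oo] -->
      Ex P (fun w => cos (lin V s w + th)).
    apply: (@Ex_cvg _ _ _ P _ _ 1).
    - by move=> m; apply: mcos; exact: measurable_lin.
    - by apply: mcos; exact: measurable_lin.
    - by move=> m w; exact: cos_max.
    - apply: filterS (linXV s) => w hw.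
      by apply: continuous_cvg; [exact: cc | apply: cvgD => //; exact: cvg_cst].
  rewrite ExZ; last by apply: bm_L1; apply: bm_cos; apply: measurable_funD => //; exact: measurable_lin.
  have cv3 : Ex P (fun w => \1_E w * cos (lin (X m) s w + th)) @[m --> \oo] -->
      pr P E * Ex P (fun w => cos (lin V s w + th)).
    rewrite (_ : (fun m => _) = (fun m => pr P E * Ex P (fun w => cos (lin (X m) s w + th)))).
      exact: cvgMl_tmp cv2.
    by apply/funext => m; exact: e.
  exact: (cvg_unique _ cv1 cv3).
(* Applied to [E] itself this reads $P(E)=P(E)^2$. *)
have := same_trig_sigma mV st sE.
have -> : (fun w => \1_E w * \1_E w) = \1_E :> (O -> R).
  by apply/funext => w; rewrite indicE; case: (_ \in _); rewrite ?mulr1 ?mulr0.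
rewrite ExZ; last by apply: bm_L1; exact: bm_indic.
rewrite pr_indic// => /eqP; rewrite -subr_eq0 -[X in X - _]mulr1 -mulrBr mulf_eq0.
by move=> /orP[/eqP ->|]; [left | rewrite subr_eq0 => /eqP <-; right].
Qed.
End zero_one_law.

Section borel_cantelli.
Context {d : measure_display} {O : measurableType d} {R : realType}.
Context (P : probability O R).

Lemma borel_cantelli1 (B : nat -> set O) (a : nat -> R) n0 M : (forall n, measurable (B n)) ->
  (forall n, 0 <= a n) -> (forall n, (n0 <= n)%N -> pr P (B n) <= a n) ->
  (forall N, \sum_(n < N) a n <= M) -> {ae P, forall w, exists N, forall n, (N <= n)%N -> ~ B n w}.
Proof.
move=> mB a0 ha hM; pose C n := if (n0 <= n)%N then B n else set0.
have mC n : measurable (C n) by rewrite /C; case: ifP.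
have s0 : P (lim_sup_set C) = 0%E.
  apply: lim_sup_set_cvg0 => //; apply: (@le_lt_trans _ _ M%:E); last exact: ltry.
  apply: lime_le; first by apply: is_cvg_nneseries => n _ _; exact: measure_ge0.
  apply: nearW => N; rewrite big_mkord.
  apply: (@le_trans _ _ (\sum_(n < N) a n)%:E); last by rewrite lee_fin.
  rewrite -sumEFin; apply: lee_sum => n _; rewrite /C; case: ifPn => hn.
    by suff : ((pr P (B n))%:E <= (a n)%:E)%E; [rewrite prE | rewrite lee_fin; exact: ha].
  by suff : (0%E <= (a n)%:E)%E; [rewrite -(measure0 P) | rewrite lee_fin].
have mL : measurable (lim_sup_set C).
  by apply: bigcapT_measurable => n; apply: bigcup_measurable => j _; exact: mC.
exists (lim_sup_set C); split => // w nw n _; apply: contrapT => h; apply: nw.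
exists (maxn n n0) => m; rewrite geq_max => /andP[m1 m2] Bm; apply: h.
by exists m => //; rewrite /C m2.
Qed.

(** The induction runs on squares because $\prod(1-1/(2m))$ decays like a square root: the
    inequality $(1-1/(2m))^2/m\le1/(m+1)$ closes it at $N/(N+K)$, which tends to 0. *)
Lemma borel_cantelli2 (A : nat -> set O) n0 : (forall n, measurable (A n)) ->
  (forall N K, pr P (\big[setI/setT]_(i < K) (~` A (N + i)%N) `&` ~` A (N + K)%N) =
     pr P (\big[setI/setT]_(i < K) (~` A (N + i)%N)) * pr P (~` A (N + K)%N)) ->
  (forall n, (n0 < n)%N -> (2 * n%:R)^-1 <= pr P (A n)) ->
  {ae P, forall w, forall N, exists2 n, (N <= n)%N & A n w}.
Proof.
move=> mA ind hA; apply/ae_foralln => N0.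
pose N := (maxn N0 n0).+1.
have mK K : measurable (\big[setI/setT]_(i < K) (~` A (N + i)%N)).
  by apply: bigsetI_measurable => // i _; exact: measurableC.
have sq K : pr P (\big[setI/setT]_(i < K) (~` A (N + i)%N)) ^+ 2 <= N%:R / (N + K)%:R.
  elim: K => [|K IH].
    rewrite big_ord0 addn0 divff ?pnatr_eq0// expr_le1// ?pr_ge0// pr_le1//.
  rewrite big_ord_recr /= ind exprMn.
  apply: le_trans (ler_wpM2r (sqr_ge0 _) IH) _.
  have m0 : 0 < (N + K)%:R :> R by rewrite ltr0n addSn.
  have q : pr P (~` A (N + K)%N) <= 1 - (2 * (N + K)%:R)^-1.
    by rewrite prC// lerD2l lerN2 hA// /N addSn ltnS (leq_trans (leq_maxr N0 n0))// leq_addr.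
  have N0' : 0 <= N%:R :> R by [].
  rewrite -mulrA ler_wpM2l//.
  have h2 : pr P (~` A (N + K)%N) ^+ 2 <= (1 - (2 * (N + K)%:R)^-1) ^+ 2.
    by rewrite ler_sqr ?nnegrE ?pr_ge0// (le_trans _ q)// pr_ge0.
  apply: le_trans (ler_wpM2l _ h2) _; first by rewrite invr_ge0 ltW.
  rewrite addnS -natr1; move: m0; set m : R := (N + K)%:R => m0.
  rewrite -subr_ge0 (_ : _ - _ = (3 * m - 1) / (4 * m ^+ 3 * (m + 1))); last first.
    by field; rewrite !gt_eqF//; lra.
  have m1 : 1 <= m by rewrite /m ler1n addSn.
  by rewrite divr_ge0 ?mulr_ge0 ?exprn_ge0//; lra.
pose Z := \bigcap_(i in setT) (~` A (N + i)%N).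
have mZ : measurable Z by apply: bigcapT_measurable => i; exact: measurableC.
have Z0 : pr P Z = 0.
  apply: le_anti; rewrite pr_ge0 andbT leNgt; apply/negP => zp.
  have hz K : pr P Z ^+ 2 <= N%:R / (N + K)%:R.
    apply: le_trans (sq K); rewrite ler_sqr ?nnegrE ?pr_ge0//; apply: pr_le => //.
    by rewrite -(bigcap_mkord K (fun i => ~` A (N + i)%N)) => w hw i _; exact: hw.
  have zz : 0 < pr P Z ^+ 2 by rewrite exprn_gt0.
  pose K := (Num.truncn (N%:R / pr P Z ^+ 2)).+1.
  have := hz K; rewrite ler_pdivlMr ?ltr0n ?addSn// mulrC -ler_pdivlMr//.
  have /andP[_ t2] := truncn_itv (divr_ge0 (ler0n R N) (ltW zz)).
  rewrite leNgt => /negP; apply; apply: lt_le_trans t2 _.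
  by rewrite ler_nat; apply: leqW; exact: leq_addl.
exists Z; split => //; first by suff : (pr P Z)%:E = 0%E :> \bar R; [rewrite prE | rewrite Z0].
move=> w nw i _ Aw; apply: nw; exists (N + i)%N => //.
by rewrite /N addSn; apply: leqW; apply: leq_trans (leq_addr _ _); exact: leq_maxl.
Qed.
End borel_cantelli.

(** Telescoping against $(p-1)^{-1}n^{1-p}$ replaces the comparison with an integral. *)
Lemma sum_powR_le {R : realType} (p : R) N : 1 < p -> \sum_(n < N) n.+1%:R `^ (- p) <= 1 + (p - 1)^-1 :> R.
Proof.
move=> p1; have s0 : 0 < p - 1 by lra.
have si : 0 < (p - 1)^-1 by rewrite invr_gt0.
case: N => [|N]; first by rewrite big_ord0; lra.
rewrite big_ord_recl /= powR1 lerD2l.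
suff : \sum_(i < N) (bump 0 i).+1%:R `^ (- p) <= (p - 1)^-1 * (1 - N.+1%:R `^ (- (p - 1))).
  move/le_trans; apply; rewrite ler_piMr ?(ltW si)// lerBlDr lerDl powR_ge0//.
elim: N => [|N IH]; first by rewrite big_ord0 powR1 subrr mulr0.
rewrite big_ord_recr /=; apply: le_trans (lerD IH (lexx _)) _.
rewrite /bump /= add1n.
pose a : R := N.+1%:R; pose b : R := N.+2%:R.
have a0 : 0 < a by rewrite ltr0n.
have ba : b = a + 1 by rewrite /a /b -[in RHS]natr1 -!natr1.
have b0 : 0 < b by rewrite ba; lra.
suff : (p - 1) * b `^ (- p) <= a `^ (- (p - 1)) - b `^ (- (p - 1)).
  rewrite -/a -/b -ler_pdivlMl// => h.
  apply: le_trans (lerD (lexx _) h) _; rewrite -mulrDr le_eqVlt; apply/orP; left; apply/eqP; congr (_ * _); ring.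
have ea (x : R) s : 0 < x -> x `^ s = expR (s * ln x).
  by move=> x0; rewrite /powR gt_eqF.
rewrite !ea//.
have l1 : b^-1 <= ln b - ln a.
  have := expR_ge1Dx (ln a - ln b); rewrite expRD expRN !lnK ?posrE// => h.
  have e : a / b = 1 - b^-1 by rewrite ba; field; rewrite gt_eqF// -ba.
  by move: h; rewrite e; set x := ln a; set y := ln b; set i := b^-1 => h; lra.
have -> : - p * ln b = - (p - 1) * ln b - ln b by ring.
rewrite expRD expRN lnK ?posrE//.
have -> : - (p - 1) * ln a = - (p - 1) * ln b + (p - 1) * (ln b - ln a) by ring.
have l2 : (p - 1) * b^-1 <= (p - 1) * (ln b - ln a) by rewrite ler_pM2l.
move: l2; set t := (p - 1) * (ln b - ln a) => l2; have l3 := expR_ge1Dx t.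
rewrite expRD; set e := expR (- (p - 1) * ln b).
have -> : (p - 1) * (e / b) = e * ((p - 1) * b^-1) by ring.
have -> : e * expR t - e = e * (expR t - 1) by ring.
rewrite ler_wpM2l ?expR_ge0//; apply: le_trans l2 _; rewrite lerBrDl; exact: l3.
Qed.

(** * The normalizing rate and geometric radii *)

Section rate.
Context {R : realType} (Q : R) (Q1 : 1 <= Q).

Definition loglog (r : R) : R := ln (ln r^-1).

Definition rate (r : R) : R := r * loglog r `^ (- Q^-1).

(** Below this radius $\ln(1/r)>e$, so the iterated logarithm exceeds 1 and the rate is positive and
    monotone. *)
Definition rate_domain : R := expR (- expR 1).

Lemma rate_domain_gt0 : 0 < rate_domain. Proof. exact: expR_gt0. Qed.

Let Q0 : 0 < Q. Proof. by rewrite (lt_le_trans ltr01). Qed.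

Lemma ln_inv_gt (r : R) : 0 < r -> r < rate_domain -> expR 1 < ln r^-1.
Proof.
move=> r0 rd; rewrite lnV ?posrE// ltrNr -(expRK (- expR 1)) ltr_ln ?posrE//; exact: expR_gt0.
Qed.

Lemma loglog_gt1 r : 0 < r -> r < rate_domain -> 1 < loglog r.
Proof.
move=> r0 rd; have h := ln_inv_gt r0 rd.
by rewrite /loglog -(expRK 1) ltr_ln ?posrE ?expR_gt0// (lt_trans (expR_gt0 1)).
Qed.

Lemma loglog_anti r r' : 0 < r -> r <= r' -> r' < rate_domain -> loglog r' <= loglog r.
Proof.
move=> r0 rr rd; have r'0 : 0 < r' by exact: lt_le_trans rr.
have h := ln_inv_gt r'0 rd; have h' := ln_inv_gt r0 (le_lt_trans rr rd).
have e0 := expR_gt0 (1 : R).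
rewrite /loglog ler_ln ?posrE ?(lt_trans e0)//.
by rewrite ler_ln ?posrE ?invr_gt0// lef_pV2 ?posrE.
Qed.

Lemma rate_gt0 r : 0 < r -> r < rate_domain -> 0 < rate r.
Proof.
move=> r0 rd; rewrite mulr_gt0// powR_gt0// (lt_trans ltr01)//; exact: loglog_gt1.
Qed.

Lemma rate_mono r r' : 0 < r -> r <= r' -> r' < rate_domain -> rate r <= rate r'.
Proof.
move=> r0 rr rd; have r'0 : 0 < r' by exact: lt_le_trans rr.
have l' : 0 < loglog r' by rewrite (lt_trans ltr01)//; exact: loglog_gt1.
have l : 0 < loglog r by apply: lt_le_trans (loglog_anti r0 rr rd).
apply: ler_pM => //; first exact: ltW.
  exact: powR_ge0.
rewrite !powRN lef_pV2 ?posrE ?powR_gt0//.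
by apply: ge0_ler_powR; rewrite ?nnegrE ?invr_ge0 ?(ltW Q0) ?(ltW l) ?(ltW l')//; exact: loglog_anti.
Qed.

(** Turns a small ball bound at level [c * rate r] into a power of $\ln(1/r)$. *)
Lemma rate_powQ r c : 0 < r -> r < rate_domain -> 0 < c ->
  (r / (c * rate r)) `^ Q = loglog r / c `^ Q.
Proof.
move=> r0 rd c0; have l0 : 0 < loglog r by rewrite (lt_trans ltr01)//; exact: loglog_gt1.
have -> : r / (c * rate r) = loglog r `^ Q^-1 / c.
  rewrite /rate powRN; field.
  by rewrite !gt_eqF// powR_gt0.
rewrite powRM ?powR_ge0 ?invr_ge0 ?(ltW c0)// -powRrM mulVf ?gt_eqF// powRr1 ?(ltW l0)//.
congr (_ * _); rewrite -[c^-1](powR_inv1 (ltW c0)) -powRrM mulN1r powRN; congr (_ ^-1).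
Qed.

Lemma rate_ratio_le r c e : 0 < r -> r < rate_domain -> 0 < c -> 0 < e -> (c / e) `^ Q < loglog r ->
  c * rate r / r < e.
Proof.
move=> r0 rd c0 e0 h; have l0 : 0 < loglog r by rewrite (lt_trans ltr01)//; exact: loglog_gt1.
have -> : c * rate r / r = c * (loglog r `^ Q^-1)^-1.
  by rewrite /rate powRN; field; rewrite !gt_eqF// powR_gt0.
rewrite ltr_pdivrMr ?powR_gt0// mulrC -ltr_pdivrMr//.
have ce : 0 <= c / e by rewrite divr_ge0// ltW.
have := @gt0_ltr_powR _ Q^-1 _ ((c / e) `^ Q) (loglog r).
rewrite invr_gt0 => /(_ Q0); rewrite !nnegrE powR_ge0 (ltW l0) -powRrM divff ?gt_eqF// powRr1//.
by apply.
Qed.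

Section sequence.
Context (lam : R) (lam1 : 1 < lam).

Definition rseq n : R := (lam ^+ n.+1)^-1.

Let lam0 : 0 < lam. Proof. exact: lt_trans lam1. Qed.

Lemma rseq_gt0 n : 0 < rseq n. Proof. by rewrite invr_gt0 exprn_gt0. Qed.

Lemma rseqS n : rseq n = lam * rseq n.+1.
Proof. by rewrite /rseq [lam ^+ n.+2]exprS invfM mulrA divff ?mul1r// gt_eqF. Qed.

Lemma rseq_anti m n : (m <= n)%N -> rseq n <= rseq m.
Proof.
by move=> mn; rewrite /rseq lef_pV2 ?posrE ?exprn_gt0//; apply: ler_weXn2l => //; exact: ltW.
Qed.

Lemma rseq_lt (e : R) : 0 < e -> \forall n \near \oo, rseq n < e.
Proof.
move=> e0; have : (lam^-1) ^+ n @[n --> \oo] --> (0 : R).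
  by apply: cvg_expr; rewrite ger0_norm ?invr_ge0 ?(ltW lam0)// invf_lt1.
move=> /cvgr_lt /(_ e e0) [N _ hN]; exists N => // n /= nN.
by rewrite /rseq -exprVn; apply: hN => /=; exact: leqW.
Qed.

Lemma ln_rseq n : ln (rseq n)^-1 = n.+1%:R * ln lam.
Proof. by rewrite /rseq invrK lnXn// mulr_natl. Qed.

Lemma loglog_rseq_gt (K : R) : \forall n \near \oo, K < loglog (rseq n).
Proof.
have l0 : 0 < ln lam by exact: ln_gt0.
have [N _ hN] := nbhs_infty_gtr (expR K / ln lam).
exists N => // n nN; rewrite /loglog ln_rseq.
have : expR K / ln lam < n%:R by exact: hN.
rewrite ltr_pdivrMr// => h.
have h2 : expR K < n.+1%:R * ln lam by apply: lt_le_trans h _; rewrite ler_wpM2r ?(ltW l0)// ler_nat.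
by rewrite -(expRK K) ltr_ln ?posrE ?expR_gt0// (lt_trans (expR_gt0 K)).
Qed.

(** One step divides the radius by [lam], while the iterated logarithm grows by at most $\ln2$,
    hence eventually by at most a factor [lam]; its power $1/Q\le1$ costs no more. *)
Lemma rate_rseq_ratio : \forall n \near \oo, rate (rseq n) <= lam ^+ 2 * rate (rseq n.+1).
Proof.
have aux (a L : R) : a < L * (lam - 1) -> a + L <= lam * L by move=> ?; lra.
have lam10 : 0 < lam - 1 by rewrite subr_gt0.
near=> n.
have rd : rseq n < rate_domain by near: n; apply: rseq_lt; exact: rate_domain_gt0.
have L1 : ln 2 / (lam - 1) < loglog (rseq n) by near: n; exact: loglog_rseq_gt.
have rd' : rseq n.+1 < rate_domain by apply: le_lt_trans rd; exact: rseq_anti.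
have l1 := loglog_gt1 (rseq_gt0 n) rd; have l2 := loglog_gt1 (rseq_gt0 n.+1) rd'.
have l10 := lt_trans ltr01 l1; have l20 := lt_trans ltr01 l2.
have ll0 : 0 < ln lam by exact: ln_gt0.
have h : loglog (rseq n.+1) <= lam * loglog (rseq n).
  apply: (@le_trans _ _ (ln 2 + loglog (rseq n))).
    rewrite /loglog !ln_rseq -lnM ?posrE ?mulr_gt0// ler_ln ?posrE ?mulr_gt0//.
    by rewrite mulrA ler_wpM2r ?(ltW ll0)// -natrM ler_nat mul2n -addnn addSn ltnS leq_addl.
  by apply: aux; rewrite -ltr_pdivrMr.
rewrite /rate [X in X * _ <= _]rseqS expr2 -!mulrA ler_pM2l// [leRHS]mulrCA ler_pM2l ?rseq_gt0//.
rewrite !powRN -ler_pdivrMl// -invfM lef_pV2 ?posrE ?powR_gt0 ?mulr_gt0 ?powR_gt0//.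
apply: (@le_trans _ _ ((lam * loglog (rseq n)) `^ Q^-1)).
  by apply: ge0_ler_powR; rewrite ?nnegrE ?invr_ge0 ?(ltW Q0) ?(ltW l20) ?mulr_ge0 ?(ltW lam0) ?(ltW l10).
rewrite powRM ?(ltW lam0) ?(ltW l10)// ler_wpM2r ?powR_ge0//.
by rewrite ler1_powR ?(ltW lam1)// invf_le1.
Unshelve. all: by end_near. Qed.

Lemma rseq_bracket N r : 0 < r -> r < rseq N -> exists2 n, (N <= n)%N & rseq n.+1 <= r <= rseq n.
Proof.
move=> r0 rN.
have ex : exists n, rseq n.+1 <= r.
  have [m _ hm] := rseq_lt r0; exists m; apply: ltW; apply: hm => /=; exact: leqW.
case: (ex_minnP ex) => n hn hmin; exists n.
  rewrite leqNgt; apply/negP => nN; have := rseq_anti nN; rewrite leNgt => /negP; apply.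
  exact: le_lt_trans hn rN.
rewrite hn /=; case: n hn hmin => [|n] hn hmin.
  by apply: ltW; apply: lt_le_trans rN _; exact: rseq_anti.
rewrite leNgt; apply/negP => h; have := hmin n (ltW h); by rewrite ltnn.
Qed.
End sequence.

Lemma liminf_right_ge (g : R -> \bar R) c (e : R) : 0 < e ->
  (forall r, 0 < r -> r < e -> (c <= g r)%E) -> (c <= limf_einf g (0 : R)^'+)%E.
Proof.
move=> e0 h; rewrite /limf_einf leeNr.
pose A := [set r : R | 0 < r < e].
apply: (@le_trans _ _ (ereal_sup [set (- g x)%E | x in A])).
  apply: ereal_inf_lbound; exists A => //; rewrite /at_right /within /=.
  apply/nbhs_ballP; exists e => //= r; rewrite /ball /= sub0r normrN => re r0.
  by rewrite /A /= r0 /=; move: re; rewrite gtr0_norm.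
apply: ge_ereal_sup => _ [r /andP[r0 re] <-].
by rewrite leeN2; exact: h.
Qed.

Lemma liminf_right_le (g : R -> \bar R) c :
  (forall e : R, 0 < e -> exists2 r, 0 < r < e & (g r <= c)%E) -> (limf_einf g (0 : R)^'+ <= c)%E.
Proof.
move=> h; rewrite /limf_einf leeNl; apply: le_ereal_inf_tmp => _ [A FA <-].
move: FA; rewrite /at_right /within /= => /nbhs_ballP[e /= e0 hA].
have [r /andP[r0 re] gr] := h e e0.
apply: (@le_trans _ _ (- g r)%E); first by rewrite leeN2.
apply: ereal_sup_ubound; exists r => //; apply: hA => //.
by rewrite /ball /= sub0r normrN gtr0_norm.
Qed.

(** A radius between two terms of the sequence is compared with the smaller one for the numerator
    and with the larger one for the rate; the mismatch is the factor $\lambda^2$, absorbed in the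
    gap between [c] and [c1]. *)
Lemma liminf_from_seq (M : R -> \bar R) lam c c1 : 1 < lam -> 0 < c -> lam ^+ 2 * c <= c1 ->
  (forall r r', 0 < r -> r <= r' -> (M r <= M r')%E) ->
  (exists N, forall n, (N <= n)%N -> ((c1 * rate (rseq lam n))%:E <= M (rseq lam n))%E) ->
  (c%:E <= limf_einf (fun r => M r * (rate r)^-1%:E)%E (0 : R)^'+)%E.
Proof.
move=> lam1 c0 cc1 mM [N hN].
have [N1 _ h1] := rate_rseq_ratio lam1.
have [N2 _ h2] := rseq_lt lam1 rate_domain_gt0.
pose N' := maxn N (maxn N1 N2).
apply: (@liminf_right_ge _ _ (rseq lam N')); first exact: rseq_gt0.
move=> r r0 rN; have [n nN /andP[b1 b2]] := rseq_bracket lam1 r0 rN.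
have /and3P[n0 n1 n2] : [&& N <= n, N1 <= n & N2 <= n]%N by rewrite -!geq_max.
have rd : rseq lam n < rate_domain by exact: h2.
have rr := le_lt_trans b2 rd.
rewrite lee_pdivlMr ?rate_gt0// -EFinM.
apply: le_trans (mM _ _ (rseq_gt0 lam1 n.+1) b1).
apply: le_trans (hN n.+1 (leqW n0)); rewrite lee_fin.
apply: (@le_trans _ _ (c * rate (rseq lam n))); first by rewrite ler_pM2l// rate_mono.
apply: (@le_trans _ _ (c * (lam ^+ 2 * rate (rseq lam n.+1)))); first by rewrite ler_pM2l//; exact: h1.
rewrite mulrA [c * _]mulrC ler_wpM2r// ltW// rate_gt0 ?rseq_gt0//.
apply: le_lt_trans rd; exact: rseq_anti.
Qed.

End rate.

(** One term of the exponential series is kept, of order high enough for its power of $n+1$ to be at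
    least 2. *)
Lemma poly_expR_bounded {R : realType} (eta a : R) : 0 < eta -> 0 < a -> exists2 K : R, 0 < K &
  forall n : nat, n.+1%:R ^+ 2 * expR (- (eta * n.+1%:R `^ a)) <= K.
Proof.
move=> eta0 a0.
pose N := (Num.truncn (2 / a)).+1.
have aN : 2 <= a * N.+1%:R.
  have /andP[_ t2] := truncn_itv (divr_ge0 (ler0n R 2) (ltW a0)).
  rewrite mulrC -ler_pdivrMr//; apply: le_trans (ltW t2) _; by rewrite ler_nat.
exists (N.+1`!%:R / eta ^+ N.+1); first by rewrite divr_gt0 ?exprn_gt0// ltr0n fact_gt0.
move=> n; set m : R := n.+1%:R; have m1 : 1 <= m by rewrite ler1n.
have x0 : 0 <= eta * m `^ a by rewrite mulr_ge0 ?powR_ge0// ltW.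
have h := expR_ge1Dxn N x0.
have f0 : 0 < N.+1`!%:R :> R by rewrite ltr0n fact_gt0.
have h2 : (eta * m `^ a) ^+ N.+1 <= N.+1`!%:R * expR (eta * m `^ a).
  rewrite -ler_pdivrMl// mulrC; lra.
have h3 : m ^+ 2 <= (m `^ a) ^+ N.+1.
  have -> : (m `^ a) ^+ N.+1 = m `^ (a * N.+1%:R) by rewrite powRrM powR_mulrn ?powR_ge0.
  have -> : m ^+ 2 = m `^ 2%:R by rewrite powR_mulrn// (le_trans ler01).
  by apply: ler_powR.
rewrite expRN -ler_pdivlMr ?invr_gt0 ?expR_gt0// invrK.
rewrite mulrAC ler_pdivlMr ?exprn_gt0//.
by apply: le_trans h2; rewrite exprMn mulrC ler_pM2l ?exprn_gt0.
Qed.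

Section excess_bounds.
Context {d : measure_display} {O : measurableType d} {R : realType}.
Context (P : probability O R) (H : set (O -> R)) (gH : gspace P H).
Context {k : nat} (gamma : 'I_k -> R) (g0 : forall j, 0 < gamma j) (k0 : (0 < k)%N).
Context (l h x0 : 'rV[R]_k) (Tx0 : rectangle l h x0).
Local Notation zz := (Num.sqrt root_half : R).

Lemma zz_bounds : 0 < zz < 1.
Proof.
have /andP[z1 z2] := @root_half_bounds R; have z0 := @root_half_gt0 R.
by rewrite sqrtr_gt0 z0 /= -[ltRHS]sqrtr1 ltr_sqrt.
Qed.

Definition chain_total : R := 2 / (1 - zz).

Lemma chain_total_gt0 : 0 < chain_total.
Proof. by have /andP[? ?] := zz_bounds; rewrite divr_gt0// subr_gt0. Qed.

(** The tail bound carries the ratio $s/t$ to the power $4(q+1)$, so a ratio of order $1/n$ already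
    gives probabilities summable in [n]. *)
Lemma net_event_pr (q : nat) (Kc : R) : 2 `^ hom_dim gamma <= 2 ^+ q -> 0 < Kc -> exists2 C, 0 < C &
  forall (Y : 'rV[R]_k -> O -> R) r s t n, 0 < r -> 0 < s -> 0 < t -> s / t <= Kc / n.+1%:R ->
  (forall x, measurable_fun setT (Y x)) ->
  (forall x y, local_ball gamma l h x0 r x -> local_ball gamma l h x0 r y -> H (fun w => Y x w - Y y w)) ->
  (forall m x, local_ball gamma l h x0 r x ->
     ip P (fun w => Y x w - Y (trunc_pt gamma x0 r m x) w)
          (fun w => Y x w - Y (trunc_pt gamma x0 r m x) w) <= (s * root_half ^+ m) ^+ 2) ->
  pr P (~` net_event gamma l h Y x0 r (t * chain_total)) <= C / n.+1%:R ^+ 2.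
Proof.
move=> wq K0; have /andP[zz0 zz1] := zz_bounds.
pose C1 : R := 4 ^+ k * 2 ^+ q * ((4 * Kc ^+ 2) ^+ (2 * q.+1) * (2 * q.+1)`!%:R * 2) * 2.
have C10 : 0 < C1.
  rewrite /C1; apply: mulr_gt0 => //; apply: mulr_gt0; first by rewrite mulr_gt0 ?exprn_gt0.
  by rewrite !mulr_gt0 ?exprn_gt0 ?mulr_gt0 ?exprn_gt0// ltr0n fact_gt0.
exists C1 => // Y r s t n r0 s0 t0 st mY HY vY.
have sub : ~` net_event gamma l h Y x0 r (t * chain_total) `<=`
    @excess d O R k gamma l h x0 r Y (fun n => t * zz ^+ n).
  move=> w nw; apply: contrapT => ne; apply: nw => m x Sx.
  have hl n' f : `|@link d O R k gamma l h x0 r Y n' f w| <= t * zz ^+ n'.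
    by rewrite leNgt; apply/negP => hf; apply: ne; exists n', f.
  apply: le_trans (chain_le g0 Tx0 r0 hl m Sx) _.
  rewrite -mulr_sumr ler_pM2l//.
  have := @geometric_two_sided R zz 0 m; rewrite zz0 zz1 => /(_ isT).
  by under eq_bigr => i _ do rewrite /dist2 sub0n subn0 add0n.
have mE := measurable_excess gH g0 Tx0 r0 HY (fun n => t * zz ^+ n).
apply: (@le_trans _ _ (pr P (@excess d O R k gamma l h x0 r Y (fun n => t * zz ^+ n)))).
  apply: pr_le => //; apply: measurableC; exact: measurable_net_event.
apply: le_trans (sup_tail gH g0 Tx0 r0 HY wq s0 t0 _) _.
  by move=> m f; apply: link_sqr_le; [exact: sqr_ge0 | exact: vY].
have -> : C1 / n.+1%:R ^+ 2 = 4 ^+ k * 2 ^+ q *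
    ((4 * Kc ^+ 2) ^+ (2 * q.+1) / n.+1%:R ^+ 2 * (2 * q.+1)`!%:R * 2) * 2.
  rewrite /C1; set X := (4 * Kc ^+ 2) ^+ _; set Y2 := _^-1; set F := _`!%:R.
  by set Z2 := _ ^+ k * _; rewrite !mulrA -!(mulrAC _ Y2).
suff hX : (4 * (s / t) ^+ 2) ^+ (2 * q.+1) <= (4 * Kc ^+ 2) ^+ (2 * q.+1) / n.+1%:R ^+ 2.
  apply: ler_wpM2r => //; apply: ler_wpM2l; first by rewrite mulr_ge0 ?exprn_ge0.
  by apply: ler_wpM2r => //; apply: ler_wpM2r.
have n1 : 0 < n.+1%:R :> R by [].
have st0 : 0 <= s / t by rewrite divr_ge0// ltW.
have h1 : 4 * (s / t) ^+ 2 <= 4 * Kc ^+ 2 / n.+1%:R ^+ 2.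
  rewrite -mulrA -expr_div_n ler_pM2l// ler_sqr ?nnegrE//; exact: le_trans st.
apply: (@le_trans _ _ ((4 * Kc ^+ 2 / n.+1%:R ^+ 2) ^+ (2 * q.+1))).
  have p1 : 0 <= 4 * (s / t) ^+ 2 by apply: mulr_ge0 => //; exact: sqr_ge0.
  have p2 := le_trans p1 h1.
  by apply: lerXn2r h1; rewrite nnegrE.
rewrite expr_div_n; apply: ler_wpM2l.
  by apply: exprn_ge0; apply: mulr_ge0 => //; exact: sqr_ge0.
rewrite lef_pV2 ?posrE ?exprn_gt0// -[leLHS]expr1; apply: ler_weXn2l => //.
by rewrite exprn_ege1// ler1n.
Qed.
End excess_bounds.

Lemma powR_strict_gap {R : realType} (Q c D : R) : 1 <= Q -> 0 < c -> c `^ Q < D ->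
  exists2 d, c < d & d `^ Q < D.
Proof.
move=> Q1 c0 cD; have Q0 : 0 < Q by exact: lt_le_trans Q1.
have D0 : 0 < D by apply: le_lt_trans cD; exact: powR_ge0.
have Qi : 0 < Q^-1 by rewrite invr_gt0.
have cd : c < D `^ Q^-1.
  have -> : c = (c `^ Q) `^ Q^-1 by rewrite -powRrM divff ?gt_eqF// powRr1// ltW.
  by apply: gt0_ltr_powR; rewrite ?nnegrE ?powR_ge0 ?(ltW D0).
exists ((c + D `^ Q^-1) / 2); first by rewrite ltr_pdivlMr//; lra.
have d0 := powR_gt0 Q^-1 D0.
have {2}-> : D = (D `^ Q^-1) `^ Q by rewrite -powRrM mulVf ?gt_eqF// powRr1// ltW.
apply: gt0_ltr_powR => //; rewrite ?nnegrE ?(ltW d0)//; first by rewrite divr_ge0// ltW// addr_gt0.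
by rewrite ltr_pdivrMr//; lra.
Qed.

Lemma powR_strict_gap_below {R : realType} (Q c D : R) : 1 <= Q -> 0 < c -> 0 < D -> D < c `^ Q ->
  exists c1, [/\ 0 < c1, c1 < c & D < c1 `^ Q].
Proof.
move=> Q1 cp D0 Dc; have Q0 : 0 < Q by exact: lt_le_trans Q1.
have q : 0 < D `^ Q^-1 by exact: powR_gt0.
have DQ : (D `^ Q^-1) `^ Q = D by rewrite -powRrM mulVf ?gt_eqF// powRr1// ltW.
have qc : D `^ Q^-1 < c.
  have -> : c = (c `^ Q) `^ Q^-1 by rewrite -powRrM divff ?gt_eqF// powRr1// ltW.
  by apply: gt0_ltr_powR; rewrite ?nnegrE ?powR_ge0 ?(ltW D0) ?invr_gt0.
exists ((D `^ Q^-1 + c) / 2); split.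
- by rewrite divr_gt0 ?addr_gt0.
- by rewrite ltr_pdivrMr//; lra.
- rewrite -{1}DQ; apply: gt0_ltr_powR; rewrite ?nnegrE ?(ltW q)//.
    by rewrite divr_ge0// ltW// addr_gt0.
  by rewrite ltr_pdivlMr//; lra.
Qed.

Section liminf.
Context {d : measure_display} {O : measurableType d} {R : realType}.
Context (P : probability O R).
Context {k : nat} (gamma : 'I_k -> R) (g0 : forall j, 0 < gamma j) (k0 : (0 < k)%N).
Context (l h : 'rV[R]_k) (v : 'rV[R]_k -> {RV P >-> R}).
Context (cv : forall w, continuous (fun x => v x w)).
Context (x0 : 'rV[R]_k) (Tx0 : rectangle l h x0).
Local Notation Q := (hom_dim gamma).
Local Notation vf := (fun x => v x : O -> R).

Definition lower_limit w : \bar R := limf_einf (chung_ratio gamma (rectangle l h) v x0 w) (0 : R)^'+.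

Definition local_osc w (r : R) : \bar R := osc (local_ball gamma l h x0 r) (fun x => v x w) x0.

Lemma chung_ratioE w : chung_ratio gamma (rectangle l h) v x0 w =
  (fun r => local_osc w r * (rate Q r)^-1%:E)%E.
Proof. by []. Qed.

Lemma local_osc_mono w r r' : r <= r' -> (local_osc w r <= local_osc w r')%E.
Proof.
move=> rr; apply: le_ereal_sup => _ [y [Ty ry] <-].
exists y => //; split => //; exact: le_trans rr.
Qed.

Let Q1 : 1 <= Q. Proof. exact: hom_dim_ge1. Qed.

Let mv x : measurable_fun setT (vf x). Proof. by []. Qed.

Lemma lil_lower D e c : 0 < D -> 0 < e ->
  (forall r u, 0 < r -> r < e -> 0 < u -> u / r < e ->
     pr P (osc_event gamma l h vf x0 r u) <= expR (- (D * (r / u) `^ Q))) ->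
  0 < c -> c `^ Q < D -> {ae P, forall w, (c%:E <= lower_limit w)%E}.
Proof.
move=> D0 e0 hD c0 cD; have [c1 cc1 c1D] := powR_strict_gap Q1 c0 cD.
have c10 : 0 < c1 by exact: lt_trans cc1.
(* The ratio of the radii is tied to the slack: [lam ^+ 2 * c] equals [c1], as [liminf_from_seq]
   demands. *)
pose lam : R := Num.sqrt (c1 / c).
have cc : 0 < c1 / c by rewrite divr_gt0.
have lam2 : lam ^+ 2 = c1 / c by rewrite sqr_sqrtr// ltW.
have lam1 : 1 < lam by rewrite -[ltLHS]sqrtr1 ltr_sqrt// ltr_pdivlMr// mul1r.
have ll0 : 0 < ln lam by exact: ln_gt0.
(* The probability at the [n]-th radius is eventually at most $((n+1)\ln\lambda)^{-p}$, and $p>1$ by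
   the choice of [c1]. *)
pose p := D / c1 `^ Q.
have cQ : 0 < c1 `^ Q by exact: powR_gt0.
have p1 : 1 < p by rewrite ltr_pdivlMr// mul1r.
pose r n := rseq lam n.
pose A n := osc_event gamma l h vf x0 (r n) (c1 * rate Q (r n)).
have r0 n : 0 < r n by exact: rseq_gt0.
have mA n : measurable (A n) by exact: (measurable_osc_event g0 mv cv).
have [N1 _ h1] := rseq_lt lam1 e0.
have [N2 _ h2] := rseq_lt lam1 (@rate_domain_gt0 R).
have [N3 _ h3] := loglog_rseq_gt lam1 ((c1 / e) `^ Q).
pose a n := (ln lam) `^ (- p) * n.+1%:R `^ (- p).
have bc : {ae P, forall w, exists N, forall n, (N <= n)%N -> ~ A n w}.
  apply: (@borel_cantelli1 _ _ _ P A a (maxn N1 (maxn N2 N3)) ((ln lam) `^ (- p) * (1 + (p - 1)^-1))).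
  - exact: mA.
  - by move=> n; rewrite mulr_ge0 ?powR_ge0.
  - move=> n; rewrite !geq_max => /and3P[n1 n2 n3].
    have rd : r n < rate_domain by exact: h2.
    have re := h1 n n1; have Ln := h3 n n3.
    apply: le_trans (hD _ _ (r0 n) re _ _) _; first by rewrite mulr_gt0// rate_gt0.
      by apply: rate_ratio_le.
    rewrite rate_powQ// /a -powRM ?(ltW ll0)// {2}/powR gt_eqF ?mulr_gt0//.
    have -> : loglog (r n) = ln (ln lam * n.+1%:R) by rewrite /loglog /r ln_rseq// [in LHS]mulrC.
    by rewrite mulNr /p mulrAC mulrA.
  - move=> N; rewrite -mulr_sumr ler_wpM2l ?powR_ge0//; exact: sum_powR_le.
apply: filterS bc => w [N hN].
apply: (@liminf_from_seq _ Q Q1 (local_osc w) lam c c1) => //.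
- by rewrite lam2 mulfVK// gt_eqF.
- by move=> r1 r2 _; exact: local_osc_mono.
- exists N => n nN; apply: ltW; rewrite ltNge; apply/negP; exact: hN.
Qed.
End liminf.

Section almost_sure.
Context {d : measure_display} {O : measurableType d} {R : realType}.
Context (P : probability O R).

Lemma ae_countable (J : countType) (A : J -> O -> Prop) : (forall j, {ae P, forall w, A j w}) ->
  {ae P, forall w, forall j, A j w}.
Proof.
move=> hA.
have hn : {ae P, forall w, forall n : nat, oapp (A^~ w) True (unpickle n)}.
  by apply/ae_foralln => n; case: (unpickle n) => [j|] /=; [exact: hA | exact: aeW].
by apply: filterS hn => w hw j; have := hw (pickle j); rewrite pickleK.
Qed.

Lemma pr_ae_eq (A B : set O) : measurable A -> measurable B -> {ae P, forall w, A w <-> B w} -> pr P A = pr P B.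
Proof.
move=> mA mB h; rewrite -!pr_indic//; apply: Ex_eq_ae; [exact: measurable_indic|exact: measurable_indic|].
apply: filterS h => w hw; rewrite !indicE; congr (_%:R); congr nat_of_bool.
by apply/idP/idP; rewrite !inE => /hw.
Qed.

Lemma pr_ae_le (A B : set O) : measurable A -> measurable B -> {ae P, forall w, A w -> B w} -> pr P A <= pr P B.
Proof.
move=> mA mB h; rewrite (@pr_ae_eq A (A `&` B)) //; last 2 first.
- exact: measurableI.
- by apply: filterS h => w hw; split => [Aw|[]//]; split=> //; exact: hw.
- by apply: pr_le => //; exact: measurableI.
Qed.

Lemma pr_eq1_ae (A : set O) : measurable A -> pr P A = 1 -> {ae P, forall w, A w}.
Proof.
move=> mA A1; exists (~` A); split => //; first exact: measurableC.
suff : (pr P (~` A))%:E = 0%E :> \bar R by rewrite prE//; exact: measurableC.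
by rewrite prC// A1 subrr.
Qed.
End almost_sure.

Section local_nets.
Context {d : measure_display} {O : measurableType d} {R : realType}.
Context (P : probability O R).
Context {k : nat} (gamma : 'I_k -> R) (g0 : forall j, 0 < gamma j) (k0 : (0 < k)%N).
Context (l h : 'rV[R]_k) (x0 : 'rV[R]_k) (Tx0 : rectangle l h x0).
Local Notation ball_at := (local_ball gamma l h x0).
Local Notation Q := (hom_dim gamma).

Lemma ae_net (A : 'rV[R]_k -> O -> Prop) r : 0 < r -> (forall x, rectangle l h x -> {ae P, forall w, A x w}) ->
  {ae P, forall w, forall n x, ball_at r x -> A (trunc_pt gamma x0 r n x) w}.
Proof.
move=> r0 hA.
have hn : {ae P, forall w, forall n, forall g : mesh_index gamma n,
    rectangle l h (mesh_pt x0 r g) -> A (mesh_pt x0 r g) w}.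
  apply/ae_foralln => n; apply: ae_countable => g.
  have [Tg|nTg] := pselect (rectangle l h (mesh_pt x0 r g)); last by apply: aeW => w /nTg.
  by apply: filterS (hA _ Tg) => w hw _.
apply: filterS hn => w hw n x Sx; have [g eg] := trunc_mesh g0 r0 n Sx.
by rewrite eg; apply: hw; rewrite -eg; case: (trunc_pt_in g0 Tx0 r0 n Sx).
Qed.

Lemma net_eventually (H : set (O -> R)) (Y : nat -> 'rV[R]_k -> O -> R) (r s t : nat -> R) (Kc : R) n0 :
  gspace P H -> 0 < Kc ->
  (forall n, 0 < r n) -> (forall n x, measurable_fun setT (Y n x)) ->
  (forall n x y, rectangle l h x -> rectangle l h y -> H (fun w => Y n x w - Y n y w)) ->
  (forall n, (n0 <= n)%N -> [/\ 0 < s n, 0 < t n & s n / t n <= Kc / n.+1%:R]) ->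
  (forall n m x, (n0 <= n)%N -> ball_at (r n) x ->
     ip P (fun w => Y n x w - Y n (trunc_pt gamma x0 (r n) m x) w)
          (fun w => Y n x w - Y n (trunc_pt gamma x0 (r n) m x) w) <= (s n * root_half ^+ m) ^+ 2) ->
  (exists2 C, 0 < C & forall n, (n0 <= n)%N ->
     pr P (~` net_event gamma l h (Y n) x0 (r n) (t n * chain_total)) <= C / n.+1%:R ^+ 2) /\
  {ae P, forall w, exists N, forall n, (N <= n)%N ->
     net_event gamma l h (Y n) x0 (r n) (t n * chain_total) w}.
Proof.
move=> gH K0 r0 mY HY hst hl.
have [q wq] : exists q : nat, 2 `^ Q <= 2 ^+ q.
  have Q0 : 0 <= Q by exact: le_trans (hom_dim_ge1 g0 k0).
  exists (Num.truncn Q).+1; rewrite -powR_mulrn//; apply: ler_powR; first by rewrite ler1n.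
  by apply: ltW; have /andP[] := truncn_itv Q0.
have [C C0 hC] := net_event_pr gH g0 Tx0 wq K0.
have hp n : (n0 <= n)%N ->
    pr P (~` net_event gamma l h (Y n) x0 (r n) (t n * chain_total)) <= C / n.+1%:R ^+ 2.
  move=> nn; have [s0 t0 st] := hst n nn; apply: (hC _ (r n) (s n)) => //.
    by move=> x y [Tx _] [Ty _]; exact: HY.
  by move=> m x; exact: hl.
split; first by exists C.
have : {ae P, forall w, exists N, forall n, (N <= n)%N ->
     ~ (~` net_event gamma l h (Y n) x0 (r n) (t n * chain_total)) w}.
  apply: (@borel_cantelli1 _ _ _ P (fun n => ~` net_event gamma l h (Y n) x0 (r n) (t n * chain_total))
    (fun n => C * n.+1%:R `^ (- 2)) n0 (C * (1 + (2 - 1)^-1))).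
  - by move=> n; apply: measurableC; exact: measurable_net_event.
  - by move=> n; rewrite mulr_ge0 ?powR_ge0// ltW.
  - by move=> n nn; rewrite powRN powR_mulrn//; exact: hp.
  - move=> N; rewrite -mulr_sumr ler_wpM2l ?(ltW C0)//; apply: sum_powR_le; lra.
apply: filterS => w [N hN]; exists N => n nN; apply: contrapT; exact: hN.
Qed.
End local_nets.

Lemma ln_le_id {R : realType} (x : R) : 0 < x -> ln x <= x.
Proof. by move=> x0; have := expR_ge1Dx (ln x); rewrite lnK ?posrE//; lra. Qed.

Lemma rate_inv_le {R : realType} (Q r : R) : 1 <= Q -> 0 < r -> r < rate_domain -> r / rate Q r <= loglog r.
Proof.
move=> Q1 r0 rd; have Q0 : 0 < Q by exact: lt_le_trans Q1.
have l1 := loglog_gt1 r0 rd; have l0 := lt_trans ltr01 l1.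
have -> : r / rate Q r = loglog r `^ Q^-1.
  by rewrite /rate powRN; field; rewrite !gt_eqF// powR_gt0.
by rewrite ler1_powR ?(ltW l1)// invf_le1.
Qed.

Lemma loglog_le_ln {R : realType} (r : R) : 0 < r -> r < rate_domain -> loglog r <= ln r^-1.
Proof.
move=> r0 rd; apply: ln_le_id; apply: lt_trans (ln_inv_gt r0 rd); exact: expR_gt0.
Qed.

Lemma weighted_link {R : realType} {k : nat} (gamma : 'I_k -> R) (g0 : forall j, 0 < gamma j)
    (x0 : 'rV[R]_k) (b r : R) m (x : 'rV[R]_k) : 0 <= b -> 0 < r -> b * (2 * r) <= 1 ->
  \sum_j b `^ gamma j * `|x 0 j - trunc_pt gamma x0 r m x 0 j| <=
    k%:R * ((b * (2 * r)) `^ gamma_min gamma * (2 * r)) * root_half ^+ m.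
Proof.
move=> b0 r0 br; pose rho := 2 * r / 2 ^+ m.
have m1 : 1 <= 2 ^+ m :> R by apply: exprn_ege1; rewrite ler1n.
have m0 : 0 < 2 ^+ m :> R by exact: lt_le_trans m1.
have r20 : 0 < 2 * r by rewrite mulr_gt0.
have rho0 : 0 <= rho by rewrite divr_ge0// ltW.
have rr : rho <= 2 * r by rewrite ler_pdivrMr// ler_peMr// ltW.
have brho : b * rho <= b * (2 * r) by rewrite ler_wpM2l.
apply: le_trans (weighted_le g0 b0 rho0 (le_trans brho br) _) _.
  by move=> j; exact: trunc_pt_coord.
rewrite -mulrA ler_wpM2l// -mulrA; apply: ler_pM => //; first exact: powR_ge0.
  by apply: ge0_ler_powR; rewrite ?nnegrE ?mulr_ge0 ?(ltW r20)// ltW// gamma_min_gt0.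
rewrite /rho ler_pM2l// -exprVn; apply: lerXn2r; rewrite ?nnegrE ?invr_ge0 ?(ltW root_half_gt0)//.
by case/andP: (@root_half_bounds R).
Qed.

(** Along geometric radii the extra power $r^g$ decays exponentially in [n], whereas $r$ divided by
    the rate is at most $\ln(1/r)$, linear in [n]. *)
Lemma geometric_beats_rate {R : realType} (Q lam g b delta c : R) : 1 <= Q -> 1 < lam -> 0 < g -> 0 < b ->
  0 < delta -> 0 < c -> exists2 Kc : R, 0 < Kc & \forall n \near \oo,
   [/\ rseq lam n < rate_domain, b * (2 * rseq lam n) <= 1,
   0 < c * ((b * (2 * rseq lam n)) `^ g * (2 * rseq lam n)), 0 < delta * rate Q (rseq lam n) &
   c * ((b * (2 * rseq lam n)) `^ g * (2 * rseq lam n)) / (delta * rate Q (rseq lam n)) <= Kc / n.+1%:R].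
Proof.
move=> Q1 lam1 g0 b0 d0 c0; have ll0 : 0 < ln lam by exact: ln_gt0.
have [K K0 hK] := @poly_expR_bounded R (g * ln lam) 1 (mulr_gt0 g0 ll0) ltr01.
have b2 : 0 < b * 2 by rewrite mulr_gt0.
pose G : R := c * 2 / delta * (b * 2) `^ g * ln lam.
have G0 : 0 < G by rewrite !mulr_gt0 ?invr_gt0 ?powR_gt0.
exists (G * K); first exact: mulr_gt0.
have [N1 _ h1] := rseq_lt lam1 (@rate_domain_gt0 R).
have b2i : 0 < (b * 2)^-1 by rewrite invr_gt0.
have [N2 _ h2] := rseq_lt lam1 b2i.
exists (maxn N1 N2) => // n; rewrite /= geq_max => /andP[n1 n2].
have r0 := rseq_gt0 lam1 n; have rd := h1 n n1; have rb := h2 n n2.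
have ra : 0 < rate Q (rseq lam n) by exact: rate_gt0.
have r20 : 0 < 2 * rseq lam n by rewrite mulr_gt0.
split => //.
- by rewrite mulrA -ler_pdivlMl// mulr1 ltW.
- by rewrite !mulr_gt0 ?powR_gt0 ?mulr_gt0.
- by rewrite mulr_gt0.
have e1 : rseq lam n `^ g = expR (- (g * ln lam * n.+1%:R `^ 1)).
  have lnr : ln (rseq lam n) = - (n.+1%:R * ln lam).
    by rewrite -(ln_rseq lam1) lnV ?posrE// opprK.
  by rewrite [LHS]/powR gt_eqF// lnr powRr1//; congr expR; ring.
have -> : (b * (2 * rseq lam n)) `^ g = (b * 2) `^ g * rseq lam n `^ g.
  by rewrite mulrA powRM ?(ltW b2) ?(ltW r0).
rewrite e1.
have := hK n; set X := expR _ => hX.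
have X0 : 0 < X by exact: expR_gt0.
have hr := le_trans (rate_inv_le Q1 r0 rd) (loglog_le_ln r0 rd); rewrite (ln_rseq lam1) in hr.
have -> : c * ((b * 2) `^ g * X * (2 * rseq lam n)) / (delta * rate Q (rseq lam n)) =
    c * 2 / delta * (b * 2) `^ g * X * (rseq lam n / rate Q (rseq lam n)).
  by field; rewrite !gt_eqF.
apply: (@le_trans _ _ (c * 2 / delta * (b * 2) `^ g * X * (n.+1%:R * ln lam))).
  by rewrite ler_pM2l// !mulr_gt0 ?invr_gt0 ?powR_gt0.
rewrite ler_pdivlMr//.
have -> : c * 2 / delta * (b * 2) `^ g * X * (n.+1%:R * ln lam) * n.+1%:R = G * (n.+1%:R ^+ 2 * X).
  by rewrite /G; ring.
by rewrite ler_pM2l.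
Qed.

(** * Zero-one dichotomy for the lower limit *)

Section dichotomy.
Context {d : measure_display} {Omega : measurableType d} {R : realType}.
Context (P : probability Omega R) {k : nat} (gamma : 'I_k -> R) (g0 : forall j, 0 < gamma j) (k0 : (0 < k)%N).
Context (l h : 'rV[R]_k).
Local Notation T := (rectangle l h).
Context (v : 'rV[R]_k -> {RV P >-> R}) (cv : forall w, continuous (fun x => v x w)).
Context (W : set R -> 'rV[R]_k -> {RV P >-> R}).
Context (W1 : centered_gaussian_field (@borel_half_line R `*` T) (fun p => W p.1 p.2)).
Context (W2 : forall x, T x -> independently_scattered (fun A => W A x) /\
   {ae P, forall w, W half_line x w = v x w}).
Context (W3 : forall A B, borel_half_line A -> borel_half_line B ->
   A `&` B = set0 -> independent_processes T (W A) (W B)).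
Context (c0 a0 : R) (c00 : 0 < c0) (a00 : 0 <= a0).
Context (hb : forall (a : R) (b : \bar R) x y,
  a0 <= a -> (a%:E < b)%E -> T x -> T y ->
  (L2norm P (fun w => (W (right_open a b) x w - v x w
                     - W (right_open a b) y w + v y w)%R)
   <= (c0 * (\sum_j a `^ gamma j * `|x 0 j - y 0 j| + inv_ext b))%:E)%E).
Context (x0 : 'rV[R]_k) (Tx0 : T x0).
Local Notation Q := (hom_dim gamma).
Local Notation vf := (fun x => v x : Omega -> R).

Let Q1 : 1 <= Q. Proof. exact: hom_dim_ge1. Qed.

Definition noise_from A : 'rV[R]_k -> Omega -> R := fun x => incr W A x x0.

Lemma noise_fromB A x y : (fun w => noise_from A x w - noise_from A y w) = incr W A x y.
Proof. by apply/funext => w; rewrite /noise_from /incr; ring. Qed.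

Lemma noise_from0 A w : noise_from A x0 w = 0.
Proof. by rewrite /noise_from /incr subrr. Qed.

Lemma measurable_noise_from A x : measurable_fun setT (noise_from A x).
Proof. exact: measurable_funB. Qed.

Lemma noise_from_split A : borel_half_line A -> forall x, T x ->
  {ae P, forall w, v x w - v x0 w = noise_from A x w + noise_from (half_line `\` A) x w}.
Proof.
move=> bA x Tx; apply: filterS (incr_split W2 bA Tx Tx0) => w hw.
by rewrite /noise_from hw [RHS]addrC subrK.
Qed.

(** Noise over a bounded set of frequencies is smoother than the whole field: its increments at
    radius $r$ are of order $r^{1+g}$ with $g$ = [gamma_min gamma], far below the rate. The set is
    enlarged to $[0,b)$ so that its end is positive and beyond [a0]. *)
Lemma head_negligible lam (m : nat) (delta : R) : 1 < lam -> 0 < delta ->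
  {ae P, forall w, exists N, forall n, (N <= n)%N ->
    net_event gamma l h (noise_from (right_open 0 (m%:R)%:E)) x0 (rseq lam n) (delta * rate Q (rseq lam n)) w}.
Proof.
move=> lam1 d0; pose b : R := a0 + m%:R + 1.
have b0 : 0 < b by rewrite ltr_wpDl ?addr_ge0.
have ct0 := @chain_total_gt0 R.
have dc0 : 0 < delta / chain_total by rewrite divr_gt0.
have kk : 0 < k%:R :> R by rewrite ltr0n.
have [Kc Kc0 [n0 _ hn]] := geometric_beats_rate Q1 lam1 (gamma_min_gt0 g0) b0 dc0 (mulr_gt0 c00 kk).
pose r n := rseq lam n.
pose s n := c0 * k%:R * ((b * (2 * r n)) `^ gamma_min gamma * (2 * r n)).
pose t n := delta / chain_total * rate Q (r n).
have bA : borel_half_line (right_open 0 (m%:R : R)%:E) by exact: borel_right_open.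
have bB : borel_half_line (right_open 0 b%:E) by exact: borel_right_open.
have := @net_eventually _ _ _ P k gamma g0 k0 l h x0 Tx0 (noise_space T W)
  (fun=> noise_from (right_open 0 (m%:R)%:E)) r s t Kc n0 (gspace_noise W1) Kc0.
case.
- by move=> n; exact: rseq_gt0.
- by move=> n x; exact: measurable_noise_from.
- by move=> n x y Tx Ty; rewrite noise_fromB; exact: (incr_in W1).
- by move=> n nn; have [] := hn n nn.
- move=> n p x nn Sx; have [_ br _ _ _] := hn n nn.
  have r0 : 0 < r n by exact: rseq_gt0.
  have Tx : T x by case: Sx.
  have [Ty _] := trunc_pt_in g0 Tx0 r0 p Sx.
  rewrite noise_fromB.
  apply: (@le_trans _ _ (var_on W (right_open 0 b%:E) x (trunc_pt gamma x0 (r n) p x))).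
    apply: (var_mono W1 W2 W3) => // u [/= u0]; rewrite !lte_fin => um; split => //=.
    by rewrite lte_fin /b (lt_le_trans um)// addrAC lerDr addr_ge0.
  apply: le_trans (var_head W1 W2 W3 c00 a00 hb _ Tx Ty) _.
    by rewrite /b -addrA lerDl addr_ge0.
  have hw := weighted_link g0 x0 p x (ltW b0) r0 br.
  have p0 : 0 <= \sum_j b `^ gamma j * `|x 0 j - trunc_pt gamma x0 (r n) p x 0 j|.
    by apply: sumr_ge0 => j _; rewrite mulr_ge0 ?powR_ge0.
  have hs : c0 * (\sum_j b `^ gamma j * `|x 0 j - trunc_pt gamma x0 (r n) p x 0 j|) <= s n * root_half ^+ p.
    have -> : s n * root_half ^+ p =
        c0 * (k%:R * ((b * (2 * r n)) `^ gamma_min gamma * (2 * r n)) * root_half ^+ p) by rewrite /s !mulrA.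
    by rewrite ler_pM2l.
  have q0 : 0 <= c0 * (\sum_j b `^ gamma j * `|x 0 j - trunc_pt gamma x0 (r n) p x 0 j|).
    by rewrite mulr_ge0// ltW.
  have q1 := le_trans q0 hs; by apply: lerXn2r hs; rewrite nnegrE.
move=> _; apply: filterS => w [N hN]; exists N => n nN; have := hN n nN.
have ctn : chain_total != 0 :> R by rewrite gt_eqF.
by rewrite /t mulrAC divfK.
Qed.

Lemma net_event_transfer (Y Y1 Y2 : 'rV[R]_k -> Omega -> R) r a a1 a2 w : a1 + a2 <= a -> (forall n x, local_ball gamma l h x0 r x ->
    Y (trunc_pt gamma x0 r n x) w - Y x0 w =
    Y1 (trunc_pt gamma x0 r n x) w - Y1 x0 w + (Y2 (trunc_pt gamma x0 r n x) w - Y2 x0 w)) ->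
  net_event gamma l h Y1 x0 r a1 w -> net_event gamma l h Y2 x0 r a2 w -> net_event gamma l h Y x0 r a w.
Proof.
move=> aa e h1 h2 n x Sx; rewrite e//; apply: le_trans (ler_normD _ _) _.
by apply: le_trans aa; apply: lerD; [exact: h1 | exact: h2].
Qed.

(* The slack [j.+1%:R^-1] makes the event stable, up to null sets, under
   perturbations of [Y] that are negligible at the scale [rate]. *)
Definition tail_event lam c (Y : 'rV[R]_k -> Omega -> R) : set Omega :=
  \bigcap_j \bigcap_N \bigcup_i
    net_event gamma l h Y x0 (rseq lam (N + i)) ((c + j.+1%:R^-1) * rate Q (rseq lam (N + i))).

Lemma tail_event_sigma lam c (J : Type) (X : J -> Omega -> R) Y : 1 < lam ->
  (forall x, T x -> exists j, X j = fun w => Y x w - Y x0 w) -> sigma_of X (tail_event lam c Y).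
Proof.
move=> lam1 HX; pose GT := g_sigma_algebraType (\bigcup_i preimage_set_system [set: Omega] (X i) measurable).
apply: (@bigcapT_measurable _ GT) => j; apply: (@bigcapT_measurable _ GT) => N.
apply: (@bigcupT_measurable _ GT) => i; apply: net_event_sigma => //; first exact: rseq_gt0.
by move=> x [Tx _]; exact: HX.
Qed.

Lemma tail_event_perturb lam c (Y Y1 Y2 : 'rV[R]_k -> Omega -> R) w : 1 < lam ->
  (forall i n x, local_ball gamma l h x0 (rseq lam i) x ->
    Y (trunc_pt gamma x0 (rseq lam i) n x) w - Y x0 w =
    Y1 (trunc_pt gamma x0 (rseq lam i) n x) w - Y1 x0 w + (Y2 (trunc_pt gamma x0 (rseq lam i) n x) w - Y2 x0 w)) ->
  (forall j, exists N, forall n, (N <= n)%N ->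
    net_event gamma l h Y2 x0 (rseq lam n) (j.+1%:R^-1 * rate Q (rseq lam n)) w) ->
  tail_event lam c Y1 w -> tail_event lam c Y w.
Proof.
move=> lam1 e small t1 j _ N _.
(* The event for [Y1] and the perturbation are both used with slack $1/(2j+2)$; together they make
   $1/(j+1)$. *)
have [N' hN'] := small j.*2.+1.
have [i _ hi] := t1 j.*2.+1 I (maxn N N') I.
have le1 : (N <= maxn N N' + i)%N by apply: leq_trans (leq_maxl _ _) (leq_addr _ _).
have le2 : (N' <= maxn N N' + i)%N by apply: leq_trans (leq_maxr _ _) (leq_addr _ _).
exists (maxn N N' + i - N)%N => //; rewrite subnKC//.
apply: net_event_transfer (e _) hi (hN' _ le2).
rewrite -mulrDl -addrA (_ : j.*2.+2%:R^-1 + _ = j.+1%:R^-1) //.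
rewrite -doubleS -mul2n natrM invfM -mulrDl (_ : 2^-1 + 2^-1 = 1) ?mul1r//; by field.
Qed.

(** The tail event at the midpoint [c1] agrees almost surely with the same event for the noise
    beyond any [m], hence is independent of the noise over $[0,m)$, and [zero_one] applies. If it is
    null, the oscillation is eventually at least [c1] times the rate along the radii; if it is sure,
    the ratio is at most [c'] at arbitrarily small radii. *)
Lemma liminf_dichotomy c c' : 0 < c -> c < c' ->
  {ae P, forall w, (lower_limit gamma l h v x0 w <= c'%:E)%E} \/
  {ae P, forall w, (c%:E <= lower_limit gamma l h v x0 w)%E}.
Proof.
move=> cp cc; pose c1 := (c + c') / 2.
have [cc1 c1c] : c < c1 /\ c1 < c' by rewrite /c1 ltr_pdivlMr// ltr_pdivrMr//; split; lra.
have c10 : 0 < c1 by exact: lt_trans cc1.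
pose lam : R := Num.sqrt (c1 / c).
have cp1 : 0 < c1 / c by rewrite divr_gt0.
have lam2 : lam ^+ 2 = c1 / c by rewrite sqr_sqrtr// ltW.
have lam1 : 1 < lam by rewrite -[ltLHS]sqrtr1 ltr_sqrt// ltr_pdivlMr// mul1r.
pose E := tail_event lam c1 vf.
pose V (x : {x | T x}) : Omega -> R := fun w => v (sval x) w - v x0 w.
pose A m : set R := right_open 0 (m%:R)%:E.
pose X m (x : {x | T x}) : Omega -> R := noise_from (A m) (sval x).
have bA m : borel_half_line (A m) by exact: borel_right_open.
have bD m : borel_half_line (half_line `\` A m) by apply: borelD => //; exact: borel_half.
have mV x : measurable_fun setT (V x) by exact: measurable_funB.
have sE : sigma_of V E by apply: tail_event_sigma => // x Tx; exists (exist _ x Tx).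
have mE : measurable E by exact: sigma_of_measurable sE.
have z1 : pr P E = 0 \/ pr P E = 1.
  apply: (@zero_one _ _ _ P _ V X) => //.
  - by move=> m x; exact: measurable_noise_from.
  - move=> m B sB.
    pose U := noise_from (half_line `\` A m).
    pose Us (x : {x | T x}) : Omega -> R := U (sval x).
    have sU : sigma_of Us (tail_event lam c1 U).
      apply: tail_event_sigma => // x Tx; exists (exist _ x Tx).
      by apply/funext => w; rewrite /Us /U noise_from0 subr0.
    have mU : measurable (tail_event lam c1 U).
      apply: sigma_of_measurable sU => x; exact: measurable_noise_from.
    (* Removing or restoring the head changes the tail event by a null set, since the head is
       eventually below every slack. *)
    have EU : {ae P, forall w, E w <-> tail_event lam c1 U w}.
      have small : {ae P, forall w, forall j, exists N, forall n, (N <= n)%N ->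
          net_event gamma l h (noise_from (A m)) x0 (rseq lam n) (j.+1%:R^-1 * rate Q (rseq lam n)) w}.
        by apply/ae_foralln => j; apply: head_negligible.
      have spl : {ae P, forall w, forall i n x, local_ball gamma l h x0 (rseq lam i) x ->
          v (trunc_pt gamma x0 (rseq lam i) n x) w - v x0 w =
          noise_from (A m) (trunc_pt gamma x0 (rseq lam i) n x) w + U (trunc_pt gamma x0 (rseq lam i) n x) w}.
        apply/ae_foralln => i; apply: (@ae_net _ _ _ P k gamma g0 l h x0 Tx0
          (fun x w => v x w - v x0 w = noise_from (A m) x w + U x w)); first exact: rseq_gt0.
        exact: noise_from_split.
      apply: filterS2 small spl => w hs hw; split.
        apply: (@tail_event_perturb _ _ _ _ (fun x w => - noise_from (A m) x w)) => //.
          by move=> i n x Sx; rewrite /= hw// /U !noise_from0 !subr0 oppr0 subr0; ring.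
        move=> j; have [N hN] := hs j; exists N => n nN p x Sx; have := hN n nN p x Sx.
        by rewrite !noise_from0 !subr0 oppr0 subr0 normrN.
      apply: (@tail_event_perturb _ _ _ _ (noise_from (A m))) => //.
      by move=> i n x Sx; rewrite /= hw// /U !noise_from0 !subr0 addrC.
    have mB : measurable B.
      by apply: sigma_of_measurable sB => x; exact: measurable_noise_from.
    rewrite (pr_ae_eq mE mU EU) (@pr_ae_eq _ _ _ P (B `&` E) (B `&` tail_event lam c1 U)).
    + apply: (gspace_indep (gspace_noise W1) _ _ _ sB sU).
      * by move=> x; apply: (incr_in W1) => //; exact: (svalP x).
      * by move=> x; apply: (incr_in W1) => //; exact: (svalP x).
      * move=> x y; apply: (incr_ip W1 W3) => //; [|exact: (svalP x)|exact: (svalP y)].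
        by apply/seteqP; split => // t [? []].
    + exact: measurableI.
    + exact: measurableI.
    + by apply: filterS EU => w hw; split => -[? ?]; split => //; apply/hw.
  - move=> x; have Tx := svalP x.
    apply: filterS2 (noise_cvg W2 Tx) (noise_cvg W2 Tx0) => w h1 h2.
    by apply: cvgB.
have r0 n : 0 < rseq lam n by exact: rseq_gt0.
have [N1 _ hd] := rseq_lt lam1 (@rate_domain_gt0 R).
case: z1 => [E0|E1].
  right; have nE : {ae P, forall w, (~` E) w}.
    by apply: pr_eq1_ae; [exact: measurableC | rewrite prC// E0 subr0].
  apply: filterS nE => w nE.
  have [j [N hN]] : exists j N, forall n, (N <= n)%N ->
      ~ net_event gamma l h vf x0 (rseq lam n) ((c1 + j.+1%:R^-1) * rate Q (rseq lam n)) w.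
    apply: contrapT => hc; apply: nE => j _ N _; apply: contrapT => hi; apply: hc.
    exists j, N => n nN hn; apply: hi; exists (n - N)%N => //; by rewrite subnKC.
  apply: (@liminf_from_seq _ Q Q1 (local_osc gamma l h v x0 w) lam c c1) => //.
  - by rewrite lam2 mulfVK// gt_eqF.
  - by move=> r1 r2 _; exact: local_osc_mono.
  - exists (maxn N N1) => n; rewrite geq_max => /andP[nN n1].
    have rd : rseq lam n < rate_domain by exact: hd.
    have := hN n nN; rewrite -osc_event_net// => no.
    apply: ltW; rewrite ltNge; apply/negP => hl; apply: no; rewrite /osc_event /=.
    apply: le_trans hl _; rewrite lee_fin ler_pM2r ?rate_gt0// lerDl invr_ge0//.
left; have Ea : {ae P, forall w, E w} by exact: pr_eq1_ae.
have [J Jc] : exists j : nat, c1 + j.+1%:R^-1 <= c'.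
  have cc0 : 0 < (c' - c1)^-1 by rewrite invr_gt0 subr_gt0.
  exists (Num.truncn (c' - c1)^-1); rewrite -lerBrDl -[leRHS]invrK lef_pV2 ?posrE//.
  by apply: ltW; have /andP[] := truncn_itv (ltW cc0).
apply: filterS Ea => w Ew; apply: liminf_right_le => e e0.
have [N2 _ he] := rseq_lt lam1 e0.
have [i _ hi] := Ew J I (maxn N1 N2) I; exists (rseq lam (maxn N1 N2 + i)).
  rewrite r0 he//=; exact: leq_trans (leq_maxr _ _) (leq_addr _ _).
have rd : rseq lam (maxn N1 N2 + i) < rate_domain.
  by apply: hd => /=; exact: leq_trans (leq_maxl _ _) (leq_addr _ _).
rewrite -osc_event_net// in hi.
rewrite chung_ratioE lee_pdivrMr ?rate_gt0// -EFinM; apply: le_trans hi _.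
by rewrite lee_fin ler_wpM2r// ltW// rate_gt0.
Qed.
End dichotomy.

Lemma sqr_mono {R : realDomainType} (a b : R) : 0 <= a -> a <= b -> a ^+ 2 <= b ^+ 2.
Proof. by move=> a0 ab; have b0 := le_trans a0 ab; apply: lerXn2r ab; rewrite nnegrE. Qed.

(** Interpolation by $\min(B,F)\le\sqrt{BF}$. It is meant for a [B] that does not decay along the
    chain and an [F] that decays with twice the desired exponent. *)
Lemma sqr_min_le {R : rcfType} (V A B F : R) : 0 <= A -> 0 <= B -> 0 <= F ->
  V <= (A + B) ^+ 2 -> V <= F ^+ 2 -> V <= (A + Num.sqrt (B * F)) ^+ 2.
Proof.
move=> A0 B0 F0 h1 h2; have BF0 : 0 <= B * F by exact: mulr_ge0.
have [BF|FB] := leP B F.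
  apply: le_trans h1 _; apply: sqr_mono; first exact: addr_ge0.
  by rewrite lerD2l -[leLHS](@ger0_norm _ B)// -sqrtr_sqr ler_wsqrtr// expr2 ler_wpM2l.
apply: le_trans h2 _; apply: sqr_mono => //; rewrite -[leLHS]add0r lerD//.
by rewrite -[leLHS](@ger0_norm _ F)// -sqrtr_sqr ler_wsqrtr// expr2 ler_wpM2r// ltW.
Qed.

Lemma harmonic_gap {R : realFieldType} (C x : R) : 0 < C -> 2 * C + 1 < x ->
  (2 * x)^-1 <= (x + 1)^-1 - C / (x + 1) ^+ 2.
Proof.
move=> C0 hx; have x0 : 0 < x by lra.
rewrite -subr_ge0 (_ : _ - _ = (x * (x - 2 * C) - 1) / (2 * x * (x + 1) ^+ 2)); last first.
  by field; rewrite !gt_eqF// addr_gt0.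
have q0 : 0 <= 2 * x * (x + 1) ^+ 2 by rewrite mulr_ge0 ?sqr_ge0 ?mulr_ge0 ?(ltW x0).
by rewrite divr_ge0//; nra.
Qed.

(** * Fast radii and bands of the noise *)

Section fast_radii.
Context {R : realType} (p : R) (p1 : 1 < p).

Definition rexp n : R := expR (- (n.+1%:R `^ p)).

(* The geometric mean of the inverses of two consecutive radii: the noise over
   [[cut n, cut n.+1)] carries the oscillation at radius [rexp n]. *)
Definition cut n : R := expR ((n.+1%:R `^ p + n%:R `^ p) / 2).

Let p0 : 0 < p. Proof. exact: lt_trans p1. Qed.

Lemma rexp_gt0 n : 0 < rexp n. Proof. exact: expR_gt0. Qed.

Lemma cut_gt0 n : 0 < cut n. Proof. exact: expR_gt0. Qed.

(** A discrete mean value bound: because $p>1$, the exponents of successive radii separate by an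
    unbounded amount, which decouples the bands. *)
Lemma powR_succ_gap n : n.+1%:R `^ (p - 1) <= n.+1%:R `^ p - n%:R `^ p :> R.
Proof.
have e m : m%:R `^ p = m%:R `^ (p - 1) * m%:R :> R.
  have [->|m0] := eqVneq (m%:R : R) 0; first by rewrite mulr0 powR0// gt_eqF.
  by rewrite -{3}(powRr1 (ler0n R m)) -powRD ?subrK//; apply/implyP.
rewrite !e.
have hB : n%:R `^ (p - 1) <= n.+1%:R `^ (p - 1) :> R.
  by apply: ge0_ler_powR; rewrite ?nnegrE ?subr_ge0 ?(ltW p1)// ler_nat.
move: hB; set A := n.+1%:R `^ _; set B := _ `^ _ => hB.
have -> : A * n.+1%:R = A * n%:R + A by rewrite -natr1 mulrDr mulr1.
by rewrite addrAC lerDr subr_ge0 ler_wpM2r.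
Qed.

Lemma cut_rexp_le n : cut n * rexp n <= expR (- (n.+1%:R `^ (p - 1) / 2)).
Proof.
rewrite /cut /rexp -expRD ler_expR; have := powR_succ_gap n.
by set a := _ `^ (p - 1); set b := _ `^ p; set c := _ `^ p => hab; rewrite -subr_ge0; lra.
Qed.

Lemma cut_rexp_ge n : expR (n.+1%:R `^ (p - 1) / 2) <= cut n.+1 * rexp n.
Proof.
rewrite /cut /rexp -expRD ler_expR; have := powR_succ_gap n.+1.
have : n.+1%:R `^ (p - 1) <= n.+2%:R `^ (p - 1) :> R.
  by apply: ge0_ler_powR; rewrite ?nnegrE ?subr_ge0 ?(ltW p1)// ler_nat.
by set a := _ `^ (p - 1); set a' := _ `^ (p - 1); set b := _ `^ p; set c := _ `^ p => *; lra.
Qed.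

Lemma cut_mono m n : (m <= n)%N -> cut m <= cut n.
Proof.
move=> mn; rewrite ler_expR ler_wpM2r ?invr_ge0//.
by apply: lerD; apply: ge0_ler_powR; rewrite ?nnegrE ?(ltW p0)// ler_nat.
Qed.

Lemma ln_rexp n : ln (rexp n)^-1 = n.+1%:R `^ p.
Proof. by rewrite lnV ?posrE ?rexp_gt0// expRK opprK. Qed.

Lemma loglog_rexp n : loglog (rexp n) = p * ln n.+1%:R.
Proof. by rewrite /loglog ln_rexp ln_powR. Qed.

Let succ_le_powR n : n.+1%:R <= n.+1%:R `^ p :> R.
Proof.
rewrite -[leLHS]powRr1//; apply: ler_powR; last exact: ltW.
by rewrite ler1n.
Qed.

Lemma rexp_lt (e : R) : 0 < e -> \forall n \near \oo, rexp n < e.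
Proof.
move=> e0; have [N _ hN] := nbhs_infty_gtr e^-1; exists N => // n nN.
rewrite /rexp expRN invf_plt ?posrE ?expR_gt0//.
apply: lt_le_trans (hN n nN) _; apply: le_trans (expR_ge1Dx _).
apply: (@le_trans _ _ n.+1%:R); first by rewrite ler_nat.
by apply: le_trans (succ_le_powR n) _; rewrite lerDr.
Qed.

Lemma loglog_rexp_gt (K : R) : \forall n \near \oo, K < loglog (rexp n).
Proof.
have [N _ hN] := nbhs_infty_gtr (expR K); exists N => // n nN.
rewrite loglog_rexp; have h : expR K < n.+1%:R by apply: lt_le_trans (hN n nN) _; rewrite ler_nat.
have l : K < ln n.+1%:R by rewrite -{1}(expRK K) ltr_ln ?posrE ?expR_gt0.
by apply: lt_le_trans l _; rewrite ler_peMl ?(ltW p1)// ln_ge0// ler1n.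
Qed.

Lemma cut_gt (K : R) : \forall n \near \oo, K < cut n.
Proof.
have [N _ hN] := nbhs_infty_gtr (2 * K); exists N => // n nN.
have := expR_ge1Dx ((n.+1%:R `^ p + n%:R `^ p) / 2); rewrite -/(cut n).
have := succ_le_powR n; have := powR_ge0 (n%:R : R) p; have := hN n nN.
have : n%:R <= n.+1%:R :> R by rewrite ler_nat.
set a := _ `^ p; set b := _ `^ p; set x := cut n; set y : R := n%:R; set z : R := n.+1%:R.
by move=> *; lra.
Qed.

Lemma stretched_beats_rate (Q G delta eta : R) : 1 <= Q -> 0 < G -> 0 < delta -> 0 < eta ->
  exists2 Kc : R, 0 < Kc & \forall n \near \oo,
   [/\ 0 < G * rexp n * expR (- (eta * n.+1%:R `^ (p - 1))), 0 < delta * rate Q (rexp n) &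
   G * rexp n * expR (- (eta * n.+1%:R `^ (p - 1))) / (delta * rate Q (rexp n)) <= Kc / n.+1%:R].
Proof.
move=> Q1 G0 d0 eta0.
have p10 : 0 < p - 1 by rewrite subr_gt0.
have [K K0 hK] := poly_expR_bounded eta0 p10.
exists (G / delta * p * K); first by rewrite !mulr_gt0 ?invr_gt0.
have [N _ hN] := rexp_lt (@rate_domain_gt0 R).
exists N => // n nN; have rd := hN n nN; have r0 := rexp_gt0 n.
have ra : 0 < rate Q (rexp n) by exact: rate_gt0.
have := hK n; set X := expR _ => hX; have X0 : 0 < X by exact: expR_gt0.
split; [by rewrite !mulr_gt0 | by rewrite mulr_gt0 |].
have hr := rate_inv_le Q1 r0 rd; rewrite loglog_rexp in hr.
have hl : p * ln n.+1%:R <= p * n.+1%:R by rewrite ler_pM2l// ln_le_id.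
have -> : G * rexp n * X / (delta * rate Q (rexp n)) = G / delta * X * (rexp n / rate Q (rexp n)).
  by field; rewrite !gt_eqF.
apply: (@le_trans _ _ (G / delta * X * (p * n.+1%:R))).
  by rewrite ler_pM2l; [exact: le_trans hl | rewrite !mulr_gt0 ?invr_gt0].
rewrite ler_pdivlMr//.
have -> : G / delta * X * (p * n.+1%:R) * n.+1%:R = G / delta * p * (n.+1%:R ^+ 2 * X) by ring.
by rewrite ler_pM2l// !mulr_gt0 ?invr_gt0.
Qed.

Lemma cut_doubles n : 2 <= expR (n.+1%:R `^ (p - 1) / 2) -> cut n * (2 * rexp n) <= 1 /\ cut n < cut n.+1.
Proof.
have r0 := rexp_gt0 n; have c0 := cut_gt0 n.
have := cut_rexp_le n; have := cut_rexp_ge n; rewrite expRN; set z := expR _ => cr2 cr1 z2.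
have z0 : 0 < z by exact: expR_gt0.
have zi : z^-1 <= 2^-1 by rewrite lef_pV2 ?posrE.
split; first by move: cr1 zi; rewrite mulrCA; set a := cut n * _ => *; lra.
rewrite -(ltr_pM2r r0); apply: le_lt_trans cr1 _; apply: lt_le_trans cr2; lra.
Qed.

Lemma expR_half_ge2 : \forall n \near \oo, 2 <= expR (n.+1%:R `^ (p - 1) / 2) :> R.
Proof.
have p10 : 0 < p - 1 by rewrite subr_gt0.
have p1i : 0 < (p - 1)^-1 by rewrite invr_gt0.
have [M _ hM] := nbhs_infty_gtr (2 `^ (p - 1)^-1 : R).
exists M => // n nM; apply: le_trans (expR_ge1Dx _).
suff : 2 <= n.+1%:R `^ (p - 1) :> R by set a := _ `^ _ => ?; lra.
have -> : 2 = (2 `^ (p - 1)^-1) `^ (p - 1) :> R by rewrite -powRrM mulVf ?gt_eqF// powRr1.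
apply: ge0_ler_powR; rewrite ?nnegrE ?powR_ge0 ?(ltW p10)//.
by apply: le_trans (ltW (hM n nM)) _; rewrite ler_nat.
Qed.

Definition band_const (c0 kk gm : R) : R :=
  c0 * (kk * (2 `^ gm * 2) + Num.sqrt ((2 * kk + 1) * (kk * 2))).

Lemma band_const_gt0 c0 kk gm : 0 < c0 -> 0 < kk -> 0 < band_const c0 kk gm.
Proof.
by move=> c00 k0; rewrite mulr_gt0// addr_gt0 ?sqrtr_gt0 ?mulr_gt0 ?addr_gt0 ?powR_gt0 ?mulr_gt0.
Qed.

(** With $y=(n+1)^{p-1}$, the radius times the lower cut is at most $e^{-y/2}$, and times the upper
    cut at least $e^{y/2}$. The head thus gains $e^{-gy/2}$, with $g$ = [gm], and the geometric mean
    for the tail $e^{-y/4}$; as $g\le1$, both are at most $e^{-gy/4}$. *)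
Lemma band_scale (c0 kk gm : R) n : 0 < c0 -> 0 < kk -> 0 < gm -> gm <= 1 ->
  c0 * (kk * ((cut n * (2 * rexp n)) `^ gm * (2 * rexp n)) +
    Num.sqrt ((cut n.+1)^-1 * ((2 * kk + 1) * (kk * (2 * rexp n))))) <=
  band_const c0 kk gm * rexp n * expR (- (gm / 4 * n.+1%:R `^ (p - 1))).
Proof.
move=> c00 k0 gm0 gm1; have r0 := rexp_gt0 n; have cn0 := cut_gt0 n; have cn1 := cut_gt0 n.+1.
have cr1 := cut_rexp_le n; have cr2 := cut_rexp_ge n.
have y0 : 0 <= n.+1%:R `^ (p - 1) :> R by exact: powR_ge0.
move: cr1 cr2 y0; set y := _ `^ (p - 1); set r := rexp n in r0 *; set a := cut n in cn0 *.
set b := cut n.+1 in cn1 * => cr1 cr2 y0.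
have ex0 : 0 < expR (- (gm / 4 * y)) by exact: expR_gt0.
rewrite /band_const -[leRHS]mulrA -[leRHS]mulrA ler_pM2l// [leRHS]mulrDl.
apply: lerD.
  have -> : kk * (2 `^ gm * 2) * (r * expR (- (gm / 4 * y))) =
     kk * (2 `^ gm * expR (- (gm / 4 * y)) * (2 * r)) by ring.
  rewrite ler_pM2l// ler_wpM2r ?mulr_ge0 ?(ltW r0)//.
  apply: (@le_trans _ _ ((2 * expR (- (y / 2))) `^ gm)).
    apply: ge0_ler_powR; rewrite ?nnegrE ?mulr_ge0 ?expR_ge0 ?(ltW gm0) ?(ltW r0) ?(ltW cn0)//.
    by rewrite mulrCA ler_pM2l.
  rewrite powRM ?expR_ge0// ler_wpM2l ?powR_ge0// /powR (gt_eqF (expR_gt0 _)) expRK ler_expR.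
  have : 0 <= gm * y by rewrite mulr_ge0// ltW.
  by move=> gy; rewrite -subr_ge0 (_ : _ - _ = gm * y / 4); [rewrite divr_ge0|field].
have -> : b^-1 * ((2 * kk + 1) * (kk * (2 * r))) = (2 * kk + 1) * (kk * 2) * ((b * r)^-1 * r ^+ 2).
  by rewrite expr2; field; rewrite !gt_eqF.
have E0 : 0 <= (2 * kk + 1) * (kk * 2) by rewrite mulr_ge0 ?addr_ge0 ?mulr_ge0 ?(ltW k0).
rewrite sqrtrM// ler_wpM2l ?sqrtr_ge0//.
rewrite sqrtrM ?invr_ge0 ?mulr_ge0 ?(ltW r0) ?(ltW cn1)// sqrtr_sqr (gtr0_norm r0) mulrC.
rewrite ler_wpM2l ?(ltW r0)//.
rewrite -[leRHS](gtr0_norm ex0) -sqrtr_sqr ler_wsqrtr// expr2 -[leRHS]expRD.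
apply: (@le_trans _ _ (expR (y / 2))^-1).
  by rewrite lef_pV2 ?posrE ?mulr_gt0 ?expR_gt0.
rewrite -expRN ler_expR.
have : 0 <= (1 - gm) * y by rewrite mulr_ge0// subr_ge0.
by move=> gy; rewrite -subr_ge0 (_ : _ - _ = (1 - gm) * y / 2); [rewrite divr_ge0|field].
Qed.
End fast_radii.

Section upper.
Context {d : measure_display} {Omega : measurableType d} {R : realType}.
Context (P : probability Omega R) {k : nat} (gamma : 'I_k -> R) (g0 : forall j, 0 < gamma j) (k0 : (0 < k)%N).
Context (l h : 'rV[R]_k).
Local Notation T := (rectangle l h).
Context (v : 'rV[R]_k -> {RV P >-> R}) (cv : forall w, continuous (fun x => v x w)).
Context (W : set R -> 'rV[R]_k -> {RV P >-> R}).
Context (W1 : centered_gaussian_field (@borel_half_line R `*` T) (fun p => W p.1 p.2)).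
Context (W2 : forall x, T x -> independently_scattered (fun A => W A x) /\
   {ae P, forall w, W half_line x w = v x w}).
Context (W3 : forall A B, borel_half_line A -> borel_half_line B ->
   A `&` B = set0 -> independent_processes T (W A) (W B)).
Context (c0 a0 : R) (c00 : 0 < c0) (a00 : 0 <= a0).
Context (hb : forall (a : R) (b : \bar R) x y,
  a0 <= a -> (a%:E < b)%E -> T x -> T y ->
  (L2norm P (fun w => (W (right_open a b) x w - v x w
                     - W (right_open a b) y w + v y w)%R)
   <= (c0 * (\sum_j a `^ gamma j * `|x 0 j - y 0 j| + inv_ext b))%:E)%E).
Context (x0 : 'rV[R]_k) (Tx0 : T x0).
Local Notation Q := (hom_dim gamma).
Local Notation vf := (fun x => v x : Omega -> R).
Local Notation from := (noise_from W x0).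

Let Q1 : 1 <= Q. Proof. exact: hom_dim_ge1. Qed.

(** Outside the band the term $1/b$ does not decrease with the chaining level and could not be
    chained alone. The variance of the whole field does decrease, and [sqr_min_le] combines the
    two. *)
Lemma band_link_le (a b r : R) m x : a0 <= a -> 0 < b -> a < b -> 0 < r -> a * (2 * r) <= 1 -> a0 * (k%:R * (2 * r)) < 1 ->
  local_ball gamma l h x0 r x ->
  var_on W (half_line `\` right_open a b%:E) x (trunc_pt gamma x0 r m x) <=
  (c0 * (k%:R * ((a * (2 * r)) `^ gamma_min gamma * (2 * r)) + Num.sqrt (b^-1 * ((2 * k%:R + 1) * (k%:R * (2 * r)))))
     * root_half ^+ m) ^+ 2.
Proof.
move=> aa b0 ab r0 ar a0r Sx.
have Tx : T x by case: Sx.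
have [Ty _] := trunc_pt_in g0 Tx0 r0 m Sx; set y := trunc_pt _ _ _ _ _ in Ty *.
have az : 0 <= a by exact: le_trans aa.
have bA : borel_half_line (right_open a b%:E) by exact: borel_right_open.
have z0 := @root_half_gt0 R; set z := root_half in z0 *.
have zm0 : 0 < z ^+ m by exact: exprn_gt0.
have r20 : 0 < 2 * r by rewrite mulr_gt0.
have kk : 0 < k%:R :> R by rewrite ltr0n.
have z2m : z ^+ m * z ^+ m = (2 ^+ m)^-1 by rewrite -exprMn -expr2 root_half_sqr exprVn.
have D1 : Delta gamma x y <= k%:R * (2 * r) * (z ^+ m * z ^+ m).
  by rewrite z2m -mulrA; exact: (Delta_trunc g0).
have D0 := Delta_ge0 gamma x y.
have D2 : Delta gamma x y <= k%:R * (2 * r).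
  have i1 : (2 ^+ m)^-1 <= 1 :> R by rewrite invf_le1 ?exprn_gt0// exprn_ege1// ler1n.
  apply: le_trans D1 _; rewrite z2m; apply: ler_piMr i1; by rewrite mulr_ge0// ltW.
have aD : a0 * Delta gamma x y < 1 by apply: le_lt_trans a0r; rewrite ler_wpM2l.
have F1 := field_var g0 W1 W2 W3 c00 a00 hb Tx Ty aD; rewrite (incr_field W2 Tx Ty) in F1.
have bi : 0 <= b^-1 by rewrite invr_ge0 ltW.
have C1 := var_compl W1 W2 c00 a00 hb aa (b := b%:E) (x := x) (y := y).
rewrite lte_fin /= in C1; have {}C1 := C1 ab bi Tx Ty.
have M1 : var_on W (half_line `\` right_open a b%:E) x y <= var_on W half_line x y.
  apply: (var_mono W1 W2 W3) => //; first by apply: borelD => //; exact: borel_half.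
  exact: borel_half.
have wl := weighted_link g0 x0 m x az r0 ar; rewrite -/y in wl.
set Aq := k%:R * _ in wl *.
have Aq0 : 0 <= Aq by rewrite /Aq !mulr_ge0 ?powR_ge0 ?(ltW r0).
pose F := (2 * k%:R + 1) * (k%:R * (2 * r)).
have F0 : 0 <= F by rewrite /F !mulr_ge0 ?addr_ge0 ?mulr_ge0 ?(ltW r0).
have p0 : 0 <= \sum_j a `^ gamma j * `|x 0 j - y 0 j|.
  by apply: sumr_ge0 => j _; rewrite mulr_ge0 ?powR_ge0.
have c0z : 0 <= c0 by exact: ltW.
have zmz := ltW zm0.
have -> : c0 * (Aq + Num.sqrt (b^-1 * F)) * z ^+ m =
   c0 * Aq * z ^+ m + Num.sqrt (c0 * b^-1 * (c0 * F * (z ^+ m * z ^+ m))).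
  have -> : c0 * b^-1 * (c0 * F * (z ^+ m * z ^+ m)) = (c0 * z ^+ m) ^+ 2 * (b^-1 * F) by ring.
  rewrite [in RHS]sqrtrM ?sqr_ge0// sqrtr_sqr ger0_norm; last by rewrite mulr_ge0.
  by ring.
apply: sqr_min_le.
- exact: mulr_ge0 (mulr_ge0 c0z Aq0) zmz.
- exact: mulr_ge0 c0z bi.
- exact: mulr_ge0 (mulr_ge0 c0z F0) (mulr_ge0 zmz zmz).
- apply: le_trans C1 _; apply: sqr_mono; first by rewrite mulr_ge0 ?addr_ge0.
  by rewrite mulrDr lerD2r -mulrA ler_pM2l.
- apply: le_trans M1 _; apply: le_trans F1 _; apply: sqr_mono; first by rewrite !mulr_ge0 ?addr_ge0 ?mulr_ge0.
  rewrite -mulrA -[leRHS]mulrA ler_pM2l// /F -[leRHS]mulrA ler_wpM2l// addr_ge0//.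
Qed.

Lemma lil_upper D e c : 0 < D -> 0 < e ->
  (forall r u, 0 < r -> r < e -> 0 < u -> u / r < e ->
     expR (- (D * (r / u) `^ Q)) <= pr P (osc_event gamma l h vf x0 r u)) ->
  0 < c -> D < c `^ Q -> {ae P, forall w, (lower_limit gamma l h v x0 w <= c%:E)%E}.
Proof.
move=> D0 e0 hD cp Dc.
have Q0 : 0 < Q by exact: lt_le_trans Q1.
have [c1 [c10 c1c Dc1]] := powR_strict_gap_below Q1 cp D0 Dc.
(* With this exponent the lower small ball bound at level [c1 * rate] along [rexp] is exactly
   $1/(n+1)$, a divergent series; $p>1$ is the slack between $D$ and $c_1^Q$. *)
pose p := c1 `^ Q / D.
have p1 : 1 < p by rewrite ltr_pdivlMr// mul1r.
(* Half of the gap pays for passing from [v] to the band, half for coming back, so that the final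
   level is [c]. *)
pose delta := (c - c1) / 2.
have d0 : 0 < delta by rewrite divr_gt0// subr_gt0.
pose r n : R := rexp p n.
have r0 n : 0 < r n by exact: rexp_gt0.
pose B n : set R := right_open (cut p n) (cut p n.+1)%:E.
have cut0 n : 0 < cut p n by exact: cut_gt0.
have bB n : borel_half_line (B n) by apply: borel_right_open; exact: ltW.
have bD n : borel_half_line (half_line `\` B n) by apply: borelD => //; exact: borel_half.
have kk : 0 < k%:R :> R by rewrite ltr0n.
have gm0 := gamma_min_gt0 g0.
have gm1 : gamma_min gamma <= 1 by rewrite /gamma_min; elim/big_rec : _ => // j x _ x1; rewrite ge_min x1 orbT.
have eta0 : 0 < gamma_min gamma / 4 by rewrite divr_gt0.
pose G := band_const c0 k%:R (gamma_min gamma).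
have G0 : 0 < G by exact: band_const_gt0.
have ct0 := @chain_total_gt0 R.
have dc0 : 0 < delta / chain_total by rewrite divr_gt0.
pose s n := G * r n * expR (- (gamma_min gamma / 4 * n.+1%:R `^ (p - 1))).
pose t n := delta / chain_total * rate Q (r n).
have [Kc Kc0 [N1 _ h1]] := stretched_beats_rate p1 Q1 G0 dc0 eta0.
have a0e : 0 < (a0 * (k%:R * 2) + 1)^-1 by rewrite invr_gt0 ltr_wpDl// !mulr_ge0.
have [N2 _ h2] := rexp_lt p1 a0e.
have [N3 _ h3] := cut_gt p1 a0.
have [N4 _ h4] := cut_gt p1 1.
have [N5 _ h5] := expR_half_ge2 p1.
pose n0 := maxn N1 (maxn N2 (maxn N3 N5)).
have gH := gspace_noise W1.
have links n m x : (n0 <= n)%N -> local_ball gamma l h x0 (r n) x ->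
    var_on W (half_line `\` B n) x (trunc_pt gamma x0 (r n) m x) <= (s n * root_half ^+ m) ^+ 2.
  rewrite !geq_max => /and4P[n1 n2 n3 n5] Sx.
  have [ar1 cc] := cut_doubles p1 (h5 n n5).
  have a0r : a0 * (k%:R * (2 * r n)) < 1.
    have -> : a0 * (k%:R * (2 * r n)) = a0 * (k%:R * 2) * r n by ring.
    have := h2 n n2; rewrite -[(_ + 1)^-1]mul1r ltr_pdivlMr; last by rewrite ltr_wpDl// !mulr_ge0.
    by rewrite mulrDr mulr1 mulrC; apply: lt_trans; rewrite ltrDl.
  apply: le_trans (band_link_le m (ltW (h3 n n3)) (cut0 n.+1) cc (r0 n) ar1 a0r Sx) _.
  apply: sqr_mono.
    rewrite mulr_ge0 ?exprn_ge0 ?(ltW root_half_gt0)// mulr_ge0 ?(ltW c00)// addr_ge0 ?sqrtr_ge0//.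
    by rewrite !mulr_ge0 ?powR_ge0 ?(ltW (r0 n)).
  by rewrite ler_wpM2r ?exprn_ge0 ?(ltW root_half_gt0)//; exact: band_scale.
have [[Cp Cp0 hCp] small] := @net_eventually _ _ _ P k gamma g0 k0 l h x0 Tx0 (noise_space T W)
  (fun n => from (half_line `\` B n)) r s t Kc n0 gH Kc0 r0
  (fun n x => measurable_noise_from _ _ _ _) 
  (fun n x y Tx Ty => eq_ind_r (noise_space T W) (incr_in W1 (bD n) Tx Ty) (noise_fromB _ _ _ _ _))
  ltac:(by move=> n; rewrite !geq_max => /andP[nn _]; have [] := h1 n nn)
  ltac:(by move=> n m x nn Sx; rewrite noise_fromB; exact: links).
have tE n : t n * chain_total = delta * rate Q (r n) by rewrite /t mulrAC divfK// gt_eqF.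
pose A n := net_event gamma l h (from (B n)) x0 (r n) ((c1 + delta) * rate Q (r n)).
have mA n : measurable (A n) by apply: measurable_net_event => // x; exact: measurable_noise_from.
have mN n a : measurable (net_event gamma l h (from (half_line `\` B n)) x0 (r n) a).
  by apply: measurable_net_event => // x; exact: measurable_noise_from.
have spl n : {ae P, forall w, forall m x, local_ball gamma l h x0 (r n) x ->
    v (trunc_pt gamma x0 (r n) m x) w - v x0 w =
    from (B n) (trunc_pt gamma x0 (r n) m x) w + from (half_line `\` B n) (trunc_pt gamma x0 (r n) m x) w}.
  apply: (@ae_net _ _ _ P k gamma g0 l h x0 Tx0
    (fun x w => v x w - v x0 w = from (B n) x w + from (half_line `\` B n) x w)) => //.
  exact: (noise_from_split W2 Tx0 (bB n)).
have Qc1 : 0 < c1 `^ Q by exact: powR_gt0.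
have mU n : measurable (osc_event gamma l h vf x0 (r n) (c1 * rate Q (r n))).
  by apply: (measurable_osc_event g0) => // x; exact: measurable_funPT.
have [N6 _ h6] := rexp_lt p1 e0.
have [N7 _ h7] := rexp_lt p1 (@rate_domain_gt0 R).
have [N8 _ h8] := loglog_rexp_gt p1 ((c1 / e) `^ Q).
have [N9 _ h9] := nbhs_infty_gtr (2 * Cp + 1).
(* The event for [v] at level [c1] has probability at least $1/(n+1)$, and the noise outside the
   band exceeds its allowance with probability $O(n^{-2})$; the event for the band alone keeps at
   least $1/(2n)$. *)
have lowP n : (maxn n0 (maxn N6 (maxn N7 (maxn N8 N9))) < n)%N -> (2 * n%:R)^-1 <= pr P (A n).
  move=> /ltnW; rewrite 4!geq_max => /and5P[nn n6 n7 n8 n9].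
  have rd : r n < rate_domain by exact: h7.
  have ra : 0 < rate Q (r n) by exact: rate_gt0.
  have hU : n.+1%:R^-1 <= pr P (osc_event gamma l h vf x0 (r n) (c1 * rate Q (r n))).
    apply: le_trans (hD _ _ (r0 n) (h6 n n6) _ _).
    - have := rate_powQ Q1 (r0 n) rd c10; rewrite loglog_rexp => ->.
      have -> : D * (p * ln n.+1%:R / c1 `^ Q) = ln n.+1%:R.
        by rewrite /p; field; rewrite !gt_eqF.
      by rewrite expRN lnK// posrE.
    - by rewrite mulr_gt0.
    - by apply: rate_ratio_le => //; exact: h8.
  have hle : pr P (osc_event gamma l h vf x0 (r n) (c1 * rate Q (r n))) <=
      pr P (A n `|` ~` net_event gamma l h (from (half_line `\` B n)) x0 (r n) (t n * chain_total)).
    apply: pr_ae_le; [exact: mU | by apply: measurableU => //; exact: measurableC |].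
    apply: filterS (spl n) => w hw; rewrite (osc_event_net g0)// => hosc.
    have [hn|] := pselect (net_event gamma l h (from (half_line `\` B n)) x0 (r n) (t n * chain_total) w);
      last by right.
    left; apply: (@net_event_transfer _ _ _ k gamma l h x0 (from (B n)) vf
      (fun x w => - from (half_line `\` B n) x w) _ _ (c1 * rate Q (r n)) (t n * chain_total)) => //.
    - by rewrite tE mulrDl.
    - by move=> m x Sx; rewrite /= hw// !noise_from0 !subr0 oppr0 subr0 addrK.
    - by move=> m x Sx; have := hn m x Sx; rewrite !noise_from0 subr0 oppr0 subr0 normrN.
  have hC := hCp n nn.
  have hP : n.+1%:R^-1 - Cp / n.+1%:R ^+ 2 <= pr P (A n).
    rewrite lerBlDr; apply: le_trans hU _; apply: le_trans hle _.
    apply: le_trans (prU _ (mA n) (measurableC (mN n _))) _; by rewrite lerD2l.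
  by apply: le_trans hP; apply: le_trans (harmonic_gap Cp0 (h9 n n9)) _; rewrite natr1.
(* The last band is disjoint from all the preceding ones, so its event is independent of them
   jointly, which is the form required by [borel_cantelli2]. *)
have indep N K : pr P (\big[setI/setT]_(i < K) (~` A (N + i)%N) `&` ~` A (N + K)%N) =
     pr P (\big[setI/setT]_(i < K) (~` A (N + i)%N)) * pr P (~` A (N + K)%N).
  pose X (q : 'I_K * {x | T x}) : Omega -> R := from (B (N + q.1)%N) (sval q.2).
  pose Y (x : {x | T x}) : Omega -> R := from (B (N + K)%N) (sval x).
  have dis (i : 'I_K) : B (N + i)%N `&` B (N + K)%N = set0.
    apply/seteqP; split => // u [[/= _ u1] [/= u2 _]]; move: u1; rewrite lte_fin ltNge => /negP; apply.
    by apply: le_trans u2; apply: cut_mono => //; rewrite -addnS leq_add2l.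
  apply: (@gspace_indep _ _ _ P _ _ _ X Y gH).
  - by move=> [i x]; apply: (incr_in W1) => //; exact: (svalP x).
  - by move=> x; apply: (incr_in W1) => //; exact: (svalP x).
  - by move=> [i x] z; exact: (incr_ip W1 W3 (bB _) (bB _) (dis i) (svalP x) Tx0 (svalP z) Tx0).
  - pose GT := g_sigma_algebraType (\bigcup_i preimage_set_system [set: Omega] (X i) measurable).
    apply: (@bigsetI_measurable _ GT) => i _; apply: (@measurableC _ GT).
    apply: net_event_sigma => // x [Tx _]; exists (i, exist _ x Tx).
    by apply/funext => w; rewrite /X noise_from0 subr0.
  - pose GT := g_sigma_algebraType (\bigcup_i preimage_set_system [set: Omega] (Y i) measurable).
    apply: (@measurableC _ GT); apply: net_event_sigma => // x [Tx _]; exists (exist _ x Tx).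
    by apply/funext => w; rewrite /Y noise_from0 subr0.
have io := borel_cantelli2 mA indep lowP.
have spl' : {ae P, forall w, forall n m x, local_ball gamma l h x0 (r n) x ->
    v (trunc_pt gamma x0 (r n) m x) w - v x0 w =
    from (B n) (trunc_pt gamma x0 (r n) m x) w + from (half_line `\` B n) (trunc_pt gamma x0 (r n) m x) w}.
  exact/ae_foralln.
apply: filterS3 io small spl' => w hio [M hM] hw; apply: liminf_right_le => e' e'0.
have [N10 _ h10] := rexp_lt p1 e'0.
have [n + An] := hio (maxn M (maxn N7 N10)); rewrite !geq_max => /and3P[nM n7 n10].
exists (r n); first by rewrite r0; exact: h10.
have rd : r n < rate_domain by exact: h7.
have ra : 0 < rate Q (r n) by exact: rate_gt0.
rewrite chung_ratioE lee_pdivrMr// -EFinM.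
suff : osc_event gamma l h vf x0 (r n) (c * rate Q (r n)) w by [].
rewrite (osc_event_net g0)//.
apply: (net_event_transfer _ _ An (hM n nM)).
- by rewrite tE -mulrDl ler_wpM2r ?(ltW ra)// /delta; lra.
- by move=> m x Sx; rewrite /= hw// !noise_from0 !subr0.
Qed.
End upper.

(** * The constant and its bounds *)

Section constant_value.
Context {d : measure_display} {O : measurableType d} {R : realType}.
Context (P : probability O R).

Lemma ae_exists (A : O -> Prop) : {ae P, forall w, A w} -> exists w, A w.
Proof.
move=> [B [mB B0 AB]]; apply: contrapT => nA.
have BT : B = setT by apply/seteqP; split => // w _; apply: AB => Aw; apply: nA; exists w.
by have := B0; rewrite BT probability_setT => /eqP; rewrite onee_eq0.
Qed.

(** The constant is the supremum of the almost sure lower bounds: a number above it is not one of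
    them, so the dichotomy makes every still larger number an almost sure upper bound. *)
Lemma ae_constant (L : O -> \bar R) a b : 0 < a -> {ae P, forall w, (a%:E <= L w)%E} ->
  {ae P, forall w, (L w <= b%:E)%E} ->
  (forall c c', 0 < c -> c < c' -> {ae P, forall w, (L w <= c'%:E)%E} \/ {ae P, forall w, (c%:E <= L w)%E}) ->
  exists2 K : R, 0 < K & {ae P, forall w, L w = K%:E}.
Proof.
move=> a0 La Lb dich.
pose S := [set c : R | 0 < c /\ {ae P, forall w, (c%:E <= L w)%E}].
have bS : ubound S b.
  move=> c [_ Lc]; have [w [h1 h2]] : exists w, (c%:E <= L w)%E /\ (L w <= b%:E)%E.
    by apply: ae_exists; apply: filterS2 Lc Lb.
  by have := le_trans h1 h2; rewrite lee_fin.
have hS : has_sup S by split; [exists a | exists b].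
have aK : a <= sup S by apply: ub_le_sup; [exists b | split].
have K0 : 0 < sup S by exact: lt_le_trans aK.
have inv0 n : 0 < n.+1%:R^-1 :> R by rewrite invr_gt0.
have small (e : R) : 0 < e -> exists n : nat, n.+1%:R^-1 <= e.
  move=> e0; have ei : 0 <= e^-1 by rewrite invr_ge0 ltW.
  exists (Num.truncn e^-1); rewrite -[leRHS]invrK lef_pV2 ?posrE ?invr_gt0//.
  by apply: ltW; have /andP[] := truncn_itv ei.
have lower : {ae P, forall w, forall n, ((sup S)%:E <= L w + (n.+1%:R^-1)%:E)%E}.
  apply/ae_foralln => n; have [c [c0 Lc] hc] := sup_adherent (inv0 n) hS.
  apply: filterS Lc => w h; apply: (@le_trans _ _ (c + n.+1%:R^-1)%:E).
    by rewrite lee_fin -lerBlDr ltW.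
  by rewrite EFinD leeD2r.
have upper : {ae P, forall w, forall n, (L w <= (sup S)%:E + (n.+1%:R^-1)%:E)%E}.
  apply/ae_foralln => n; pose c := sup S + n.+1%:R^-1 / 2.
  have h0 : 0 < n.+1%:R^-1 / 2 :> R by rewrite divr_gt0.
  have cK : sup S < c by rewrite ltrDl.
  have cc : c < sup S + n.+1%:R^-1 by rewrite ltrD2l ltr_pdivrMr// ltr_pMr// ltr1n.
  have c0 : 0 < c by exact: lt_trans cK.
  case: (dich _ _ c0 cc) => [|Lc]; first by rewrite EFinD.
  have Sc : S c by split.
  have hub : has_ubound S by exists b.
  by have := ub_le_sup hub Sc; rewrite leNgt cK.
exists (sup S) => //; apply: filterS2 lower upper => w h1 h2; apply/eqP; rewrite eq_le; apply/andP; split.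
  apply/lee_addgt0Pr => e e0; have [n hn] := small e e0.
  by apply: le_trans (h2 n) _; rewrite leeD2l// lee_fin.
apply/lee_addgt0Pr => e e0; have [n hn] := small e e0.
by apply: le_trans (h1 n) _; rewrite leeD2l// lee_fin.
Qed.
End constant_value.

Section chung.
Context {d : measure_display} {Omega : measurableType d} {R : realType}.
Context (P : probability Omega R) {k : nat} (gamma : 'I_k -> R) (g0 : forall j, 0 < gamma j) (k0 : (0 < k)%N).
Context (l h : 'rV[R]_k).
Local Notation T := (rectangle l h).
Context (v : 'rV[R]_k -> {RV P >-> R}) (cv : forall w, continuous (fun x => v x w)).
Local Notation Q := (hom_dim gamma).
Local Notation vf := (fun x => v x : Omega -> R).

(** The quantifiers are those of [small_ball_regime], and the ball is intersected with the
    rectangle, so boundary points are covered. *)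
Definition regime_upper x0 (D : R) := exists2 e : R, 0 < e & forall r u : R, 0 < r -> r < e -> 0 < u -> u / r < e ->
  pr P (osc_event gamma l h vf x0 r u) <= expR (- (D * (r / u) `^ Q)).

Definition regime_lower x0 (D : R) := exists2 e : R, 0 < e & forall r u : R, 0 < r -> r < e -> 0 < u -> u / r < e ->
  expR (- (D * (r / u) `^ Q)) <= pr P (osc_event gamma l h vf x0 r u).

Lemma osc_event_prE x0 r u : T x0 -> 0 < r ->
  small_ball_prob v (T `&` Delta_ball gamma x0 r) x0 u = (pr P (osc_event gamma l h vf x0 r u))%:E.
Proof.
move=> Tx0 r0; rewrite prE//; apply: (measurable_osc_event g0) => // x; exact: measurable_funPT.
Qed.

Lemma Delta_ball_interior x0 : T° x0 -> exists2 e : R, 0 < e & forall r, 0 < r -> r < e -> Delta_ball gamma x0 r `<=` T.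
Proof.
move=> /nbhs_ballP[e /= e0 he]; exists (Num.min e 1); first by rewrite lt_min e0 ltr01.
move=> r r0; rewrite lt_min => /andP[re r1] y hy; apply: he; split => // i j; rewrite /ball /= (ord1 i).
apply: le_lt_trans (Delta_coord g0 x0 y j) _.
have D0 := Delta_ge0 gamma x0 y; have b1 := beta_ge1 g0 j.
apply: (@le_lt_trans _ _ (r `^ beta gamma j)).
  by apply: ge0_ler_powR; rewrite ?nnegrE ?(ltW r0)// (le_trans ler01).
apply: le_lt_trans re; rewrite -[leRHS]powRr1 ?(ltW r0)//.
by apply: ger_powR => //; rewrite r0 ltW.
Qed.

Lemma estimate_regime x0 (D1 D2 : R) : T° x0 -> small_ball_estimate gamma T v D1 D2 ->
  [/\ 0 < D1, 0 < D2, regime_lower x0 D1 & regime_upper x0 D2].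
Proof.
move=> ix0 [D10 D20 [r1 r10 hr]].
have Tx0 : T x0 by exact: interior_subset ix0.
have [e1 e10 he] := Delta_ball_interior ix0.
have e0 : 0 < Num.min r1 (Num.min e1 1) by rewrite !lt_min r10 e10 ltr01.
have main r u : 0 < r -> r < Num.min r1 (Num.min e1 1) -> 0 < u -> u / r < Num.min r1 (Num.min e1 1) ->
    expR (- (D1 * (r / u) `^ Q)) <= pr P (osc_event gamma l h vf x0 r u) <= expR (- (D2 * (r / u) `^ Q)).
  move=> r0; rewrite !lt_min => /and3P[rr1 re1 _] u0 /and3P[_ _]; rewrite ltr_pdivrMr// mul1r => ur.
  have sub := he r r0 re1.
  have := hr u r x0 u0 ur (ltW rr1) Tx0 sub.
  by rewrite -{1 2}(setIidr sub) osc_event_prE// !lee_fin !mulNr.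
by split => //; [exists (Num.min r1 (Num.min e1 1)) | exists (Num.min r1 (Num.min e1 1))] => // r u a b c e;
  have /andP[] := main r u a b c e.
Qed.

(** A strict inequality for the limit holds eventually along the filter and, multiplied by
    $(r/u)^Q$, is a small ball bound. The lower bound assumed beforehand keeps the probabilities
    positive, so that the extended logarithm is a real one. *)
Lemma exponent_regime x0 (L : \bar R) : T x0 -> (exists D, regime_lower x0 D) ->
  small_ball_exponent gamma T v x0 p @[p --> small_ball_regime] --> L ->
  (forall D, (D%:E < L)%E -> regime_upper x0 D) /\ (forall D, (L < D%:E)%E -> regime_lower x0 D).
Proof.
move=> Tx0 [D0 [e0 e00 h0]] cL.
have val r u : 0 < r -> r < e0 -> 0 < u -> u / r < e0 ->
   small_ball_exponent gamma T v x0 (r, u) =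
     (- ((u / r) `^ Q * ln (pr P (osc_event gamma l h vf x0 r u))))%:E /\
   0 < pr P (osc_event gamma l h vf x0 r u).
  move=> r0 re u0 ur; have p0 : 0 < pr P (osc_event gamma l h vf x0 r u).
    by apply: lt_le_trans (h0 r u r0 re u0 ur); exact: expR_gt0.
  by split => //; rewrite /small_ball_exponent /= osc_event_prE// lne_EFin.
have inv r u : 0 < r -> 0 < u -> (r / u) `^ Q = ((u / r) `^ Q)^-1.
  move=> r0 u0; have -> : r / u = (u / r)^-1 by rewrite invfM invrK mulrC.
  have ur0 : 0 <= u / r by rewrite divr_ge0// ltW.
  by rewrite -[_^-1 in LHS](powR_inv1 ur0) -powRrM mulN1r powRN.
split=> D hD.
- have /cL [e e1 he] : nbhs L [set y | (D%:E < y)%E] by exact: (open_ereal_gt' hD).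
  exists (Num.min e e0); first by rewrite lt_min e1.
  move=> r u r0; rewrite !lt_min => /andP[re re0] u0 /andP[ue ue0].
  have re' : 0 < r < e by rewrite r0.
  have hy := he r u re' u0 ue; have [ve p0] := val r u r0 re0 u0 ue0.
  move: hy; rewrite /= ve lte_fin (inv r u)// => hlt; have q0 : 0 < (u / r) `^ Q by rewrite powR_gt0// divr_gt0.
  rewrite -[leLHS]lnK ?posrE// ler_expR lerNr; apply: ltW.
  by rewrite ltr_pdivrMr// mulrC mulrN.
- have /cL [e e1 he] : nbhs L [set y | (y < D%:E)%E] by exact: (open_ereal_lt' hD).
  exists (Num.min e e0); first by rewrite lt_min e1.
  move=> r u r0; rewrite !lt_min => /andP[re re0] u0 /andP[ue ue0].
  have re' : 0 < r < e by rewrite r0.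
  have hy := he r u re' u0 ue; have [ve p0] := val r u r0 re0 u0 ue0.
  move: hy; rewrite /= ve lte_fin (inv r u)// => hlt; have q0 : 0 < (u / r) `^ Q by rewrite powR_gt0// divr_gt0.
  rewrite -[leRHS]lnK ?posrE// ler_expR lerNl; apply: ltW.
  by rewrite ltr_pdivlMr// mulrC mulrN.
Qed.

Context (W : set R -> 'rV[R]_k -> {RV P >-> R}).
Context (W1 : centered_gaussian_field (@borel_half_line R `*` T) (fun p => W p.1 p.2)).
Context (W2 : forall x, T x -> independently_scattered (fun A => W A x) /\
   {ae P, forall w, W half_line x w = v x w}).
Context (W3 : forall A B, borel_half_line A -> borel_half_line B ->
   A `&` B = set0 -> independent_processes T (W A) (W B)).
Context (c0 a0 : R) (c00 : 0 < c0) (a00 : 0 <= a0).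
Context (hb : forall (a : R) (b : \bar R) x y,
  a0 <= a -> (a%:E < b)%E -> T x -> T y ->
  (L2norm P (fun w => (W (right_open a b) x w - v x w
                     - W (right_open a b) y w + v y w)%R)
   <= (c0 * (\sum_j a `^ gamma j * `|x 0 j - y 0 j| + inv_ext b))%:E)%E).

(** [kappa] is $K^Q$ with $K$ the almost sure value of the lower limit. A bound with $D$ on the
    wrong side of $K^Q$ leaves room for a level [c] strictly between $D^{1/Q}$ and $K$, at which
    [lil_lower] or [lil_upper] contradicts that value. *)
Lemma chung_constant x0 : T x0 -> (exists2 D, 0 < D & regime_lower x0 D) -> (exists2 D, 0 < D & regime_upper x0 D) ->
  exists kappa, [/\ 0 < kappa, chung_LIL gamma T v x0 kappa,
    forall D, 0 < D -> regime_lower x0 D -> kappa <= D & forall D, 0 < D -> regime_upper x0 D -> D <= kappa].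
Proof.
move=> Tx0 [A A0 [eA eA0 hA]] [C C0 [eC eC0 hC]].
have Q1 : 1 <= Q by exact: hom_dim_ge1.
have Q0 : 0 < Q by exact: lt_le_trans Q1.
have lo D c : 0 < D -> regime_upper x0 D -> 0 < c -> c `^ Q < D ->
    {ae P, forall w, (c%:E <= lower_limit gamma l h v x0 w)%E}.
  by move=> D0 [e e0 he] cp cD; exact: (lil_lower g0 k0 cv Tx0 D0 e0 he).
have up D c : 0 < D -> regime_lower x0 D -> 0 < c -> D < c `^ Q ->
    {ae P, forall w, (lower_limit gamma l h v x0 w <= c%:E)%E}.
  by move=> D0 [e e0 he] cp cD; exact: (lil_upper g0 k0 cv W1 W2 W3 c00 a00 hb Tx0 D0 e0 he).
have rt D : 0 < D -> (D `^ Q^-1) `^ Q = D.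
  by move=> D0; rewrite -powRrM mulVf ?gt_eqF// powRr1// ltW.
(* The factors 2 only provide the strict inequalities asked for by [lo] and [up], so as to start
   from one almost sure lower and one almost sure upper bound. *)
have C20 : 0 < C / 2 by rewrite divr_gt0.
have A20 : 0 < A * 2 by rewrite mulr_gt0.
have La := lo C ((C / 2) `^ Q^-1) C0 (ex_intro2 _ _ eC eC0 hC) (powR_gt0 _ C20).
have Lb := up A ((A * 2) `^ Q^-1) A0 (ex_intro2 _ _ eA eA0 hA) (powR_gt0 _ A20).
rewrite rt// ltr_pdivrMr// ltr_pMr// ltr1n in La; rewrite rt// ltr_pMr// ltr1n in Lb.
have [K K0 LK] := ae_constant (powR_gt0 _ C20) (La isT) (Lb isT)
  (fun c c' => @liminf_dichotomy _ _ _ P _ _ g0 k0 l h v cv W W1 W2 W3 c0 a0 c00 a00 hb x0 Tx0 c c').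
exists (K `^ Q); split.
- exact: powR_gt0.
- apply: filterS LK => w; rewrite /lower_limit => ->.
  by rewrite -powRrM divff ?gt_eqF// powRr1// ltW.
- move=> D D0 hD; rewrite leNgt; apply/negP => DK.
  have [c [cp cK Dc]] := powR_strict_gap_below Q1 K0 D0 DK.
  have [w [e1 e2]] : exists w, lower_limit gamma l h v x0 w = K%:E /\ (lower_limit gamma l h v x0 w <= c%:E)%E.
    by apply: (@ae_exists _ _ _ P); apply: filterS2 LK (up D c D0 hD cp Dc).
  by move: e2; rewrite e1 lee_fin leNgt cK.
- move=> D D0 hD; rewrite leNgt; apply/negP => DK.
  have [c cK cD] := powR_strict_gap Q1 K0 DK.
  have cp : 0 < c by exact: lt_trans cK.
  have [w [e1 e2]] : exists w, lower_limit gamma l h v x0 w = K%:E /\ (c%:E <= lower_limit gamma l h v x0 w)%E.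
    by apply: (@ae_exists _ _ _ P); apply: filterS2 LK (lo D c D0 hD cp cD).
  by move: e2; rewrite e1 lee_fin leNgt cK.
Qed.
End chung.

(* [C1] and [C2] are constants for which the small ball estimate holds on T; if
   x0 is interior to T, the bounds on [kappa] hold for every such pair.  This
   fails on the boundary, where balls around x0 are truncated by T. *)
Theorem theorem4p4 (d : measure_display) (Omega : measurableType d)
    (R : realType) (P : probability Omega R) (k : nat)
    (v : 'rV[R]_k -> {RV P >-> R}) (gamma : 'I_k -> R) (l h : 'rV[R]_k)
    (hk : (0 < k)%N) (hlh : forall j, l 0 j < h 0 j)
    (hv : continuous_gaussian_field v)
    (hA : assumption_A gamma (rectangle l h) v)
    (hB : assumption_B gamma (rectangle l h) v) :
  exists C1 C2 : R,
  small_ball_estimate gamma (rectangle l h) v C1 C2 /\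
  forall x0 : 'rV[R]_k, rectangle l h x0 ->
  exists kappa : R,
  [/\ 0 < kappa,
      chung_LIL gamma (rectangle l h) v x0 kappa,
      C2 <= kappa <= C1,
      (rectangle l h)° x0 ->
        forall D1 D2 : R, small_ball_estimate gamma (rectangle l h) v D1 D2 ->
        D2 <= kappa <= D1 &
      forall L : \bar R,
        small_ball_exponent gamma (rectangle l h) v x0 p
          @[p --> small_ball_regime] --> L ->
        kappa%:E = L].
Proof.
have [Wh [W1 W2 W3 [c0 [a0 [c00 a00 g0 hb _]]]]] := hA.
have [c2 c20 hB2] := hB; have [_ cv] := hv.
have Q1 : 1 <= hom_dim gamma by exact: hom_dim_ge1.
have gH := gspace_noise W1.
have Hv x : rectangle l h x -> noise_space (rectangle l h) Wh (v x) by exact: field_in.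
have mv x : measurable_fun setT (v x : Omega -> R) by exact: measurable_funPT.
have [q wq] : exists q : nat, 2 `^ hom_dim gamma <= 2 ^+ q.
  exists (Num.truncn (hom_dim gamma)).+1; rewrite -powR_mulrn//; apply: ler_powR; first by rewrite ler1n.
  by apply: ltW; have /andP[] := truncn_itv (le_trans ler01 Q1).
have c0k : 0 < c0 * (2 * k%:R + 1) by rewrite mulr_gt0// ltr_wpDl ?mulr_ge0.
have [A A0 hlow] := small_ball_lower P g0 l h mv cv hk wq c0k.
have [C C0 hupp] := small_ball_upper gH g0 hk cv Hv c20 hB2.
(* Radii below [w] leave room in the rectangle, from any of its points, for the separated points
   placed towards the center. *)
pose w : R := \big[Num.min/1]_j ((h 0 j - l 0 j) / 2).
have w0 : 0 < w.
  by rewrite /w; elim/big_rec : _ => // j x _ x0; rewrite lt_min x0 andbT divr_gt0// subr_gt0.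
have wj j : w <= (h 0 j - l 0 j) / 2 by rewrite /w (bigD1 j)//= ge_min lexx.
have w1 : w <= 1 by rewrite /w; elim/big_rec : _ => // j x _ x1; rewrite ge_min x1 orbT.
have a0k : 0 < a0 * (k%:R * 2) + 1 by rewrite ltr_wpDl// !mulr_ge0.
(* The second bound keeps [a0] times the distances met in the chaining below 1, as [field_var]
   requires. *)
pose e0 := Num.min w (a0 * (k%:R * 2) + 1)^-1.
have e00 : 0 < e0 by rewrite lt_min w0 invr_gt0.
have e01 : e0 <= 1 by rewrite ge_min w1.
have low x0 r u : rectangle l h x0 -> 0 < u -> u < r -> r < e0 ->
    expR (- (A * (r / u) `^ hom_dim gamma)) <= pr P (osc_event gamma l h (fun x => v x : Omega -> R) x0 r u).
  move=> Tx0 u0 ur; rewrite lt_min => /andP[rw ra].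
  have r0 : 0 < r by exact: lt_trans ur.
  apply: (hlow _ x0 r u gH Tx0 u0 ur).
    by move=> x y [Tx _] [Ty _]; exact: (gspaceB gH (Hv x Tx) (Hv y Ty)).
  move=> x y Tx Ty Dxy; apply: (field_var g0 W1 W2 W3 c00 a00 hb Tx Ty).
  apply: (@le_lt_trans _ _ (a0 * (k%:R * 2) * r)).
    by rewrite -!mulrA ler_wpM2l.
  move: ra; rewrite -[(_ + 1)^-1]mul1r ltr_pdivlMr// mulrDr mulr1 mulrC; apply: lt_trans.
  by rewrite ltrDl.
have upp x0 r u : rectangle l h x0 -> 0 < u -> u < r -> r < e0 ->
    pr P (osc_event gamma l h (fun x => v x : Omega -> R) x0 r u) <= expR (- (C * (r / u) `^ hom_dim gamma)).
  move=> Tx0 u0 ur; rewrite lt_min => /andP[rw _].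
  apply: hupp => //; first exact: le_trans (ltW rw) w1.
  by move=> j; exact: le_trans (ltW rw) (wj j).
have rlow x0 : rectangle l h x0 -> regime_lower gamma l h v x0 A.
  move=> Tx0; exists e0 => // r u r0 re u0 ure; apply: low => //.
  by rewrite -[r]mul1r -ltr_pdivrMr//; exact: lt_le_trans e01.
have rupp x0 : rectangle l h x0 -> regime_upper gamma l h v x0 C.
  move=> Tx0; exists e0 => // r u r0 re u0 ure; apply: upp => //.
  by rewrite -[r]mul1r -ltr_pdivrMr//; exact: lt_le_trans e01.
exists A, C; split.
  (* The estimate allows the radius to equal its upper limit, whereas [low] and [upp] ask for a
     radius strictly below [e0]; hence the half. *)
  split => //; exists (e0 / 2); first by rewrite divr_gt0.
  move=> u r z u0 ur re Tz sub; have r0 : 0 < r by exact: lt_trans ur.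
  have re0 : r < e0 by apply: le_lt_trans re _; rewrite ltr_pdivrMr// ltr_pMr// ltr1n.
  have := osc_event_prE g0 cv u Tz r0; rewrite (setIidr sub) => ->.
  by rewrite !lee_fin !mulNr low//= upp.
move=> x0 Tx0.
have [kappa [k0 lil klow kupp]] := chung_constant g0 hk cv W1 W2 W3 c00 a00 hb Tx0
  (ex_intro2 _ _ A A0 (rlow x0 Tx0)) (ex_intro2 _ _ C C0 (rupp x0 Tx0)).
exists kappa; split => //.
- by rewrite kupp ?klow//; [exact: rlow | exact: rupp].
- move=> ix0 D1 D2 hD; have [D10 D20 hD1 hD2] := estimate_regime g0 cv ix0 hD.
  by rewrite kupp// klow.
- move=> L cL.
  have [hu hl] := exponent_regime g0 cv Tx0 (ex_intro _ A (rlow x0 Tx0)) cL.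
  apply: le_anti; apply/andP; split.
  + rewrite leNgt; apply/negP => Lk.
    (* [L] is a priori any extended real below [kappa], possibly nonpositive or $-\infty$; a
       positive [D] strictly between is exhibited in each case, since [klow] speaks of positive
       constants only. *)
    have [D [D0 LD Dk]] : exists D : R, [/\ 0 < D, (L < D%:E)%E & D < kappa].
      case: L Lk {cL hu hl} => [x|//|_]; last first.
        by exists (kappa / 2); rewrite divr_gt0// ltNyr ltr_pdivrMr// ltr_pMr// ltr1n.
      rewrite lte_fin => xk; have [x0'|x0'] := ltP 0 x.
        exists ((x + kappa) / 2); split; first by rewrite divr_gt0 ?addr_gt0.
          by rewrite lte_fin; have [] := midf_lt xk.
        by have [] := midf_lt xk.
      exists (kappa / 2); split; first by rewrite divr_gt0.
        by rewrite lte_fin; apply: le_lt_trans x0' _; rewrite divr_gt0.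
      by rewrite ltr_pdivrMr// ltr_pMr// ltr1n.
    by have := klow D D0 (hl D LD); rewrite leNgt Dk.
  + rewrite leNgt; apply/negP => kL.
    have [D [D0 DL kD]] : exists D : R, [/\ 0 < D, (D%:E < L)%E & kappa < D].
      case: L kL {cL hu hl} => [x|_|//]; last first.
        by exists (kappa + 1); rewrite addr_gt0// ltry ltrDl.
      rewrite lte_fin => kx; have x0' := lt_trans k0 kx.
      exists ((kappa + x) / 2); split; first by rewrite divr_gt0 ?addr_gt0.
        by rewrite lte_fin; have [] := midf_lt kx.
      by have [] := midf_lt kx.
    by have := kupp D D0 (hu D DL); rewrite leNgt kD.
Qed.
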